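(* Let $Z_N=\{u\in\mathbb{C}^N : u_i\neq u_j \text{ for } i\neq j\}$, let $T\to Z_N$ be its universal cover, and let $U\subset Z_N$ be a contractible open subset, lifted to $T$ (i.e. identified with an open subset of $T$ mapping biholomorphically onto it). Let $\sum_{i=1}^N\eta_i(u)\,du_i$ be a holomorphic 1-form on $U$ such that (i) $\eta_i(u)\neq 0$ for all $i$ and all $u\in U$; (ii) the 1-form is closed, i.e. $\eta_{ab}:=\partial\eta_a/\partial u_b$ is symmetric in $a$ and $b$; (iii) for some constant $D$ the functions $\eta_i$ satisfy the system of PDEs $$(\partial_{u_1}+\cdots+\partial_{u_N})\eta_i=0\quad(1\le i\le N),$$ $$(D+u_1\partial_{u_1}+\cdots+u_N\partial_{u_N})\eta_i=0\quad(1\le i\le N),$$ $$\frac{\partial\eta_{ij}}{\partial u_k}-\frac12\Big(\frac{\eta_{ij}\eta_{kj}}{\eta_j}+\frac{\eta_{jk}\eta_{ik}}{\eta_k}+\frac{\eta_{ki}\eta_{ji}}{\eta_i}\Big)=0\quad(k\neq i\neq j\neq k).$$ Then $\sum_{i=1}^N\eta_i(u)\,du_i$ extends to a global meromorphic 1-form on $T$.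
   Context: Notation: $\partial_{u_a}=\partial/\partial u_a$. The functions $u_1,\dots,u_N$ on $T$ are the pullbacks of the coordinates on $Z_N\subset\mathbb{C}^N$; the $du_i$ form a global frame of the cotangent bundle of $T$, so the statement means that each $\eta_i$ extends to a meromorphic function on $T$. *)

(* Defs.v *)
From HB Require Import structures.
From mathcomp Require Import all_boot all_order all_algebra.
From mathcomp Require Import complex.
From mathcomp Require Import all_classical all_reals all_analysis.

Set Implicit Arguments.
Unset Strict Implicit.
Unset Printing Implicit Defensive.

Import Order.TTheory GRing.Theory Num.Theory numFieldNormedType.Exports.
Local Open Scope classical_set_scope.
Local Open Scope ring_scope.

(* R[i] as a normed space over itself; consequently [differentiable] on
   functions 'rV[R[i]]_N -> R[i] is Frechet differentiability over the complex
   numbers, and 'D_v is the complex directional derivative. *)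
HB.instance Definition _ (R : realType) := NormedModule.copy R[i] R[i]^o.

Definition homeomorphism_on (X Y : topologicalType) (f : X -> Y)
    (A : set X) (B : set Y) : Prop :=
  [/\ set_fun A B f, {within A, continuous f} &
      exists g : Y -> X, [/\ set_fun B A g, {within B, continuous g},
        {in A, cancel f g} & {in B, cancel g f}]].

Section Homotopy.
Variable R : realType.
Let I01 : set R := `[0, 1].

Definition contractible (X : topologicalType) (A : set X) : Prop :=
  exists (c : X) (H : R * X -> X),
    [/\ A c, {within I01 `*` A, continuous H},
        (forall s x, I01 s -> A x -> A (H (s, x))),
        (forall x, A x -> H (0, x) = x) &
        (forall x, A x -> H (1, x) = c)].

Definition path_connected (X : topologicalType) : Prop :=
  forall x y : X, exists gamma : R -> X,
    [/\ {within I01, continuous gamma}, gamma 0 = x & gamma 1 = y].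

Definition null_homotopic (X : topologicalType) (gamma : R -> X) : Prop :=
  exists H : R * R -> X,
    [/\ {within I01 `*` I01, continuous H},
        (forall s, I01 s -> H (s, 0) = gamma s),
        (forall s, I01 s -> H (s, 1) = gamma 0) &
        (forall t, I01 t -> H (0, t) = gamma 0 /\ H (1, t) = gamma 0)].

Definition simply_connected (X : topologicalType) : Prop :=
  [/\ [set: X] !=set0, path_connected X &
      forall gamma : R -> X, {within I01, continuous gamma} ->
        gamma 0 = gamma 1 -> null_homotopic gamma].

End Homotopy.

Definition evenly_covered (X Y : topologicalType) (p : X -> Y) (V : set Y)
    : Prop :=
  exists sheets : set (set X),
    [/\ trivIset sheets id, p @^-1` V = \bigcup_(S in sheets) S &
        forall S, sheets S -> open S /\ homeomorphism_on p S V].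

Definition covering_map (X Y : topologicalType) (p : X -> Y) (Z : set Y)
    : Prop :=
  [/\ continuous p, range p = Z &
      forall z, Z z ->
        exists V : set Y, [/\ open V, V z, V `<=` Z & evenly_covered p V]].

Definition universal_cover (R : realType) (X Y : topologicalType) (p : X -> Y)
    (Z : set Y) : Prop :=
  covering_map p Z /\ simply_connected R X.

Section Holomorphic.
Variables (R : realType) (N : nat).
Local Notation C := R[i].
Local Notation CN := 'rV[C]_N.

Definition Zconf : set CN :=
  [set u | forall i j : 'I_N, i != j -> u 0 i != u 0 j].

Definition partial (i : 'I_N) (f : CN -> C) (u : CN) : C :=
  'D_(delta_mx 0 i : CN) f u.

Definition holomorphic (U : set CN) (f : CN -> C) : Prop :=
  forall u, U u -> differentiable f u.

(* T carries the complex structure pulled back along p, the one for which the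
   covering map p is a local biholomorphism. *)
Section Cover.
Variables (T : topologicalType) (p : T -> CN).

(* As p is a local biholomorphism, a homeomorphism onto U which is a
   restriction of p to an open set is a biholomorphism. *)
Definition lift_of (U : set CN) (L : set T) : Prop :=
  open L /\ homeomorphism_on p L U.

Definition holomorphic_cover (W : set T) (f : T -> C) : Prop :=
  forall t, W t -> exists g : CN -> C,
    (\forall u \near p t, differentiable g u) /\
    (\forall s \near t, f s = g (p s)).

(* A meromorphic function is a function f, relevant only on a dense open set W
   of regular points, which is locally, near every point of T, a quotient g / h
   of holomorphic functions with h vanishing identically on no nonempty open
   set. *)
Definition meromorphic_cover (W : set T) (f : T -> C) : Prop :=
  [/\ open W, dense W, holomorphic_cover W f &
      forall t : T, exists (V : set T) (g h : T -> C),
        [/\ open V /\ V t, holomorphic_cover V g, holomorphic_cover V h,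
            (forall O : set T, open O -> O !=set0 -> O `<=` V ->
               exists2 s, O s & h s != 0) &
            forall s, V s -> W s -> h s * f s = g s]].

End Cover.

End Holomorphic.

(* Main.v *)
Require Import Defs.
From HB Require Import structures.
From mathcomp Require Import all_boot all_order all_algebra.
From mathcomp Require Import perm complex.
From mathcomp Require Import all_classical all_reals all_analysis.
From mathcomp Require Import ring lra zify.
Import Order.TTheory GRing.Theory Num.Theory numFieldNormedType.Exports.
Local Open Scope classical_set_scope.
Local Open Scope ring_scope.

Set Implicit Arguments.
Unset Strict Implicit.
Unset Printing Implicit Defensive.

(** The equations describe an isomonodromic deformation, and the theorem is its Painleve property.
    Locally write eta_i = psi_i^2 and gamma_ij = (d_j eta_i) / (2 psi_i psi_j) for i != j. For a
    direction w put V_ij = (u_j - u_i) gamma_ij and W_ij = (w_j - w_i) gamma_ij. The system yields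
    d_w psi = - psi W for the row psi ([psi_D]) and d_w V = W V - V W ([gam_D]). Hence the Fuchsian
    equation dY/dlam = - (lam - diag u)^-1 V Y is compatible with the deformation equation d_w Y =
    (W + diag(w_a / (lam - u_a)) V) Y.

    Local step. Let the coordinates of a be at mutual distance at least 10 rho, and let u be close
    to a. The transport X(lam) of the deformation equation along the segment from a to u is
    holomorphic in lam outside discs about the a_j, infinity included. Near disc j it factors as X =
    Z_j G_j ([star]): G_j is the transport of the Fuchsian equation at the fixed point a from lam to
    lam - (u_j - a_j), and Z_j is the transport at fixed lam - u_j, which has no singularity in the
    disc. The jump G_j is built from V(a) and u_j - a_j alone, so it is holomorphic in u for |u - a|
    < rho, however small the domain of eta is. Multiplied on the left by psi(u), the outer function
    takes the known value psi(a) at infinity, and entry i of the inner row of disc i takes the value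
    psi_i(u) at lam = u_i ([ZZ_fix], [rh_data]). Cauchy's formula in the exterior domain
    ([exterior_cauchy]) turns this Riemann-Hilbert problem into an infinite linear system 1 + K for
    the Taylor coefficients in the discs, where K has geometrically small entries, is holomorphic in
    u and vanishes at u = a. Cramer's rule with Fredholm determinants ([fredholm], [rh_fredholm])
    gives h psi_i = g_i with h and g_i holomorphic for |u - a| < rho and h(a) = 1. Thus eta_i = (g_i
    / h)^2 on a ball whose radius depends only on a ([local_meromorphic]).

    Global step. Because of the uniform radius, tuples (h, q_i) representing eta_i = q_i / h
    continue along every path in Z_N ([extend], [flat_exists]). At a zero of h or of some q_i the
    local step is applied at a nearby generic point; the equations persist by the identity theorem
    ([soln_generic]). Simple connectedness of T makes the continuation independent of the path
    ([monodromy_trivial], [continued_uniq]), and [global_quotient] assembles the result. A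
    contraction of U shows that on L the continuation is eta itself.

    The complex analysis is developed from Goursat's theorem on, with circle integrals as averages
    over roots of unity and limits taken along an ultrafilter. *)

(** * Real-valued norms on complex normed spaces *)

Section RealNorm.
Variable R : realType.
Local Notation C := R[i].

(** Norms over C are complex numbers; passing to the real part makes estimates accessible to [lra]
    and [nra]. *)
Definition nr (E : normedModType C) (x : E) : R := complex.Re `|x|.

Lemma nrE (E : normedModType C) (x : E) : `|x| = (nr x)%:C%C.
Proof. by rewrite /nr RRe_real// normr_real. Qed.

Lemma nr_ge0 (E : normedModType C) (x : E) : 0 <= nr x.
Proof. by rewrite -lecR -nrE normr_ge0. Qed.

Lemma nr0 (E : normedModType C) : nr (0 : E) = 0.
Proof. by rewrite /nr normr0. Qed.

Lemma nr_eq0 (E : normedModType C) (x : E) : nr x = 0 -> x = 0.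
Proof. by move=> x0; apply/eqP; rewrite -normr_eq0 nrE x0. Qed.

Lemma nr_gt0 (E : normedModType C) (x : E) : x != 0 -> 0 < nr x.
Proof.
move=> x0; rewrite lt_neqAle nr_ge0 andbT eq_sym.
by apply: contraNneq x0 => /nr_eq0 ->.
Qed.

Lemma nrD (E : normedModType C) (x y : E) : nr (x + y) <= nr x + nr y.
Proof. by rewrite -lecR rmorphD/= -!nrE ler_normD. Qed.

Lemma nrN (E : normedModType C) (x : E) : nr (- x) = nr x.
Proof. by rewrite /nr normrN. Qed.

Lemma nrB (E : normedModType C) (x y : E) : nr (x - y) <= nr x + nr y.
Proof. by rewrite -(nrN y) nrD. Qed.

Lemma nrBC (E : normedModType C) (x y : E) : nr (x - y) = nr (y - x).
Proof. by rewrite -nrN opprB. Qed.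

Lemma nrBD (E : normedModType C) (y x z : E) : nr (x - z) <= nr (x - y) + nr (y - z).
Proof. by have := nrD (x - y) (y - z); rewrite addrA subrK. Qed.

Lemma nrBl (E : normedModType C) (x y : E) : nr x - nr y <= nr (x - y).
Proof. by rewrite lerBlDr; have := nrD (x - y) y; rewrite subrK. Qed.

Lemma nrZ (E : normedModType C) (a : C) (x : E) : nr (a *: x) = nr a * nr x.
Proof. by apply: complexI; rewrite rmorphM/= -!nrE normrZ. Qed.

Lemma nrM (a b : C) : nr (a * b) = nr a * nr b.
Proof. by apply: complexI; rewrite rmorphM/= -!nrE normrM. Qed.

Lemma nr1 : nr (1 : C) = 1.
Proof. by apply: complexI; rewrite -nrE normr1. Qed.

Lemma nrV (a : C) : nr a^-1 = (nr a)^-1.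
Proof. by apply: complexI; rewrite fmorphV/= -!nrE normfV. Qed.

Lemma nrX (a : C) n : nr (a ^+ n) = nr a ^+ n.
Proof. by elim: n => [|n IH]; rewrite ?expr0 ?nr1// !exprS nrM IH. Qed.

Lemma nrR (r : R) : nr (r%:C%C : C) = `|r|.
Proof. by rewrite /nr normc_def/= expr0n/= addr0 sqrtr_sqr. Qed.

Lemma nr_nat n : nr (n%:R : C) = n%:R.
Proof. by rewrite -(rmorph_nat (real_complex R)) nrR normr_nat. Qed.

Lemma nr_neq0 (a : C) : 0 < nr a -> a != 0.
Proof. by apply: contraTneq => ->; rewrite nr0 ltxx. Qed.

Lemma nr_sum (E : normedModType C) (I : Type) (s : seq I) (P : pred I) (F : I -> E) :
  nr (\sum_(i <- s | P i) F i) <= \sum_(i <- s | P i) nr (F i).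
Proof.
elim/big_ind2: _ => [|x a y b xa yb|//]; first by rewrite nr0.
by apply: le_trans (nrD _ _) _; rewrite lerD.
Qed.

Lemma Re_nr (z : C) : complex.Re z <= nr z.
Proof.
rewrite /nr normc_def/=; apply: le_trans (ler_norm _) _.
by rewrite -sqrtr_sqr ler_wsqrtr// lerDl sqr_ge0.
Qed.

Lemma ReN_nr (z : C) : - complex.Re z <= nr z.
Proof. by case: z => a b; have := Re_nr (- (a +i* b)%C); rewrite nrN. Qed.

Lemma Im_nr (z : C) : complex.Im z <= nr z.
Proof.
rewrite /nr normc_def/=; apply: le_trans (ler_norm _) _.
by rewrite -sqrtr_sqr ler_wsqrtr// lerDr sqr_ge0.
Qed.

Lemma ImN_nr (z : C) : - complex.Im z <= nr z.
Proof. by case: z => a b; have := Im_nr (- (a +i* b)%C); rewrite nrN. Qed.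

Lemma nr_ReIm (z : C) : nr z <= `|complex.Re z| + `|complex.Im z|.
Proof.
case: z => a b /=; rewrite (_ : (a +i* b)%C = a%:C%C + 'i%C * b%:C%C); last first.
  by rewrite [LHS]complexE.
apply: le_trans (nrD _ _) _; rewrite nrM !nrR.
have -> : nr ('i%C : C) = 1.
  by rewrite /nr normc_def/= expr0n/= expr1n add0r sqrtr1.
by rewrite mul1r.
Qed.

Lemma near_nrP (E : normedModType C) (u : E) (P : set E) :
  nbhs u P <-> exists2 r : R, 0 < r & forall v, nr (v - u) < r -> P v.
Proof.
split=> [/nbhs_ballP[e /= e0 eP]|[r r0 rP]].
  have er : e = (complex.Re e)%:C%C by rewrite RRe_real// gtr0_real.
  exists (complex.Re e); first by rewrite -ltcR -er.
  move=> v vu; apply: eP; rewrite -ball_normE /ball_/= nrE er ltcR.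
  by rewrite nrBC.
apply/nbhs_ballP; exists r%:C%C; first by rewrite /= ltcR.
by move=> v; rewrite -ball_normE /ball_/= nrE ltcR nrBC => /rP.
Qed.

Lemma nr_coord n (v : 'rV[C]_n) i : nr (v 0 i) <= nr v.
Proof.
rewrite -lecR -!nrE.
rewrite [leRHS]/Num.norm/= mx_normE -[leLHS]nngE num_le.
exact: (le_bigmax _ (fun i => `|v i.1 i.2|%:nng) (0, i)).
Qed.

Lemma nr_row_le n (v : 'rV[C]_n) (r : R) : 0 <= r ->
  (forall i, nr (v 0 i) <= r) -> nr v <= r.
Proof.
move=> r0 vr; have [v0|v0] := eqVneq (mx_norm v) 0.
  by rewrite /nr [`|v|]v0.
have [[j i] /= e] := mx_norm_neq0 v0.
by rewrite {1}/nr [`|v|]e (ord1 j); apply: vr.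
Qed.

Lemma nr_row_lt n (v : 'rV[C]_n) (r : R) : 0 < r ->
  (forall i, nr (v 0 i) < r) -> nr v < r.
Proof.
move=> r0 vr; have [v0|v0] := eqVneq (mx_norm v) 0.
  by rewrite /nr [`|v|]v0.
have [[j i] /= e] := mx_norm_neq0 v0.
by rewrite {1}/nr [`|v|]e (ord1 j); apply: vr.
Qed.

End RealNorm.

(** * Limits along a free ultrafilter on the natural numbers *)

Section Ultralimit.
Variable R : realType.
Local Notation C := R[i].

Lemma ultra_nat_ex : exists G : set_system nat, UltraFilter G /\ eventually `<=` G.
Proof. exact: (@ultraFilterLemma nat eventually _). Qed.

Definition ultra : set_system nat := projT1 (cid ultra_nat_ex).

Lemma ultra_ultra : UltraFilter ultra.
Proof. by rewrite /ultra; case: cid => G []. Qed.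

Lemma ultra_oo : eventually `<=` ultra.
Proof. by rewrite /ultra; case: cid => G []. Qed.

#[global] Instance ultra_filter : ProperFilter ultra.
Proof. exact: (@ultra_proper _ _ ultra_ultra). Qed.

Lemma ultra_ge N : ultra [set n | (N <= n)%N].
Proof. by apply: ultra_oo; exists N. Qed.

Definition bnd (a : nat -> C) := exists M : R, forall n, nr (a n) <= M.

Definition ulim_to (a : nat -> C) (z : C) :=
  forall e : R, 0 < e -> ultra [set n | nr (a n - z) < e].

(** Every bounded sequence has such a limit, so [Lim] is additive and multiplicative on all bounded
    sequences, and limits can be named before any convergence is proved. On convergent sequences it
    is the usual limit ([Lim_cvg]). *)
Definition Lim (a : nat -> C) : C := xget 0 [set z | ulim_to a z].

(** The limit is the supremum of the c that lie below x n for almost all n; that almost all terms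
    lie below sup + e is the ultrafilter dichotomy. *)
Lemma ulim_real (x : nat -> R) M : (forall n, `|x n| <= M) ->
  exists l, forall e : R, 0 < e -> ultra [set n | `|x n - l| < e].
Proof.
move=> xM; pose S := [set c | ultra [set n | c <= x n]].
have SM : has_sup S.
  split.
    exists (- M); rewrite /S/=; apply: filterS filterT => n _ /=.
    by have := xM n; rewrite ler_norml => /andP[].
  exists M => c; rewrite /S/= => /filter_ex[n /= cn].
  by apply: le_trans cn _; have := xM n; rewrite ler_norml => /andP[].
exists (sup S) => e e0.
have [c Sc ce] : exists2 c, S c & sup S - e < c.
  by apply: sup_adherent.
have e20 : 0 < e / 2 by rewrite divr_gt0.
have : ~ S (sup S + e / 2).
  move=> h; have : sup S + e / 2 <= sup S by apply: ub_le_sup => //; case: SM.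
  by lra.
rewrite /S/=; have [//|/= h _] := in_ultra_setVsetC [set n | sup S + e / 2 <= x n] ultra_ultra.
apply: filterS2 Sc h => n /= cn /negP; rewrite -ltNge => xn.
by rewrite ltr_norml; apply/andP; split; lra.
Qed.

Lemma Lim_to (a : nat -> C) : bnd a -> ulim_to a (Lim a).
Proof.
move=> [M aM]; rewrite /Lim; apply: (@xgetPex _ 0 [set z | ulim_to a z]).
have [l hl] : exists l, forall e : R, 0 < e -> ultra [set n | `|complex.Re (a n) - l| < e].
  apply: (ulim_real (M := M)) => n; apply: le_trans (aM n).
  by rewrite ler_norml Re_nr -lerN2 opprK ReN_nr.
have [m hm] : exists m, forall e : R, 0 < e -> ultra [set n | `|complex.Im (a n) - m| < e].
  apply: (ulim_real (M := M)) => n; apply: le_trans (aM n).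
  by rewrite ler_norml Im_nr -lerN2 opprK ImN_nr.
exists (l +i* m)%C => e e0; have e20 : 0 < e / 2 by rewrite divr_gt0.
apply: filterS2 (hl _ e20) (hm _ e20) => n /= h1 h2.
apply: le_lt_trans (nr_ReIm _) _; case: (a n) h1 h2 => x y /= h1 h2; lra.
Qed.

Lemma ulim_uniq (a : nat -> C) y z : ulim_to a y -> ulim_to a z -> y = z.
Proof.
move=> ay az; apply/eqP; rewrite -subr_eq0; apply/negPn/negP => yz.
have d0 := nr_gt0 yz; have d20 : 0 < nr (y - z) / 2 by rewrite divr_gt0.
have [n [/= h1 h2]] := filter_ex (filterI (ay _ d20) (az _ d20)).
by have := nrBD (a n) y z; rewrite (nrBC y (a n)); lra.
Qed.

Lemma LimE (a : nat -> C) z : ulim_to a z -> Lim a = z.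
Proof.
move=> az; apply: (ulim_uniq _ az).
by rewrite /Lim; apply: (@xgetPex _ 0 [set z | ulim_to a z]); exists z.
Qed.

Lemma ulim_ae (a b : nat -> C) z :
  ultra [set n | a n = b n] -> ulim_to a z -> ulim_to b z.
Proof. by move=> ab az e e0; apply: filterS2 ab (az e e0) => n /= ->. Qed.

Lemma ulim_cst (z : C) : ulim_to (fun=> z) z.
Proof. by move=> e e0; apply: filterS filterT => n _ /=; rewrite subrr nr0. Qed.

Lemma ulimD a b y z : ulim_to a y -> ulim_to b z ->
  ulim_to (fun n => a n + b n) (y + z).
Proof.
move=> ay bz e e0; have e20 : 0 < e / 2 by rewrite divr_gt0.
apply: filterS2 (ay _ e20) (bz _ e20) => n /= h1 h2.
rewrite opprD addrACA; apply: le_lt_trans (nrD _ _) _; lra.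
Qed.

Lemma ulimM a b y z : ulim_to a y -> ulim_to b z ->
  ulim_to (fun n => a n * b n) (y * z).
Proof.
move=> ay bz e e0.
pose d := Num.min 1 (e / (2 * (nr z + nr y + 1))).
have ny := nr_ge0 y; have nz := nr_ge0 z.
have d0 : 0 < d by rewrite lt_min ltr01 divr_gt0// mulr_gt0//; lra.
have d1 : d <= 1 by rewrite ge_min lexx.
have de : d * (nr z + nr y + 1) <= e / 2.
  have : d <= e / (2 * (nr z + nr y + 1)) by rewrite ge_min lexx orbT.
  rewrite ler_pdivlMr; last by rewrite mulr_gt0//; lra.
  by move=> h; rewrite ler_pdivlMr//; lra.
apply: filterS2 (ay _ d0) (bz _ d0) => n /= h1 h2.
have -> : a n * b n - y * z = (a n - y) * z + y * (b n - z) + (a n - y) * (b n - z) by ring.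
apply: le_lt_trans (nrD _ _) _; rewrite nrM.
have := nrD ((a n - y) * z) (y * (b n - z)); rewrite !nrM.
have := nr_ge0 (a n - y); have := nr_ge0 (b n - z); nra.
Qed.

Lemma ulim_le a z M : ultra [set n | nr (a n) <= M] -> ulim_to a z -> nr z <= M.
Proof.
move=> aM az; rewrite leNgt; apply/negP => Mz.
have d0 : 0 < nr z - M by rewrite subr_gt0.
have [n [/= h1 h2]] := filter_ex (filterI aM (az _ d0)).
by have := nrBl z (a n); rewrite (nrBC z); lra.
Qed.

Lemma bnd_cst (z : C) : bnd (fun=> z).
Proof. by exists (nr z). Qed.

Lemma bndD a b : bnd a -> bnd b -> bnd (fun n => a n + b n).
Proof.
by move=> [M h] [N k]; exists (M + N) => n; apply: le_trans (nrD _ _) _; rewrite lerD.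
Qed.

Lemma bndM a b : bnd a -> bnd b -> bnd (fun n => a n * b n).
Proof. by move=> [M h] [N k]; exists (M * N) => n; rewrite nrM ler_pM// nr_ge0. Qed.

Lemma bnd_sum (I : Type) (s : seq I) (P : pred I) (a : I -> nat -> C) :
  (forall i, bnd (a i)) -> bnd (fun n => \sum_(i <- s | P i) a i n).
Proof.
move=> ha; elim: s => [|i s IH].
  by exists 0 => n; rewrite big_nil nr0.
case: (boolP (P i)) => Pi.
  have [M h] := bndD (ha i) IH; exists M => n; rewrite big_cons Pi; exact: h.
by have [M h] := IH; exists M => n; rewrite big_cons (negPf Pi); exact: h.
Qed.

Lemma Lim_ext a b : (forall n, a n = b n) -> Lim a = Lim b.
Proof. by move=> ab; congr Lim; apply/funext. Qed.

Lemma Lim_cst (z : C) : Lim (fun=> z) = z.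
Proof. exact/LimE/ulim_cst. Qed.

Lemma LimD a b : bnd a -> bnd b -> Lim (fun n => a n + b n) = Lim a + Lim b.
Proof. by move=> ha hb; apply/LimE/ulimD; apply: Lim_to. Qed.

Lemma LimM a b : bnd a -> bnd b -> Lim (fun n => a n * b n) = Lim a * Lim b.
Proof. by move=> ha hb; apply/LimE/ulimM; apply: Lim_to. Qed.

Lemma LimZ z a : bnd a -> Lim (fun n => z * a n) = z * Lim a.
Proof. by move=> ha; rewrite LimM ?Lim_cst//; apply: bnd_cst. Qed.

Lemma LimN a : bnd a -> Lim (fun n => - a n) = - Lim a.
Proof.
by move=> ha; rewrite -mulN1r -LimZ//; apply: Lim_ext => n; rewrite mulN1r.
Qed.

Lemma bndN a : bnd a -> bnd (fun n => - a n).
Proof. by move=> [M h]; exists M => n; rewrite nrN. Qed.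

Lemma bndB a b : bnd a -> bnd b -> bnd (fun n => a n - b n).
Proof. by move=> ha hb; apply: bndD => //; apply: bndN. Qed.

Lemma LimB a b : bnd a -> bnd b -> Lim (fun n => a n - b n) = Lim a - Lim b.
Proof. by move=> ha hb; rewrite LimD ?LimN//; apply: bndN. Qed.

Lemma Lim_sum (I : Type) (s : seq I) (P : pred I) (a : I -> nat -> C) :
  (forall i, bnd (a i)) ->
  Lim (fun n => \sum_(i <- s | P i) a i n) = \sum_(i <- s | P i) Lim (a i).
Proof.
move=> ha; elim: s => [|i s IH].
  by rewrite big_nil -[RHS](Lim_cst 0); apply: Lim_ext => n; rewrite big_nil.
rewrite big_cons; case: (boolP (P i)) => Pi; rewrite -IH.
  rewrite -LimD//; last exact: bnd_sum.
  by apply: Lim_ext => n; rewrite big_cons Pi.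
by apply: Lim_ext => n; rewrite big_cons (negPf Pi).
Qed.

Lemma nr_Lim a M : (forall n, nr (a n) <= M) -> nr (Lim a) <= M.
Proof.
move=> aM; apply: ulim_le (Lim_to _); last by exists M.
by apply: filterS filterT => n _ /=; apply: aM.
Qed.

Lemma Lim_cvg a z : (forall e : R, 0 < e ->
  exists N, forall n, (N <= n)%N -> nr (a n - z) < e) -> Lim a = z.
Proof.
move=> az; apply: LimE => e e0; have [N hN] := az _ e0.
by apply: filterS (ultra_ge N) => n /= /hN.
Qed.

Lemma Lim_shift_sub a b : bnd a -> bnd b ->
  (forall e : R, 0 < e -> exists N, forall n, (N <= n)%N -> nr (a n - b n) < e) ->
  Lim a = Lim b.
Proof.
move=> ha hb hab; apply/eqP; rewrite -subr_eq0 -LimB//; apply/eqP.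
by apply: Lim_cvg => e /hab[N h]; exists N => n Nn; rewrite subr0; apply: h.
Qed.

End Ultralimit.

(** * Complex Frechet derivatives with real error bounds *)

Section Frechet.
Variable R : realType.
Local Notation C := R[i].

Section Def.
Variable E : normedModType C.
Implicit Types (f g L : E -> C) (u v : E).

(** The derivative is carried as an explicit functional, so that the rules of calculus produce it by
    computation. [cder_differentiable] and [differentiable_cder] translate to and from
    [differentiable]. *)
Definition cder f u L := [/\
  forall (a : C) x y, L (a *: x + y) = a * L x + L y,
  exists2 K : R, 0 <= K & forall v, nr (L v) <= K * nr v &
  forall e : R, 0 < e -> exists2 d : R, 0 < d &
    forall v, nr v < d -> nr (f (u + v) - f u - L v) <= e * nr v].

Lemma cder_lin f u L : cder f u L -> forall (a : C) x y, L (a *: x + y) = a * L x + L y.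
Proof. by case. Qed.

Lemma cder_lin0 f u L : cder f u L -> L 0 = 0.
Proof. by case=> /(_ (-1) 0 0); rewrite scaler0 add0r mulN1r addNr. Qed.

Lemma cder_linZ f u L : cder f u L -> forall (a : C) x, L (a *: x) = a * L x.
Proof. by move=> h a x; rewrite -[a *: x]addr0 (cder_lin h) (cder_lin0 h) addr0. Qed.

Lemma cder_linD f u L : cder f u L -> forall x y, L (x + y) = L x + L y.
Proof. by move=> h x y; rewrite -[x in LHS]scale1r (cder_lin h) mul1r. Qed.

Lemma cder_linN f u L : cder f u L -> forall x, L (- x) = - L x.
Proof. by move=> h x; rewrite -scaleN1r (cder_linZ h) mulN1r. Qed.

Lemma cder_uniq f u L L' : cder f u L -> cder f u L' -> L = L'.
Proof.
move=> h h'; apply/funext => v; apply/eqP; rewrite -subr_eq0; apply/negPn/negP => n0.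
have v0 : v != 0 by apply: contraNneq n0 => ->; rewrite (cder_lin0 h) (cder_lin0 h') subrr.
have nv := nr_gt0 v0; have nd := nr_gt0 n0.
(* With a quarter of the relative gap as tolerance, the two error bounds on a small multiple of [v]
   add up to half the gap. *)
pose e := nr (L v - L' v) / (4 * nr v).
have e0 : 0 < e by rewrite divr_gt0// mulr_gt0.
have [_ _ /(_ _ e0)[d d0 hd]] := h; have [_ _ /(_ _ e0)[d' d'0 hd']] := h'.
pose m := Num.min d d' / (2 * nr v).
have m0 : 0 < m by rewrite divr_gt0 ?mulr_gt0// lt_min d0.
have nm : nr (m%:C%C *: v) = m * nr v by rewrite nrZ nrR gtr0_norm.
have md : m * nr v < Num.min d d'.
  have -> : m * nr v = Num.min d d' / 2 by rewrite /m invfM mulrA mulfVK// gt_eqF.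
  by rewrite ltr_pdivrMr// ltr_pMr ?ltr1n// lt_min d0.
have := hd (m%:C%C *: v); rewrite nm => /(_ _)/[dup].
have [md1 md2] : m * nr v < d /\ m * nr v < d'.
  by move: md; rewrite lt_min => /andP[].
move=> /(_ md1) k1 _; have k2 := hd' (m%:C%C *: v).
rewrite nm in k2; have {}k2 := k2 md2.
have e1 : nr (m%:C%C * (L v - L' v)) = m * nr (L v - L' v).
  by rewrite nrM nrR gtr0_norm.
have : m * nr (L v - L' v) <= 2 * e * (m * nr v).
  rewrite -e1 mulrBr -(cder_linZ h) -(cder_linZ h').
  rewrite (_ : _ - _ = (f (u + m%:C%C *: v) - f u - L' (m%:C%C *: v)) -
     (f (u + m%:C%C *: v) - f u - L (m%:C%C *: v))); last by ring.
  apply: le_trans (nrB _ _) _; lra.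
have -> : 2 * e * (m * nr v) = m * nr (L v - L' v) / 2.
  by rewrite /e; field; rewrite gt_eqF.
have := mulr_gt0 m0 nd; lra.
Qed.

Lemma cder_loc f g u L : (\forall v \near u, f v = g v) -> cder f u L -> cder g u L.
Proof.
move=> /near_nrP[r r0 fg] [h1 h2 h3]; split=> // e /h3[d d0 hd].
exists (Num.min d r); first by rewrite lt_min d0.
move=> v; rewrite lt_min => /andP[vd vr].
by rewrite -!fg ?hd// ?subrr ?nr0// addrC addKr.
Qed.

Lemma cder_eq f g u L : (forall v, f v = g v) -> cder f u L -> cder g u L.
Proof. by move=> fg; rewrite (funext fg). Qed.

Lemma cder_eqL f u L L' : (forall v, L v = L' v) -> cder f u L -> cder f u L'.
Proof. by move=> fg; rewrite (funext fg). Qed.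

Lemma cder_lip f u L : cder f u L -> exists K : R, exists2 d : R, 0 < d &
  0 < K /\ forall v, nr v < d -> nr (f (u + v) - f u) <= K * nr v.
Proof.
move=> [_ [K K0 hK] /(_ _ ltr01)[d d0 hd]]; exists (K + 1); exists d => //.
split=> [|v vd]; first by lra.
have := hd _ vd; have := hK v.
have := nrD (f (u + v) - f u - L v) (L v); rewrite subrK; lra.
Qed.

Lemma cder_cont f u L : cder f u L -> forall e : R, 0 < e -> exists2 d : R, 0 < d &
  forall v, nr (v - u) < d -> nr (f v - f u) < e.
Proof.
move=> /cder_lip[K [d d0 [K0 hK]]] e e0.
exists (Num.min d (e / K)); first by rewrite lt_min d0 divr_gt0.
move=> v; rewrite lt_min => /andP[vd ve].
have := hK _ vd; rewrite [u + _]addrC subrK => /le_lt_trans; apply.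
by rewrite mulrC -ltr_pdivlMr.
Qed.

Lemma cder_cst (c : C) u : cder (fun=> c) u (fun=> 0).
Proof.
split=> [a x y||e e0]; first by rewrite mulr0 addr0.
  by exists 0 => // v; rewrite nr0 mul0r.
by exists 1 => // v _; rewrite !subrr nr0 mulr_ge0 ?nr_ge0// ltW.
Qed.

Lemma cderD f g u L M : cder f u L -> cder g u M ->
  cder (fun v => f v + g v) u (fun v => L v + M v).
Proof.
move=> [f1 [K K0 f2] f3] [g1 [K' K'0 g2] g3]; split=> [a x y||e e0].
- by rewrite f1 g1; ring.
- exists (K + K'); first by rewrite addr_ge0.
  by move=> v; rewrite mulrDl; apply: le_trans (nrD _ _) _; rewrite lerD.
- have e20 : 0 < e / 2 by rewrite divr_gt0.
  have [d d0 hd] := f3 _ e20; have [d' d'0 hd'] := g3 _ e20.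
  exists (Num.min d d'); first by rewrite lt_min d0.
  move=> v; rewrite lt_min => /andP[vd vd'].
  rewrite (_ : _ - _ - _ = (f (u + v) - f u - L v) + (g (u + v) - g u - M v)); last by ring.
  apply: le_trans (nrD _ _) _; have := hd _ vd; have := hd' _ vd'; lra.
Qed.

Lemma cderM f g u L M : cder f u L -> cder g u M ->
  cder (fun v => f v * g v) u (fun v => L v * g u + f u * M v).
Proof.
move=> hf hg; have [Kg [dg dg0 [Kg0 lg]]] := cder_lip hg.
have [f1 [K K0 f2] f3] := hf; have [g1 [K' K'0 g2] g3] := hg; split=> [a x y||e e0].
- by rewrite f1 g1; ring.
- exists (K * nr (g u) + nr (f u) * K'); first by rewrite addr_ge0// mulr_ge0 ?nr_ge0.
  move=> v; rewrite mulrDl; apply: le_trans (nrD _ _) _; rewrite !nrM.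
  have := f2 v; have := g2 v; have := nr_ge0 (f u); have := nr_ge0 (g u).
  by move=> *; rewrite lerD//; nra.
- pose A := nr (g u) + nr (f u) + 1.
  have gu := nr_ge0 (g u); have fu := nr_ge0 (f u).
  have A0 : 0 < A by rewrite /A; lra.
  pose e1 := Num.min 1 (e / (3 * A)).
  have e10 : 0 < e1 by rewrite lt_min ltr01 divr_gt0// mulr_gt0.
  have e1e : e1 * A <= e / 3.
    have : e1 <= e / (3 * A) by rewrite ge_min lexx orbT.
    by rewrite ler_pdivlMr ?mulr_gt0//; lra.
  have [d d0 hd] := f3 _ e10; have [d' d'0 hd'] := g3 _ e10.
  have [Kf [df df0 [Kf0 lf]]] := cder_lip hf.
  pose D := Num.min (Num.min d d') (Num.min (Num.min df dg) (e / (3 * (Kf * Kg)))).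
  have KK : 0 < Kf * Kg by rewrite mulr_gt0.
  exists D; first by rewrite !lt_min d0 d'0 df0 dg0 divr_gt0// mulr_gt0.
  move=> v; rewrite !lt_min => /andP[/andP[vd vd'] /andP[/andP[vdf vdg] ve]].
  rewrite (_ : _ - _ - _ = (f (u + v) - f u - L v) * g u + f u * (g (u + v) - g u - M v)
     + (f (u + v) - f u) * (g (u + v) - g u)); last by ring.
  apply: le_trans (nrD _ _) _.
  have := nrD ((f (u + v) - f u - L v) * g u) (f u * (g (u + v) - g u - M v)).
  rewrite !nrM.
  have k1 := hd _ vd; have k2 := hd' _ vd'; have k3 := lf _ vdf; have k4 := lg _ vdg.
  have nv := nr_ge0 v.
  have k5 : nr (f (u + v) - f u) * nr (g (u + v) - g u) <= e / 3 * nr v.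
    apply: (@le_trans _ _ ((Kf * nr v) * (Kg * nr v))).
      by rewrite ler_pM ?nr_ge0.
    move: ve; rewrite ltr_pdivlMr ?mulr_gt0// => ve.
    rewrite (_ : Kf * nr v * (Kg * nr v) = (nr v * (Kf * Kg)) * nr v); last by ring.
    by rewrite ler_wpM2r//; lra.
  have k6 : nr (f (u + v) - f u - L v) * nr (g u) <= e1 * nr v * nr (g u).
    by rewrite ler_wpM2r.
  have k7 : nr (f u) * nr (g (u + v) - g u - M v) <= nr (f u) * (e1 * nr v).
    by rewrite ler_wpM2l.
  have k8 : e1 * A * nr v <= e / 3 * nr v by rewrite ler_wpM2r.
  have k9 : 0 <= e1 * nr v by rewrite mulr_ge0// ltW.
  move: k8; rewrite /A; nra.
Qed.

Lemma cderZ (c : C) f u L : cder f u L -> cder (fun v => c * f v) u (fun v => c * L v).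
Proof.
move=> h; apply: cder_eqL (cderM (cder_cst c u) h) => v.
by rewrite mul0r add0r.
Qed.

Lemma cderN f u L : cder f u L -> cder (fun v => - f v) u (fun v => - L v).
Proof.
move=> h; apply: (@cder_eq (fun v => -1 * f v)) => [v|]; first by rewrite mulN1r.
by apply: cder_eqL (cderZ (-1) h) => v; rewrite mulN1r.
Qed.

Lemma cderB f g u L M : cder f u L -> cder g u M ->
  cder (fun v => f v - g v) u (fun v => L v - M v).
Proof. by move=> hf hg; apply: cderD => //; apply: cderN. Qed.

Lemma cder_sum (I : Type) (s : seq I) (P : pred I) (f L : I -> E -> C) u :
  (forall i, P i -> cder (f i) u (L i)) ->
  cder (fun v => \sum_(i <- s | P i) f i v) u (fun v => \sum_(i <- s | P i) L i v).
Proof.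
move=> h; elim: s => [|i s IH].
  apply: (@cder_eq (fun=> 0)) => [v|]; first by rewrite big_nil.
  by apply: cder_eqL (cder_cst 0 u) => v; rewrite big_nil.
case: (boolP (P i)) => Pi.
  apply: (@cder_eq (fun v => f i v + \sum_(i <- s | P i) f i v)) => [v|].
    by rewrite big_cons Pi.
  by apply: cder_eqL (cderD (h _ Pi) IH) => v; rewrite big_cons Pi.
apply: (@cder_eq (fun v => \sum_(i <- s | P i) f i v)) => [v|].
  by rewrite big_cons (negPf Pi).
by apply: cder_eqL IH => v; rewrite big_cons (negPf Pi).
Qed.

Lemma cder_differentiable f u L : cder f u L ->
  differentiable f u /\ forall v, 'D_v f u = L v.
Proof.
move=> [h1 [K K0 h2] h3].
have ladd : linear (L : E -> C^o) by move=> a x y; rewrite h1.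
pose Lm := GRing.isLinear.Build _ _ _ _ L ladd.
pose LL : {linear E -> C} := HB.pack L Lm.
have cL : continuous LL.
  apply: bounded_linear_continuous; apply/linear_boundedP.
  exists (K + 1)%:C%C; split; first by rewrite realE ler0c; apply/orP; left; lra.
  move=> M KM x; apply: (@le_trans _ _ ((K + 1)%:C%C * `|x|)); last first.
    by rewrite ler_wpM2r// ltW.
  rewrite !nrE -rmorphM lecR /=; apply: le_trans (h2 x) _.
  by rewrite ler_wpM2r ?nr_ge0//; lra.
have o : f \o shift u = cst (f u) + LL +o_ 0 id.
  apply/eqaddoP => e e0; have er : e = (complex.Re e)%:C%C by rewrite RRe_real// gtr0_real.
  have [d d0 hd] : exists2 d : R, 0 < d &
      forall v, nr v < d -> nr (f (u + v) - f u - L v) <= complex.Re e * nr v.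
    by apply: h3; rewrite -ltcR -er.
  apply/near_nrP; exists d => // v; rewrite subr0 => /hd.
  rewrite -lecR rmorphM/= -er -!nrE; apply: le_trans.
  by rewrite !fctE /= opprD addrA [u + v]addrC.
have dL := diff_unique cL o.
have df : differentiable f u by apply/diff_locallyP; rewrite dL.
by split=> // v; rewrite deriveE// dL.
Qed.

Lemma differentiable_cder f u : differentiable f u -> cder f u (fun v => 'D_v f u).
Proof.
move=> df; have /eqadd_some_oP o := diff_locally df; have cdf := diff_continuous df.
rewrite (_ : (fun v => _) = 'd f u); last by apply/funext => v; rewrite deriveE.
split=> [a x y||e e0]; first by rewrite linearP.
  have /linear_boundedP/pinfty_ex_gt0[M M0 hM] := continuous_linear_bounded 0 (cdf 0).
  have er : M = (complex.Re M)%:C%C by rewrite RRe_real// gtr0_real.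
  exists (complex.Re M) => [|v]; first by rewrite ltW// -ltcR -er.
  by rewrite -lecR rmorphM/= -er -!nrE.
have e0' : 0 < e%:C%C :> C by rewrite ltcR.
have /near_nrP[d d0 hd] := o _ e0'.
exists d => // v vd; have := hd v; rewrite subr0 => /(_ vd).
rewrite !nrE -rmorphM lecR; apply: le_trans.
by rewrite !fctE /= opprD addrA [u + v]addrC.
Qed.

End Def.

End Frechet.

(** * Integrals along segments and Goursat's theorem *)

Section Goursat.
Variable R : realType.
Local Notation C := R[i].

Definition cd (f : C -> C) (z a : C) := cder f z (fun v => v * a).

Lemma cder_cd (f : C -> C) z L : cder f z L -> cd f z (L 1).
Proof.
move=> h; apply: (cder_eqL _ h) => v.
by rewrite -[v in LHS]mulr1 -[v * 1]/(v *: (1 : C)) (cder_linZ h).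
Qed.

Lemma cd_uniq (f : C -> C) z a b : cd f z a -> cd f z b -> a = b.
Proof. by move=> h k; have /(congr1 (fun g => g 1)) := cder_uniq h k; rewrite !mul1r. Qed.

Lemma cd_id z : cd (fun z => z) z 1.
Proof.
split=> [a x y||e e0]; first by rewrite !mulr1.
  by exists 1 => // v; rewrite mulr1 mul1r.
exists 1 => // v _; rewrite (_ : _ - _ = 0); last by ring.
by rewrite nr0 mulr_ge0 ?nr_ge0// ltW.
Qed.

Section Compact.
Variables (f : C -> C) (c : C) (r : R).
Hypothesis hf : forall z, nr (z - c) <= r -> exists L, cder f z L.

(** Compactness through ultralimits: a sequence of points at which [f] grows without bound has a
    limit in the closed disc, against continuity there. *)
Lemma disc_bounded : exists M : R, forall z, nr (z - c) <= r -> nr (f z) <= M.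
Proof.
apply: contrapT => h.
have hn n : exists z, nr (z - c) <= r /\ n%:R < nr (f z).
  apply: contrapT => k; apply: h; exists n%:R => z zr; rewrite leNgt; apply/negP => nz.
  by apply: k; exists z.
have [z hz] := choice hn.
have bz : bnd z.
  exists (r + nr c) => n; have [+ _] := hz n; have := nrD (z n - c) c; rewrite subrK; lra.
have zl := Lim_to bz; have lr : nr (Lim z - c) <= r.
  have -> : Lim z - c = Lim (fun n => z n - c).
    by rewrite LimB ?Lim_cst//; exact: bnd_cst.
  by apply: nr_Lim => n; have [] := hz n.
have [L /cder_cont/(_ _ ltr01)[d d0 hd]] := hf lr.
pose N := Num.bound (nr (f (Lim z)) + 1).
have [n [/= h1 h2]] := filter_ex (filterI (zl _ d0) (ultra_ge N)).
have := hd _ h1; have [_ h3] := hz n.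
have h4 : nr (f (Lim z)) + 1 < N%:R by apply: archi_boundP; rewrite addr_ge0 ?nr_ge0.
have h5 : (N%:R : R) <= n%:R by rewrite ler_nat.
have := nrBl (f (z n)) (f (Lim z)); lra.
Qed.

Lemma disc_unif_cont (e : R) : 0 < e -> exists2 d : R, 0 < d &
  forall z z', nr (z - c) <= r -> nr (z' - c) <= r -> nr (z' - z) < d -> nr (f z' - f z) <= e.
Proof.
move=> e0; apply: contrapT => h.
have hn n : exists p : C * C, [/\ nr (p.1 - c) <= r, nr (p.2 - c) <= r,
    nr (p.2 - p.1) < n.+1%:R^-1 & e < nr (f p.2 - f p.1)].
  apply: contrapT => k; apply: h; exists n.+1%:R^-1; first by rewrite invr_gt0.
  move=> z z' h1 h2 h3; rewrite leNgt; apply/negP => h4.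
  by apply: k; exists (z, z').
have [p hp] := choice hn; pose z n := (p n).1.
have bz : bnd z.
  exists (r + nr c) => n; have [+ _ _ _] := hp n; have := nrD (z n - c) c; rewrite /z subrK; lra.
have zl := Lim_to bz; have lr : nr (Lim z - c) <= r.
  have -> : Lim z - c = Lim (fun n => z n - c).
    by rewrite LimB ?Lim_cst//; exact: bnd_cst.
  by apply: nr_Lim => n; have [] := hp n.
have e20 : 0 < e / 2 by rewrite divr_gt0.
have [L /cder_cont/(_ _ e20)[d d0 hd]] := hf lr.
have d20 : 0 < d / 2 by rewrite divr_gt0.
pose N := Num.bound (2 / d).
have [n [/= h1 h2]] := filter_ex (filterI (zl _ d20) (ultra_ge N)).
have := hp n; rewrite -/(z n) => -[_ _ h3 h4].
have h5 : n.+1%:R^-1 < d / 2.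
  rewrite invf_plt ?posrE// invf_div.
  apply: lt_le_trans (_ : N%:R <= _); last by rewrite ler_nat ltnW.
  by apply: archi_boundP; rewrite divr_ge0// ltW.
have {h5}h3 := lt_trans h3 h5.
have k1 : nr (z n - Lim z) < d by lra.
have k2 : nr ((p n).2 - Lim z) < d.
  by have := nrBD (p n).1 (p n).2 (Lim z); rewrite -/(z n); lra.
have := hd _ k1; have := hd _ k2.
by have := nrBD (f (Lim z)) (f (p n).2) (f (p n).1); rewrite (nrBC (f (Lim z))) -/(z n); lra.
Qed.

End Compact.

Definition segpt (a b : C) (t : R) : C := a + t%:C%C * (b - a).

Lemma segpt_disc a b c r t : 0 <= t <= 1 -> nr (a - c) <= r -> nr (b - c) <= r ->
  nr (segpt a b t - c) <= r.
Proof.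
move=> /andP[t0 t1] ar br; rewrite /segpt.
rewrite (_ : _ - c = (1 - t)%:C%C * (a - c) + t%:C%C * (b - c)); last first.
  by rewrite rmorphB rmorph1; ring.
apply: le_trans (nrD _ _) _; rewrite !nrM !nrR ger0_norm ?subr_ge0// ger0_norm//.
have h : 0 <= 1 - t by rewrite subr_ge0.
have := ler_wpM2l h ar; have := ler_wpM2l t0 br; lra.
Qed.

Lemma segpt_dist a b t : 0 <= t <= 1 -> nr (segpt a b t - a) <= nr (b - a).
Proof.
move=> /andP[t0 t1]; rewrite /segpt addrC addKr nrM nrR ger0_norm//.
by rewrite ler_piMl// nr_ge0.
Qed.

Definition node (n k : nat) : R := (2 * k + 1)%:R / (2 ^ n.+1)%:R.

Lemma node01 n k : (k < 2 ^ n)%N -> 0 <= node n k <= 1.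
Proof.
move=> kn; rewrite /node divr_ge0//= ler_pdivrMr ?mul1r ?ler_nat ?ltr0n ?expn_gt0//.
rewrite expnS; lia.
Qed.

(** Midpoint sums over 2^n equal pieces. They split exactly at the middle of the segment ([rsumS])
    and are exact on affine functions ([rsum_affine]), the two facts that the triangle argument
    consumes. *)
Definition rsum (f : C -> C) (a b : C) n : C :=
  (b - a) / (2 ^ n)%:R * \sum_(0 <= k < 2 ^ n) f (segpt a b (node n k)).

Definition mid (a b : C) : C := (a + b) / 2.

Lemma pow2_neq0 n : ((2 ^ n)%:R : C) != 0.
Proof. by rewrite pnatr_eq0 -lt0n expn_gt0. Qed.

Lemma node_C n k : (node n k)%:C%C = (2 * k + 1)%:R / (2 ^ n.+1)%:R :> C.
Proof. by rewrite /node rmorphM/= fmorphV/= !rmorph_nat. Qed.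

Lemma rsumS f a b n : rsum f a b n.+1 = rsum f a (mid a b) n + rsum f (mid a b) b n.
Proof.
have p := pow2_neq0 n; have p3 : (2 ^ n)%:R + (2 ^ n)%:R != 0 :> C.
  by rewrite -natrD pnatr_eq0 addnn double_eq0 -lt0n expn_gt0.
rewrite /rsum expnS mul2n -addnn.
rewrite (big_cat_nat (n := (2 ^ n)%N))//= ?leq_addr//.
have -> : \sum_(2 ^ n <= k < 2 ^ n + 2 ^ n) f (segpt a b (node n.+1 k)) =
    \sum_(0 <= k < 2 ^ n) f (segpt a b (node n.+1 (k + 2 ^ n))).
  by rewrite -{1}[(2 ^ n)%N]add0n big_addn addnK.
rewrite mulrDr.
congr (_ + _).
  congr (_ * _); first by rewrite /mid natrD; field; rewrite ?p ?p3.
  apply: eq_bigr => k _; congr f; rewrite /segpt !node_C !expnS !natrM /mid.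
  by field; rewrite p.
congr (_ * _); first by rewrite /mid natrD; field; rewrite ?p ?p3.
apply: eq_bigr => k _; congr f; rewrite /segpt !node_C !expnS ![(2 * _ + 1)%:R]natrD !natrM [(_ + 2 ^ n)%:R]natrD /mid.
by field; rewrite p.
Qed.

Lemma rsum_opp f a b n : rsum f b a n = - rsum f a b n.
Proof.
rewrite /rsum big_nat_rev/= add0n -mulNr -mulNr opprB; congr (_ * _).
rewrite !big_mkord; apply: eq_bigr => k _; congr f; rewrite /segpt !node_C.
have p := pow2_neq0 n.
have -> : (2 * (2 ^ n - k.+1) + 1)%:R = 2 * (2 ^ n)%:R - (2 * k + 1)%:R :> C.
  rewrite -natrM -natrB; first by congr _%:R; have := ltn_ord k; lia.
  by have := ltn_ord k; lia.
by rewrite !expnS natrM; field.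
Qed.

Lemma sum_odd n : (\sum_(0 <= k < n) (2 * k + 1) = n ^ 2)%N.
Proof. by elim: n => [|n IH]; [rewrite big_geq|rewrite big_nat_recr//= IH; lia]. Qed.

Lemma rsum_affine (al be : C) a b n :
  rsum (fun z => al * z + be) a b n = al * (b ^+ 2 - a ^+ 2) / 2 + be * (b - a).
Proof.
have p := pow2_neq0 n; have p2 : (2 : C) != 0 by rewrite pnatr_eq0.
rewrite /rsum (eq_bigr (fun k => (al * a + be) +
   (al * (b - a) / (2 ^ n.+1)%:R) * (2 * k + 1)%:R)); last first.
  by move=> k _; rewrite /segpt node_C; ring.
rewrite big_split/= sumr_const_nat subn0 -mulr_sumr -natr_sum sum_odd.
rewrite -[_ *+ (2 ^ n)]mulr_natr (natrX _ (2 ^ n) 2) expnS natrM; field; by rewrite p.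
Qed.

Lemma rsum_close (f g : C -> C) a b (e : R) :
  (forall t, 0 <= t <= 1 -> nr (f (segpt a b t) - g (segpt a b t)) <= e) ->
  forall n, nr (rsum f a b n - rsum g a b n) <= e * nr (b - a).
Proof.
move=> fg n; have p := pow2_neq0 n.
rewrite /rsum -mulrBr -sumrB nrM nrM nrV nr_nat.
have P0 : 0 < (2 ^ n)%:R :> R by rewrite ltr0n expn_gt0.
have : nr (\sum_(0 <= k < 2 ^ n) (f (segpt a b (node n k)) - g (segpt a b (node n k)))) <=
   e * (2 ^ n)%:R.
  apply: le_trans (nr_sum _ _ _) _; rewrite !big_nat.
  apply: (@le_trans _ _ (\sum_(0 <= i < 2 ^ n) e)).
    by rewrite [leRHS]big_nat ler_sum// => k kn; apply/fg/node01.
  by rewrite sumr_const_nat subn0 mulr_natr.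
by move=> h; rewrite -mulrA [e * _]mulrC ler_wpM2l ?nr_ge0// ler_pdivrMl// mulrC.
Qed.

Lemma double_lt_pow2 k n : (k < 2 ^ n)%N ->
  (k.*2 < 2 ^ n.+1)%N /\ (k.*2.+1 < 2 ^ n.+1)%N.
Proof. by rewrite expnS; lia. Qed.

Lemma odd_center k : (2 * k.*2 + 2 = (2 * k + 1) * 2)%N.
Proof. by lia. Qed.

Lemma odd_center1 k : (2 * k.*2.+1 + 1 = (2 * k.*2 + 2) + 1)%N.
Proof. by lia. Qed.

Section Integral.
Variables (f : C -> C) (c : C) (r : R).
Hypothesis hf : forall z, nr (z - c) <= r -> exists L, cder f z L.

Definition J a b := Lim (rsum f a b).

Lemma rsum_bnd a b : nr (a - c) <= r -> nr (b - c) <= r -> bnd (rsum f a b).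
Proof.
move=> ar br; have [M hM] := disc_bounded hf; exists (M * nr (b - a)) => n.
have := @rsum_close f (fun=> 0) a b M _ n.
rewrite {2}/rsum big1// mulr0 subr0; apply => t t01.
by rewrite subr0; apply/hM/segpt_disc.
Qed.

(** Comparing consecutive sums suffices: [J] is an ultralimit, and only its invariance under the
    shift by one is wanted in [J_mid]. *)
Lemma rsum_cauchy a b : nr (a - c) <= r -> nr (b - c) <= r -> forall e : R, 0 < e ->
  exists N, forall n, (N <= n)%N -> nr (rsum f a b n.+1 - rsum f a b n) < e.
Proof.
move=> ar br e e0; pose e1 := e / (nr (b - a) + 1).
have nab : 0 < nr (b - a) + 1 by have := nr_ge0 (b - a); lra.
have e10 : 0 < e1 by rewrite divr_gt0.
have [d d0 hd] := disc_unif_cont hf e10.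
exists (Num.bound (nr (b - a) / d)) => n Nn.
have P0 : 0 < (2 ^ n)%:R :> R by rewrite ltr0n expn_gt0.
have h1 : nr (b - a) < d * (2 ^ n)%:R.
  rewrite mulrC -ltr_pdivrMr//; apply: lt_trans (_ : n%:R < _); last first.
    by rewrite ltr_nat ltn_expl.
  apply: lt_le_trans (_ : (Num.bound (nr (b - a) / d))%:R <= _); last by rewrite ler_nat.
  by apply: archi_boundP; rewrite divr_ge0 ?nr_ge0// ltW.
suff h : nr (rsum f a b n.+1 - rsum f a b n) <= e1 * nr (b - a).
  apply: le_lt_trans h _; rewrite /e1 mulrAC ltr_pdivrMr// ltr_pM2l//; lra.
(* each level-n node is compared with its two level-(n+1) neighbours *)
have E : rsum f a b n.+1 - rsum f a b n = (b - a) / (2 ^ n.+1)%:R *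
   \sum_(0 <= k < 2 ^ n) ((f (segpt a b (node n.+1 k.*2)) - f (segpt a b (node n k)))
      + (f (segpt a b (node n.+1 k.*2.+1)) - f (segpt a b (node n k)))).
  have -> : rsum f a b n.+1 = (b - a) / (2 ^ n.+1)%:R * \sum_(0 <= k < 2 ^ n)
     (f (segpt a b (node n.+1 k.*2)) + f (segpt a b (node n.+1 k.*2.+1))).
    congr (_ * _); rewrite expnS mul2n; elim: (2 ^ n)%N => [|m IH].
      by rewrite !big_geq.
    by rewrite doubleS !big_nat_recr//= IH addrA.
  rewrite (_ : rsum f a b n = (b - a) / (2 ^ n.+1)%:R * \sum_(0 <= k < 2 ^ n)
     (f (segpt a b (node n k)) + f (segpt a b (node n k)))); last first.
    rewrite big_split/= /rsum expnS natrM; field; by rewrite pow2_neq0.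
  rewrite -mulrBr -sumrB; congr (_ * _); apply: eq_bigr => k _; ring.
have P1 : 0 < (2 ^ n.+1)%:R :> R by rewrite ltr0n expn_gt0.
rewrite E nrM nrM nrV nr_nat.
have near k j : (k < 2 ^ n)%N -> (j < 2 ^ n.+1)%N ->
    `|node n.+1 j - node n k| <= (2 ^ n)%:R^-1 ->
    nr (f (segpt a b (node n.+1 j)) - f (segpt a b (node n k))) <= e1.
  move=> kn jn h; apply: hd; [by apply: segpt_disc => //; apply: node01..|].
  rewrite /segpt opprD addrACA subrr add0r -mulrBl -rmorphB nrM nrR.
  apply: le_lt_trans (ler_wpM2r (nr_ge0 _) h) _.
  by rewrite ltr_pdivrMl// mulrC.
have nodeS k : node n k = (2 * k.*2 + 2)%:R / (2 ^ n.+2)%:R.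
  rewrite /node (expnS _ n.+1) natrM invfM mulrA; congr (_ / _).
  by rewrite odd_center natrM mulfK ?pnatr_eq0.
have P2 : 0 < (2 ^ n.+2)%:R :> R by rewrite ltr0n expn_gt0.
have bd : nr (\sum_(0 <= k < 2 ^ n) ((f (segpt a b (node n.+1 k.*2)) - f (segpt a b (node n k)))
      + (f (segpt a b (node n.+1 k.*2.+1)) - f (segpt a b (node n k))))) <= (2 ^ n.+1)%:R * e1.
  apply: le_trans (nr_sum _ _ _) _.
  apply: (@le_trans _ _ (\sum_(0 <= k < 2 ^ n) (2 * e1))); last first.
    by rewrite sumr_const_nat subn0 -[_ *+ (2 ^ n)]mulr_natr expnS natrM mulrAC.
  rewrite !big_nat ler_sum// => k kn; apply: le_trans (nrD _ _) _.
  have [k1 k2] := double_lt_pow2 kn.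
  have q : (2 ^ n.+2)%:R^-1 <= (2 ^ n)%:R^-1 :> R.
    by rewrite lef_pV2 ?posrE// ler_nat leq_exp2l// ltnW.
  have := near _ _ kn k1; have := near _ _ kn k2.
  rewrite nodeS /node -!mulrBl !normrM normfV [`|(2 ^ n.+2)%:R|]normr_nat.
  rewrite (_ : (2 * k.*2.+1 + 1)%:R - (2 * k.*2 + 2)%:R = 1 :> R); last first.
    by rewrite odd_center1 [(_ + 1)%:R]natrD; ring.
  rewrite (_ : (2 * k.*2 + 1)%:R - (2 * k.*2 + 2)%:R = -1 :> R); last first.
    by rewrite !natrD; ring.
  by rewrite normrN1 normr1 !mul1r => /(_ q) ? /(_ q) ?; lra.
by rewrite -mulrA [e1 * _]mulrC ler_wpM2l ?nr_ge0// ler_pdivrMl.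
Qed.

Lemma J_mid a b : nr (a - c) <= r -> nr (b - c) <= r ->
  J a b = J a (mid a b) + J (mid a b) b.
Proof.
move=> ar br; have mr : nr (mid a b - c) <= r.
  have := @segpt_disc a b c r (2^-1) _ ar br; rewrite /segpt fmorphV/= rmorph_nat.
  rewrite (_ : a + _ = mid a b); last by rewrite /mid; field.
  by apply; rewrite invr_ge0 ler0n invf_le1 ?ler1n.
rewrite /J -LimD; [|exact: rsum_bnd..].
apply: Lim_shift_sub; [exact: rsum_bnd|by apply: bndD; exact: rsum_bnd|].
move=> e /(rsum_cauchy ar br)[N h]; exists N => n /h.
by rewrite -rsumS nrBC.
Qed.

Lemma J_opp a b : nr (a - c) <= r -> nr (b - c) <= r -> J b a = - J a b.
Proof.
by move=> ar br; rewrite -LimN; [apply: Lim_ext => n; exact: rsum_opp|exact: rsum_bnd].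
Qed.

Lemma J_close a b al be (e : R) : nr (a - c) <= r -> nr (b - c) <= r ->
  (forall t, 0 <= t <= 1 -> nr (f (segpt a b t) - (al * segpt a b t + be)) <= e) ->
  nr (J a b - (al * (b ^+ 2 - a ^+ 2) / 2 + be * (b - a))) <= e * nr (b - a).
Proof.
move=> ar br h; rewrite -[X in J a b - X](Lim_cst) /J -LimB; [|exact: rsum_bnd|exact: bnd_cst].
apply: nr_Lim => n; rewrite -(rsum_affine _ _ _ _ n); exact: rsum_close.
Qed.

End Integral.

End Goursat.

Section GoursatTheorem.
Variable R : realType.
Local Notation C := R[i].

(** Uniform differentiability is what the proof of Cauchy's formula asks of [F]. A primitive has it
    at once ([J_UD]); an arbitrary holomorphic function gets it only after the formula has been
    applied to its primitive ([holo_UD_lt]). *)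
Definition UD (F f : C -> C) (c : C) (r : R) := forall e : R, 0 < e ->
  exists2 d : R, 0 < d & forall z z', nr (z - c) <= r -> nr (z' - c) <= r ->
    nr (z' - z) < d -> nr (F z' - F z - f z * (z' - z)) <= e * nr (z' - z).

Lemma nr_half (x : C) : nr (x / 2) = nr x / 2.
Proof. by rewrite nrM nrV nr_nat. Qed.

Lemma mid_disc (a b c : C) (r : R) : nr (a - c) <= r -> nr (b - c) <= r ->
  nr (mid a b - c) <= r.
Proof.
move=> ar br; rewrite (_ : _ - c = (a - c) / 2 + (b - c) / 2); last first.
  by rewrite /mid; field.
by apply: le_trans (nrD _ _) _; rewrite !nr_half; lra.
Qed.

Section Triangle.
Variables (f : C -> C) (c : C) (r : R).
Hypothesis hf : forall z, nr (z - c) <= r -> exists L, cder f z L.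

Definition tri (t : C * C * C) := J f t.1.1 t.1.2 + J f t.1.2 t.2 + J f t.2 t.1.1.
Definition per (t : C * C * C) : R := nr (t.1.1 - t.1.2) + nr (t.1.2 - t.2) + nr (t.2 - t.1.1).
Definition in_disc (t : C * C * C) :=
  [/\ nr (t.1.1 - c) <= r, nr (t.1.2 - c) <= r & nr (t.2 - c) <= r].

Lemma tri_step t : in_disc t -> exists t', [/\ in_disc t', nr (tri t) <= 4 * nr (tri t'),
  per t' = per t / 2 & nr (t'.1.1 - t.1.1) <= per t / 2].
Proof.
case: t => -[a b] d [/= ha hb hd].
have h1 := mid_disc ha hb; have h2 := mid_disc hb hd; have h3 := mid_disc hd ha.
pose m1 := mid a b; pose m2 := mid b d; pose m3 := mid d a.
have E : tri (a, b, d) = tri (a, m1, m3) + tri (m1, b, m2) + tri (m3, m2, d) + tri (m1, m2, m3).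
  rewrite /tri /= (J_mid hf ha hb) (J_mid hf hb hd) (J_mid hf hd ha) -/m1 -/m2 -/m3.
  by rewrite (J_opp hf h1 h3) (J_opp hf h1 h2) (J_opp hf h2 h3); ring.
have p (x y z : C) : x - y = z / 2 -> nr (x - y) = nr z / 2 by move=> ->; rewrite nr_half.
have nn (x : C) := nr_ge0 x.
have e1 : a - m1 = (a - b) / 2 by rewrite /m1 /mid; field.
have e2 : m1 - m3 = (b - d) / 2 by rewrite /m1 /m3 /mid; field.
have e3 : m3 - a = (d - a) / 2 by rewrite /m3 /mid; field.
have e4 : m1 - b = (a - b) / 2 by rewrite /m1 /mid; field.
have e5 : b - m2 = (b - d) / 2 by rewrite /m2 /mid; field.
have e6 : m2 - m1 = (d - a) / 2 by rewrite /m1 /m2 /mid; field.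
have e7 : m3 - m2 = (a - b) / 2 by rewrite /m3 /m2 /mid; field.
have e8 : m2 - d = (b - d) / 2 by rewrite /m2 /mid; field.
have e9 : d - m3 = (d - a) / 2 by rewrite /m3 /mid; field.
have M1 : nr (m1 - a) <= per (a, b, d) / 2.
  by rewrite nrBC (p _ _ _ e1) /per/=; have := nn (b - d); have := nn (d - a); lra.
have M3 : nr (m3 - a) <= per (a, b, d) / 2.
  by rewrite (p _ _ _ e3) /per/=; have := nn (b - d); have := nn (a - b); lra.
have bound : nr (tri (a, b, d)) <= nr (tri (a, m1, m3)) + nr (tri (m1, b, m2)) +
    nr (tri (m3, m2, d)) + nr (tri (m1, m2, m3)).
  rewrite E; do 3![apply: le_trans (nrD _ _) _; rewrite lerD2r].
  exact: lexx.
move: (p _ _ _ e1) (p _ _ _ e2) (p _ _ _ e3) (p _ _ _ e4) (p _ _ _ e5) (p _ _ _ e6)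
  (p _ _ _ e7) (p _ _ _ e8) (p _ _ _ e9) => {E p e1 e2 e3 e4 e5 e6 e7 e8 e9} e1 e2 e3 e4 e5 e6 e7 e8 e9.
have [k1|k1] := leP (nr (tri (a, b, d))) (4 * nr (tri (a, m1, m3))).
  exists (a, m1, m3); split=> //.
    by rewrite /per/= e1 e2 e3; lra.
  by rewrite subrr nr0 divr_ge0// /per !addr_ge0.
have [k2|k2] := leP (nr (tri (a, b, d))) (4 * nr (tri (m1, b, m2))).
  exists (m1, b, m2); split=> //.
  by rewrite /per/= e4 e5 e6; lra.
have [k3|k3] := leP (nr (tri (a, b, d))) (4 * nr (tri (m3, m2, d))).
  exists (m3, m2, d); split=> //.
  by rewrite /per/= e7 e8 e9; lra.
exists (m1, m2, m3); split=> //; first by lra.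
rewrite /per/= (nrBC m1) (nrBC m2 m3) (nrBC m3 m1).
by rewrite e6 e7 e2; lra.
Qed.

(** Bisect repeatedly, keeping a quarter with at least a fourth of the integral. The triangles
    shrink to a point where [f] is affine up to e |z - z0|; affine functions integrate to zero, so
    the n-th integral is at most 2 e per^2 / 4^n, which the factor 4^n compensates exactly. *)
Lemma goursat t : in_disc t -> tri t = 0.
Proof.
move=> ht0; have /choice[F hF] : forall t, exists t', in_disc t ->
    [/\ in_disc t', nr (tri t) <= 4 * nr (tri t'), per t' = per t / 2
      & nr (t'.1.1 - t.1.1) <= per t / 2].
  move=> t'; have [/tri_step[t'' h]|nt] := pselect (in_disc t'); first by exists t''.
  by exists t'.
pose u n := iter n F t.
have hin n : in_disc (u n) by elim: n => //= n /hF[].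
have hper n : per (u n) = per t / 2 ^+ n.
  elim: n => [|n IH]; first by rewrite expr0 divr1.
  by have [_ _ -> _] := hF _ (hin n); rewrite -/(u n) IH exprSr invfM mulrA.
have htri n : nr (tri t) <= 4 ^+ n * nr (tri (u n)).
  elim: n => [|n IH]; first by rewrite expr0 mul1r.
  apply: le_trans IH _; rewrite exprSr -mulrA ler_wpM2l ?exprn_ge0//.
  by have [] := hF _ (hin n).
pose v n := (u n).1.1.
have p0 : 0 <= per t by rewrite /per !addr_ge0 ?nr_ge0.
have hv n k : nr (v (n + k)%N - v n) <= per (u n) * (1 - 2^-1 ^+ k).
  elim: k => [|k IH]; first by rewrite addn0 subrr nr0 expr0 subrr mulr0.
  have [_ _ _ h] := hF _ (hin (n + k)%N).
  have h' : nr (v (n + k.+1)%N - v (n + k)%N) <= per (u (n + k)%N) / 2.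
    by rewrite /v addnS; exact: h.
  have := nrBD (v (n + k)%N) (v (n + k.+1)%N) (v n).
  have e : per (u (n + k)%N) = per (u n) * 2^-1 ^+ k.
    by rewrite !hper exprD invfM mulrA exprVn.
  by rewrite e in h'; rewrite exprSr; lra.
have hv2 n k : (n <= k)%N -> nr (v k - v n) <= per (u n).
  move=> /subnKC <-; apply: le_trans (hv _ _) _.
  have pn : 0 <= per (u n) by rewrite hper divr_ge0// exprn_ge0.
  have q0 : 0 <= 2^-1 ^+ (k - n) :> R by rewrite exprn_ge0// invr_ge0.
  by nra.
have bv : bnd v.
  exists (r + nr c) => n; have [+ _ _] := hin n.
  by have := nrD (v n - c) c; rewrite subrK /v; lra.
have vl := Lim_to bv.
have lv n : nr (Lim v - v n) <= per (u n).
  have k : ulim_to (fun k => v k - v n) (Lim v - v n).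
    by apply: ulimD => //; apply: ulim_cst.
  by apply: ulim_le k; apply: filterS (ultra_ge n) => k /=; apply: hv2.
have lr : nr (Lim v - c) <= r.
  have k : ulim_to (fun k => v k - c) (Lim v - c).
    by apply: ulimD => //; apply: ulim_cst.
  by apply: ulim_le k; apply: filterS filterT => k _ /=; have [] := hin k.
have [L /cder_cd hL] := hf lr; pose al := L 1; pose z := Lim v.
(* The summand 1 keeps the factor positive when the triangle is degenerate. *)
suff h e : 0 < e -> nr (tri t) <= e * (2 * per t ^+ 2 + 1).
  apply: nr_eq0; apply/eqP; rewrite eq_le nr_ge0 andbT leNgt; apply/negP => pos.
  have P : 0 < 2 * per t ^+ 2 + 1 by have := sqr_ge0 (per t); lra.
  have := h (nr (tri t) / (2 * (2 * per t ^+ 2 + 1))).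
  rewrite divr_gt0 ?mulr_gt0// => /(_ isT).
  rewrite (_ : _ / _ * _ = nr (tri t) / 2); first by lra.
  by field; rewrite gt_eqF.
move=> e0; have [_ _ /(_ _ e0)[d d0 hd]] := hL.
pose n := (Num.bound (2 * per t / d)).+1.
have P0 : 0 < 2 ^+ n :> R by rewrite exprn_gt0.
have nd : 2 * per (u n) < d.
  rewrite hper mulrA ltr_pdivrMr// [d * _]mulrC -ltr_pdivrMr//.
  apply: lt_trans (_ : (Num.bound (2 * per t / d))%:R < _).
    by apply: archi_boundP; rewrite divr_ge0 ?mulr_ge0// ltW.
  by rewrite -natrX ltr_nat; apply: ltn_trans (ltn_expl _ (ltnSn 1)) _; rewrite ltn_exp2l.
have := htri n; have := hin n; have := hper n; have := lv n; move: nd.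
rewrite /v; case: (u n) => -[a b] k /= nd hlv hp [ha hb hk] ht.
have pn : 0 <= per (a, b, k) by rewrite /per !addr_ge0 ?nr_ge0.
have edge x y : nr (x - c) <= r -> nr (y - c) <= r -> nr (x - a) + nr (y - x) <= per (a, b, k) ->
   nr (J f x y - (al * (y ^+ 2 - x ^+ 2) / 2 + (f z - al * z) * (y - x)))
     <= (e * (2 * per (a, b, k))) * nr (y - x).
  move=> hx hy hxy; apply: (J_close hf) => // q q01.
  have dz : nr (segpt x y q - z) <= 2 * per (a, b, k).
    have := nrBD x (segpt x y q) z; have := segpt_dist x y q01.
    have := nrBD a x z; rewrite (nrBC a) /z /v; lra.
  have := hd (segpt x y q - z); rewrite [Lim v + _]addrC subrK => /(_ (le_lt_trans dz nd)).
  rewrite (_ : f _ - _ - _ = f (segpt x y q) - (al * segpt x y q + (f z - al * z))); last first.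
    by rewrite /z /al; ring.
  by move=> h; apply: le_trans h _; rewrite ler_wpM2l// ltW.
have nn (x : C) := nr_ge0 x.
have E1 : nr (a - a) + nr (b - a) <= per (a, b, k).
  by rewrite subrr nr0 add0r nrBC /per/= -addrA lerDl addr_ge0.
have E2 : nr (b - a) + nr (k - b) <= per (a, b, k).
  by rewrite (nrBC b) (nrBC k) /per/= lerDl.
have E3 : nr (k - a) + nr (a - k) <= per (a, b, k).
  rewrite /per/= (nrBC a k); have := nrBD b k a; rewrite (nrBC k b) (nrBC b a); lra.
have := edge _ _ ha hb E1; have := edge _ _ hb hk E2; have := edge _ _ hk ha E3.
set A1 := J f k a - _; set A2 := J f b k - _; set A3 := J f a b - _ => h1 h2 h3.
have EE : tri (a, b, k) = A1 + A2 + A3.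
  by rewrite /tri/= /A1 /A2 /A3; field.
have := nrD (A1 + A2) A3; have := nrD A1 A2; rewrite -EE => q1 q2.
have tb : nr (tri (a, b, k)) <= e * (2 * per (a, b, k)) * per (a, b, k).
  by rewrite {2}/per/= (nrBC a b) (nrBC b k) (nrBC k a); nra.
apply: le_trans ht _.
have P4 : 0 <= 4 ^+ n :> R by rewrite exprn_ge0.
apply: le_trans (ler_wpM2l P4 tb) _.
rewrite hp (_ : 4 ^+ n * _ = e * (2 * per t ^+ 2)); first by rewrite ler_pM2l//; lra.
rewrite (_ : 4 = 2 ^+ 2 :> R); last by rewrite expr2; lra.
by rewrite -exprM mulnC exprM; field; rewrite gt_eqF.
Qed.

Lemma J_UD : UD (J f c) f c r.
Proof.
move=> e e0; have [d d0 hd] := disc_unif_cont hf e0; exists d => // z z' hz hz' zz.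
have r0 : 0 <= r by apply: le_trans hz; rewrite nr_ge0.
have hc : nr (c - c) <= r by rewrite subrr nr0.
have : in_disc (c, z, z') by [].
move=> /goursat; rewrite /tri/= (J_opp hf hc hz').
move=> /eqP; rewrite subr_eq0 => /eqP <-; rewrite [J f c z + _]addrC addrK.
have := @J_close _ _ _ _ hf z z' 0 (f z) e hz hz'.
rewrite mul0r mul0r add0r; apply => t t01.
rewrite mul0r add0r; apply: hd => //; first exact: segpt_disc.
exact: le_lt_trans (segpt_dist _ _ t01) zz.
Qed.

End Triangle.

End GoursatTheorem.

(** * Roots of unity of order 2^n and circle means *)

Section RootsOfUnity.
Variable R : realType.
Local Notation C := R[i].

(** A primitive 2^n-th root of unity by repeated square roots. The value -1 at n = 1 is set by hand,
    since the chosen square root of 1 is not -1; afterwards the root with nonnegative real part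
    makes the sequence tend to 1. *)
Fixpoint zeta (n : nat) : C := match n with
  | 0 => 1 | m.+1 => match m with 0 => -1 | _ => sqrtc (zeta m) end end.

Lemma zetaSS n : zeta n.+2 ^+ 2 = zeta n.+1.
Proof. by rewrite /= sqr_sqrtc. Qed.

Lemma zetaS n : zeta n.+1 ^+ 2 = zeta n.
Proof. by case: n => [|n]; rewrite ?zetaSS// sqrrN expr1n. Qed.

Lemma zeta_half n : zeta n.+1 ^+ (2 ^ n) = -1.
Proof. by elim: n => [|n IH]; rewrite ?expr1// expnS exprM zetaSS. Qed.

Lemma zeta_pow n : zeta n ^+ (2 ^ n) = 1.
Proof. by elim: n => [|n IH]; rewrite ?expr1// expnS exprM zetaS. Qed.

Lemma nr_zeta n : nr (zeta n) = 1.
Proof.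
apply/eqP; have h : nr (zeta n) ^+ (2 ^ n) = 1 by rewrite -nrX zeta_pow nr1.
by rewrite -(@pexpr_eq1 _ _ (2 ^ n)) ?expn_gt0 ?nr_ge0// h.
Qed.

Lemma zeta_pow_dvd n m : zeta n ^+ m = 1 -> (2 ^ n %| m)%N.
Proof.
elim: n m => [|n IH] m h; first by rewrite expn0 dvd1n.
have /IH/dvdnP[q e] : zeta n ^+ m = 1 by rewrite -zetaS -exprM mulnC exprM h expr1n.
move: h; rewrite e mulnC exprM zeta_half -signr_odd expnSr dvdn_pmul2l ?expn_gt0//.
rewrite dvdn2; case: (odd q) => //=; rewrite expr1 => /eqP.
by rewrite eq_sym -subr_eq0 opprK -[1 + 1]/(2%:R) pnatr_eq0.
Qed.

Lemma zeta_pow_neq1 n m : (0 < m < 2 ^ n)%N -> zeta n ^+ m != 1.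
Proof.
move=> /andP[m0 mn]; apply/eqP => /zeta_pow_dvd /dvdn_leq -/(_ m0).
by rewrite leqNgt mn.
Qed.

Lemma sum_root (w : C) N : w ^+ N = 1 -> w != 1 -> \sum_(0 <= k < N) w ^+ k = 0.
Proof.
move=> wN w1; apply: (@mulfI _ (w - 1)); first by rewrite subr_eq0.
by rewrite mulr0 big_mkord -subrX1 wN subrr.
Qed.

Lemma Re_zeta n : 0 <= complex.Re (zeta n.+2).
Proof.
rewrite -[zeta _]/(sqrtc (zeta n.+1)); case: (zeta n.+1) => a b /=.
exact: sqrtr_ge0.
Qed.

(** Factor x^2 - 1 = (x - 1) (x + 1). As |x| = 1 and Re x >= 0, the factor |x + 1| is at least sqrt
    2 > 4/3. *)
Lemma zeta_near1 n : nr (zeta n.+1 - 1) <= 2 * (3 / 4) ^+ n.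
Proof.
elim: n => [|n IH].
  by rewrite expr0 mulr1 (_ : zeta 1 - 1 = - (2%:R)) ?nrN ?nr_nat//; rewrite /=; ring.
have h : nr (zeta n.+2 - 1) * nr (zeta n.+2 + 1) = nr (zeta n.+1 - 1).
  have := zetaSS n; move: (zeta n.+2) (zeta n.+1) => x y <-.
  by rewrite -nrM; congr nr; ring.
have h2 : 4 / 3 <= nr (zeta n.+2 + 1).
  have : nr (zeta n.+2 + 1) ^+ 2 >= 2.
    have := nr_zeta n.+2; have := Re_zeta n; case: (zeta n.+2) => a b /= a0.
    rewrite /nr !normc_def/= addr0 => k.
    have {}k : a ^+ 2 + b ^+ 2 = 1.
      by rewrite -[LHS]sqr_sqrtr ?k ?expr1n// addr_ge0 ?sqr_ge0.
    by rewrite sqr_sqrtr ?addr_ge0 ?sqr_ge0//; nra.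
  by have := nr_ge0 (zeta n.+2 + 1); nra.
have := nr_ge0 (zeta n.+2 - 1).
have : 0 <= (3 / 4 : R) ^+ n by rewrite exprn_ge0//; lra.
by rewrite exprSr; nra.
Qed.

Lemma geom_small (q e : R) : 0 <= q < 1 -> 0 < e -> exists N, forall n, (N <= n)%N -> q ^+ n < e.
Proof.
move=> /andP[q0 q1] e0; have [->|qn0] := eqVneq q 0.
  by exists 1%N => -[|n] // _; rewrite expr0n.
have qp : 0 < q by rewrite lt_neqAle eq_sym qn0.
pose x := q^-1 - 1; have x0 : 0 < x by rewrite subr_gt0 invf_gt1.
have bern n : 1 + n%:R * x <= q^-1 ^+ n.
  elim: n => [|n IH]; first by rewrite mul0r addr0 expr0.
  rewrite exprSr -{2}[q^-1](subrK 1) -/x -natr1.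
  have : 0 <= n%:R :> R by [].
  by nra.
exists (Num.bound (e^-1 / x)) => n Nn.
rewrite -[ltRHS]invrK -[q ^+ n]invrK ltf_pV2 ?posrE ?invr_gt0 ?exprn_gt0// -exprVn.
have : e^-1 / x < n%:R.
  apply: lt_le_trans (_ : (Num.bound (e^-1 / x))%:R <= _); last by rewrite ler_nat.
  by apply: archi_boundP; rewrite divr_ge0// ?invr_ge0 ltW.
by rewrite ltr_pdivrMr//; have := bern n; lra.
Qed.

Lemma zeta_cvg1 (e : R) : 0 < e -> exists N, forall n, (N <= n)%N -> nr (zeta n - 1) < e.
Proof.
move=> e0; have e20 : 0 < e / 2 by rewrite divr_gt0.
have q01 : 0 <= (3 / 4 : R) < 1 by lra.
have [N hN] := geom_small q01 e20.
exists N.+1 => -[//|n] nN; apply: le_lt_trans (zeta_near1 n) _.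
by have := hN n nN; lra.
Qed.

Definition avg (r : R) (G : C -> C) n : C :=
  (2 ^ n)%:R^-1 * \sum_(0 <= k < 2 ^ n) G (r%:C%C * zeta n ^+ k).

(** Plays the role of (2 pi i)^-1 times the integral of G(s) ds / s over |s| = r; an integral of
    g(s) ds therefore appears as the mean of g(s) s. *)
Definition mean (r : R) (G : C -> C) : C := Lim (avg r G).

Lemma nr_node (r : R) n k : 0 <= r -> nr (r%:C%C * zeta n ^+ k) = r.
Proof. by move=> r0; rewrite nrM nrX nr_zeta expr1n mulr1 nrR ger0_norm. Qed.

Lemma avg_le r G M n : 0 <= r -> (forall s, nr s = r -> nr (G s) <= M) -> nr (avg r G n) <= M.
Proof.
move=> r0 h; have P0 : 0 < (2 ^ n)%:R :> R by rewrite ltr0n expn_gt0.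
rewrite /avg nrM nrV nr_nat ler_pdivrMl//; apply: le_trans (nr_sum _ _ _) _.
apply: (@le_trans _ _ (\sum_(0 <= i < 2 ^ n) M)).
  by apply: ler_sum => k _; apply/h/nr_node.
by rewrite sumr_const_nat subn0 mulr_natl.
Qed.

Definition bnd_on (r : R) (G : C -> C) := exists M : R, forall s, nr s = r -> nr (G s) <= M.

Lemma avg_bnd r G : 0 <= r -> bnd_on r G -> bnd (avg r G).
Proof. by move=> r0 [M h]; exists M => n; apply: avg_le. Qed.

Lemma nr_mean r G M : 0 <= r -> (forall s, nr s = r -> nr (G s) <= M) -> nr (mean r G) <= M.
Proof. by move=> r0 h; apply: nr_Lim => n; apply: avg_le. Qed.

Lemma mean_ext r G H : 0 <= r -> (forall s, nr s = r -> G s = H s) -> mean r G = mean r H.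
Proof.
move=> r0 h; apply: Lim_ext => n; congr (_ * _).
by apply: eq_bigr => k _; apply/h/nr_node.
Qed.

Lemma meanD r G H : 0 <= r -> bnd_on r G -> bnd_on r H ->
  mean r (fun s => G s + H s) = mean r G + mean r H.
Proof.
move=> r0 hG hH; rewrite /mean -LimD; [|exact: avg_bnd..].
by apply: Lim_ext => n; rewrite -mulrDr -big_split.
Qed.

Lemma meanZ r (a : C) G : 0 <= r -> bnd_on r G -> mean r (fun s => a * G s) = a * mean r G.
Proof.
move=> r0 hG; rewrite /mean -LimZ; last exact: avg_bnd.
by apply: Lim_ext => n; rewrite /avg -mulr_sumr mulrCA.
Qed.

Lemma meanB r G H : 0 <= r -> bnd_on r G -> bnd_on r H ->
  mean r (fun s => G s - H s) = mean r G - mean r H.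
Proof.
move=> r0 hG hH; rewrite /mean -LimB; [|exact: avg_bnd..].
by apply: Lim_ext => n; rewrite -mulrBr -sumrB.
Qed.

Lemma mean_sum r (I : Type) (s : seq I) (G : I -> C -> C) : 0 <= r ->
  (forall i, bnd_on r (G i)) ->
  mean r (fun x => \sum_(i <- s) G i x) = \sum_(i <- s) mean r (G i).
Proof.
move=> r0 hG; rewrite /mean -Lim_sum; last by move=> i; exact: avg_bnd.
by apply: Lim_ext => n; rewrite /avg exchange_big/= mulr_sumr.
Qed.

Lemma mean_cst r (a : C) : mean r (fun=> a) = a.
Proof.
rewrite /mean -[RHS]Lim_cst; apply: Lim_ext => n.
by rewrite /avg sumr_const_nat subn0 -[a *+ _]mulr_natl mulKf// pnatr_eq0 -lt0n expn_gt0.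
Qed.

Lemma mean_pow r m : (0 < m)%N -> mean r (fun s => s ^+ m) = 0.
Proof.
move=> m0; apply: Lim_cvg => e e0; exists m => n mn; rewrite subr0.
rewrite (_ : avg _ _ _ = 0) ?nr0// /avg.
rewrite (eq_bigr (fun k => r%:C%C ^+ m * (zeta n ^+ m) ^+ k)); last first.
  by move=> k _; rewrite exprMn -!exprM mulnC.
rewrite -mulr_sumr sum_root ?mulr0//; first by rewrite -exprM mulnC exprM zeta_pow expr1n.
by rewrite zeta_pow_neq1// m0 (leq_ltn_trans mn)// ltn_expl.
Qed.

Lemma mean_powV r m : (0 < m)%N -> mean r (fun s => s ^- m) = 0.
Proof.
move=> m0; apply: Lim_cvg => e e0; exists m => n mn; rewrite subr0.
rewrite (_ : avg _ _ _ = 0) ?nr0// /avg.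
rewrite (eq_bigr (fun k => r%:C%C ^- m * (zeta n ^- m) ^+ k)); last first.
  by move=> k _; rewrite exprMn invfM exprVn -!exprM mulnC.
rewrite -mulr_sumr sum_root ?mulr0//; first by rewrite exprVn -exprM mulnC exprM zeta_pow expr1n invr1.
by rewrite invr_eq1 zeta_pow_neq1// m0 (leq_ltn_trans mn)// ltn_expl.
Qed.

End RootsOfUnity.

(** * Cauchy's formula for uniformly differentiable functions *)

Section Cauchy.
Variable R : realType.
Local Notation C := R[i].

(** Multiplied by 1 - q^N, with q = a / r and N = 2^n, each value of the kernel is a finite
    geometric sum in powers of the root of unity; averaging kills all of it but the constant
    term. *)
Lemma avg_kernel n (r : R) (a : C) : nr a < r ->
  avg r (fun s => s / (s - a)) n * (1 - (a / r%:C%C) ^+ (2 ^ n)) = 1.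
Proof.
move=> ar; have r0 : 0 < r by apply: le_lt_trans ar; rewrite nr_ge0.
have rn : (r%:C%C : C) != 0 by rewrite nr_neq0// nrR gtr0_norm.
have zn : zeta R n != 0 by rewrite nr_neq0// nr_zeta.
pose q := a / r%:C%C; pose N := (2 ^ n)%N.
have term k : (r%:C%C * zeta R n ^+ k) / (r%:C%C * zeta R n ^+ k - a) * (1 - q ^+ N) =
    \sum_(0 <= m < N) q ^+ m * (zeta R n ^- m) ^+ k.
  have znk : zeta R n ^+ k != 0 by rewrite expf_neq0.
  have d0 : r%:C%C * zeta R n ^+ k - a != 0.
    rewrite subr_eq0; apply: contraTneq ar => <-.
    by rewrite nr_node ?ltxx// ltW.
  pose x := q / zeta R n ^+ k.
  have xN : x ^+ N = q ^+ N by rewrite /x exprMn exprVn -exprM mulnC exprM zeta_pow expr1n invr1 mulr1.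
  rewrite -xN (eq_bigr (fun m => x ^+ m)); last first.
    by move=> m _; rewrite /x [(q / _) ^+ m]exprMn; congr (_ * _); rewrite !exprVn -!exprM mulnC.
  rewrite big_mkord -[1 - x ^+ N]opprB subrX1 /x /q; set S := \sum_(i < _) _; field.
  by rewrite d0 rn znk.
rewrite /avg -/N -mulrA mulr_suml -/q (eq_bigr (fun k => \sum_(0 <= m < N) q ^+ m * (zeta R n ^- m) ^+ k)); last by move=> k _; exact: term.
have N0 : (0 < N)%N by rewrite expn_gt0.
rewrite exchange_big_nat/= big_ltn//.
have -> : \sum_(1 <= m < N) \sum_(0 <= k < N) q ^+ m * (zeta R n ^- m) ^+ k = 0.
  rewrite big_nat big1// => m /andP[m0 mN]; rewrite -mulr_sumr sum_root ?mulr0//.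
    by rewrite exprVn -exprM mulnC exprM zeta_pow expr1n invr1.
  by rewrite invr_eq1 zeta_pow_neq1// m0.
rewrite addr0 (eq_bigr (fun=> 1)); last by move=> k _; rewrite !expr0 invr1 expr1n mulr1.
by rewrite sumr_const_nat subn0 mulVf// pnatr_eq0 -lt0n.
Qed.

(** Contract the circle to [a] in [m] steps along the segments from [a] to the nodes. The kernel S /
    (S - (a - c)) cancels the displacement of a node, so one step changes the average by about 1/m
    times the average of f(z) S. The latter is a discrete integral of [f] around a closed polygon,
    small because the increments of [F] telescope. *)
Lemma avg_homotopy (F f : C -> C) c (r : R) a n (e d : R) :
  0 < r -> nr (a - c) < r -> 0 < e -> 0 < d ->
  (forall z z', nr (z - c) <= r -> nr (z' - c) <= r -> nr (z' - z) < d ->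
     nr (F z' - F z - f z * (z' - z)) <= e * nr (z' - z)) ->
  (0 < n)%N -> r * nr (zeta R n - 1) < d ->
  nr (avg r (fun s => F (c + s) * (s / (s - (a - c)))) n
      - F a * avg r (fun s => s / (s - (a - c))) n) <= 2 * e * r.
Proof.
move=> r0 ar e0 d0 ud n0 zd; pose N := (2 ^ n)%N; pose S k : C := r%:C%C * zeta R n ^+ k.
have N0 : 0 < N%:R :> R by rewrite ltr0n expn_gt0.
have nS k : nr (S k) = r by rewrite nr_node// ltW.
have Sa k : S k - (a - c) != 0.
  by rewrite subr_eq0; apply: contraTneq ar => <-; rewrite nS ltxx.
pose w k := S k / (S k - (a - c)).
pose m := (Num.bound (2 * r / d)).+1.
have m0 : 0 < m%:R :> R by rewrite ltr0n.
have md : 2 * r / m%:R < d.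
  rewrite ltr_pdivrMr// [d * _]mulrC -ltr_pdivrMr//.
  apply: lt_trans (_ : (Num.bound (2 * r / d))%:R < _); last by rewrite ltr_nat.
  by apply: archi_boundP; rewrite divr_ge0 ?mulr_ge0// ltW.
pose z l k := segpt a (c + S k) (l%:R / m%:R).
have zin l k : (l <= m)%N -> nr (z l k - c) <= r.
  move=> lm; apply: segpt_disc; [|exact: ltW|by rewrite addrC addKr nS].
  by rewrite divr_ge0//= ler_pdivrMr// mul1r ler_nat.
pose phi l := N%:R^-1 * \sum_(0 <= k < N) F (z l k) * w k.
have phim : phi m = avg r (fun s => F (c + s) * (s / (s - (a - c)))) n.
  congr (_ * _); apply: eq_bigr => k _; congr (F _ * _).
  by rewrite /z /segpt divff ?gt_eqF// mul1r addrC subrK.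
have phi0 : phi 0%N = F a * avg r (fun s => s / (s - (a - c))) n.
  rewrite /phi /avg mulrCA [F a * \sum_(_ <= _ < _) _]mulr_sumr; congr (_ * _); apply: eq_bigr => k _.
  by rewrite /z /segpt mul0r mul0r addr0.
have zeta1 : zeta R n != 1.
  by rewrite -[zeta R n]expr1 zeta_pow_neq1//= -{1}(expn0 2) ltn_exp2l.
(* For l > 0 the telescoped sum is divided by t (zeta - 1). For l = 0 all nodes coincide with [a],
   and the sum of the roots of unity vanishes. *)
have fS l : (l <= m)%N -> nr (\sum_(0 <= k < N) f (z l k) * S k) <= N%:R * (e * r).
  have [->|l0 lm] := posnP l => [_|].
    rewrite (eq_bigr (fun k => f a * r%:C%C * zeta R n ^+ k)); last first.
      by move=> k _; rewrite /z /segpt mul0r mul0r addr0 /S mulrA.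
    by rewrite -mulr_sumr sum_root ?zeta_pow// mulr0 nr0 !mulr_ge0// ltW.
  pose t : R := l%:R / m%:R; have t0 : 0 < t by rewrite divr_gt0// ltr0n.
  have t1 : t <= 1 by rewrite ler_pdivrMr// mul1r ler_nat.
  have dz k : z l k.+1 - z l k = t%:C%C * (zeta R n - 1) * S k.
    by rewrite /z /segpt -/t /S exprS; ring.
  have nz : 0 < nr (zeta R n - 1) by apply: nr_gt0; rewrite subr_eq0.
  have ndz k : nr (z l k.+1 - z l k) = t * nr (zeta R n - 1) * r.
    by rewrite dz nrM nrM nS nrR gtr0_norm.
  pose E k := F (z l k.+1) - F (z l k) - f (z l k) * (z l k.+1 - z l k).
  have nE k : nr (E k) <= e * (t * nr (zeta R n - 1) * r).
    rewrite -(ndz k); apply: ud; rewrite ?zin// ndz.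
    apply: le_lt_trans zd; rewrite mulrC ler_wpM2l ?(ltW r0)//.
    by rewrite ler_piMl// ltW.
  have SE : \sum_(0 <= k < N) E k = - (t%:C%C * (zeta R n - 1)) * \sum_(0 <= k < N) f (z l k) * S k.
    rewrite /E sumrB telescope_sumr// /z /S zeta_pow expr0 subrr sub0r mulNr mulr_sumr.
    by congr (- _); apply: eq_bigr => k _; rewrite -/(S k) -/(S k.+1) -/(z l k) -/(z l k.+1) dz; ring.
  have : nr (\sum_(0 <= k < N) E k) <= N%:R * (e * (t * nr (zeta R n - 1) * r)).
    apply: le_trans (nr_sum _ _ _) _.
    apply: (@le_trans _ _ (\sum_(0 <= i < N) (e * (t * nr (zeta R n - 1) * r)))).
      by apply: ler_sum => k _.
    by rewrite sumr_const_nat subn0 mulr_natl.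
  rewrite SE nrM nrN nrM nrR gtr0_norm// => h.
  have tz : 0 < t * nr (zeta R n - 1) by rewrite mulr_gt0.
  rewrite -(ler_pM2l tz); apply: le_trans h _.
  by rewrite le_eqVlt; apply/orP; left; apply/eqP; ring.
have step l : (l < m)%N -> nr (phi l.+1 - phi l) <= 2 * e * r / m%:R.
  move=> lm; have dz k : z l.+1 k - z l k = m%:R^-1 * (S k - (a - c)).
    rewrite /z /segpt opprD addrACA subrr add0r -mulrBl -rmorphB -mulrBl -natrB// subSnn mul1r.
    by rewrite fmorphV/= rmorph_nat; ring.
  pose D k := F (z l.+1 k) - F (z l k) - f (z l k) * (z l.+1 k - z l k).
  have nSa k : nr (S k - (a - c)) <= 2 * r.
    by have := nrB (S k) (a - c); rewrite nS; lra.
  have ndz k : nr (z l.+1 k - z l k) = m%:R^-1 * nr (S k - (a - c)).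
    by rewrite dz nrM nrV nr_nat.
  have nD k : nr (D k * w k) <= e * r / m%:R.
    have h : nr (D k) <= e * nr (z l.+1 k - z l k).
      apply: ud; rewrite ?zin// ?(ltnW lm)// ndz; apply: le_lt_trans md.
      by rewrite mulrC ler_wpM2r// invr_ge0 ltW.
    rewrite nrM; apply: le_trans (ler_wpM2r (nr_ge0 _) h) _.
    rewrite ndz /w nrM nrV nS.
    have p0 := nr_gt0 (Sa k).
    by rewrite le_eqVlt; apply/orP; left; apply/eqP; field; rewrite !gt_eqF.
  have -> : phi l.+1 - phi l = N%:R^-1 * \sum_(0 <= k < N) D k * w k
      + m%:R^-1 * (N%:R^-1 * \sum_(0 <= k < N) f (z l k) * S k).
    rewrite /phi -mulrBr -sumrB mulrCA -mulrDr; congr (_ * _).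
    rewrite mulr_sumr -big_split/=; apply: eq_bigr => k _.
    have -> : m%:R^-1 * (f (z l k) * S k) = f (z l k) * (z l.+1 k - z l k) * w k.
      by rewrite dz /w; field; rewrite Sa pnatr_eq0.
    by rewrite /D; ring.
  apply: le_trans (nrD _ _) _; rewrite !nrM !nrV !nr_nat.
  have h1 : nr (\sum_(0 <= k < N) D k * w k) <= N%:R * (e * r / m%:R).
    apply: le_trans (nr_sum _ _ _) _.
    apply: (@le_trans _ _ (\sum_(0 <= i < N) (e * r / m%:R))).
      by apply: ler_sum => k _.
    by rewrite sumr_const_nat subn0 mulr_natl.
  have h2 := fS l (ltnW lm).
  have k1 : N%:R^-1 * nr (\sum_(0 <= k < N) D k * w k) <= e * r / m%:R by rewrite ler_pdivrMl.
  have k2 : N%:R^-1 * nr (\sum_(0 <= k < N) f (z l k) * S k) <= e * r by rewrite ler_pdivrMl.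
  have m0' : 0 <= m%:R^-1 :> R by rewrite invr_ge0 ltW.
  apply: le_trans (lerD k1 (ler_wpM2l m0' k2)) _.
  by rewrite le_eqVlt; apply/orP; left; apply/eqP; ring.
rewrite -phim -phi0 -telescope_sumr//; apply: le_trans (nr_sum _ _ _) _.
apply: (@le_trans _ _ (\sum_(0 <= i < m) (2 * e * r / m%:R))).
  by rewrite !big_nat; apply: ler_sum => k /andP[_ km]; apply: step.
by rewrite sumr_const_nat subn0 -[_ *+ m]mulr_natl mulrC mulfVK// gt_eqF.
Qed.

Lemma cauchy_UD (F f : C -> C) c (r : R) a : 0 < r -> nr (a - c) < r -> UD F f c r ->
  mean r (fun s => F (c + s) * (s / (s - (a - c)))) = F a.
Proof.
move=> r0 ar ud; apply: Lim_cvg => e e0.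
(* With this tolerance the homotopy contributes e / 4; the deviation of the averaged kernel from 1,
   controlled by [e2], contributes at most e / 2. *)
have e10 : 0 < e / (8 * r) by rewrite divr_gt0// mulr_gt0.
have [d d0 hd] := ud _ e10.
have [N1 hN1] := @zeta_cvg1 R (d / r) (divr_gt0 d0 r0).
pose q := nr (a - c) / r.
have q01 : 0 <= q < 1 by rewrite divr_ge0 ?nr_ge0 ?(ltW r0)//= ltr_pdivrMr// mul1r.
pose e2 := Num.min (2^-1) (e / (4 * (nr (F a) + 1))).
have Fa := nr_ge0 (F a).
have Fa1 : 0 < nr (F a) + 1 by lra.
have e20 : 0 < e2 by rewrite lt_min invr_gt0 ltr0n divr_gt0// mulr_gt0.
have [N2 hN2] := geom_small q01 e20.
exists (maxn 1 (maxn N1 N2)) => n; rewrite !geq_max => /andP[n0 /andP[n1 n2]].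
set A := avg _ _ n.
have zd : r * nr (zeta R n - 1) < d by rewrite mulrC -ltr_pdivlMr// hN1.
have := @avg_homotopy F f c r a n _ _ r0 ar e10 d0 hd n0 zd.
have := avg_kernel n ar; rewrite -/A; set W := avg _ _ n => hW hA.
have qn : nr (((a - c) / r%:C%C) ^+ (2 ^ n)) < e2.
  rewrite nrX nrM nrV nrR gtr0_norm//; apply: hN2.
  by apply: leq_trans n2 _; rewrite ltnW// ltn_expl.
move: hW qn; set Q := _ ^+ _ => hW qn.
have e2h : e2 <= 2^-1 by rewrite ge_min lexx.
have e2e : e2 * (nr (F a) + 1) <= e / 4.
  have : e2 <= e / (4 * (nr (F a) + 1)) by rewrite ge_min lexx orbT.
  by rewrite ler_pdivlMr ?mulr_gt0//; lra.
have W2 : nr W <= 2.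
  have := congr1 (@nr R _) hW; rewrite nrM nr1.
  have := nrBl (1 : C) Q; rewrite nr1; have := nr_ge0 W; nra.
have W1 : W - 1 = W * Q by rewrite -{1}hW; ring.
have -> : A - F a = (A - F a * W) + F a * (W * Q) by rewrite -W1; ring.
clearbody A W; apply: le_lt_trans (nrD _ _) _; rewrite !nrM.
have h1 : 2 * (e / (8 * r)) * r = e / 4 by field; rewrite gt_eqF.

have h2 : nr (F a) * (nr W * nr Q) <= nr (F a) * (2 * e2).
  by rewrite ler_wpM2l// ler_pM ?nr_ge0// ltW.
move: h2 hA e2e e20 e0; rewrite h1; clearbody e2; move: (nr _ * (nr W * _)) (nr (A - _)) => x y; nra.
Qed.

Lemma quad_cd (F : C -> C) z L (K d : R) : 0 < d ->
  (forall h, nr h < d -> nr (F (z + h) - F z - h * L) <= K * nr h ^+ 2) -> cd F z L.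
Proof.
move=> d0 q; split=> [a x y||e e0].
- by rewrite mulrDl -mulrA.
- by exists (nr L); rewrite ?nr_ge0// => v; rewrite nrM mulrC.
have K1 : 0 < `|K| + 1 by have := normr_ge0 K; lra.
exists (Num.min d (e / (`|K| + 1))); first by rewrite lt_min d0 divr_gt0.
move=> v; rewrite lt_min => /andP[vd ve]; apply: le_trans (q _ vd) _.
move: ve; rewrite ltr_pdivlMr// => ve; have := nr_ge0 v; have := ler_norm K.
by rewrite expr2 mulrA; nra.
Qed.

Lemma UD_cd (F f : C -> C) c r z : UD F f c r -> nr (z - c) < r -> cd F z (f z).
Proof.
move=> ud zr; split=> [a x y||e e0].
- by rewrite mulrDl -mulrA.
- by exists (nr (f z)); rewrite ?nr_ge0// => v; rewrite nrM mulrC.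
have [d d0 hd] := ud _ e0.
exists (Num.min d (r - nr (z - c))); first by rewrite lt_min d0 subr_gt0.
move=> v; rewrite lt_min => /andP[vd vr].
have := hd z (z + v); rewrite [z + v]addrC addrK [v * _]mulrC; apply=> //; first exact: ltW.
have := nrD v (z - c); rewrite addrA; lra.
Qed.

Lemma kernel1 (s x h : C) : x != 0 -> x - h != 0 ->
  s / (x - h) - s / x - h * (s / x ^+ 2) = s * h ^+ 2 / (x ^+ 2 * (x - h)).
Proof. by move=> x0 xh; field; rewrite x0 xh. Qed.

Lemma kernel2 (s x h : C) : x != 0 -> x - h != 0 ->
  s / (x - h) ^+ 2 - s / x ^+ 2 - h * (2 * s / x ^+ 3) =
  s * h ^+ 2 * (3 * x - 2 * h) / (x ^+ 3 * (x - h) ^+ 2).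
Proof. by move=> x0 xh; field; rewrite x0 xh. Qed.

End Cauchy.

(** * Cauchy's formula for holomorphic functions and Taylor expansion *)

Section CauchyFormula.
Variable R : realType.
Local Notation C := R[i].

Lemma mean_quad (r0 : R) (G kb ka k1 : C -> C) (h : C) (M K : R) : 0 <= r0 ->
  (forall s, nr s = r0 -> nr (G s) <= M) ->
  bnd_on r0 kb -> bnd_on r0 ka -> bnd_on r0 k1 ->
  (forall s, nr s = r0 -> nr (kb s - ka s - h * k1 s) <= K) ->
  nr (mean r0 (fun s => G s * kb s) - mean r0 (fun s => G s * ka s)
      - h * mean r0 (fun s => G s * k1 s)) <= M * K.
Proof.
move=> r00 hG hb ha h1 hK.
have B k : bnd_on r0 k -> bnd_on r0 (fun s => G s * k s).
  by move=> [L hL]; exists (M * L) => s hs; rewrite nrM ler_pM ?nr_ge0 ?hG ?hL.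
have Bz : bnd_on r0 (fun s => h * (G s * k1 s)).
  by have [L hL] := B _ h1; exists (nr h * L) => s hs; rewrite nrM ler_wpM2l ?nr_ge0 ?hL.
rewrite -meanZ//; last exact: B.
rewrite -meanB//; [|exact: B..].
rewrite -meanB//; last first.
  have [L hL] := B _ hb; have [L' hL'] := B _ ha; exists (L + L') => s hs.
  by apply: le_trans (nrB _ _) _; rewrite lerD ?hL ?hL'.
apply: nr_mean => // s hs.
rewrite (_ : _ - _ = G s * (kb s - ka s - h * k1 s)); last by ring.
by rewrite nrM ler_pM ?nr_ge0 ?hG ?hK.
Qed.

(** The primitive [F] of [f] obeys Cauchy's formula. Hence f = F' is the mean with the kernel
    differentiated once ([m1]), and one more differentiation ([m2]) gives the derivative of [f] with
    a quadratic remainder that is uniform on smaller discs. *)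
Lemma holo_UD_lt (f : C -> C) c (r0 r : R) : 0 < r < r0 ->
  (forall z, nr (z - c) <= r0 -> exists L, cder f z L) ->
  exists f1, forall r', r' < r -> UD f f1 c r'.
Proof.
move=> /andP[rp rr0] hf; have r00 : 0 < r0 by lra.
pose F := J f c; have udF : UD F f c r0 := J_UD hf.
have [M0 hM0] := disc_bounded hf.
have FM : exists2 M : R, 0 <= M & forall z, nr (z - c) <= r0 -> nr (F z) <= M.
  have hcc : nr (c - c) <= r0 by rewrite subrr nr0 ltW.
  have M00 : 0 <= M0 by apply: le_trans (hM0 c hcc); rewrite nr_ge0.
  exists (M0 * r0) => [|z zr]; first by rewrite mulr_ge0// ltW.
  have := @J_close R f c r0 hf c z 0 0 M0 hcc zr.
  rewrite !mul0r addr0 subr0 => h; apply: le_trans (h _) _; last by rewrite ler_wpM2l.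
  by move=> t t01; rewrite mul0r addr0 subr0; apply/hM0/segpt_disc.
have [M M00 hM] := FM; pose rho := r0 - r; have rho0 : 0 < rho by rewrite subr_gt0.
have sep a s : nr (a - c) <= r -> nr s = r0 -> rho <= nr (s - (a - c)).
  by move=> ha hs; have := nrBl s (a - c); rewrite hs /rho; lra.
have sn a s : nr (a - c) <= r -> nr s = r0 -> s - (a - c) != 0.
  by move=> ha hs; rewrite nr_neq0//; apply: lt_le_trans rho0 (sep _ _ ha hs).
have inv a s k : nr (a - c) <= r -> nr s = r0 -> nr ((s - (a - c)) ^+ k)^-1 <= rho ^- k.
  move=> ha hs; rewrite nrV nrX lef_pV2 ?posrE ?exprn_gt0//.
    by rewrite lerXn2r ?nnegrE ?nr_ge0 ?(ltW rho0) ?sep.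
  exact: lt_le_trans rho0 (sep _ _ ha hs).
have r0n := ltW r00.
have FMs s : nr s = r0 -> nr (F (c + s)) <= M by move=> hs; apply: hM; rewrite addrC addKr hs.
have bk a k al : nr (a - c) <= r -> bnd_on r0 (fun s => al * s / (s - (a - c)) ^+ k).
  move=> ha; exists (nr al * r0 * rho ^- k) => s hs.
  by rewrite !nrM hs ler_wpM2l ?inv// mulr_ge0 ?nr_ge0.
have bk1 a k : nr (a - c) <= r -> bnd_on r0 (fun s => s / (s - (a - c)) ^+ k).
  by move=> ha; have [K h] := bk a k 1 ha; exists K => s hs; rewrite -[s in s / _]mul1r h.
have bk0 a : nr (a - c) <= r -> bnd_on r0 (fun s => s / (s - (a - c))).
  by move=> ha; have [K h] := bk1 a 1%N ha; exists K => s hs; rewrite -[s - _]expr1 h.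
pose m1 a := mean r0 (fun s => F (c + s) * (s / (s - (a - c)) ^+ 2)).
pose m2 a := mean r0 (fun s => F (c + s) * (2 * s / (s - (a - c)) ^+ 3)).
have q1 a b : nr (a - c) <= r -> nr (b - c) <= r ->
    nr (F b - F a - (b - a) * m1 a) <= M * (r0 * nr (b - a) ^+ 2 * rho ^- 3).
  move=> ha hb; rewrite -(@cauchy_UD _ F f c r0 b r00 _ udF); last by lra.
  rewrite -(@cauchy_UD _ F f c r0 a r00 _ udF); last by lra.
  apply: mean_quad => //; [exact: bk0..|exact: bk1|] => s hs.
  have xh : s - (a - c) - (b - a) = s - (b - c) by ring.
  rewrite -xh kernel1 ?xh ?sn// invfM 2!nrM nrX hs ler_wpM2l//.
    by rewrite mulr_ge0// exprn_ge0// nr_ge0.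
  by rewrite nrM (exprD rho 2 1) (invfM (rho ^+ 2)) ler_pM ?nr_ge0 ?inv//; have := inv b s 1%N hb hs; rewrite !expr1.
have f_m1 a : nr (a - c) < r -> f a = m1 a.
  move=> ha; have h1 : cd F a (f a) by apply: UD_cd udF _; lra.
  apply: (cd_uniq h1); apply: (@quad_cd _ _ _ _ (M * (r0 * rho ^- 3)) (r - nr (a - c))).
    by rewrite subr_gt0.
  move=> h hr; have := q1 a (a + h) (ltW ha).
  rewrite [a + h]addrC addrK mulrAC => k; rewrite -mulrA; apply: k.
  by have := nrD h (a - c); rewrite addrA; lra.
have q2 a b : nr (a - c) < r -> nr (b - c) < r ->
    nr (f b - f a - m2 a * (b - a)) <= M * (r0 * nr (b - a) ^+ 2 * (3 * (2 * r0) + 2 * (2 * r0)) * rho ^- 5).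
  move=> ha hb; rewrite !f_m1// [m2 a * _]mulrC; have ha' := ltW ha; have hb' := ltW hb.
  apply: mean_quad => //; [exact: bk1..|exact: bk|] => s hs.
  have xh : s - (a - c) - (b - a) = s - (b - c) by ring.
  rewrite -xh kernel2 ?xh ?sn// invfM 3!nrM nrX hs ler_pM ?mulr_ge0 ?exprn_ge0 ?nr_ge0//.
    rewrite ler_wpM2l// ?mulr_ge0 ?exprn_ge0 ?nr_ge0//.
    apply: le_trans (nrB _ _) _; rewrite !nrM !nr_nat.
    have := nrB s (a - c); have := nrB (b - c) (a - c); rewrite hs.
    by rewrite (_ : b - c - (a - c) = b - a); [lra|ring].
  by rewrite nrM (exprD rho 3 2) (invfM (rho ^+ 3)) ler_pM ?nr_ge0 ?inv.
exists m2 => r' r'r e e0.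
pose K := M * (r0 * (3 * (2 * r0) + 2 * (2 * r0)) * rho ^- 5) + 1.
have K0 : 0 < K.
  by rewrite ltr_wpDl// !mulr_ge0 ?invr_ge0 ?exprn_ge0 ?(ltW rho0)//; lra.
exists (e / K); first by rewrite divr_gt0.
move=> z z' hz hz' zz; apply: le_trans (q2 _ _ _ _) _; [lra|lra|].
move: zz; rewrite ltr_pdivlMr//; set d := nr (z' - z) => zz.
have d0 : 0 <= d := nr_ge0 _.
apply: (@le_trans _ _ (d * K * d)); last by rewrite ler_wpM2r// ltW.
rewrite (_ : M * _ = d ^+ 2 * (K - 1)); last by rewrite /K; ring.
by rewrite expr2 -mulrA -mulrA ler_wpM2l// mulrC ler_wpM2r//; lra.
Qed.

Lemma holo_UD (f : C -> C) c (r0 r : R) : 0 < r < r0 ->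
  (forall z, nr (z - c) <= r0 -> exists L, cder f z L) -> exists f1, UD f f1 c r.
Proof.
move=> /andP[rp rr0] hf; have h : 0 < (r + r0) / 2 < r0 by lra.
by have [f1 hf1] := holo_UD_lt h hf; exists f1; apply: hf1; lra.
Qed.

Lemma cauchy (f : C -> C) c (r0 r : R) a : 0 < r < r0 ->
  (forall z, nr (z - c) <= r0 -> exists L, cder f z L) -> nr (a - c) < r ->
  mean r (fun s => f (c + s) * (s / (s - (a - c)))) = f a.
Proof.
move=> rr hf ar; have [f1 ud] := holo_UD rr hf.
by apply: cauchy_UD ud => //; case/andP: rr.
Qed.

(** The Taylor coefficient of order [m] at [c], as a Cauchy integral. *)
Definition tc (f : C -> C) (c : C) (r : R) (m : nat) : C := mean r (fun s => f (c + s) * s ^- m).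

Section Taylor.
Variables (f : C -> C) (c : C) (r0 r M : R).
Hypothesis rr0 : 0 < r < r0.
Hypothesis hf : forall z, nr (z - c) <= r0 -> exists L, cder f z L.
Hypothesis hM : forall s, nr s = r -> nr (f (c + s)) <= M.

Let r_gt0 : 0 < r. Proof. by case/andP: rr0. Qed.

Let M_ge0 : 0 <= M.
Proof.
have := hM (s := r%:C%C); rewrite nrR gtr0_norm// => /(_ erefl); apply: le_trans.
exact: nr_ge0.
Qed.

Lemma tc_le m : nr (tc f c r m) <= M * r ^- m.
Proof.
by apply: nr_mean => [|s hs]; rewrite ?(ltW r_gt0)// nrM nrV nrX hs ler_wpM2r ?hM// invr_ge0 exprn_ge0// ltW.
Qed.

Lemma tc_bnd m : bnd_on r (fun s => f (c + s) * s ^- m).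
Proof.
exists (M * r ^- m) => s hs.
by rewrite nrM nrV nrX hs ler_wpM2r ?hM// invr_ge0 exprn_ge0// ltW.
Qed.

Lemma taylor z n : nr z < r ->
  nr (f (c + z) - \sum_(0 <= m < n) tc f c r m * z ^+ m) <= M * (nr z / r) ^+ n * (r / (r - nr z)).
Proof.
move=> zr; have r0' := ltW r_gt0.
have zc : nr (c + z - c) < r by rewrite [c + z]addrC addrK.
rewrite -(cauchy rr0 hf zc) [c + z]addrC addrK.
have -> : \sum_(0 <= m < n) tc f c r m * z ^+ m =
    mean r (fun s => \sum_(0 <= m < n) z ^+ m * (f (c + s) * s ^- m)).
  rewrite mean_sum//; last first.
    by move=> i; have [K h] := tc_bnd i; exists (nr (z ^+ i) * K) => s hs; rewrite nrM ler_wpM2l ?nr_ge0 ?h.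
  by apply: eq_bigr => m _; rewrite (@meanZ R r (z ^+ m) (fun s => f (c + s) * s ^- m) r0' (tc_bnd m)) [RHS]mulrC.
have d s : nr s = r -> r - nr z <= nr (s - z) by move=> hs; have := nrBl s z; rewrite hs.
have sz0 : 0 < r - nr z by rewrite subr_gt0.
have szn s : nr s = r -> s - z != 0 by move=> /d h; rewrite nr_neq0//; lra.
have sn (s : C) : nr s = r -> s != 0 by move=> h; rewrite nr_neq0// h.
have iv s : nr s = r -> (nr (s - z))^-1 <= (r - nr z)^-1.
  by move=> hs; rewrite lef_pV2 ?posrE ?d//; have := d s hs; lra.
rewrite -meanB//; last 2 first.
- exists (M * (r / (r - nr z))) => s hs.
  by rewrite nrM nrM nrV hs ler_pM ?mulr_ge0 ?nr_ge0 ?hM ?invr_ge0 ?nr_ge0// ler_wpM2l ?iv.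
- exists (\sum_(0 <= m < n) nr (z ^+ m) * (M * r ^- m)) => s hs.
  apply: le_trans (nr_sum _ _ _) _; apply: ler_sum => m _.
  by rewrite nrM ler_wpM2l ?nr_ge0// nrM nrV nrX hs ler_wpM2r ?hM// invr_ge0 exprn_ge0.
apply: nr_mean => // s hs.
have -> : f (c + s) * (s / (s - z)) - \sum_(0 <= m < n) z ^+ m * (f (c + s) * s ^- m) =
    f (c + s) * (z / s) ^+ n * (s / (s - z)).
  rewrite (eq_bigr (fun m => f (c + s) * (z / s) ^+ m)); last first.
    by move=> m _; rewrite exprMn exprVn mulrCA.
  have := subrX1 (z / s) n; rewrite -mulr_sumr big_mkord; set S := \sum_(i < n) _ => e.
  have -> : (z / s) ^+ n = 1 + (z / s - 1) * S by rewrite -e; ring.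
  by field; rewrite szn// sn.
have q0 : 0 <= nr z / r by rewrite divr_ge0 ?nr_ge0.
rewrite nrM nrM nrX nrM nrV hs nrM nrV hs; apply: ler_pM.
- by rewrite mulr_ge0 ?nr_ge0 ?exprn_ge0.
- by rewrite divr_ge0 ?nr_ge0.
- by rewrite ler_wpM2r ?hM// exprn_ge0.
- by rewrite ler_wpM2l ?iv.
Qed.

Lemma tc0 : tc f c r 0 = f c.
Proof.
have h : nr (0 : C) < r by rewrite nr0.
have := taylor 1 h; rewrite addr0 nr0 mul0r expr1 mulr0 mul0r big_nat1 expr0 mulr1 => k.
apply/eqP; rewrite eq_sym -subr_eq0; apply/eqP/nr_eq0/eqP.
by rewrite eq_le k nr_ge0.
Qed.

Lemma taylor2 z : nr z <= r / 2 ->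
  nr (f (c + z) - f c - z * tc f c r 1) <= 2 * M / r ^+ 2 * nr z ^+ 2.
Proof.
move=> zr; have zr' : nr z < r by have := r_gt0; lra.
have := taylor 2 zr'; rewrite big_nat_recr//= big_nat1 expr0 mulr1 tc0 expr1 opprD addrA [tc _ _ _ _ * z]mulrC.
move/le_trans; apply; have z0 := nr_ge0 z; have r0' := r_gt0.
have h : r / (r - nr z) <= 2 by rewrite ler_pdivrMr ?subr_gt0//; lra.
have p0 : 0 <= M * (nr z / r) ^+ 2 by rewrite mulr_ge0// exprn_ge0// divr_ge0// ltW.
apply: le_trans (ler_wpM2l p0 h) _.
by rewrite le_eqVlt; apply/orP; left; apply/eqP; field; rewrite gt_eqF.
Qed.

Lemma cd_tc1 : cd f c (tc f c r 1).
Proof.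
have r2 : 0 < r / 2 by have := r_gt0; lra.
by apply: (@quad_cd _ _ _ _ (2 * M / r ^+ 2) (r / 2)) => // h /ltW/taylor2.
Qed.

End Taylor.

End CauchyFormula.

(** * Holomorphic functions on normed spaces *)

Section SeveralVariables.
Variable R : realType.
Local Notation C := R[i].

Lemma cder_affine (E E' : normedModType C) (f : E -> C) (A : E' -> E) (l : E' -> E) u L (K : R) :
  (forall x h, A (x + h) = A x + l h) ->
  (forall (a : C) x y, l (a *: x + y) = a *: l x + l y) ->
  (forall v, nr (l v) <= K * nr v) ->
  cder f (A u) L -> cder (fun x => f (A x)) u (fun h => L (l h)).
Proof.
move=> hA hl hK [f1 [k k0 f2] f3].
have K0 v : nr (l v) <= (`|K| + 1) * nr v.
  by apply: le_trans (hK v) _; rewrite ler_wpM2r ?nr_ge0//; have := ler_norm K; lra.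
have K1 : 0 < `|K| + 1 by have := normr_ge0 K; lra.
split=> [a x y||e e0]; first by rewrite hl f1.
  exists (k * (`|K| + 1)); first by rewrite mulr_ge0// ltW.
  by move=> v; apply: le_trans (f2 _) _; rewrite -mulrA ler_wpM2l.
have [d d0 hd] := f3 _ (divr_gt0 e0 K1).
exists (d / (`|K| + 1)); first by rewrite divr_gt0.
move=> v vd; rewrite hA; apply: le_trans (hd _ _) _.
  by apply: le_lt_trans (K0 v) _; rewrite mulrC -ltr_pdivlMr.
by rewrite -mulrA ler_wpM2l ?(ltW e0)// ler_pdivrMl.
Qed.

Lemma cder_line (E : normedModType C) (f : E -> C) u v (z : C) L :
  cder f (u + z *: v) L -> cd (fun z => f (u + z *: v)) z (L v).
Proof.
move=> h; apply: (cder_eqL _ (@cder_affine _ _ f (fun z : C => u + z *: v) (fun z : C => z *: v) z L (nr v) _ _ _ h)).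
- by move=> w; rewrite (cder_linZ h).
- by move=> x y; rewrite scalerDl addrA.
- by move=> a x y; rewrite scalerDl -scalerA.
- by move=> w; rewrite nrZ mulrC.
Qed.

Lemma cder_comp (E : normedModType C) (g : C -> C) (f : E -> C) u L b :
  cd g (f u) b -> cder f u L -> cder (fun v => g (f v)) u (fun v => L v * b).
Proof.
move=> [_ _ hg] hf; have [K [df df0 [K0 lf]]] := cder_lip hf; have [f1 [k k0 f2] f3] := hf.
split=> [a x y||e e0]; first by rewrite f1 mulrDl mulrA.
  exists (k * nr b); first by rewrite mulr_ge0 ?nr_ge0.
  by move=> v; rewrite nrM mulrAC ler_wpM2r ?nr_ge0.
have e1 : 0 < e / (2 * K) by rewrite divr_gt0// mulr_gt0.
have b1 : 0 < nr b + 1 by have := nr_ge0 b; lra.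
have e2 : 0 < e / (2 * (nr b + 1)) by rewrite divr_gt0// mulr_gt0.
have [d d0 hd] := hg _ e1; have [d' d'0 hd'] := f3 _ e2.
exists (Num.min (Num.min d' df) (d / K)); first by rewrite !lt_min d'0 df0 divr_gt0.
move=> v; rewrite !lt_min => /andP[/andP[vd' vdf] vd].
have h1 := lf _ vdf.
have h2 : nr (f (u + v) - f u) < d.
  by apply: le_lt_trans h1 _; rewrite mulrC -ltr_pdivlMr.
have h3 := hd _ h2; rewrite [f u + _]addrC subrK in h3.
have h4 := hd' _ vd'.
have -> : g (f (u + v)) - g (f u) - L v * b =
   (g (f (u + v)) - g (f u) - (f (u + v) - f u) * b) + (f (u + v) - f u - L v) * b by ring.
apply: le_trans (nrD _ _) _; rewrite nrM.
have k1 : e / (2 * K) * nr (f (u + v) - f u) <= e / 2 * nr v.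
  apply: le_trans (ler_wpM2l (ltW e1) h1) _.
  by rewrite le_eqVlt; apply/orP; left; apply/eqP; field; rewrite gt_eqF.
have k2 : nr (f (u + v) - f u - L v) * nr b <= e / 2 * nr v.
  apply: le_trans (ler_wpM2r (nr_ge0 b) h4) _.
  rewrite (_ : e / (2 * (nr b + 1)) * nr v * nr b = (e / 2 * nr v) * (nr b / (nr b + 1))); last first.
    by field; rewrite gt_eqF.
  have p : 0 <= e / 2 * nr v by rewrite mulr_ge0 ?nr_ge0// divr_ge0// ltW.
  by rewrite ler_piMr// ler_pdivrMr// mul1r; lra.
have := h3; lra.
Qed.

Lemma cd_inv (z : C) : z != 0 -> cd (fun z => z^-1) z (- z ^- 2).
Proof.
move=> z0; have n0 := nr_gt0 z0.
apply: (@quad_cd _ _ _ _ (2 / nr z ^+ 3) (nr z / 2)); first by rewrite divr_gt0.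
move=> h hz; have h1 : nr z / 2 <= nr (z + h).
  by have := nrBl z (- h); rewrite nrN opprK; lra.
have zh : z + h != 0 by rewrite nr_neq0//; lra.
have -> : (z + h)^-1 - z^-1 - h * - z ^- 2 = h ^+ 2 * (z ^+ 2)^-1 * (z + h)^-1.
  by field; rewrite z0 zh.
rewrite nrM nrM !nrV !nrX [leRHS]mulrC -mulrA; apply: ler_wpM2l; first by rewrite exprn_ge0 ?nr_ge0.
have : (nr (z + h))^-1 <= (nr z / 2)^-1 by rewrite lef_pV2 ?posrE//; lra.
move=> k; apply: (@le_trans _ _ ((nr z ^+ 2)^-1 * (nr z / 2)^-1)).
  by rewrite ler_wpM2l// invr_ge0 exprn_ge0// ltW.
by rewrite le_eqVlt; apply/orP; left; apply/eqP; field; rewrite gt_eqF.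
Qed.

Lemma cderV (E : normedModType C) (f : E -> C) u L : f u != 0 -> cder f u L ->
  cder (fun v => (f v)^-1) u (fun v => - L v / f u ^+ 2).
Proof.
move=> f0 h; apply: (cder_eqL _ (cder_comp (cd_inv f0) h)) => v.
by rewrite mulrN mulNr.
Qed.

Section Holomorphy.
Variable E : normedModType C.
Implicit Types (f : E -> C) (u v : E) (B : set E).

Definition hol B f := forall u, B u -> exists L, cder f u L.
Definition bal u (r : R) : set E := [set v | nr (v - u) < r].

Lemma balC u r : 0 < r -> bal u r u.
Proof. by rewrite /bal/= subrr nr0. Qed.

Lemma bal_sub u r u' r' : nr (u' - u) + r' <= r -> bal u' r' `<=` bal u r.
Proof. by move=> h v; rewrite /bal/= => h'; have := nrBD u' v u; lra. Qed.

Lemma bal_nbhs u r v : bal u r v -> nbhs v (bal u r).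
Proof.
move=> h; apply/near_nrP; exists (r - nr (v - u)); first by rewrite subr_gt0.
by move=> w hw; rewrite /bal/=; have := nrBD v w u; lra.
Qed.

Lemma hol_sub B B' f : B `<=` B' -> hol B' f -> hol B f.
Proof. by move=> s h u /s/h. Qed.

Lemma hol_ext B f g : (forall u, B u -> nbhs u B) -> (forall u, B u -> f u = g u) ->
  hol B f -> hol B g.
Proof.
move=> oB fg h u Bu; have [L hL] := h _ Bu; exists L; apply: cder_loc hL.
by apply: filterS (oB _ Bu) => v /fg.
Qed.

Lemma cderE f u L : cder f u L -> L = fun v => 'D_v f u.
Proof. by move=> /cder_differentiable[_ h]; apply/funext. Qed.

Lemma hol_cder B f u : hol B f -> B u -> cder f u (fun v => 'D_v f u).
Proof. by move=> h /h[L hL]; have e := cderE hL; rewrite -e. Qed.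

Lemma hol_cst B (c : C) : hol B (fun=> c).
Proof. by move=> u _; eexists; exact: cder_cst. Qed.

Lemma holD B f g : hol B f -> hol B g -> hol B (fun u => f u + g u).
Proof. by move=> hf hg u Bu; have [L ?] := hf u Bu; have [M ?] := hg u Bu; eexists; apply: cderD; eassumption. Qed.

Lemma holB B f g : hol B f -> hol B g -> hol B (fun u => f u - g u).
Proof. by move=> hf hg u Bu; have [L ?] := hf u Bu; have [M ?] := hg u Bu; eexists; apply: cderB; eassumption. Qed.

Lemma holM B f g : hol B f -> hol B g -> hol B (fun u => f u * g u).
Proof. by move=> hf hg u Bu; have [L ?] := hf u Bu; have [M ?] := hg u Bu; eexists; apply: cderM; eassumption. Qed.

Lemma hol_sum B (I : Type) (s : seq I) (P : pred I) (f : I -> E -> C) :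
  (forall i, P i -> hol B (f i)) -> hol B (fun u => \sum_(i <- s | P i) f i u).
Proof.
move=> h u Bu; exists (fun v => \sum_(i <- s | P i) 'D_v (f i) u).
by apply: cder_sum => i Pi; apply: hol_cder (h _ Pi) Bu.
Qed.

Lemma hol_prod B (I : Type) (s : seq I) (P : pred I) (f : I -> E -> C) :
  (forall i, P i -> hol B (f i)) -> hol B (fun u => \prod_(i <- s | P i) f i u).
Proof.
move=> h; elim: s => [|i s IH] u Bu.
  by exists (fun=> 0); apply: cder_eq (cder_cst 1 u) => v; rewrite big_nil.
case: (boolP (P i)) => Pi.
  have [L hL] := holM (h _ Pi) IH Bu; exists L.
  by apply: cder_eq hL => v; rewrite big_cons Pi.
by have [L hL] := IH u Bu; exists L; apply: cder_eq hL => v; rewrite big_cons (negPf Pi).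
Qed.

Lemma holX B f n : hol B f -> hol B (fun u => f u ^+ n).
Proof.
move=> h; elim: n => [|n IH] u Bu.
  by exists (fun=> 0); apply: cder_eq (cder_cst 1 u) => v; rewrite expr0.
by have [L hL] := holM h IH Bu; exists L; apply: cder_eq hL => v; rewrite exprS.
Qed.

Lemma holV B f : (forall u, B u -> f u != 0) -> hol B f -> hol B (fun u => (f u)^-1).
Proof. by move=> h0 h u Bu; have [L hL] := h u Bu; eexists; apply: cderV hL; exact: h0. Qed.

Section Estimates.
Variables (f : E -> C) (u : E) (rho M : R).
Hypothesis rho0 : 0 < rho.
Hypothesis hf : hol (bal u rho) f.
Hypothesis hM : forall v, bal u rho v -> nr (f v) <= M.

(** Restrict to the complex line through [u] in direction [v]; the one-variable estimates on the
    circle of radius rho / (2 |v|) give both bounds. *)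
Lemma cauchy_est L v : cder f u L ->
  nr (L v) <= 2 * M / rho * nr v /\
  (nr v <= rho / 4 -> nr (f (u + v) - f u - L v) <= 8 * M / rho ^+ 2 * nr v ^+ 2).
Proof.
move=> hL; have [->|v0] := eqVneq v 0.
  by rewrite (cder_lin0 hL) addr0 subrr subr0 !nr0 expr0n/= !mulr0.
have nv := nr_gt0 v0.
pose r0 := 3 * rho / 4 / nr v; pose r := rho / 2 / nr v.
have rp : 0 < r by rewrite !divr_gt0.
have rr0 : 0 < r < r0.
  by rewrite rp /= /r /r0 ltr_pM2r ?invr_gt0//; move: rho0; lra.
have inb (z : C) : nr z <= r0 -> bal u rho (u + z *: v).
  rewrite /bal/= addrC addKr nrZ /r0 ler_pdivlMr// => h.
  by apply: le_lt_trans h _; move: rho0; lra.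
have hg (z : C) : nr (z - 0) <= r0 -> exists L, cder (fun z : C => f (u + z *: v)) z L.
  by rewrite subr0 => /inb/hf[L' hL']; eexists; apply: cder_line hL'.
have gM (s : C) : nr s = r -> nr (f (u + (0 + s) *: v)) <= M.
  by move=> hs; rewrite add0r; apply/hM/inb; rewrite hs; case/andP: rr0 => _ /ltW.
have h1 := cd_tc1 rr0 hg gM.
have h2 : cd (fun z : C => f (u + z *: v)) 0 (L v).
  by apply: cder_line; rewrite scale0r addr0.
have e := cd_uniq h1 h2; split.
  rewrite -e; apply: le_trans (tc_le rr0 gM 1) _; rewrite expr1 /r.
  by rewrite le_eqVlt; apply/orP; left; apply/eqP; field; rewrite !gt_eqF.
move=> vr; have z1 : nr (1 : C) <= r / 2.
  by rewrite nr1 /r ler_pdivlMr// mul1r ler_pdivlMr//; lra.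
have := taylor2 rr0 hg gM z1.
rewrite add0r scale1r scale0r addr0 mul1r e nr1 expr1n mulr1 => h; apply: le_trans h _.
by rewrite le_eqVlt; apply/orP; left; apply/eqP; rewrite /r; field; rewrite !gt_eqF.
Qed.

End Estimates.

(** The Cauchy estimates bound the linear parts and the second-order remainders uniformly in [n], so
    both pass to the ultralimit. A common bound on the functions takes the place of uniform
    convergence. *)
Lemma weierstrass (f : nat -> E -> C) u (rho M : R) (L : nat -> E -> C) : 0 < rho ->
  (forall n, hol (bal u rho) (f n)) ->
  (forall n v, bal u rho v -> nr (f n v) <= M) -> (forall n, cder (f n) u (L n)) ->
  cder (fun v => Lim (fun n => f n v)) u (fun v => Lim (fun n => L n v)).
Proof.
move=> rho0 hf hM hL.
have est n v := @cauchy_est (f n) u rho M rho0 (hf n) (hM n) (L n) v (hL n).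
have bL v : bnd (fun n => L n v) by exists (2 * M / rho * nr v) => n; have [] := est n v.
have bf v : bal u rho v -> bnd (fun n => f n v) by move=> h; exists M => n; apply: hM.
have M0 : 0 <= M by apply: le_trans (hM 0%N u (balC _ rho0)); rewrite nr_ge0.
split=> [a x y||e e0].
- rewrite -LimZ// -LimD//; last by apply: bndM => //; exact: bnd_cst.
  by apply: Lim_ext => n; rewrite (cder_lin (hL n)).
- exists (2 * M / rho); first by rewrite divr_ge0 ?mulr_ge0// ltW.
  by move=> v; apply: nr_Lim => n; have [] := est n v.
pose K := 8 * M / rho ^+ 2 + 1.
have K0 : 0 < K.
  have : 0 <= 8 * M / rho ^+ 2 by rewrite divr_ge0 ?mulr_ge0 ?exprn_ge0// ltW.
  by rewrite /K; lra.
exists (Num.min (rho / 4) (e / K)); first by rewrite lt_min !divr_gt0.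
move=> v; rewrite lt_min => /andP[v1 v2].
have buv : bal u rho (u + v) by rewrite /bal/= addrC addKr; lra.
have bu : bal u rho u by apply: balC.
rewrite /= -LimB; [|exact: bf..].
rewrite -LimB; [|by apply: bndB; exact: bf|exact: bL].
apply: nr_Lim => n; have [_ h] := est n v; apply: le_trans (h (ltW v1)) _.
move: v2; rewrite ltr_pdivlMr// => v2; have := nr_ge0 v => v0.
have : 8 * M / rho ^+ 2 <= K by rewrite /K; lra.
by move=> h1; rewrite expr2 mulrA ler_wpM2r//; apply: le_trans (ltW v2); rewrite mulrC ler_wpM2l.
Qed.

Lemma hol_Lim (f : nat -> E -> C) (u0 : E) (r M : R) :
  (forall n, hol (bal u0 r) (f n)) -> (forall n v, bal u0 r v -> nr (f n v) <= M) ->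
  hol (bal u0 r) (fun v => Lim (fun n => f n v)).
Proof.
move=> hf hM u ur; pose rho := r - nr (u - u0).
have rho0 : 0 < rho by rewrite subr_gt0.
have sub : bal u rho `<=` bal u0 r by apply: bal_sub; rewrite /rho; lra.
exists (fun v => Lim (fun n => 'D_v (f n) u)); apply: (@weierstrass _ _ rho M) => //.
- by move=> n; apply: hol_sub (hf n).
- by move=> n v /sub; apply: hM.
- by move=> n; apply: hol_cder (hf n) ur.
Qed.

Lemma hol_bounded B f u : nbhs u B -> hol B f ->
  exists2 r : R, 0 < r & bal u r `<=` B /\ exists M, forall v, bal u r v -> nr (f v) <= M.
Proof.
move=> /near_nrP[r r0 rB] hf; have [|L hL] := hf u; first by apply: rB; rewrite subrr nr0.
have [d d0 hd] := cder_cont hL ltr01.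
exists (Num.min r d); first by rewrite lt_min r0.
split=> [v|]; first by rewrite /bal/= lt_min => /andP[/rB].
exists (nr (f u) + 1) => v; rewrite /bal/= lt_min => /andP[_ /hd].
by have := nrBl (f v) (f u); lra.
Qed.

Lemma dquot_lim f u L v (k : R) : 0 < k -> cder f u L ->
  Lim (fun n => (k / 2 ^+ n)%:C%C^-1 * (f (u + (k / 2 ^+ n)%:C%C *: v) - f u)) = L v.
Proof.
move=> k0 h; apply: Lim_cvg => e e0.
have n1 : 0 < nr v + 1 by have := nr_ge0 v; lra.
have [_ _ /(_ _ (divr_gt0 e0 n1))[d d0 hd]] := h.
have q01 : 0 <= (2^-1 : R) < 1 by lra.
have [N hN] := @geom_small R 2^-1 (d / ((nr v + 1) * k)) q01 (divr_gt0 d0 (mulr_gt0 n1 k0)).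
exists N => n /hN; rewrite exprVn ltr_pdivlMr ?mulr_gt0// => hn.
have p0 : 0 < k / 2 ^+ n by rewrite divr_gt0// exprn_gt0.
set t := k / 2 ^+ n in p0 *.
have ht : t * (nr v + 1) < d by rewrite /t; move: hn; rewrite mulrC [(nr v + 1) * k]mulrC -mulrA mulrAC mulrA mulrAC.
have tv : nr (t%:C%C *: v) < d.
  by rewrite nrZ nrR gtr0_norm//; have := nr_ge0 v; nra.
have tn : (t%:C%C : C) != 0 by rewrite nr_neq0// nrR gtr0_norm.
have := hd _ tv; rewrite (cder_linZ h) => hh.
have -> : t%:C%C^-1 * (f (u + t%:C%C *: v) - f u) - L v =
   t%:C%C^-1 * (f (u + t%:C%C *: v) - f u - t%:C%C * L v) by field.
rewrite nrM nrV nrR gtr0_norm// ltr_pdivrMl//; apply: le_lt_trans hh _.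
rewrite nrZ nrR gtr0_norm// mulrCA ltr_pM2l// mulrAC ltr_pdivrMr// ltr_pM2l//; lra.
Qed.

(** The difference quotients of [f] in direction [v] are holomorphic and uniformly bounded, so
    [weierstrass] differentiates their limit. Its derivative in direction [x] is the limit of the
    difference quotients of the derivative along [x]; the clause asks that the latter be
    differentiable, which the first half supplies in [D_comm]. *)
Lemma hol_D_comm (u0 : E) f (r : R) v u : hol (bal u0 r) f -> bal u0 r u ->
  exists L, cder (fun w => 'D_v f w) u L /\
    forall x, (exists L', cder (fun w => 'D_x f w) u L') -> L x = 'D_v (fun w => 'D_x f w) u.
Proof.
move=> hf ur; have [rho rho0 [sub [M hM]]] := hol_bounded (bal_nbhs ur) hf.
have nv : 0 < nr v + 1 by have := nr_ge0 v; lra.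
pose k := rho / (8 * (nr v + 1)); have k0 : 0 < k by rewrite divr_gt0// mulr_gt0.
pose t n := k / 2 ^+ n; have t0 n : 0 < t n by rewrite divr_gt0// exprn_gt0.
have tk n : t n <= k.
  by rewrite ler_pdivrMr ?exprn_gt0// ler_pMr// exprn_ege1//; lra.
have tn n : ((t n)%:C%C : C) != 0 by rewrite nr_neq0// nrR gtr0_norm.
have ntv n : nr ((t n)%:C%C *: v) <= rho / 8.
  rewrite nrZ nrR gtr0_norm//; apply: (@le_trans _ _ (k * (nr v + 1))).
    by rewrite ler_pM ?nr_ge0 ?(ltW (t0 n))//; lra.
  by rewrite /k le_eqVlt; apply/orP; left; apply/eqP; field; rewrite gt_eqF.
pose q n w := (t n)%:C%C^-1 * (f (w + (t n)%:C%C *: v) - f w).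
have rho2 : 0 < rho / 2 by lra.
have in1 w : bal u (rho / 2) w -> bal u rho w by rewrite /bal/=; lra.
have in2 n w : bal u (rho / 2) w -> bal u rho (w + (t n)%:C%C *: v).
  rewrite /bal/= addrAC => h; apply: le_lt_trans (nrD _ _) _.
  by have := ntv n; lra.
have hq n w : bal u (rho / 2) w -> cder (q n) w
    (fun x => (t n)%:C%C^-1 * ('D_x f (w + (t n)%:C%C *: v) - 'D_x f w)).
  move=> hw; apply: cderZ; apply: cderB; last exact: hol_cder hf (sub _ (in1 _ hw)).
  apply: (@cder_affine E E f (fun w => w + (t n)%:C%C *: v) id w (fun x => 'D_x f (w + (t n)%:C%C *: v)) 1) => //.
  - by move=> x h; rewrite addrAC.
  - by move=> x; rewrite mul1r.
  - exact: hol_cder hf (sub _ (in2 n _ hw)).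
have M0 : 0 <= M by apply: le_trans (hM u (balC _ rho0)); rewrite nr_ge0.
have qM n w : bal u (rho / 2) w -> nr (q n w) <= (4 * M / rho + 4 * M / rho) * (nr v + 1).
  move=> hw; have hol2 : hol (bal w (rho / 2)) f.
    by apply: hol_sub hf; apply: subset_trans sub; apply: bal_sub; move: hw; rewrite /bal/=; lra.
  have hM2 x : bal w (rho / 2) x -> nr (f x) <= M.
    by move=> hx; apply: hM; apply: bal_sub hx; move: hw; rewrite /bal/=; lra.
  have [] := @cauchy_est f w (rho / 2) M rho2 hol2 hM2 _ ((t n)%:C%C *: v) (hol_cder hol2 (balC _ rho2)).
  set D := 'D__ f w; move=> h1 h2; have {}h2 := h2 _.
  have hn := ntv n; have {}h2 : nr (f (w + (t n)%:C%C *: v) - f w - D) <= 8 * M / (rho / 2) ^+ 2 * nr ((t n)%:C%C *: v) ^+ 2.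
    by apply: h2; lra.
  have := nrD (f (w + (t n)%:C%C *: v) - f w - D) D; rewrite subrK => h3.
  rewrite /q nrM nrV nrR gtr0_norm// ler_pdivrMl//.
  apply: le_trans h3 _; apply: le_trans (lerD h2 h1) _.
  have e : nr ((t n)%:C%C *: v) = t n * nr v by rewrite nrZ nrR gtr0_norm.
  have a1 : 8 * M / (rho / 2) ^+ 2 * nr ((t n)%:C%C *: v) ^+ 2 <= 4 * M / rho * nr ((t n)%:C%C *: v).
    rewrite [nr _ ^+ 2]expr2 mulrA ler_wpM2r ?nr_ge0//.
    apply: (@le_trans _ _ (8 * M / (rho / 2) ^+ 2 * (rho / 8))).
      by rewrite ler_wpM2l// divr_ge0 ?mulr_ge0 ?exprn_ge0// ltW.
    by rewrite le_eqVlt; apply/orP; left; apply/eqP; field; rewrite gt_eqF.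
  have a2 : 2 * M / (rho / 2) = 4 * M / rho by field; rewrite gt_eqF.
  rewrite a2; apply: le_trans (lerD a1 (lexx _)) _; rewrite -mulrDl mulrCA ler_wpM2l//.
    by rewrite addr_ge0// divr_ge0 ?mulr_ge0// ltW.
  by rewrite e ler_wpM2l ?(ltW (t0 n))//; lra.
have W := @weierstrass q u (rho / 2) _ _ rho2 (fun n w hw => ex_intro _ _ (hq n w hw)) qM (fun n => hq n u (balC _ rho2)).
eexists; split.
  apply: cder_loc W; apply: filterS (bal_nbhs (balC _ rho2)) => w hw.
  by rewrite /q (dquot_lim v k0 (hol_cder hf (sub _ (in1 _ hw)))).
move=> x [L' hL'] /=; rewrite (dquot_lim v k0 hL').
by rewrite (cderE hL').
Qed.

Lemma hol_D (u0 : E) f (r : R) v : hol (bal u0 r) f -> hol (bal u0 r) (fun w => 'D_v f w).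
Proof. by move=> hf u ur; have [L [hL _]] := hol_D_comm v hf ur; exists L. Qed.

Lemma D_comm (u0 : E) f (r : R) x v u : hol (bal u0 r) f -> bal u0 r u ->
  'D_x (fun w => 'D_v f w) u = 'D_v (fun w => 'D_x f w) u.
Proof.
move=> hf ur; have [L [hL h]] := hol_D_comm v hf ur.
have [_ e] := cder_differentiable hL.
exact: (etrans (e x) (h x (hol_D x hf ur))).
Qed.

End Holomorphy.

End SeveralVariables.

(** * The identity theorem *)

Section Identity.
Variable R : realType.
Local Notation C := R[i].

Lemma small_all0 (x K d : R) : 0 < d -> 0 <= x -> (forall t, 0 < t < d -> x <= K * t) -> x = 0.
Proof.
move=> d0 x0 h; apply/eqP; rewrite eq_le x0 andbT leNgt; apply/negP => xp.
have K0 : 0 < K.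
  have := h (d / 2); rewrite divr_gt0//= => /(_ _) k.
  have {}k : x <= K * (d / 2) by apply: k; lra.
  by nra.
pose t := Num.min (d / 2) (x / (2 * K)).
have t0 : 0 < t by rewrite lt_min !divr_gt0// mulr_gt0.
have td : t < d.
  by apply: le_lt_trans (_ : d / 2 < d); [rewrite ge_min lexx|lra].
have tx : t <= x / (2 * K) by rewrite ge_min lexx orbT.
have := h t; rewrite t0 td => /(_ isT) k.
have : K * t <= x / 2.
  apply: le_trans (ler_wpM2l (ltW K0) tx) _.
  by rewrite le_eqVlt; apply/orP; left; apply/eqP; field; rewrite gt_eqF.
lra.
Qed.

Lemma tc_zero (f : C -> C) (r0 r M d : R) : 0 < r < r0 ->
  (forall z, nr (z - 0) <= r0 -> exists L, cder f z L) ->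
  (forall s, nr s = r -> nr (f (0 + s)) <= M) ->
  0 < d -> (forall z, nr z < d -> f z = 0) -> forall n, tc f 0 r n = 0.
Proof.
move=> rr0 hf hM d0 fz n; have r1 : 0 < r by case/andP: rr0.
elim/ltn_ind: n => n IH; apply: nr_eq0.
apply: (@small_all0 _ (2 * M / r ^+ n.+1) (Num.min d (r / 2))); rewrite ?nr_ge0//.
  by rewrite lt_min d0 divr_gt0.
move=> t /andP[t0]; rewrite lt_min => /andP[td tr].
have nt : nr (t%:C%C : C) = t by rewrite nrR gtr0_norm.
have tr' : nr (t%:C%C : C) < r by rewrite nt; lra.
have := taylor rr0 hf hM n.+1 tr'; rewrite add0r fz ?nt// big_nat_recr//=.
rewrite big_nat big1 ?add0r ?sub0r; last by move=> k /andP[_ kn]; rewrite IH// mul0r.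
rewrite nrN nrM nrX nt => h.
have M0 : 0 <= M by apply: le_trans (hM r%:C%C _); rewrite ?nr_ge0// nrR gtr0_norm.
have h2 : r / (r - t) <= 2 by rewrite ler_pdivrMr ?subr_gt0//; lra.
have p : 0 <= M * (t / r) ^+ n.+1 by rewrite mulr_ge0// exprn_ge0// divr_ge0// ltW.
have := le_trans h (ler_wpM2l p h2).
rewrite (_ : M * _ * 2 = 2 * M / r ^+ n.+1 * t * t ^+ n); last first.
  by rewrite expr_div_n exprS; field; rewrite expf_neq0// gt_eqF.
by rewrite ler_pM2r// exprn_gt0.
Qed.

Variable E : normedModType C.
Implicit Types (f : E -> C) (u v a : E).

Lemma id_step f a (r d : R) : hol (bal a r) f -> 0 < d -> (forall v, bal a d v -> f v = 0) ->
  forall v, bal a r v -> f v = 0.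
Proof.
move=> hf d0 fz b br; have [ab|ab] := eqVneq b a.
  by rewrite ab; apply: fz; apply: balC.
have w0 : b - a != 0 by rewrite subr_eq0.
have nw := nr_gt0 w0; pose w := b - a; pose s := r / nr w.
have s1 : 1 < s by rewrite ltr_pdivlMr// mul1r.
(* On the complex line through [a] and [b], the point [b] has parameter 1 and the ball ends at
   parameter s > 1; these are two radii in between. *)
pose r1 := (2 + s) / 3; pose r0 := (1 + 2 * s) / 3.
have rr : 0 < r1 < r0 by rewrite /r1 /r0; apply/andP; split; lra.
pose phi (z : C) := f (a + z *: w).
have inb (z : C) : nr z <= r0 -> bal a r (a + z *: w).
  rewrite /bal/= addrC addKr nrZ => h.
  apply: le_lt_trans (ler_wpM2r (ltW nw) h) _.
  by rewrite -ltr_pdivlMr// -/s /r0; lra.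
have hphi (z : C) : nr (z - 0) <= r0 -> exists L, cder phi z L.
  by rewrite subr0 => /inb/hf[L hL]; eexists; apply: cder_line hL.
have [M hM] := disc_bounded hphi.
have hMs (z : C) : nr z = r1 -> nr (phi (0 + z)) <= M.
  by move=> hz; apply: hM; rewrite add0r subr0 hz; case/andP: rr => _ /ltW.
have phz (z : C) : nr z < d / nr w -> phi z = 0.
  by rewrite ltr_pdivlMr// => h; apply: fz; rewrite /bal/= addrC addKr nrZ.
have tz := tc_zero rr hphi hMs (divr_gt0 d0 nw) phz.
have r11 : 1 < r1 by rewrite /r1; lra.
have nr1r : nr (1 : C) < r1 by rewrite nr1.
have fb : f b = phi (0 + 1) by rewrite /phi add0r scale1r /w [a + _]addrC subrK.
apply: nr_eq0; apply/eqP; rewrite eq_le nr_ge0 andbT leNgt; apply/negP => fp.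
have q01 : 0 <= r1^-1 < 1 by rewrite invr_ge0 invf_lt1; lra.
have M0 : 0 <= M.
  by apply: le_trans (hMs r1%:C%C _); rewrite ?nr_ge0// nrR gtr0_norm//; lra.
pose K := M * (r1 / (r1 - 1)) + 1.
have K0 : 0 < K.
  have : 0 <= M * (r1 / (r1 - 1)) by rewrite mulr_ge0// divr_ge0//; lra.
  by rewrite /K; lra.
have [N /(_ N (leqnn N)) hN] := geom_small q01 (divr_gt0 fp K0).
have := taylor rr hphi hMs N nr1r; rewrite big1 ?subr0; last by move=> m _; rewrite tz mul0r.
rewrite -fb nr1 mul1r => h.
have : r1^-1 ^+ N * K < nr (f b) by rewrite -ltr_pdivlMr.
have e0 : 0 <= r1^-1 ^+ N by rewrite exprn_ge0//; case/andP: q01.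
by move: h; rewrite -mulrA [_ ^+ N * _]mulrC mulrA /K; nra.
Qed.

(** Vanishing spreads by [id_step] along a chain of balls of common radius [del] centred on the
    segment from [a] to [b]; consecutive centres lie less than [del] apart. *)
Lemma identity u0 (r : R) f a : hol (bal u0 r) f -> bal u0 r a ->
  (\forall v \near a, f v = 0) -> forall v, bal u0 r v -> f v = 0.
Proof.
move=> hf ha /near_nrP[d d0 fz] b hb.
pose del := Num.min (r - nr (a - u0)) (r - nr (b - u0)).
have del0 : 0 < del by rewrite lt_min !subr_gt0; apply/andP; split.
pose m := (Num.bound (nr (b - a) / del)).+1.
have m0 : 0 < m%:R :> R by rewrite ltr0n.
have md : nr (b - a) / m%:R < del.
  rewrite ltr_pdivrMr// [del * _]mulrC -ltr_pdivrMr//.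
  apply: lt_trans (_ : (Num.bound (nr (b - a) / del))%:R < _); last by rewrite ltr_nat.
  by apply: archi_boundP; rewrite divr_ge0 ?nr_ge0// ltW.
pose p k : E := a + (k%:R / m%:R : C) *: (b - a).
have sub k : (k <= m)%N -> bal (p k) del `<=` bal u0 r.
  move=> km; apply: bal_sub; pose t : R := k%:R / m%:R.
  have t0 : 0 <= t by rewrite divr_ge0.
  have t1 : t <= 1 by rewrite ler_pdivrMr// mul1r ler_nat.
  have tC : (k%:R / m%:R : C) = t%:C%C by rewrite rmorphM/= fmorphV/= !rmorph_nat.
  have -> : p k - u0 = (1 - t)%:C%C *: (a - u0) + t%:C%C *: (b - u0).
    rewrite /p tC rmorphB rmorph1 scalerBl scale1r addrAC -[RHS]addrA; congr (_ + _).
    rewrite (_ : b - a = (b - u0) - (a - u0)); last by rewrite opprB addrA subrK.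
    by rewrite scalerBr addrC.
  have e1 : del <= r - nr (a - u0) by rewrite ge_min lexx.
  have e2 : del <= r - nr (b - u0) by rewrite ge_min lexx orbT.
  have := nrD ((1 - t)%:C%C *: (a - u0)) (t%:C%C *: (b - u0)).
  rewrite !nrZ !nrR ger0_norm ?subr_ge0// ger0_norm//.
  have := nr_ge0 (a - u0); have := nr_ge0 (b - u0); nra.
have zero k : (k <= m)%N -> forall v, bal (p k) del v -> f v = 0.
  elim: k => [|k IH] km.
    apply: (@id_step f (p 0%N) del d _ d0); first exact: hol_sub (sub _ km) hf.
    by move=> v; rewrite /bal /p/= mul0r scale0r addr0; exact: fz.
  have pk : nr (p k.+1 - p k) < del.
    rewrite /p opprD addrACA subrr add0r -scalerBl nrZ -mulrBl -natrB// subSnn mul1r.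
    by rewrite nrV nr_nat mulrC.
  apply: (@id_step f (p k.+1) del (del - nr (p k.+1 - p k)) _ _).
  - exact: hol_sub (sub _ km) hf.
  - by rewrite subr_gt0.
  - move=> v hv; apply: (IH (ltnW km)); apply: bal_sub hv; lra.
apply: (zero m (leqnn m)); rewrite /p divff ?scale1r ?pnatr_eq0// [a + _]addrC subrK.
exact: balC.
Qed.

Lemma hol_dense u0 (r : R) f : hol (bal u0 r) f -> (exists2 a, bal u0 r a & f a != 0) ->
  forall a, bal u0 r a -> forall d, 0 < d -> exists2 v, bal u0 r v /\ nr (v - a) < d & f v != 0.
Proof.
move=> hf [b hb fb] a ha d d0; apply: contrapT => h.
suff /(identity hf ha)/(_ b hb) e : \forall v \near a, f v = 0 by rewrite e eqxx in fb.
have /near_nrP[r' r'0 hr'] := bal_nbhs ha.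
apply/near_nrP; exists (Num.min r' d); first by rewrite lt_min r'0.
move=> v; rewrite lt_min => /andP[v1 v2]; apply/eqP/negPn/negP => fv.
by apply: h; exists v => //; split=> //; apply: hr'.
Qed.

End Identity.

(** * Coordinates and partial derivatives on C^N *)

Section Scalar.
Variable R : realType.
Local Notation C := R[i].
Variable N : nat.
Local Notation CN := 'rV[C]_N.

Lemma cder_coord (u : CN) i : cder (fun v : CN => v 0 i) u (fun v : CN => v 0 i).
Proof.
split=> [a x y||e e0]; first by rewrite !mxE.
  by exists 1 => // v; rewrite mul1r nr_coord.
exists 1 => // v _; rewrite mxE (_ : _ - _ = 0) ?nr0; last by ring.
by rewrite mulr_ge0 ?nr_ge0// ltW.
Qed.

Lemma hol_coord B i : hol B (fun v : CN => v 0 i).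
Proof. by move=> u _; exists (fun v : CN => v 0 i); apply: cder_coord. Qed.

(* a function of one coordinate *)
Lemma cder_of_coord (g : C -> C) (u : CN) i b : cd g (u 0 i) b ->
  cder (fun v : CN => g (v 0 i)) u (fun v : CN => v 0 i * b).
Proof. by move=> h; apply: (cder_comp h (cder_coord u i)). Qed.

Lemma D_partial (f : CN -> C) (u v : CN) L : cder f u L ->
  L v = \sum_(k < N) v 0 k * partial k f u.
Proof.
move=> h; have [_ e] := cder_differentiable h.
rewrite [in LHS](row_sum_delta v).
have lin_sum (I : Type) (s : seq I) (F : I -> CN) : L (\sum_(i <- s) F i) = \sum_(i <- s) L (F i).
  by elim: s => [|x s IH]; rewrite ?big_nil ?(cder_lin0 h)// !big_cons (cder_linD h) IH.
by rewrite lin_sum; apply: eq_bigr => k _; rewrite (cder_linZ h) /partial e.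
Qed.

Lemma hol_holomorphic (B : set CN) f : hol B f <-> holomorphic B f.
Proof.
split=> h u Bu; first by have [L hL] := h _ Bu; have [] := cder_differentiable hL.
by eexists; apply: differentiable_cder; apply: h.
Qed.

End Scalar.

(** * Bounds for determinants and cofactors *)

Section Determinants.
Variable R : realType.
Local Notation C := R[i].

Lemma nr_prod (I : Type) (s : seq I) (P : pred I) (F : I -> C) :
  nr (\prod_(i <- s | P i) F i) = \prod_(i <- s | P i) nr (F i).
Proof. by elim/big_ind2: _ => [|x a y b <- <-|//]; rewrite ?nr1 ?nrM. Qed.

(** The product of row sums expands over all maps from rows to columns, and the permutations are
    some of these. *)
Lemma nr_det n (A : 'M[C]_n) : nr (\det A) <= \prod_i \sum_j nr (A i j).
Proof.
rewrite bigA_distr_bigA/= (bigID (fun f : {ffun 'I_n -> 'I_n} => injectiveb f))/=.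
apply: (@le_trans _ _ (\sum_(f : {ffun 'I_n -> 'I_n} | injectiveb f) \prod_i nr (A i (f i)))); last first.
  by rewrite lerDl; apply: sumr_ge0 => f _; apply: prodr_ge0 => i _; exact: nr_ge0.
rewrite (reindex (@pval _)) /=; last first.
  pose in_Sn := insubd (1%g : 'S_n).
  by exists in_Sn => /= f Uf; first apply: val_inj; apply: insubdK.
rewrite /determinant; apply: le_trans (nr_sum _ _ _) _.
rewrite [leRHS](eq_bigl xpredT); last by move=> s; rewrite (valP s).
apply: ler_sum => s _; rewrite nrM nrX nrN nr1 expr1n mul1r nr_prod.
by apply: ler_prod => i _; rewrite nr_ge0 /= pvalE.
Qed.

(** Deleting a row and a column only lowers the remaining row sums, and the factor of the deleted
    row can be restored because it is at least 1. *)
Lemma nr_cofactor n (A : 'M[C]_n) (B : 'I_n -> R) i j :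
  (forall k, 1 <= B k) -> (forall k, \sum_l nr (A k l) <= B k) ->
  nr (cofactor A i j) <= \prod_k B k.
Proof.
case: n A B i j => [|n] A B i j; first by case: i.
move=> B1 AB; rewrite /cofactor nrM nrX nrN nr1 expr1n mul1r.
apply: le_trans (nr_det _) _.
rewrite (bigD1_ord i)//=; apply: (@le_trans _ _ (\prod_(k < n) B (lift i k))).
  apply: ler_prod => k _; rewrite sumr_ge0/=; last by move=> l _; exact: nr_ge0.
  apply: le_trans (AB _); rewrite [leRHS](bigD1_ord j)//=.
  apply: (@le_trans _ _ (\sum_l nr (A (lift i k) (lift j l)))); last by rewrite lerDr nr_ge0.
  by apply: ler_sum => l _; rewrite !mxE.
by rewrite ler_peMl// prodr_ge0// => k _; apply: le_trans (B1 _).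
Qed.

Lemma geom_sum_le (q : R) n : 0 <= q < 1 -> \sum_(i < n) q ^+ i <= (1 - q)^-1.
Proof.
move=> /andP[q0 q1]; have p : 0 < 1 - q by rewrite subr_gt0.
rewrite -[leRHS]mul1r ler_pdivlMr// mulrC.
have := subrX1 q n; set S := \sum_(i < n) _ => e.
have : 0 <= q ^+ n by rewrite exprn_ge0.
by nra.
Qed.

End Determinants.

(** * Fredholm determinants and Cramer's rule *)

Section Fredholm.
Variable R : realType.
Local Notation C := R[i].
Variables (E : normedModType C) (S I : finType).
Variables (u0 : E) (r : R) (K : nat * S -> nat * S -> E -> C) (b : nat * S -> E -> C)
  (c : I -> nat * S -> E -> C) (Co th : R).
Hypothesis th01 : 0 <= th < 1.
Hypothesis Co0 : 0 <= Co.
Hypothesis holK : forall p q, hol (bal u0 r) (K p q).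
Hypothesis holb : forall p, hol (bal u0 r) (b p).
Hypothesis holc : forall i p, hol (bal u0 r) (c i p).
Hypothesis leK : forall p q w, bal u0 r w -> nr (K p q w) <= Co * th ^+ p.1 * th ^+ q.1.
Hypothesis leb : forall p w, bal u0 r w -> nr (b p w) <= Co * th ^+ p.1.
Hypothesis lec : forall i p w, bal u0 r w -> nr (c i p w) <= Co * th ^+ p.1.
Hypothesis K0 : forall p q, K p q u0 = 0.

Section Truncation.
Variable M : nat.
Local Notation T := ('I_M * S)%type.
Let ix (k : 'I_#|{: T}|) : nat * S := (nat_of_ord (enum_val k).1, (enum_val k).2).

Definition trmx_ (w : E) : 'M[C]_#|{: T}| := \matrix_(k, l) ((k == l)%:R + K (ix k) (ix l) w).

(** The numerator in Cramer's rule for the functional [c i] of the row solution of a (1 + K) = b.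
    Written with cofactors, it is holomorphic also where the determinant vanishes. *)
Definition trnum i (w : E) : C :=
  \sum_k c i (ix k) w * \sum_l b (ix l) w * cofactor (trmx_ w) k l.

Let th0 : 0 <= th. Proof. by case/andP: th01. Qed.

Let C1 : R := Co * (#|S|%:R * (1 - th)^-1).

Let C10 : 0 <= C1.
Proof. by case/andP: th01 => _ h; rewrite !mulr_ge0// invr_ge0 subr_ge0 ltW. Qed.

Let sum_ix (F : nat -> R) : \sum_k F (ix k).1 = #|S|%:R * \sum_(m < M) F m.
Proof.
rewrite (reindex (enum_rank : T -> _)) /=; last first.
  by exists enum_val => x _; rewrite ?enum_rankK ?enum_valK.
rewrite (eq_bigr (fun p : T => F p.1)); last by move=> p _; rewrite /ix enum_rankK.
rewrite -(pair_bigA _ (fun (m : 'I_M) (s : S) => F m))/= mulr_sumr.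
by apply: eq_bigr => m _; rewrite sumr_const mulr_natl.
Qed.

Lemma sum_th : \sum_k th ^+ (ix k).1 <= #|S|%:R * (1 - th)^-1.
Proof. by rewrite (sum_ix (fun m => th ^+ m)) ler_wpM2l// geom_sum_le. Qed.

Let rowb k : R := 1 + C1 * th ^+ (ix k).1.

Let rowb1 k : 1 <= rowb k.
Proof. by rewrite lerDl mulr_ge0// exprn_ge0. Qed.

Let row_le w k : bal u0 r w -> \sum_l nr (trmx_ w k l) <= rowb k.
Proof.
move=> hw; apply: (@le_trans _ _ (\sum_l ((k == l)%:R + Co * th ^+ (ix k).1 * th ^+ (ix l).1))).
  apply: ler_sum => l _; rewrite mxE; apply: le_trans (nrD _ _) _.
  by rewrite lerD ?leK// nr_nat.
rewrite big_split/= (bigD1 k)//= eqxx big1 ?addr0; last first.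
  by move=> l; rewrite eq_sym => /negPf ->.
rewrite lerD2l -mulr_sumr /C1 [leRHS]mulrAC.
by apply: ler_wpM2l; [rewrite mulr_ge0// exprn_ge0|exact: sum_th].
Qed.

(** Bounds the product of the row sums 1 + C1 th^m for every truncation at once, by 1 + x <= exp
    x. *)
Definition fredQ : R := expR (C1 * (#|S|%:R * (1 - th)^-1)).

Let prod_le : \prod_k rowb k <= fredQ.
Proof.
apply: (@le_trans _ _ (\prod_k expR (C1 * th ^+ (ix k).1))).
  apply: ler_prod => k _; rewrite (le_trans _ (rowb1 k))//=.
  exact: expR_ge1Dx.
rewrite -expR_sum ler_expR -mulr_sumr ler_wpM2l//; exact: sum_th.
Qed.

Lemma det_trmx_le w : bal u0 r w -> nr (\det (trmx_ w)) <= fredQ.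
Proof.
move=> hw; apply: le_trans (nr_det _) _; apply: le_trans prod_le.
apply: ler_prod => k _; rewrite row_le// andbT.
by apply: sumr_ge0 => l _; exact: nr_ge0.
Qed.

Lemma cofactor_trmx_le w k l : bal u0 r w -> nr (cofactor (trmx_ w) k l) <= fredQ.
Proof. by move=> hw; apply: le_trans prod_le; apply: nr_cofactor => // k'; exact: row_le. Qed.

Lemma double_sum_le (F G : 'I_#|{: T}| -> C) (A B : R) w : bal u0 r w -> 0 <= A -> 0 <= B ->
  (forall k, nr (F k) <= A * th ^+ (ix k).1) -> (forall k, nr (G k) <= B * th ^+ (ix k).1) ->
  nr (\sum_k F k * \sum_l G l * cofactor (trmx_ w) k l) <=
  A * B * fredQ * (#|S|%:R * (1 - th)^-1) ^+ 2.
Proof.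
move=> hw A0 B0 hF hG; set s := #|S|%:R * _.
have Q0 : 0 <= fredQ by apply: ltW; exact: expR_gt0.
have inner k : nr (\sum_l G l * cofactor (trmx_ w) k l) <= B * s * fredQ.
  apply: le_trans (nr_sum _ _ _) _.
  apply: (@le_trans _ _ (\sum_l B * th ^+ (ix l).1 * fredQ)).
    by apply: ler_sum => l _; rewrite nrM ler_pM ?nr_ge0 ?hG ?cofactor_trmx_le.
  by rewrite -mulr_suml -mulr_sumr ler_wpM2r// ler_wpM2l// sum_th.
apply: le_trans (nr_sum _ _ _) _.
apply: (@le_trans _ _ (\sum_k A * th ^+ (ix k).1 * (B * s * fredQ))).
  by apply: ler_sum => k _; rewrite nrM ler_pM ?nr_ge0 ?hF ?inner.
rewrite -mulr_suml -mulr_sumr.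
have s0 : 0 <= s by case/andP: th01 => _ h; rewrite mulr_ge0// invr_ge0 subr_ge0 ltW.
apply: (@le_trans _ _ (A * s * (B * s * fredQ))).
  by apply: ler_wpM2r; [exact: mulr_ge0 (mulr_ge0 B0 s0) Q0|rewrite ler_wpM2l// sum_th].
by rewrite le_eqVlt; apply/orP; left; apply/eqP; ring.
Qed.

Lemma trnum_le i w : bal u0 r w ->
  nr (trnum i w) <= Co * Co * fredQ * (#|S|%:R * (1 - th)^-1) ^+ 2.
Proof.
move=> hw; apply: double_sum_le => // k; [exact: lec|exact: leb].
Qed.

Lemma hol_det_mx n (A : E -> 'M[C]_n) B : (forall k l, hol B (fun w => A w k l)) ->
  hol B (fun w => \det (A w)).
Proof.
move=> h; apply: hol_sum => s _; apply: holM; first exact: hol_cst.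
by apply: hol_prod => i _; exact: h.
Qed.

Lemma hol_trmx k l : hol (bal u0 r) (fun w => trmx_ w k l).
Proof.
have h := holD (hol_cst (B := bal u0 r) ((k == l)%:R : C)) (holK (ix k) (ix l)).
by move=> w hw; have [L hL] := h w hw; exists L; apply: cder_eq hL => v; rewrite mxE.
Qed.

Lemma hol_det : hol (bal u0 r) (fun w => \det (trmx_ w)).
Proof. by apply: hol_det_mx => k l; exact: hol_trmx. Qed.

Lemma hol_trnum i : hol (bal u0 r) (trnum i).
Proof.
apply: hol_sum => k _; apply: holM; first exact: holc.
apply: hol_sum => l _; apply: holM; first exact: holb.
apply: holM; first exact: hol_cst.
apply: hol_det_mx => k' l'; have h := hol_trmx (lift k k') (lift l l').
by move=> w hw; have [L hL] := h w hw; exists L; apply: cder_eq hL => v; rewrite !mxE.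
Qed.

Lemma det_trmx_u0 : \det (trmx_ u0) = 1.
Proof.
have -> : trmx_ u0 = 1%:M by apply/matrixP => k l; rewrite !mxE K0 addr0.
exact: det1.
Qed.

(** The truncated unknowns solve the truncated system up to an error [ep] of order th^M. Cramer's
    rule then holds to the same order, because determinant and cofactors are bounded by [fredQ]. *)
Lemma trunc_solve i w (a : nat * S -> C) (ps : C) (D : R) : bal u0 r w -> 0 <= D ->
  (forall q, nr (a q + \sum_(p : T) a (nat_of_ord p.1, p.2) * K (nat_of_ord p.1, p.2) q w - b q w)
     <= D * th ^+ M * th ^+ q.1) ->
  nr (ps - \sum_(p : T) a (nat_of_ord p.1, p.2) * c i (nat_of_ord p.1, p.2) w) <= D * th ^+ M ->
  nr (\det (trmx_ w) * ps - trnum i w) <=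
    (fredQ * D + Co * D * fredQ * (#|S|%:R * (1 - th)^-1) ^+ 2) * th ^+ M.
Proof.
move=> hw D0 ha hps.
have sumT (F : nat * S -> C) : \sum_(p : T) F (nat_of_ord p.1, p.2) = \sum_k F (ix k).
  rewrite [RHS](reindex (enum_rank : T -> _)) /=; last first.
    by exists enum_val => x _; rewrite ?enum_rankK ?enum_valK.
  by apply: eq_bigr => p _; rewrite /ix enum_rankK.
rewrite (sumT (fun p => a p * c i p w)) in hps.
pose ep q := a (ix q) + \sum_k a (ix k) * K (ix k) (ix q) w - b (ix q) w.
have hep q : nr (ep q) <= D * th ^+ M * th ^+ (ix q).1.
  by have := ha (ix q); rewrite (sumT (fun p => a p * K p (ix q) w)).
pose av := \row_k a (ix k) : 'rV[C]_#|{: T}|.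
have eqn : av *m trmx_ w = \row_k (b (ix k) w + ep k).
  apply/rowP => k; rewrite !mxE (eq_bigr (fun l => (l == k)%:R * a (ix l) + a (ix l) * K (ix l) (ix k) w)); last first.
    by move=> l _; rewrite !mxE; ring.
  rewrite big_split/= (bigD1 k)//= eqxx mul1r big1 ?addr0; last first.
    by move=> l /negPf ->; rewrite mul0r.
  by rewrite /ep; ring.
have cram k : \det (trmx_ w) * a (ix k) = \sum_l b (ix l) w * cofactor (trmx_ w) k l
    + \sum_l ep l * cofactor (trmx_ w) k l.
  have := congr1 (fun v => (v *m \adj (trmx_ w)) 0 k) eqn.
  rewrite -mulmxA mul_mx_adj mul_mx_scalar !mxE => ->.
  by rewrite -big_split/=; apply: eq_bigr => l _; rewrite !mxE mulrDl.
clearbody ep; have -> : \det (trmx_ w) * ps - trnum i w = \det (trmx_ w) * (ps - \sum_k a (ix k) * c i (ix k) w)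
    + \sum_k c i (ix k) w * \sum_l ep l * cofactor (trmx_ w) k l.
  rewrite mulrBr -addrA; congr (_ + _); rewrite /trnum mulr_sumr -!sumrN -big_split/=.
  by apply: eq_bigr => k _; rewrite mulrA cram; ring.
apply: le_trans (nrD _ _) _; rewrite mulrDl lerD//.
  by rewrite nrM -mulrA ler_pM ?nr_ge0 ?det_trmx_le.
have tM : 0 <= th ^+ M by rewrite exprn_ge0.
apply: le_trans (@double_sum_le _ _ Co (D * th ^+ M) w hw Co0 (mulr_ge0 D0 tM) _ hep) _.
  by move=> k; exact: lec.
by rewrite le_eqVlt; apply/orP; left; apply/eqP; ring.
Qed.

End Truncation.

(** Both [h] and [g] are ultralimits of the truncated determinants and numerators, holomorphic by
    [hol_Lim]. The infinite system enters through its truncations with error of order th^M, so that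
    no infinite sum has to be formed. *)
Theorem fredholm : exists (h : E -> C) (g : I -> E -> C),
  [/\ hol (bal u0 r) h, forall i, hol (bal u0 r) (g i), h u0 = 1 &
  forall i w (a : nat * S -> C) (ps : C) (D : R), bal u0 r w ->
  (forall M q, nr (a q + \sum_(p : 'I_M * S) a (nat_of_ord p.1, p.2) * K (nat_of_ord p.1, p.2) q w
       - b q w) <= D * th ^+ M * th ^+ q.1) ->
  (forall M, nr (ps - \sum_(p : 'I_M * S) a (nat_of_ord p.1, p.2) * c i (nat_of_ord p.1, p.2) w)
     <= D * th ^+ M) ->
  h w * ps = g i w].
Proof.
exists (fun w => Lim (fun M => \det (trmx_ M w))), (fun i w => Lim (fun M => trnum M i w)); split.
- by apply: (hol_Lim (M := fredQ)) => n; [exact: hol_det|exact: det_trmx_le].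
- by move=> i; apply: hol_Lim => n; [exact: hol_trnum|exact: trnum_le].
- by rewrite -[RHS]Lim_cst; apply: Lim_ext => n; exact: det_trmx_u0.
move=> i w a ps D hw ha hps.
have D0 : 0 <= D.
  by have := hps 0%N; rewrite expr0 mulr1; apply: le_trans; exact: nr_ge0.
have bd : bnd (fun M => \det (trmx_ M w)) by exists fredQ => n; exact: det_trmx_le.
rewrite mulrC -LimZ//; apply: Lim_shift_sub.
- by apply: bndM => //; exact: bnd_cst.
- by eexists => n; exact: trnum_le.
move=> e e0; set A := fredQ * D + Co * D * fredQ * (#|S|%:R * (1 - th)^-1) ^+ 2.
have A0 : 0 <= A.
  have Q0 : 0 <= fredQ by apply: ltW; exact: expR_gt0.
  apply: addr_ge0; first exact: mulr_ge0.
  by apply: mulr_ge0; [exact: mulr_ge0 (mulr_ge0 Co0 D0) Q0|exact: sqr_ge0].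
have A1 : 0 < A + 1 by lra.
have [N hN] := geom_small th01 (divr_gt0 e0 A1); exists N => n /hN hn.
rewrite mulrC; apply: le_lt_trans (@trunc_solve n i w a ps D hw D0 (ha n) (hps n)) _.
rewrite -/A; move: hn; rewrite ltr_pdivlMr//; apply: le_lt_trans.
by rewrite mulrC ler_wpM2l ?exprn_ge0//; [case/andP: th01|lra].
Qed.

End Fredholm.

(** * Power series with geometric bounds *)

Section PowerSeries.
Variable R : realType.
Local Notation C := R[i].

Definition psum (a : nat -> C) (t : C) n : C := \sum_(0 <= k < n) a k * t ^+ k.
Definition ps (a : nat -> C) (t : C) : C := Lim (psum a t).

Definition gbd (a : nat -> C) (K s : R) := forall k, nr (a k) <= K * s ^+ k.

Lemma gbd_ge0 a K s : gbd a K s -> 0 <= K.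
Proof. by move=> /(_ 0%N); rewrite expr0 mulr1; apply: le_trans; exact: nr_ge0. Qed.

Lemma psum_tail a K s t m n : gbd a K s -> 0 <= s -> nr t * s < 1 -> (m <= n)%N ->
  nr (psum a t n - psum a t m) <= K * (s * nr t) ^+ m / (1 - s * nr t).
Proof.
move=> ga s0 ts mn; set q := s * nr t.
have q01 : 0 <= q < 1 by rewrite mulr_ge0 ?nr_ge0//= /q mulrC.
have K0 := gbd_ge0 ga; case/andP: (q01) => q0 q1.
have -> : psum a t n - psum a t m = \sum_(m <= k < n) a k * t ^+ k.
  by rewrite /psum (big_cat_nat (n := m))//= addrAC subrr add0r.
apply: le_trans (nr_sum _ _ _) _.
rewrite -{1}[m]add0n big_addn big_mkord.
apply: (@le_trans _ _ (\sum_(i < n - m) K * q ^+ m * q ^+ i)).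
  apply: ler_sum => i _; rewrite nrM nrX -mulrA -exprD addnC.
  by rewrite /q exprMn mulrA ler_wpM2r ?exprn_ge0 ?nr_ge0.
by rewrite -mulr_sumr ler_wpM2l ?mulr_ge0 ?exprn_ge0// geom_sum_le.
Qed.

Lemma psum_le a K s t n : gbd a K s -> 0 <= s -> nr t * s < 1 ->
  nr (psum a t n) <= K / (1 - s * nr t).
Proof.
move=> ga s0 ts; have := psum_tail ga s0 ts (leq0n n).
by rewrite {2}/psum big_geq// subr0 expr0 mulr1.
Qed.

Lemma psum_bnd a K s t : gbd a K s -> 0 <= s -> nr t * s < 1 -> bnd (psum a t).
Proof. by move=> ga s0 ts; eexists => n; apply: psum_le ga s0 ts. Qed.

Lemma ps_le a K s t : gbd a K s -> 0 <= s -> nr t * s < 1 -> nr (ps a t) <= K / (1 - s * nr t).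
Proof. by move=> ga s0 ts; apply: nr_Lim => n; apply: psum_le. Qed.

Lemma ps_tail a K s t m : gbd a K s -> 0 <= s -> nr t * s < 1 ->
  nr (ps a t - psum a t m) <= K * (s * nr t) ^+ m / (1 - s * nr t).
Proof.
move=> ga s0 ts; have h : ulim_to (fun n => psum a t n - psum a t m) (ps a t - psum a t m).
  apply: ulimD; last exact: ulim_cst.
  by apply: Lim_to; apply: psum_bnd ga s0 ts.
by apply: ulim_le h; apply: filterS (ultra_ge m) => n /= mn; apply: psum_tail.
Qed.

Lemma ps_uniq a K s t z (K' : R) : gbd a K s -> 0 <= s -> nr t * s < 1 ->
  (forall n, nr (z - psum a t n) <= K' * (s * nr t) ^+ n) -> ps a t = z.
Proof.
move=> ga s0 ts hz; apply: Lim_cvg => e e0.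
have q01 : 0 <= s * nr t < 1 by rewrite mulr_ge0 ?nr_ge0//= mulrC.
have K'1 : 0 < `|K'| + 1 by have := normr_ge0 K'; lra.
have [N hN] := geom_small q01 (divr_gt0 e0 K'1); exists N => n /hN hn.
rewrite nrBC; apply: le_lt_trans (hz n) _; move: hn; rewrite ltr_pdivlMr// mulrC.
apply: le_lt_trans; rewrite ler_wpM2r ?exprn_ge0//; first by case/andP: q01.
by have := ler_norm K'; lra.
Qed.

Lemma psD a b K K' s t : gbd a K s -> gbd b K' s -> 0 <= s -> nr t * s < 1 ->
  ps (fun k => a k + b k) t = ps a t + ps b t.
Proof.
move=> ga gb s0 ts; rewrite /ps -LimD; [|exact: psum_bnd ga s0 ts|exact: psum_bnd gb s0 ts].
by apply: Lim_ext => n; rewrite /psum -big_split; apply: eq_bigr => k _; rewrite mulrDl.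
Qed.

Lemma ps_sum (J : Type) (r : seq J) (a : J -> nat -> C) K s t :
  (forall j, gbd (a j) K s) -> 0 <= s -> nr t * s < 1 ->
  ps (fun k => \sum_(j <- r) a j k) t = \sum_(j <- r) ps (a j) t.
Proof.
move=> ga s0 ts; rewrite /ps -Lim_sum; last by move=> j; exact: psum_bnd (ga j) s0 ts.
by apply: Lim_ext => n; rewrite /psum exchange_big; apply: eq_bigr => k _; rewrite mulr_suml.
Qed.

Definition cprod (a b : nat -> C) k : C := \sum_(i < k.+1) a i * b (k - i)%N.

Lemma cprod_sum_le (K K' s s' : R) (a b : nat -> R) k : 0 <= s -> s < s' -> 0 <= K -> 0 <= K' ->
  (forall i, 0 <= a i <= K * s ^+ i) -> (forall i, (i <= k)%N -> 0 <= b i <= K' * s' ^+ i) ->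
  \sum_(i < k.+1) a i * b (k - i)%N <= K * K' / (1 - s / s') * s' ^+ k.
Proof.
move=> s0 ss' K0 K'0 ga gb; have s'0 : 0 < s' by lra.
apply: (@le_trans _ _ (\sum_(i < k.+1) K * K' * s' ^+ k * (s / s') ^+ i)).
  apply: ler_sum => i _; have /andP[a0 a1] := ga i; have /andP[b0 b1] := gb (k - i)%N (leq_subr _ _).
  apply: le_trans (ler_pM a0 b0 a1 b1) _.
  have e : s' ^+ k = s' ^+ (k - i) * s' ^+ i by rewrite -exprD subnK// -ltnS ltn_ord.
  rewrite e expr_div_n le_eqVlt; apply/orP; left; apply/eqP.
  by field; rewrite expf_neq0// gt_eqF.
have q01 : 0 <= s / s' < 1 by rewrite divr_ge0 ?(ltW s'0)//= ltr_pdivrMr// mul1r.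
rewrite -mulr_sumr; apply: (@le_trans _ _ (K * K' * s' ^+ k * (1 - s / s')^-1)).
  by rewrite ler_wpM2l ?geom_sum_le// mulr_ge0 ?exprn_ge0 ?(ltW s'0)// mulr_ge0.
by rewrite mulrAC.
Qed.

Lemma cprod_gbd a b K K' s s' : 0 <= s -> s < s' -> gbd a K s -> gbd b K' s' ->
  gbd (cprod a b) (K * K' / (1 - s / s')) s'.
Proof.
move=> s0 ss' ga gb k; apply: le_trans (nr_sum _ _ _) _.
under eq_bigr do rewrite nrM.
apply: (@cprod_sum_le K K' s s' (fun i => nr (a i)) (fun i => nr (b i))) => //.
- exact: gbd_ge0 ga.
- exact: gbd_ge0 gb.
- by move=> i; rewrite nr_ge0 ga.
- by move=> i _; rewrite nr_ge0 gb.
Qed.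

Lemma psum_cprod a b t n : psum (cprod a b) t n =
  \sum_(0 <= i < n) \sum_(0 <= j < n) (if (i + j < n)%N then a i * t ^+ i * (b j * t ^+ j) else 0).
Proof.
rewrite /psum /cprod.
transitivity (\sum_(0 <= k < n) \sum_(0 <= i < n) (if (i <= k)%N then a i * t ^+ i * (b (k - i)%N * t ^+ (k - i)) else 0)).
  rewrite !big_nat; apply: eq_bigr => k /andP[_ kn].
  rewrite mulr_suml (big_cat_nat (n := k.+1))//= [X in _ + X]big_nat [X in _ + X]big1 ?addr0; last first.
    by move=> i /andP[ki _]; rewrite leqNgt ki.
  rewrite big_mkord; apply: eq_bigr => i _; have ik : (i <= k)%N by rewrite -ltnS.
  have e : t ^+ k = t ^+ i * t ^+ (k - i) by rewrite -exprD subnKC.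
  by rewrite ik e; ring.
rewrite exchange_big_nat/= !big_nat; apply: eq_bigr => i /andP[_ i_n].
rewrite (big_cat_nat (n := i))//=; last exact: ltnW.
rewrite [X in X + _]big_nat [X in X + _]big1 ?add0r; last first.
  by move=> k /andP[_ ki]; rewrite leqNgt ki.
rewrite [RHS](big_cat_nat (n := (n - i)%N))//= ?leq_subr//.
have -> : \sum_(n - i <= j < n) (if (i + j < n)%N then a i * t ^+ i * (b j * t ^+ j) else 0) = 0.
  by rewrite big_nat big1// => j /andP[nij _]; rewrite -ltn_subRL ltnNge nij.
rewrite addr0 -{1}(add0n i) big_addn.
rewrite !big_nat; apply: eq_bigr => j /andP[_ jn].
by rewrite leq_addl addnK -ltn_subRL jn.
Qed.

(** The product of partial sums and the partial sum of the Cauchy product differ by the terms with i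
    + j >= n. These are of order p^n for any p strictly between q = s |t| and 1. *)
Lemma psM a b K K' s t : gbd a K s -> gbd b K' s -> 0 <= s -> nr t * s < 1 ->
  ps (cprod a b) t = ps a t * ps b t.
Proof.
move=> ga gb s0 ts; set q := s * nr t.
have q01 : 0 <= q < 1 by rewrite mulr_ge0 ?nr_ge0//= /q mulrC.
case/andP: (q01) => q0 q1; have K0 := gbd_ge0 ga; have K'0 := gbd_ge0 gb.
rewrite /ps -LimM; [|exact: psum_bnd ga s0 ts|exact: psum_bnd gb s0 ts].
have bM : bnd (fun n => psum a t n * psum b t n) by apply: bndM; [exact: psum_bnd ga s0 ts|exact: psum_bnd gb s0 ts].
pose p := (1 + q) / 2; have p01 : 0 <= p < 1 by rewrite /p; apply/andP; split; lra.
have qp : q < p by rewrite /p; lra.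
have p0 : 0 < p by lra.
clearbody p.
have term (c : nat -> C) (L : R) i : gbd c L s -> nr (c i * t ^+ i) <= L * q ^+ i.
  by move=> gc; rewrite nrM nrX /q exprMn mulrA ler_wpM2r ?exprn_ge0 ?nr_ge0.
pose T := K * K' * ((1 - q / p)^-1 * (1 - q / p)^-1).
have qp01 : 0 <= q / p < 1 by rewrite divr_ge0 ?(ltW p0)//= ltr_pdivrMr// mul1r.
have diff n : nr (psum (cprod a b) t n - psum a t n * psum b t n) <= T * p ^+ n.
  rewrite nrBC psum_cprod {1}/psum mulr_suml -sumrB; apply: le_trans (nr_sum _ _ _) _.
  apply: (@le_trans _ _ (\sum_(0 <= i < n) \sum_(0 <= j < n) K * K' * p ^+ n * ((q / p) ^+ i * (q / p) ^+ j))).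
    apply: ler_sum => i _; rewrite /psum mulr_sumr -sumrB; apply: le_trans (nr_sum _ _ _) _.
    apply: ler_sum => j _; case: ltnP => ij.
      rewrite subrr nr0 !mulr_ge0 ?exprn_ge0 ?(ltW p0)//; by case/andP: qp01.
    rewrite subr0 nrM; apply: le_trans (ler_pM (nr_ge0 _) (nr_ge0 _) (term a K i ga) (term b K' j gb)) _.
    apply: (@le_trans _ _ (K * K' * (p ^+ (i + j) * ((q / p) ^+ i * (q / p) ^+ j)))).
      rewrite !expr_div_n exprD le_eqVlt; apply/orP; left; apply/eqP.
      by field; rewrite !expf_neq0 ?gt_eqF.
    rewrite -[leRHS]mulrA ler_wpM2l ?mulr_ge0// ler_wpM2r//.
      by rewrite mulr_ge0 ?exprn_ge0//; case/andP: qp01.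
    by rewrite ler_wiXn2l//; [exact: ltW|case/andP: p01 => _ /ltW].
  rewrite !big_mkord; under eq_bigr do rewrite -mulr_sumr big_mkord -mulr_sumr.
  rewrite -mulr_sumr -mulr_suml /T.
  rewrite [leRHS]mulrAC ler_wpM2l//; first by rewrite !mulr_ge0 ?exprn_ge0 ?(ltW p0).
  have g0 : 0 <= \sum_(i < n) (q / p) ^+ i.
    by apply: sumr_ge0 => i _; rewrite exprn_ge0//; case/andP: qp01.
  by rewrite ler_pM// geom_sum_le.
have [M hM] := bM; apply: Lim_shift_sub => //.
  exists (M + T) => n; have T0 : 0 <= T.
    by rewrite !mulr_ge0// invr_ge0 subr_ge0; case/andP: qp01 => _ /ltW.
  have := diff n; have : T * p ^+ n <= T by rewrite ler_piMr// exprn_ile1 ?(ltW p0)//; case/andP: p01 => _ /ltW.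
  have := nrD (psum (cprod a b) t n - psum a t n * psum b t n) (psum a t n * psum b t n).
  by rewrite subrK; have := hM n; lra.
move=> e e0; have T1 : 0 < `|T| + 1 by have := normr_ge0 T; lra.
have [N hN] := geom_small p01 (divr_gt0 e0 T1); exists N => n /hN hn.
apply: le_lt_trans (diff n) _; move: hn; rewrite ltr_pdivlMr// mulrC.
apply: le_lt_trans; rewrite ler_wpM2r ?exprn_ge0 ?(ltW p0)//.
by have := ler_norm T; lra.
Qed.

Lemma ps_geom (q : C) s t : nr q <= s -> nr t * s < 1 ->
  ps (fun k => q ^+ k.+1) t = q / (1 - q * t).
Proof.
move=> qs ts; have s0 : 0 <= s by apply: le_trans qs; exact: nr_ge0.
have qt : nr (q * t) < 1.
  by apply: le_lt_trans ts; rewrite nrM mulrC ler_wpM2l ?nr_ge0.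
have d0 : 1 - q * t != 0.
  by rewrite subr_eq0; apply: contraTneq qt => <-; rewrite nr1 ltxx.
have dn := nr_gt0 d0.
apply: (@ps_uniq _ s s _ _ (nr q / nr (1 - q * t))) => // [k|n].
  by rewrite nrX exprS ler_pM ?nr_ge0 ?exprn_ge0 ?nr_ge0// lerXn2r ?nnegrE ?nr_ge0.
have -> : q / (1 - q * t) - psum (fun k => q ^+ k.+1) t n = q * (q * t) ^+ n / (1 - q * t).
  have -> : psum (fun k => q ^+ k.+1) t n = q * \sum_(i < n) (q * t) ^+ i.
    by rewrite /psum big_mkord mulr_sumr; apply: eq_bigr => i _; rewrite exprS exprMn mulrA.
  have := subrX1 (q * t) n; set S := \sum_(i < n) _ => e.
  have -> : (q * t) ^+ n = 1 + (q * t - 1) * S by rewrite -e; ring.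
  by field.
rewrite nrM nrM nrV nrX mulrAC ler_wpM2l ?divr_ge0 ?nr_ge0//.
rewrite lerXn2r ?nnegrE ?nr_ge0 ?mulr_ge0 ?nr_ge0// nrM ler_wpM2r ?nr_ge0//.
Qed.

Lemma ps_taylor (f : C -> C) (r0 r M : R) t : 0 < r < r0 ->
  (forall z, nr (z - 0) <= r0 -> exists L, cder f z L) ->
  (forall s, nr s = r -> nr (f (0 + s)) <= M) -> nr t < r ->
  ps (tc f 0 r) t = f t.
Proof.
move=> rr hf hM tr; have r1 : 0 < r by case/andP: rr.
apply: (@ps_uniq _ M r^-1 _ _ (M * (r / (r - nr t)))).
- by move=> k; rewrite exprVn; exact: (tc_le rr hM).
- by rewrite invr_ge0 ltW.
- by rewrite ltr_pdivrMr// mul1r.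
- move=> n; have := taylor rr hf hM n tr; rewrite add0r mulrAC.
  by rewrite [_^-1 * _]mulrC.
Qed.

Section Holomorphic.
Variable E : normedModType C.

Lemma psum_hol (a : nat -> E -> C) (T : E -> C) (B : set E) n :
  (forall k, hol B (a k)) -> hol B T -> hol B (fun e => psum (fun k => a k e) (T e) n).
Proof.
by move=> ha hT; apply: hol_sum => k _; apply: holM => //; exact: holX.
Qed.

Lemma ps_hol (a : nat -> E -> C) (T : E -> C) u0 r (K s : R) th : 0 <= s -> th < 1 ->
  (forall k, hol (bal u0 r) (a k)) -> hol (bal u0 r) T ->
  (forall e, bal u0 r e -> gbd (fun k => a k e) K s /\ nr (T e) * s <= th) ->
  hol (bal u0 r) (fun e => ps (fun k => a k e) (T e)).
Proof.
move=> s0 th1 ha hT hb.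
have th0 e : bal u0 r e -> 0 < 1 - s * nr (T e) /\ 1 - th <= 1 - s * nr (T e).
  by move=> /hb[_ h]; split; rewrite mulrC; lra.
apply: (@hol_Lim _ _ (fun n e => psum (fun k => a k e) (T e) n) u0 r (K / (1 - th))) => [n|n e be].
  exact: psum_hol.
have [g h] := hb e be; have [h1 h2] := th0 e be.
apply: le_trans (psum_le n g s0 _) _; first by lra.
have K0 := gbd_ge0 g.
by rewrite ler_wpM2l// lef_pV2 ?posrE//; lra.
Qed.

End Holomorphic.

Lemma cd_pow k (t : C) : cd (fun t => t ^+ k) t (k%:R * t ^+ k.-1).
Proof.
elim: k => [|k IH].
  by apply: (cder_eqL _ (cder_cst 1 t)) => v; rewrite mul0r mulr0.
rewrite /cd; apply: (@cder_eq _ _ (fun t : C => t * t ^+ k)); first by move=> x; rewrite exprS.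
apply: (cder_eqL _ (cderM (cd_id t) IH)) => v.
case: k IH => [|k] _ /=; first by rewrite expr0; ring.
by rewrite [in RHS]mulrS exprS; ring.
Qed.

Lemma ps_cd (a : nat -> C) (K s : R) t : 0 < s -> gbd a K s -> nr t * s < 1 ->
  cd (ps a) t (ps (fun k => k.+1%:R * a k.+1) t).
Proof.
move=> s0 ga ts; pose r := (s^-1 - nr t) / 2.
have st : nr t < s^-1 by rewrite -[s^-1]mul1r ltr_pdivlMr.
have r0 : 0 < r by rewrite /r; lra.
have inb v : bal t r v -> nr v * s < 1 /\ nr v * s <= (1 + nr t * s) / 2.
  rewrite /bal/= => h; have hv : nr v <= (s^-1 + nr t) / 2.
    by have := nrD (v - t) t; rewrite subrK /r in h *; lra.
  have : nr v * s <= (s^-1 + nr t) / 2 * s by rewrite ler_wpM2r// ltW.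
  have e : s^-1 * s = 1 by rewrite mulVf// gt_eqF.
  by nra.
(* One term more, so that the derivative is exactly the partial sum of length [n] of the derived
   series. *)
pose f n v := psum a v n.+1.
have fS v : nr v * s < 1 -> ps a v = Lim (fun n => f n v).
  move=> vs; apply: Lim_shift_sub; [exact: psum_bnd ga (ltW s0) vs| |].
    by have [M h] := psum_bnd ga (ltW s0) vs; exists M => n; apply: h.
  move=> e e0; have q01 : 0 <= s * nr v < 1 by rewrite mulr_ge0 ?nr_ge0 ?(ltW s0)//= mulrC.
  have K0 := gbd_ge0 ga; have K1 : 0 < K + 1 by lra.
  have [N hN] := geom_small q01 (divr_gt0 e0 K1); exists N => n /hN hn.
  rewrite /f {2}/psum big_nat_recr//= -/(psum a v n) opprD addrA subrr sub0r nrN nrM nrX.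
  move: hn; rewrite ltr_pdivlMr//; apply: le_lt_trans.
  apply: (@le_trans _ _ (K * (s * nr v) ^+ n)).
    by rewrite exprMn mulrA ler_wpM2r ?exprn_ge0 ?nr_ge0.
  by rewrite mulrC ler_wpM2l ?exprn_ge0//; [case/andP: q01|lra].
have hf n v : cd (f n) v (psum (fun k => k.+1%:R * a k.+1) v n).
  have h : cder (f n) v (fun x => \sum_(0 <= k < n.+1) a k * (x * (k%:R * v ^+ k.-1))).
    by apply: cder_sum => k _; apply: cderZ; exact: cd_pow.
  apply: (cder_eqL _ h) => x; rewrite big_nat_recl//= mul0r mulr0 mulr0 add0r /psum mulr_sumr.
  by apply: eq_bigr => k _; ring.
pose B := K / (1 - (1 + nr t * s) / 2).
have hol n : hol (bal t r) (f n) by move=> v _; eexists; exact: hf.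
have fM n v : bal t r v -> nr (f n v) <= B.
  move=> bv; have [h1 h2] := inb v bv.
  apply: le_trans (psum_le n.+1 ga (ltW s0) h1) _; have K0 := gbd_ge0 ga.
  by rewrite ler_wpM2l// lef_pV2 ?posrE//; rewrite ?[s * _]mulrC; lra.
have bdd : bnd (psum (fun k => k.+1%:R * a k.+1) t).
  exists (2 * B / r) => n; have [+ _] := @cauchy_est R _ (f n) t r B r0 (hol n) (fM n) _ (1 : C) (hf n t).
  by rewrite nr1 mul1r mulr1.
have W := @weierstrass R _ f t r B _ r0 hol fM (fun n => hf n t).
have {}W : cder (fun v => Lim (fun n => f n v)) t (fun x => x * ps (fun k => k.+1%:R * a k.+1) t).
  by apply: cder_eqL W => x; rewrite LimZ.
apply: cder_loc W; apply: filterS (bal_nbhs (balC t r0)) => v /inb[h _].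
by rewrite fS.
Qed.

End PowerSeries.

(** * Matrix norms, matrix power series and their derivatives *)

Section MatrixNorm.
Variable R : realType.
Local Notation C := R[i].

Definition mn m n (A : 'M[C]_(m, n)) : R := \sum_i \sum_j nr (A i j).

Lemma mn_ge0 m n (A : 'M[C]_(m, n)) : 0 <= mn A.
Proof. by apply: sumr_ge0 => i _; apply: sumr_ge0 => j _; exact: nr_ge0. Qed.

Lemma mn_coef m n (A : 'M[C]_(m, n)) i j : nr (A i j) <= mn A.
Proof.
rewrite /mn (bigD1 i)//= (bigD1 j)//= -addrA lerDl addr_ge0//.
  by apply: sumr_ge0 => k _; exact: nr_ge0.
by apply: sumr_ge0 => k _; apply: sumr_ge0 => l _; exact: nr_ge0.
Qed.

Lemma mnD m n (A B : 'M[C]_(m, n)) : mn (A + B) <= mn A + mn B.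
Proof.
rewrite /mn -big_split/=; apply: ler_sum => i _; rewrite -big_split/=.
by apply: ler_sum => j _; rewrite mxE; exact: nrD.
Qed.

Lemma mn0 m n : mn (0 : 'M[C]_(m, n)) = 0.
Proof. by rewrite /mn big1// => i _; rewrite big1// => j _; rewrite mxE nr0. Qed.

Lemma mn_sum m n (I : Type) (s : seq I) (P : pred I) (F : I -> 'M[C]_(m, n)) :
  mn (\sum_(i <- s | P i) F i) <= \sum_(i <- s | P i) mn (F i).
Proof.
elim/big_ind2: _ => [|x a y b xa yb|//]; first by rewrite mn0.
by apply: le_trans (mnD _ _) _; rewrite lerD.
Qed.

Lemma mnZ m n (a : C) (A : 'M[C]_(m, n)) : mn (a *: A) = nr a * mn A.
Proof.
rewrite /mn mulr_sumr; apply: eq_bigr => i _; rewrite mulr_sumr.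
by apply: eq_bigr => j _; rewrite mxE nrM.
Qed.

Lemma mnM m n p (A : 'M[C]_(m, n)) (B : 'M[C]_(n, p)) : mn (A *m B) <= mn A * mn B.
Proof.
rewrite /mn mulr_suml; apply: ler_sum => i _; rewrite mulr_suml.
apply: (@le_trans _ _ (\sum_k \sum_j nr (A i j) * nr (B j k))).
  apply: ler_sum => k _; rewrite mxE; apply: le_trans (nr_sum _ _ _) _.
  by apply: ler_sum => j _; rewrite nrM.
rewrite exchange_big/=; apply: ler_sum => j _; rewrite -mulr_sumr ler_wpM2l ?nr_ge0//.
rewrite [leRHS](bigD1 j)//= lerDl.
by apply: sumr_ge0 => k _; apply: sumr_ge0 => l _; exact: nr_ge0.
Qed.

Lemma mn_le m n (A : 'M[C]_(m, n)) (K : R) : (forall i j, nr (A i j) <= K) -> mn A <= (m * n)%:R * K.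
Proof.
move=> h; apply: (@le_trans _ _ (\sum_(i < m) \sum_(j < n) K)).
  by apply: ler_sum => i _; apply: ler_sum => j _.
by rewrite !sumr_const !card_ord -mulrnA mulr_natl mulnC.
Qed.

Lemma mnT m n (A : 'M[C]_(m, n)) : mn A^T = mn A.
Proof.
rewrite /mn exchange_big; apply: eq_bigr => i _; apply: eq_bigr => j _.
by rewrite mxE.
Qed.

Definition mgbd m n (A : nat -> 'M[C]_(m, n)) (K s : R) := forall k, mn (A k) <= K * s ^+ k.

Lemma mgbd_gbd m n (A : nat -> 'M[C]_(m, n)) K s i j : mgbd A K s -> gbd (fun k => A k i j) K s.
Proof. by move=> h k; apply: le_trans (h k); exact: mn_coef. Qed.

Lemma mgbd_ge0 m n (A : nat -> 'M[C]_(m, n)) K s : mgbd A K s -> 0 <= K.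
Proof. by move=> /(_ 0%N); rewrite expr0 mulr1; apply: le_trans; exact: mn_ge0. Qed.

Definition mps m n (A : nat -> 'M[C]_(m, n)) (t : C) : 'M[C]_(m, n) :=
  \matrix_(i, j) ps (fun k => A k i j) t.

Definition mcprod m n p (A : nat -> 'M[C]_(m, n)) (B : nat -> 'M[C]_(n, p)) k : 'M[C]_(m, p) :=
  \sum_(i < k.+1) A i *m B (k - i)%N.

Lemma mps_mul m n p (A : nat -> 'M[C]_(m, n)) (B : nat -> 'M[C]_(n, p)) K K' s t :
  mgbd A K s -> mgbd B K' s -> 0 < s -> nr t * s < 1 ->
  mps (mcprod A B) t = mps A t *m mps B t.
Proof.
move=> hA hB s0 ts; apply/matrixP => i j; rewrite !mxE.
rewrite (eq_bigr (fun l => ps (cprod (fun k => A k i l) (fun k => B k l j)) t)); last first.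
  by move=> l _; rewrite !mxE (psM (mgbd_gbd i l hA) (mgbd_gbd l j hB) (ltW s0) ts).
(* A ratio strictly between s and 1 / |t|, since [cprod_gbd] needs two distinct ratios. *)
pose s2 := if nr t == 0 then s + 1 else (s + (nr t)^-1) / 2.
have [ss2 ts2] : s < s2 /\ nr t * s2 < 1.
  rewrite /s2; case: eqVneq => [->|t0]; first by rewrite mul0r; split; lra.
  have tp : 0 < nr t by rewrite lt_neqAle eq_sym t0 nr_ge0.
  have st : s < (nr t)^-1 by rewrite -[(nr t)^-1]mul1r ltr_pdivlMr// mulrC.
  split; first lra.
  have : nr t * (nr t)^-1 = 1 by rewrite divff.
  by nra.
have g l : gbd (cprod (fun k => A k i l) (fun k => B k l j)) (K * K' / (1 - s / s2)) s2.
  apply: cprod_gbd; [exact: ltW|exact: ss2|exact: mgbd_gbd|].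
  move=> k; apply: le_trans (mgbd_gbd l j hB k) _; rewrite ler_wpM2l ?(mgbd_ge0 hB)//.
  by rewrite lerXn2r ?nnegrE ?(ltW s0) ?(ltW ss2)//; lra.
rewrite -(ps_sum _ g)//; last by lra.
congr (ps _ t); apply/funext => k; rewrite /mcprod summxE exchange_big/=.
by rewrite /cprod; apply: eq_bigr => l _; rewrite mxE.
Qed.

Definition mcd m n (F : C -> 'M[C]_(m, n)) (t : C) (D : 'M[C]_(m, n)) :=
  forall i j, cd (fun z => F z i j) t (D i j).

Lemma mps_cd m n (A : nat -> 'M[C]_(m, n)) K s t : 0 < s -> mgbd A K s -> nr t * s < 1 ->
  mcd (mps A) t (mps (fun k => k.+1%:R *: A k.+1) t).
Proof.
move=> s0 hA ts i j; have h := ps_cd s0 (mgbd_gbd i j hA) ts.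
rewrite /cd; apply: (@cder_eq R C (ps (fun k => A k i j))); first by move=> v; rewrite mxE.
apply: (cder_eqL _ h) => v; rewrite mxE; congr (v * ps _ t).
by apply/funext => k; rewrite mxE.
Qed.

Lemma mcdM m n p (F : C -> 'M[C]_(m, n)) (G : C -> 'M[C]_(n, p)) t D D' :
  mcd F t D -> mcd G t D' -> mcd (fun z => F z *m G z) t (D *m G t + F t *m D').
Proof.
move=> hF hG i j; rewrite /cd.
apply: (@cder_eq R C (fun z => \sum_k F z i k * G z k j)); first by move=> v; rewrite mxE.
apply: (cder_eqL _ (cder_sum _ (fun k _ => cderM (hF i k) (hG k j)))) => v.
rewrite !mxE mulrDr !mulr_sumr -big_split/=; apply: eq_bigr => k _; ring.
Qed.

Lemma mcdB m n (F G : C -> 'M[C]_(m, n)) t D D' :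
  mcd F t D -> mcd G t D' -> mcd (fun z => F z - G z) t (D - D').
Proof.
move=> hF hG i j; rewrite /cd.
apply: (@cder_eq R C (fun z => F z i j - G z i j)); first by move=> v; rewrite !mxE.
by apply: (cder_eqL _ (cderB (hF i j) (hG i j))) => v; rewrite !mxE mulrBr.
Qed.

Lemma mcd_cst m n (A : 'M[C]_(m, n)) t : mcd (fun=> A) t 0.
Proof. by move=> i j; apply: (cder_eqL _ (cder_cst (A i j) t)) => v; rewrite mxE mulr0. Qed.

Lemma mcd_eq m n (F G : C -> 'M[C]_(m, n)) t D : (forall z, F z = G z) -> mcd F t D -> mcd G t D.
Proof. by move=> /funext ->. Qed.

End MatrixNorm.

(** * Linear differential equations solved by power series *)

Section LinearODE.
Variable R : realType.
Local Notation C := R[i].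
Variable N : nat.
Local Notation M := 'M[C]_N.
Implicit Types (Om P Q : nat -> M) (q : 'I_N -> C).

(** The coefficients of the solution of X' = Om X with X(0) = 1. The recurrence refers to all
    earlier coefficients, so structural recursion runs over tables: up to index [n] the function
    [Xpre Om n] holds the final values. *)
Fixpoint Xpre Om n : nat -> M := match n with
  | 0 => fun=> 1%:M
  | m.+1 => fun k => if (k <= m)%N then Xpre Om m k
            else m.+1%:R^-1 *: \sum_(i < m.+1) Om i *m Xpre Om m (m - i)%N
  end.

Definition Xs Om n := Xpre Om n n.

Lemma XpreE Om n k : (k <= n)%N -> Xpre Om n k = Xs Om k.
Proof.
elim: n => [|n IH]; first by rewrite leqn0 => /eqP ->.
by rewrite leq_eqVlt => /orP[/eqP -> //|]; rewrite ltnS => kn; rewrite /= kn IH.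
Qed.

Lemma XsS Om n : n.+1%:R *: Xs Om n.+1 = mcprod Om (Xs Om) n.
Proof.
rewrite {1}/Xs /= ltnn scalerA divff ?pnatr_eq0// scale1r.
by apply: eq_bigr => i _; rewrite XpreE// leq_subr.
Qed.

Lemma Xs0 Om : Xs Om 0 = 1%:M. Proof. by []. Qed.

(** In units of s'^k, coefficient k + 1 is at most c / (k + 1) times the running bound. The bound
    can thus grow only in the first [Num.bound c] steps, by a factor at most 1 + c in each. *)
Definition odeK (Co s s' : R) : R :=
  let c := Co / (s' - s) in mn (1%:M : M) * (1 + c) ^+ (Num.bound c).

Lemma Xs_bound Om Co s s' : 0 <= s -> s < s' -> mgbd Om Co s ->
  mgbd (Xs Om) (odeK Co s s') s'.
Proof.
move=> s0 ss' hO; have s'0 : 0 < s' by lra.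
have Co0 := mgbd_ge0 hO; rewrite /odeK; set c := Co / _; set n0 := Num.bound c.
have ds : 0 < s' - s by rewrite subr_gt0.
have c0 : 0 <= c by rewrite divr_ge0// ltW.
have c1 : 1 <= 1 + c by lra.
have one0 : 0 <= mn (1%:M : M) := mn_ge0 _.
pose B k := mn (1%:M : M) * (1 + c) ^+ (minn k n0).
have B0 k : 0 <= B k by rewrite mulr_ge0// exprn_ge0//; lra.
have Bm j k : (j <= k)%N -> B j <= B k.
  by move=> jk; rewrite ler_wpM2l// ler_weXn2l//; lia.
have main k : forall j, (j <= k)%N -> mn (Xs Om j) <= B k * s' ^+ j.
  elim: k => [|k IH] j; first by rewrite leqn0 => /eqP ->; rewrite /B min0n !expr0 !mulr1.
  rewrite leq_eqVlt => /orP[/eqP ->|]; last first.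
    rewrite ltnS => jk; apply: le_trans (IH _ jk) _.
    by rewrite ler_wpM2r ?Bm// exprn_ge0// ltW.
  have k1 : 0 < k.+1%:R :> R by rewrite ltr0n.
  have e : mn (mcprod Om (Xs Om) k) = k.+1%:R * mn (Xs Om k.+1) by rewrite -XsS mnZ nr_nat.
  have : mn (mcprod Om (Xs Om) k) <= Co * B k / (1 - s / s') * s' ^+ k.
    apply: le_trans (mn_sum _ _ _) _.
    apply: (@le_trans _ _ (\sum_(i < k.+1) mn (Om i) * mn (Xs Om (k - i)%N))).
      by apply: ler_sum => i _; exact: mnM.
    apply: (@cprod_sum_le R Co (B k) s s' (fun i => mn (Om i)) (fun i => mn (Xs Om i))) => //.
      by move=> i; rewrite mn_ge0 hO.
    by move=> i ik; rewrite mn_ge0 IH.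
  rewrite e -ler_pdivlMl// => h; apply: le_trans h _.
  have -> : k.+1%:R^-1 * (Co * B k / (1 - s / s') * s' ^+ k) = (c / k.+1%:R) * B k * s' ^+ k.+1.
    rewrite exprS /c; have : k.+1%:R != 0 :> R by rewrite gt_eqF.
    move: k.+1%:R => x x0; have s'n : s' != 0 by rewrite gt_eqF.
    have dn : s' - s != 0 by rewrite gt_eqF.
    by field; rewrite x0 s'n dn.
  rewrite ler_wpM2r ?exprn_ge0 ?(ltW s'0)//.
  have [kn|kn] := ltnP k n0.
    have -> : B k.+1 = (1 + c) * B k.
      by rewrite /B (minn_idPl (ltnW kn)) (minn_idPl kn) exprS; ring.
    rewrite ler_wpM2r// ler_pdivrMr//.
    have : 1 <= k.+1%:R :> R by rewrite ler1n.
    by nra.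
  apply: le_trans (Bm k k.+1 (leqnSn k)); rewrite ler_piMl// ler_pdivrMr// mul1r.
  apply: (@le_trans _ _ n0%:R); first by apply: ltW; exact: archi_boundP.
  by rewrite ler_nat leqW.
move=> k; apply: le_trans (main k k (leqnn k)) _.
rewrite ler_wpM2r ?exprn_ge0 ?(ltW s'0)// ler_wpM2l// ler_weXn2l//.
exact: geq_minr.
Qed.

Lemma Xs_ode Om Co s s' t : 0 <= s -> s < s' -> mgbd Om Co s -> nr t * s' < 1 ->
  mcd (mps (Xs Om)) t (mps Om t *m mps (Xs Om) t).
Proof.
move=> s0 ss' hO ts; have s'0 : 0 < s' by lra.
have hX := Xs_bound s0 ss' hO.
have hO' : mgbd Om Co s'.
  move=> k; apply: le_trans (hO k) _; rewrite ler_wpM2l ?(mgbd_ge0 hO)//.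
  by rewrite lerXn2r ?nnegrE ?(ltW s'0)// ltW.
rewrite -(mps_mul hO' hX s'0 ts) -(_ : (fun k => k.+1%:R *: Xs Om k.+1) = mcprod Om (Xs Om)).
  exact: mps_cd hX ts.
by apply/funext => k; rewrite XsS.
Qed.

Lemma mps_at0 m n (A : nat -> 'M[C]_(m, n)) : mps A 0 = A 0%N.
Proof.
apply/matrixP => i j; rewrite mxE; apply: Lim_cvg => e e0; exists 1%N => -[//|k] _.
rewrite /psum big_nat_recl//= expr0 mulr1 big1 ?addr0 ?subrr ?nr0// => l _.
by rewrite expr0n mulr0.
Qed.

(** These are the coefficients of q_j / (1 - q_j t), so that [Om_] expands P(t) + diag(q_j / (1 -
    q_j t)) Q(t). *)
Definition Dg q (l : nat) : M := diag_mx (\row_j q j ^+ l.+1).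
Definition Om_ P Q q k : M := P k + mcprod (Dg q) Q k.

Lemma mn_Dg q (ka : R) l : (forall j, nr (q j) <= ka) -> 0 <= ka -> mn (Dg q l) <= (N%:R * ka) * ka ^+ l.
Proof.
move=> hq ka0; rewrite /mn; apply: (@le_trans _ _ (\sum_(i < N) ka ^+ l.+1)); last first.
  by rewrite sumr_const card_ord mulr_natl exprS -mulrnAl.
apply: ler_sum => i _; rewrite (bigD1 i)//= !mxE eqxx mulr1n nrX big1 ?addr0.
  by rewrite lerXn2r ?nnegrE ?nr_ge0.
by move=> j ji; rewrite !mxE eq_sym (negPf ji) mulr0n nr0.
Qed.

Lemma Om_bound P Q q (Cp ka ka' : R) : (forall j, nr (q j) <= ka) -> 0 <= ka -> ka < ka' ->
  mgbd P Cp ka' -> mgbd Q Cp ka' ->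
  mgbd (Om_ P Q q) (Cp + N%:R * ka * Cp / (1 - ka / ka')) ka'.
Proof.
move=> hq ka0 kk hP hQ k; apply: le_trans (mnD _ _) _; rewrite mulrDl lerD//.
apply: le_trans (mn_sum _ _ _) _.
apply: (@le_trans _ _ (\sum_(i < k.+1) mn (Dg q i) * mn (Q (k - i)%N))).
  by apply: ler_sum => i _; exact: mnM.
apply: (@cprod_sum_le R (N%:R * ka) Cp ka ka' (fun i => mn (Dg q i)) (fun i => mn (Q i))) => //.
- by rewrite mulr_ge0.
- exact: mgbd_ge0 hP.
- by move=> i; rewrite mn_ge0 mn_Dg.
- by move=> i _; rewrite mn_ge0 hQ.
Qed.

Lemma mps_Dg q (ka : R) t : (forall j, nr (q j) <= ka) -> nr t * ka < 1 ->
  mps (Dg q) t = diag_mx (\row_j (q j / (1 - q j * t))).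
Proof.
move=> hq tk; apply/matrixP => i j; rewrite !mxE; case: eqVneq => [->|ij].
  rewrite mulr1n -(ps_geom (hq j) tk); congr (ps _ t); apply/funext => k.
  by rewrite !mxE eqxx mulr1n.
rewrite mulr0n (_ : (fun k => _) = fun=> 0); last by apply/funext => k; rewrite !mxE (negPf ij) mulr0n.
rewrite /ps (_ : psum _ t = fun=> 0) ?Lim_cst//; apply/funext => n.
by rewrite /psum big1// => k _; rewrite mul0r.
Qed.

Lemma mps_Om P Q q (Cp ka ka' : R) t : (forall j, nr (q j) <= ka) -> 0 <= ka -> ka < ka' ->
  mgbd P Cp ka' -> mgbd Q Cp ka' -> nr t * ka' < 1 ->
  mps (Om_ P Q q) t = mps P t + diag_mx (\row_j (q j / (1 - q j * t))) *m mps Q t.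
Proof.
move=> hq ka0 kk hP hQ tk; have k0 : 0 < ka' by lra.
have tka : nr t * ka < 1 by apply: le_lt_trans tk; rewrite ler_wpM2l ?nr_ge0// ltW.
have hD : mgbd (Dg q) (N%:R * ka) ka'.
  move=> l; apply: le_trans (mn_Dg l hq ka0) _; rewrite ler_wpM2l ?mulr_ge0//.
  by rewrite lerXn2r ?nnegrE ?(ltW k0)// ltW.
rewrite -(mps_Dg hq tka) -(mps_mul hD hQ k0 tk); apply/matrixP => i j; rewrite !mxE.
pose k2 := if nr t == 0 then ka' + 1 else (ka' + (nr t)^-1) / 2.
have [kk2 tk2] : ka' < k2 /\ nr t * k2 < 1.
  rewrite /k2; case: eqVneq => [->|t0]; first by rewrite mul0r; split; lra.
  have tp : 0 < nr t by rewrite lt_neqAle eq_sym t0 nr_ge0.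
  have st : ka' < (nr t)^-1 by rewrite -[(nr t)^-1]mul1r ltr_pdivlMr// mulrC.
  split; first lra.
  have : nr t * (nr t)^-1 = 1 by rewrite divff.
  by nra.
have up (a : nat -> C) K : gbd a K ka' -> gbd a K k2.
  move=> ga k; apply: le_trans (ga k) _; rewrite ler_wpM2l ?(gbd_ge0 ga)//.
  by rewrite lerXn2r ?nnegrE ?(ltW k0) ?(ltW kk2)//; lra.
have hc : mgbd (mcprod (Dg q) Q) (N%:R * ka * Cp / (1 - ka / ka')) ka'.
  have := @Om_bound (fun=> 0) Q q Cp ka ka' hq ka0 kk _ hQ => h k.
  apply: le_trans (mn_sum _ _ _) _.
  apply: (@le_trans _ _ (\sum_(i < k.+1) mn (Dg q i) * mn (Q (k - i)%N))).
    by apply: ler_sum => l _; exact: mnM.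
  apply: (@cprod_sum_le R (N%:R * ka) Cp ka ka' (fun i => mn (Dg q i)) (fun i => mn (Q i))) => //.
  - by rewrite mulr_ge0.
  - exact: mgbd_ge0 hP.
  - by move=> l; rewrite mn_ge0 mn_Dg.
  - by move=> l _; rewrite mn_ge0 hQ.
rewrite -(psD (mgbd_gbd i j hP) (mgbd_gbd i j hc) (ltW k0) tk).
by congr (ps _ t); apply/funext => k; rewrite mxE.
Qed.

End LinearODE.

(** * Uniqueness for linear differential equations *)

Section Uniqueness.
Variable R : realType.
Local Notation C := R[i].

Lemma mean_value (f f' : C -> C) (tau r K : R) : 0 < r < tau ->
  (forall z, nr z < tau -> cd f z (f' z)) -> (forall z, nr z <= r -> nr (f' z) <= K) ->
  forall t, nr t <= r -> nr (f t - f 0) <= K * nr t.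
Proof.
move=> /andP[r0 rt] hf hK t tr.
pose r1 := (2 * r + tau) / 3; pose r2 := (r + 2 * tau) / 3.
have rr : 0 < r1 < r2 by rewrite /r1 /r2; apply/andP; split; lra.
have h2 z : nr (z - 0) <= r2 -> exists L, cder f z L.
  rewrite subr0 => zr; eexists; apply: hf; apply: le_lt_trans zr _.
  by rewrite /r2; lra.
have [f1 ud] := holo_UD rr h2.
have f1E z : nr z <= r -> f1 z = f' z.
  move=> zr; have zt : nr z < tau by lra.
  apply: (cd_uniq _ (hf z zt)); apply: UD_cd ud _.
  by rewrite subr0 /r1; lra.
suff main e : 0 < e -> nr (f t - f 0) <= (K + e) * nr t.
  have [t0|t0] := eqVneq (nr t) 0.
    have := main 1 ltr01; rewrite t0 !mulr0 (nr_eq0 t0) subrr nr0//.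
  have tp : 0 < nr t by rewrite lt_neqAle eq_sym t0 nr_ge0.
  rewrite leNgt; apply/negP => h.
  pose e := (nr (f t - f 0) - K * nr t) / (2 * nr t).
  have e0 : 0 < e by rewrite divr_gt0 ?mulr_gt0// subr_gt0.
  have := main e e0; have -> : (K + e) * nr t = K * nr t + (nr (f t - f 0) - K * nr t) / 2.
    by rewrite /e; field.
  by lra.
move=> e0; have [d d0 hd] := ud _ e0.
pose m := (Num.bound (nr t / d)).+1.
have m0 : 0 < m%:R :> R by rewrite ltr0n.
have md : nr t / m%:R < d.
  rewrite ltr_pdivrMr// [d * _]mulrC -ltr_pdivrMr//.
  apply: lt_trans (_ : (Num.bound (nr t / d))%:R < _); last by rewrite ltr_nat.
  by apply: archi_boundP; rewrite divr_ge0 ?nr_ge0// ltW.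
pose z k : C := (k%:R / m%:R) * t.
have zr k : (k <= m)%N -> nr (z k) <= r.
  move=> km; rewrite /z nrM nrM nrV !nr_nat; apply: le_trans tr.
  by rewrite ler_piMl ?nr_ge0// ler_pdivrMr// mul1r ler_nat.
have dz k : z k.+1 - z k = t / m%:R by rewrite /z -natr1; ring.
have ndz k : nr (z k.+1 - z k) = nr t / m%:R by rewrite dz nrM nrV nr_nat.
have step k : (k < m)%N -> nr (f (z k.+1) - f (z k)) <= (K + e) * (nr t / m%:R).
  move=> km; have k1 := zr _ (ltnW km); have k2 := zr _ km.
  have := hd (z k) (z k.+1); rewrite !subr0 ndz.
  have a1 : nr (z k) <= r1 by rewrite /r1; lra.
  have a2 : nr (z k.+1) <= r1 by rewrite /r1; lra.
  move=> /(_ a1 a2 md); rewrite (f1E _ k1) => h.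
  have := nrD (f (z k.+1) - f (z k) - f' (z k) * (z k.+1 - z k)) (f' (z k) * (z k.+1 - z k)).
  rewrite subrK nrM ndz => h'; apply: le_trans h' _; rewrite mulrDl addrC lerD//.
  by rewrite ler_wpM2r ?hK// divr_ge0 ?nr_ge0// ltW.
have -> : f t - f 0 = \sum_(0 <= k < m) (f (z k.+1) - f (z k)).
  by rewrite telescope_sumr// /z divff ?mul1r ?mul0r ?mul0r ?pnatr_eq0.
apply: le_trans (nr_sum _ _ _) _.
apply: (@le_trans _ _ (\sum_(0 <= i < m) ((K + e) * (nr t / m%:R)))).
  by rewrite !big_nat; apply: ler_sum => k /andP[_ km]; apply: step.
rewrite sumr_const_nat subn0 -[_ *+ m]mulr_natl le_eqVlt; apply/orP; left; apply/eqP.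
by field; rewrite gt_eqF.
Qed.

(** On a disc with D r <= 1/2 every application of the mean value inequality halves the bound on
    [Y], so [Y] vanishes there; the identity theorem carries this to |t| < tau. *)
Lemma ode_uniq m n (Y : C -> 'M[C]_(m, n)) (A : C -> 'M[C]_m) (tau ka : R) : 0 < tau ->
  (forall t, nr t < tau -> mcd Y t (A t *m Y t)) -> (forall t, nr t < tau -> mn (A t) <= ka) ->
  Y 0 = 0 -> forall t, nr t < tau -> Y t = 0.
Proof.
move=> tau0 hY hA Y0.
have ka0 : 0 <= ka by apply: le_trans (mn_ge0 _) (hA 0 _); rewrite nr0.
pose D : R := (m * n)%:R * ka; have D0 : 0 <= D by rewrite mulr_ge0.
pose r := Num.min (tau / 2) (2 * (D + 1))^-1.
have r0 : 0 < r by rewrite lt_min divr_gt0//= invr_gt0 mulr_gt0//; lra.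
have rt : r < tau by apply: le_lt_trans (_ : tau / 2 < tau); [rewrite ge_min lexx|lra].
have rD : D * r <= 2^-1.
  have : r <= (2 * (D + 1))^-1 by rewrite ge_min lexx orbT.
  move=> h; apply: le_trans (ler_wpM2l D0 h) _.
  by rewrite ler_pdivrMr ?mulr_gt0//; lra.
have ents i j z : nr z < tau -> exists L, cder (fun z => Y z i j) z L.
  by move=> /hY h; eexists; exact: h.
have [B hB] : exists B, forall t, nr t <= r -> mn (Y t) <= B.
  have hp (p : 'I_m * 'I_n) : exists M : R, forall t, nr t <= r -> nr (Y t p.1 p.2) <= M.
    have hd z : nr (z - 0) <= r -> exists L, cder (fun z => Y z p.1 p.2) z L.
      by rewrite subr0 => zr; apply: ents; lra.
    by have [M hM] := disc_bounded hd; exists M => t tr; apply: hM; rewrite subr0.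
  have [b hb] := choice hp.
  exists (\sum_i \sum_j b (i, j)) => t tr.
  by apply: ler_sum => i _; apply: ler_sum => j _; exact: (hb (i, j)).
have B0 : 0 <= B by apply: le_trans (mn_ge0 _) (hB 0 _); rewrite nr0 ltW.
have small k : forall t, nr t <= r -> mn (Y t) <= B * 2^-1 ^+ k.
  elim: k => [|k IH] t tr; first by rewrite expr0 mulr1 hB.
  have e0 : 0 <= B * 2^-1 ^+ k by rewrite mulr_ge0// exprn_ge0// invr_ge0.
  have ent i j : nr (Y t i j) <= ka * (B * 2^-1 ^+ k) * r.
    have := @mean_value (fun z => Y z i j) (fun z => (A z *m Y z) i j) tau r (ka * (B * 2^-1 ^+ k)).
    rewrite r0 rt => /(_ isT) mv.
    have {}mv := mv (fun z zt => hY z zt i j).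
    have dk z : nr z <= r -> nr ((A z *m Y z) i j) <= ka * (B * 2^-1 ^+ k).
      move=> zr; apply: le_trans (mn_coef _ _ _) _; apply: le_trans (mnM _ _) _.
      by rewrite ler_pM ?mn_ge0 ?IH ?hA//; lra.
    have := mv dk t tr; rewrite Y0 mxE subr0 => h; apply: le_trans h _.
    by rewrite ler_wpM2l// mulr_ge0.
  apply: le_trans (mn_le ent) _; rewrite exprSr.
  have -> : (m * n)%:R * (ka * (B * 2^-1 ^+ k) * r) = (D * r) * (B * 2^-1 ^+ k) by rewrite /D; ring.
  by rewrite [B * (_ * _)]mulrA [leRHS]mulrC ler_wpM2r.
have zero t : nr t <= r -> forall i j, Y t i j = 0.
  move=> tr i j; apply: nr_eq0; apply/eqP; rewrite eq_le nr_ge0 andbT leNgt; apply/negP => p.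
  have q01 : 0 <= (2^-1 : R) < 1 by lra.
  have B1 : 0 < B + 1 by lra.
  have [n0 /(_ n0 (leqnn _))] := geom_small q01 (divr_gt0 p B1).
  rewrite ltr_pdivlMr// => h; have := le_trans (mn_coef _ i j) (small n0 t tr).
  have : 0 <= (2^-1 : R) ^+ n0 by rewrite exprn_ge0//; lra.
  nra.
move=> t tt; apply/matrixP => i j; rewrite [RHS]mxE.
apply: (@identity R C 0 tau (fun z => Y z i j) 0) => //.
- by move=> z; rewrite /bal/= subr0; apply: ents.
- exact: balC.
- by apply/near_nrP; exists r => // v; rewrite subr0 => /ltW/zero.
- by rewrite /bal/= subr0.
Qed.

Lemma ode_uniq2 m n (Y Y' : C -> 'M[C]_(m, n)) (A : C -> 'M[C]_m) (tau ka : R) : 0 < tau ->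
  (forall t, nr t < tau -> mcd Y t (A t *m Y t)) ->
  (forall t, nr t < tau -> mcd Y' t (A t *m Y' t)) ->
  (forall t, nr t < tau -> mn (A t) <= ka) ->
  Y 0 = Y' 0 -> forall t, nr t < tau -> Y t = Y' t.
Proof.
move=> tau0 hY hY' hA Y0 t tt; apply/eqP; rewrite -subr_eq0; apply/eqP.
apply: (@ode_uniq m n (fun t => Y t - Y' t) A tau ka) => //; last by rewrite Y0 subrr.
by move=> z zt; rewrite mulmxBr; apply: mcdB; [exact: hY|exact: hY'].
Qed.

Lemma mps_mn m n (A : nat -> 'M[C]_(m, n)) (K s : R) t th : mgbd A K s -> 0 <= s ->
  nr t * s <= th -> th < 1 -> mn (mps A t) <= (m * n)%:R * (K / (1 - th)).
Proof.
move=> hA s0 ts th1; apply: mn_le => i j; rewrite mxE.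
apply: le_trans (ps_le (mgbd_gbd i j hA) s0 _) _; first by lra.
rewrite ler_wpM2l ?(mgbd_ge0 hA)// lef_pV2 ?posrE; rewrite ?[s * _]mulrC; lra.
Qed.

End Uniqueness.

(** * Holomorphic dependence of solutions on parameters *)

Section ParametricODE.
Variable R : realType.
Local Notation C := R[i].
Variables (N : nat) (E : normedModType C).
Implicit Types (P Q : nat -> 'M[C]_N) (q : E -> 'I_N -> C).

Lemma Xpre_hol (B : set E) (Om : nat -> E -> 'M[C]_N) n k i j :
  (forall l a b, hol B (fun e => Om l e a b)) ->
  hol B (fun e => Xpre (fun l => Om l e) n k i j).
Proof.
move=> hO; elim: n k i j => [|n IH] k i j /=; first exact: hol_cst.
case: leqP => _; first exact: IH.
have h : hol B (fun e => n.+1%:R^-1 * \sum_(l < n.+1) \sum_c Om l e i c *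
     Xpre (fun l => Om l e) n (n - l)%N c j).
  apply: holM; first exact: hol_cst.
  apply: hol_sum => l _; apply: hol_sum => c _; apply: holM; [exact: hO|exact: IH].
move=> e Be; have [L hL] := h e Be; exists L; apply: cder_eq hL => v.
rewrite mxE summxE; congr (_ * _); apply: eq_bigr => l _; by rewrite mxE.
Qed.

Lemma Om_hol (B : set E) P Q q l a b : (forall j, hol B (fun e => q e j)) ->
  hol B (fun e => Om_ P Q (q e) l a b).
Proof.
move=> hq; have h : hol B (fun e => P l a b + \sum_(k < l.+1) q e a ^+ k.+1 * Q (l - k)%N a b).
  apply: holD; first exact: hol_cst.
  by apply: hol_sum => k _; apply: holM; [exact: holX|exact: hol_cst].
move=> e Be; have [L hL] := h e Be; exists L; apply: cder_eq hL => v.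
rewrite mxE /mcprod summxE; congr (_ + _); apply: eq_bigr => k _.
rewrite mxE (bigD1 a)//= !mxE eqxx mulr1n big1 ?addr0// => c ca.
by rewrite !mxE eq_sym (negPf ca) mulr0n mul0r.
Qed.

(** The transport from 0 to t of the equation with matrix P(t) + diag(q_j / (1 - q_j t)) Q(t). All
    transports below are instances, the spectral parameter entering through [q]. *)
Definition Xi P Q (q : 'I_N -> C) (t : C) : 'M[C]_N := mps (Xs (Om_ P Q q)) t.

Definition XiK (Cp ka ka' s : R) : R := odeK N (Cp + N%:R * ka * Cp / (1 - ka / ka')) ka' s.

Lemma Xi_gbd P Q (q : 'I_N -> C) (Cp ka ka' s : R) :
  (forall j, nr (q j) <= ka) -> 0 <= ka -> ka < ka' -> ka' < s ->
  mgbd P Cp ka' -> mgbd Q Cp ka' -> mgbd (Xs (Om_ P Q q)) (XiK Cp ka ka' s) s.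
Proof.
move=> hq ka0 kk ks hP hQ; apply: Xs_bound => //; first by lra.
exact: Om_bound.
Qed.

Lemma Xi_hol P Q q (T : E -> C) u0 r (Cp ka ka' s th : R) i j :
  0 <= ka -> ka < ka' -> ka' < s -> th < 1 ->
  mgbd P Cp ka' -> mgbd Q Cp ka' ->
  (forall j, hol (bal u0 r) (fun e => q e j)) -> hol (bal u0 r) T ->
  (forall e, bal u0 r e -> (forall j, nr (q e j) <= ka) /\ nr (T e) * s <= th) ->
  hol (bal u0 r) (fun e => Xi P Q (q e) (T e) i j).
Proof.
move=> ka0 kk ks th1 hP hQ hq hT hb.
have h : hol (bal u0 r) (fun e => ps (fun k => Xs (Om_ P Q (q e)) k i j) (T e)).
  apply: (@ps_hol R E (fun k e => Xs (Om_ P Q (q e)) k i j) T u0 r (XiK Cp ka ka' s) s th) => //.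
  - by lra.
  - move=> k; apply: (@Xpre_hol _ (fun l e => Om_ P Q (q e) l) k k i j) => l a b.
    exact: Om_hol.
  - move=> e /hb[h1 h2]; split=> //.
    by have := mgbd_gbd i j (Xi_gbd h1 ka0 kk ks hP hQ).
by move=> e be; have [L hL] := h e be; exists L; apply: cder_eq hL => v; rewrite mxE.
Qed.

Lemma Xi_ode P Q (q : 'I_N -> C) (Cp ka ka' s : R) t :
  (forall j, nr (q j) <= ka) -> 0 <= ka -> ka < ka' -> ka' < s ->
  mgbd P Cp ka' -> mgbd Q Cp ka' -> nr t * s < 1 ->
  mcd (Xi P Q q) t ((mps P t + diag_mx (\row_j (q j / (1 - q j * t))) *m mps Q t) *m Xi P Q q t).
Proof.
move=> hq ka0 kk ks hP hQ ts.
have tk : nr t * ka' < 1.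
  by apply: le_lt_trans ts; rewrite ler_wpM2l ?nr_ge0// ltW.
rewrite -(mps_Om hq ka0 kk hP hQ tk); apply: (Xs_ode _ ks _ ts); first by lra.
exact: Om_bound.
Qed.

Lemma Xi_at0 P Q (q : 'I_N -> C) : Xi P Q q 0 = 1%:M.
Proof. by rewrite /Xi mps_at0 Xs0. Qed.

Lemma Xi_mn P Q (q : 'I_N -> C) (Cp ka ka' s th : R) t :
  (forall j, nr (q j) <= ka) -> 0 <= ka -> ka < ka' -> ka' < s -> th < 1 ->
  mgbd P Cp ka' -> mgbd Q Cp ka' -> nr t * s <= th ->
  mn (Xi P Q q t) <= (N * N)%:R * (XiK Cp ka ka' s / (1 - th)).
Proof.
move=> hq ka0 kk ks th1 hP hQ ts; apply: mps_mn (Xi_gbd hq ka0 kk ks hP hQ) _ ts th1.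
by lra.
Qed.

Lemma Xi_coef_mn P Q (q : 'I_N -> C) (Cp ka ka' th : R) t :
  (forall j, nr (q j) <= ka) -> 0 <= ka -> ka < ka' -> th < 1 ->
  mgbd P Cp ka' -> mgbd Q Cp ka' -> nr t * ka' <= th ->
  mn (mps P t + diag_mx (\row_j (q j / (1 - q j * t))) *m mps Q t) <=
  (N * N)%:R * ((Cp + N%:R * ka * Cp / (1 - ka / ka')) / (1 - th)).
Proof.
move=> hq ka0 kk th1 hP hQ ts; rewrite -(mps_Om hq ka0 kk hP hQ); last by lra.
by apply: mps_mn (Om_bound hq ka0 kk hP hQ) _ ts th1; lra.
Qed.

End ParametricODE.

(** * Functions of two complex variables and rules for matrix derivatives *)

Section TwoVariables.
Variable R : realType.
Local Notation C := R[i].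
Local Notation CC := (C * C)%type.

Lemma nr_pairE (x : CC) : nr x = Num.max (nr x.1) (nr x.2).
Proof.
rewrite {1}/nr prod_normE !nrE /Order.max ltcR; by case: ifP.
Qed.

Lemma nr_fst (x : CC) : nr x.1 <= nr x.
Proof. by rewrite nr_pairE le_max lexx. Qed.

Lemma nr_snd (x : CC) : nr x.2 <= nr x.
Proof. by rewrite nr_pairE le_max lexx orbT. Qed.

Lemma cder_lin_id (E : normedModType C) (l : E -> C) (K : R) u :
  (forall (a : C) x y, l (a *: x + y) = a * l x + l y) -> (forall v, nr (l v) <= K * nr v) ->
  cder l u l.
Proof.
move=> hl hK; have hid := cd_id (l u).
apply: (cder_eqL _ (@cder_affine R C E (fun z => z) l l u _ K _ hl hK hid)).
  by move=> v; rewrite mulr1.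
by move=> x h; rewrite -[x in l (x + _)]scale1r hl mul1r.
Qed.

Lemma hol_fst B : hol B (fun e : CC => e.1).
Proof.
move=> u _; eexists; apply: (@cder_lin_id _ (fun e : CC => e.1) 1) => //.
by move=> v; rewrite mul1r nr_fst.
Qed.

Lemma hol_snd B : hol B (fun e : CC => e.2).
Proof.
move=> u _; eexists; apply: (@cder_lin_id _ (fun e : CC => e.2) 1) => //.
by move=> v; rewrite mul1r nr_snd.
Qed.

Lemma cder_fst (f : CC -> C) (s t : C) L : cder f (s, t) L -> cd (fun z => f (z, t)) s (L (1, 0)).
Proof.
move=> h; have e z : (z, t) = (0, t) + z *: (1, 0) :> CC.
  by congr (_, _); rewrite /= ?scaler0 ?addr0 ?add0r// -[z *: 1]/(z * 1) mulr1.
apply: (@cder_eq R C (fun z => f ((0, t) + z *: (1, 0)))); first by move=> z; rewrite -e.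
by apply: cder_line; rewrite -e.
Qed.

Lemma cder_snd (f : CC -> C) (s t : C) L : cder f (s, t) L -> cd (fun z => f (s, z)) t (L (0, 1)).
Proof.
move=> h; have e z : (s, z) = (s, 0) + z *: (0, 1) :> CC.
  by congr (_, _); rewrite /= ?scaler0 ?addr0 ?add0r// -[z *: 1]/(z * 1) mulr1.
apply: (@cder_eq R C (fun z => f ((s, 0) + z *: (0, 1)))); first by move=> z; rewrite -e.
by apply: cder_line; rewrite -e.
Qed.

Lemma mcd_diag n (f : 'I_n -> C -> C) t d : (forall a, cd (f a) t (d a)) ->
  mcd (fun z => diag_mx (\row_a f a z)) t (diag_mx (\row_a d a)).
Proof.
move=> h a b; rewrite /cd; case: (eqVneq a b) => [->|ab].
  apply: (@cder_eq R C (f b)); first by move=> v; rewrite !mxE eqxx mulr1n.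
  by apply: cder_eqL (h b) => v; rewrite !mxE eqxx mulr1n.
apply: (@cder_eq R C (fun=> 0)); first by move=> v; rewrite !mxE (negPf ab) mulr0n.
by apply: cder_eqL (cder_cst 0 t) => v; rewrite !mxE (negPf ab) mulr0n mulr0.
Qed.

Lemma mcdD m n (F G : C -> 'M[C]_(m, n)) t D D' :
  mcd F t D -> mcd G t D' -> mcd (fun z => F z + G z) t (D + D').
Proof.
move=> hF hG i j; rewrite /cd.
apply: (@cder_eq R C (fun z => F z i j + G z i j)); first by move=> v; rewrite !mxE.
by apply: (cder_eqL _ (cderD (hF i j) (hG i j))) => v; rewrite !mxE mulrDr.
Qed.

Lemma mcdN m n (F : C -> 'M[C]_(m, n)) t D : mcd F t D -> mcd (fun z => - F z) t (- D).
Proof.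
move=> hF; have := mcdB (mcd_cst (0 : 'M[C]_(m,n)) t) hF; rewrite sub0r.
by apply: mcd_eq => z; rewrite sub0r.
Qed.

Lemma mcd_uniq m n (F : C -> 'M[C]_(m, n)) t D D' : mcd F t D -> mcd F t D' -> D = D'.
Proof. by move=> h h'; apply/matrixP => i j; exact: cd_uniq (h i j) (h' i j). Qed.

Lemma cd_affV (a b t : C) : a + t * b != 0 -> cd (fun z => (a + z * b)^-1) t (- b * (a + t * b)^-1 ^+ 2).
Proof.
move=> h0; have h : cd (fun z : C => a + z * b) t b.
  rewrite /cd; apply: cder_eqL (cderD (cder_cst a t) (cderM (cd_id t) (cder_cst b t))) => v.
  by rewrite mulr0 addr0 mulr1 add0r.
apply: (cder_eqL _ (@cderV R C (fun z => a + z * b) t _ h0 h)) => v; rewrite -exprVn; ring.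
Qed.

End TwoVariables.

(** * Isomonodromic deformation along a complex line *)

Section Compatibility.
Variable R : realType.
Local Notation C := R[i].
Local Notation CC := (C * C)%type.
Variables (N : nat) (P Q : nat -> 'M[C]_N) (Cp rho0 : R) (Gam : C -> 'M[C]_N) (u0 w : 'I_N -> C).
Local Notation V := (mps Q).
Local Notation VV := (mps P).
Let u j t := u0 j + t * w j.
Hypotheses (hP : mgbd P Cp 4^-1) (hQ : mgbd Q Cp 4^-1).
Hypothesis hV : forall t, nr t < 3 -> mcd V t (VV t *m V t - V t *m VV t).
Hypothesis eV : forall t a b, nr t < 3 -> V t a b = (u b t - u a t) * Gam t a b.
Hypothesis eVV : forall t a b, nr t < 3 -> VV t a b = (w b - w a) * Gam t a b.
Hypothesis rho00 : 0 < rho0.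
Hypothesis sep : forall a b, a != b -> 10 * rho0 <= nr (u0 a - u0 b).
Hypothesis hw : forall a, nr (w a) <= rho0 / 8.
Variable i : 'I_N.

(** With s = lam - u_i(t) held fixed, the deformation equation has the coefficients (w_j - w_i) / (s
    + u_i(t) - u_j(t)). The one with j = i, the only possible singularity at s = 0, has numerator
    zero; hence [ZZ], the transport at fixed s, is regular in the whole disc. *)
Definition qZ s j : C := (w j - w i) / (s + u0 i - u0 j).
Definition ZZ s t : 'M[C]_N := Xi P Q (qZ s) t.

Let den s a : nr s < 5 * rho0 -> a != i -> 5 * rho0 <= nr (s + u0 i - u0 a).
Proof.
have r0 := rho00.
move=> hs ai; have := sep ai; have := nrBl (u0 a - u0 i) s; rewrite [nr (_ - s)]nrBC.
rewrite (_ : s - (u0 a - u0 i) = s + u0 i - u0 a); last by ring.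
by lra.
Qed.

Let dw a b : nr (w a - w b) <= rho0 / 4.
Proof.
apply: le_trans (nrB _ _) _; rewrite (_ : rho0 / 4 = rho0 / 8 + rho0 / 8); last by field.
exact: lerD.
Qed.

Let qZ_le s j : nr s < 5 * rho0 -> nr (qZ s j) <= 8^-1.
Proof.
have r0 := rho00.
move=> hs; rewrite /qZ; have [->|ji] := eqVneq j i; first by rewrite subrr mul0r nr0.
have d := den hs ji; rewrite nrM nrV ler_pdivrMr; last by apply: lt_le_trans d; rewrite mulr_gt0.
apply: le_trans (dw _ _) _; move: d; move: (nr _) => x d; lra.
Qed.

Let du s t a : nr s < 5 * rho0 -> s != 0 -> nr t < 3 -> s + u i t - u a t != 0.
Proof.
have r0 := rho00.
move=> hs s0 ht; have [->|ai] := eqVneq a i; first by rewrite addrK.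
have d := den hs ai; rewrite (_ : _ - _ = (s + u0 i - u0 a) + t * (w i - w a)); last by rewrite /u; ring.
have h : nr (t * (w i - w a)) <= 3 * (rho0 / 4).
  by rewrite nrM ler_pM ?nr_ge0// ltW.
apply/eqP => h0; have := nrBl (s + u0 i - u0 a) (- (t * (w i - w a))).
rewrite opprK h0 nr0 nrN; apply/negP; rewrite -ltNge subr_gt0.
by apply: le_lt_trans h _; apply: lt_le_trans d; lra.
Qed.

Let pp s t a : C := (s + u i t - u a t)^-1.

Lemma ZZ_hol s t : nr s < 5 * rho0 -> nr t < 3 ->
  exists2 r, 0 < r & forall a b, hol (bal ((s, t) : CC) r) (fun e : CC => ZZ e.1 e.2 a b).
Proof.
have r0 := rho00.
move=> hs ht; exists (Num.min (5 * rho0 - nr s) (3 - nr t)); first by rewrite lt_min !subr_gt0 hs.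
set r := Num.min _ _ => a b.
have be e : bal ((s, t) : CC) r e -> nr e.1 < 5 * rho0 /\ nr e.2 < 3.
  rewrite /bal /= => h; have h1 := le_lt_trans (nr_fst _) h; have h2 := le_lt_trans (nr_snd _) h.
  rewrite /= lt_min in h1; move/andP: h1 => [h1 _]; rewrite /= lt_min in h2; move/andP: h2 => [_ h2].
  have := nrBl e.1 s; have := nrBl e.2 t; split; lra.
(* The rates increase strictly: 1/8 bounds the parameters [qZ], 1/4 is the growth rate of [P] and
   [Q], and 7/24 is that of the solution; |t| < 3 gives |t| 7/24 < 7/8. *)
apply: (@Xi_hol R N _ P Q (fun e => qZ e.1) (fun e : CC => e.2) (s, t) r Cp 8^-1 4^-1 (7/24) (7/8)) => //; try lra.
- move=> j; rewrite /qZ; have [->|ji] := eqVneq j i.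
    apply: (hol_ext _ _ (@hol_cst _ _ _ (0 : C))) => [x|x _]; first exact: bal_nbhs.
    by rewrite subrr mul0r.
  apply: holM; first exact: hol_cst.
  apply: holV.
    move=> e /be[h1 _]; apply: contraTneq isT => h0; have := den h1 ji; rewrite h0 nr0; lra.
  by apply: holB; [apply: holD; [exact: hol_fst|exact: hol_cst]|exact: hol_cst].
- exact: hol_snd.
- by move=> e /be[h1 h2]; split; [move=> j; exact: qZ_le|lra].
Qed.

Definition Mm s t : 'M[C]_N := VV t + diag_mx (\row_a ((w a - w i) * pp s t a)) *m V t.

Let qZE s t a : nr s < 5 * rho0 -> nr t < 3 ->
  qZ s a / (1 - qZ s a * t) = (w a - w i) * pp s t a.
Proof.
have r0 := rho00.
move=> hs ht; rewrite /qZ /pp; have [->|ai] := eqVneq a i; first by rewrite subrr !mul0r.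
have d := den hs ai; have d0 : s + u0 i - u0 a != 0.
  by apply: contraTneq isT => h0; move: d; rewrite h0 nr0; lra.
have e : s + u i t - u a t = (s + u0 i - u0 a) * (1 - (w a - w i) / (s + u0 i - u0 a) * t).
  by rewrite /u; field.
by rewrite e invfM mulrA.
Qed.

Lemma ZZ_ode s t : nr s < 5 * rho0 -> nr t < 3 -> mcd (ZZ s) t (Mm s t *m ZZ s t).
Proof.
move=> hs ht; rewrite /Mm (_ : \row_a _ = \row_a (qZ s a / (1 - qZ s a * t))).
  by apply: (@Xi_ode R N P Q (qZ s) Cp 8^-1 4^-1 (7/24) t); try lra; [move=> j; exact: qZ_le| |].
by apply/rowP => a; rewrite !mxE qZE.
Qed.

Lemma Mm_mn s t : nr s < 5 * rho0 -> nr t < 3 ->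
  mn (Mm s t) <= (N * N)%:R * ((Cp + N%:R * 8^-1 * Cp / (1 - 8^-1 / 4^-1)) / (1 - 3/4)).
Proof.
move=> hs ht; rewrite /Mm (_ : \row_a _ = \row_a (qZ s a / (1 - qZ s a * t))).
  by apply: Xi_coef_mn => //; try lra; move=> j; exact: qZ_le.
by apply/rowP => a; rewrite !mxE qZE.
Qed.

(** The matrix of the Fuchsian equation in lam at time [t], in the variable s = lam - u_i(t). *)
Definition AA s t : 'M[C]_N := - (diag_mx (\row_a pp s t a) *m V t).
Definition Zs s t : 'M[C]_N := \matrix_(a, b) 'D_((1, 0) : CC) (fun e : CC => ZZ e.1 e.2 a b) (s, t).

(** Since [V] and [VV] are one matrix [Gam] scaled entrywise by differences of u and of w, the claim
    reduces to the identity p_b - p_a = (u_b - u_a) p_a p_b. *)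
Lemma zero_curvature s t : nr s < 5 * rho0 -> s != 0 -> nr t < 3 ->
  let p := diag_mx (\row_a pp s t a) in
  let p2 := diag_mx (\row_a ((w a - w i) * pp s t a ^+ 2)) in
  (VV t + diag_mx (\row_a ((w a - w i) * pp s t a)) *m V t) *m AA s t
   - AA s t *m (VV t + diag_mx (\row_a ((w a - w i) * pp s t a)) *m V t) =
  - (p *m (VV t *m V t - V t *m VV t)).
Proof.
move=> hs s0 ht p p2; set vp := diag_mx (\row_a ((w a - w i) * _)).
have key : VV t *m p - p *m VV t + vp *m V t *m p - p *m V t *m vp = 0.
  apply/matrixP => a b; rewrite !mxE.
  have e1 (X : 'M[C]_N) f : (X *m diag_mx (\row_c f c)) a b = X a b * f b.
    by rewrite mul_mx_diag !mxE.
  have e2 (X : 'M[C]_N) f : (diag_mx (\row_c f c) *m X) a b = f a * X a b.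
    by rewrite mul_diag_mx !mxE.
  have -> : \sum_j VV t a j * p j b = VV t a b * pp s t b by have := e1 (VV t) (pp s t); rewrite mxE.
  have -> : \sum_j p a j * VV t j b = pp s t a * VV t a b by have := e2 (VV t) (pp s t); rewrite mxE.
  have -> : \sum_j (vp *m V t) a j * p j b = (vp *m V t) a b * pp s t b.
    by have := e1 (vp *m V t) (pp s t); rewrite mxE.
  have -> : \sum_j (p *m V t) a j * vp j b = (p *m V t) a b * ((w b - w i) * pp s t b).
    by have := e1 (p *m V t) (fun a => (w a - w i) * pp s t a); rewrite mxE.
  rewrite /vp /p !e2 (eV _ _ ht) (eVV _ _ ht).
  have pa := du a hs s0 ht; have pb := du b hs s0 ht; rewrite /pp.
  by field; rewrite pa pb.
rewrite /AA -/p.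
have -> : (VV t + vp *m V t) *m - (p *m V t) - - (p *m V t) *m (VV t + vp *m V t) =
  - (p *m (VV t *m V t - V t *m VV t)) - (VV t *m p - p *m VV t + vp *m V t *m p - p *m V t *m vp) *m V t.
  rewrite !mulmxBr !mulmxBl !mulmxDl !mulmxN !mulNmx !mulmxDr !mulmxA.
  move: (VV t *m p *m V t) => X1; move: (p *m VV t *m V t) => X2; move: (p *m V t *m VV t) => X3.
  move: (vp *m V t *m p *m V t) => X4; move: (p *m V t *m vp *m V t) => X5.
  by apply/matrixP => a b; rewrite !mxE; ring.
by rewrite key mul0mx subr0.
Qed.


Let cd_pp_s s t a : nr s < 5 * rho0 -> s != 0 -> nr t < 3 ->
  cd (fun z => pp z t a) s (- pp s t a ^+ 2).
Proof.
move=> hs s0 ht; have d := du a hs s0 ht.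
have h : cd (fun z => ((u i t - u a t) + z * 1)^-1) s (- 1 * ((u i t - u a t) + s * 1)^-1 ^+ 2).
  by apply: cd_affV; rewrite mulr1 addrC addrA.
have e z : (u i t - u a t) + z * 1 = z + u i t - u a t by ring.
apply: (@cder_eq R C (fun z => ((u i t - u a t) + z * 1)^-1)); first by move=> z; rewrite e.
by apply: (cder_eqL _ h) => v; rewrite e mulN1r.
Qed.

Let cd_pp_t s t a : nr s < 5 * rho0 -> s != 0 -> nr t < 3 ->
  cd (fun z => pp s z a) t ((w a - w i) * pp s t a ^+ 2).
Proof.
move=> hs s0 ht; have d := du a hs s0 ht.
have e z : (s + u0 i - u0 a) + z * (w i - w a) = s + u i z - u a z by rewrite /u; ring.
have h := @cd_affV R (s + u0 i - u0 a) (w i - w a) t; rewrite e in h; have {}h := h d.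
apply: (@cder_eq R C (fun z => ((s + u0 i - u0 a) + z * (w i - w a))^-1)); first by move=> z; rewrite e.
by apply: (cder_eqL _ h) => v; rewrite opprB.
Qed.

Let dM s t := - (diag_mx (\row_a ((w a - w i) * pp s t a ^+ 2)) *m V t).

Lemma Mm_ds s t : nr s < 5 * rho0 -> s != 0 -> nr t < 3 -> mcd (fun z => Mm z t) s (dM s t).
Proof.
move=> hs s0 ht; have hd a : cd (fun z => (w a - w i) * pp z t a) s (- ((w a - w i) * pp s t a ^+ 2)).
  by apply: (cder_eqL _ (cderZ (w a - w i) (cd_pp_s a hs s0 ht))) => v; ring.
have h := mcdD (mcd_cst (VV t) s) (mcdM (mcd_diag hd) (mcd_cst (V t) s)).
rewrite add0r mulmx0 addr0 in h; rewrite /dM -mulNmx.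
suff <- : diag_mx (\row_a (- ((w a - w i) * pp s t a ^+ 2))) =
          - diag_mx (\row_a ((w a - w i) * pp s t a ^+ 2)) by [].
by apply/matrixP => a b; rewrite !mxE mulNrn.
Qed.

Lemma AA_dt s t : nr s < 5 * rho0 -> s != 0 -> nr t < 3 ->
  mcd (AA s) t (dM s t - diag_mx (\row_a pp s t a) *m (VV t *m V t - V t *m VV t)).
Proof.
move=> hs s0 ht.
have h := mcdN (mcdM (mcd_diag (fun a => cd_pp_t a hs s0 ht)) (hV ht)).
by rewrite opprD in h.
Qed.

Lemma ZZ_ds s t : nr s < 5 * rho0 -> nr t < 3 -> mcd (fun z => ZZ z t) s (Zs s t).
Proof.
move=> hs ht a b; have [r r0 h] := ZZ_hol hs ht; rewrite /Zs mxE.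
by have := cder_fst (hol_cder (h a b) (balC _ r0)).
Qed.

(** By symmetry of mixed derivatives this is the s-derivative of the equation for [ZZ] in t. *)
Lemma Zs_dt s t : nr s < 5 * rho0 -> s != 0 -> nr t < 3 ->
  mcd (Zs s) t (dM s t *m ZZ s t + Mm s t *m Zs s t).
Proof.
move=> hs s0 ht a b; have [r r0 h] := ZZ_hol hs ht; have {}h := h a b.
set f := (fun e : CC => ZZ e.1 e.2 a b) in h.
have b0 : bal ((s, t) : CC) r (s, t) := balC _ r0.
have c1 := cder_snd (hol_cder (hol_D ((1, 0) : CC) h) b0).
have c2 := cder_fst (hol_cder (hol_D ((0, 1) : CC) h) b0).
have c3 := mcdM (Mm_ds hs s0 ht) (ZZ_ds hs ht) a b.
rewrite (D_comm ((0, 1) : CC) ((1, 0) : CC) h b0) in c1.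
have near_s : \forall z \near s, 'D_((0, 1) : CC) f (z, t) = (Mm z t *m ZZ z t) a b.
  apply/near_nrP; exists (Num.min r (5 * rho0 - nr s)); first by rewrite lt_min r0 subr_gt0.
  move=> z; rewrite lt_min => /andP[zr zs].
  have bz : bal ((s, t) : CC) r (z, t).
    by rewrite /bal /= nr_pairE /= subrr nr0 gt_max zr.
  have zs' : nr z < 5 * rho0 by have := nrBl z s; lra.
  exact: cd_uniq (cder_snd (hol_cder h bz)) (ZZ_ode zs' ht a b).
have c4 := cder_loc near_s c2; rewrite -(cd_uniq c4 c3).
apply: (@cder_eq R C (fun z => 'D_((1, 0) : CC) f (s, z))) c1 => z; by rewrite /Zs mxE.
Qed.

Lemma Zs_at0 s : nr s < 5 * rho0 -> Zs s 0 = 0.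
Proof.
move=> hs; have t0 : nr (0 : C) < 3 by rewrite nr0.
apply: (mcd_uniq (ZZ_ds hs t0)); apply: (@mcd_eq R N N (fun=> 1%:M)) (mcd_cst _ _) => z.
by rewrite /ZZ Xi_at0.
Qed.

Lemma compat_alg n (X Z M Z' A K A0 : 'M[C]_n) : M *m A - A *m M = - K ->
  X *m Z + M *m Z' - ((X - K) *m Z + A *m (M *m Z) - (M *m Z *m A0 + Z *m 0)) =
  M *m (Z' - (A *m Z - Z *m A0)).
Proof.
move=> h; rewrite -[X - K]/(X + - K) -h mulmx0 addr0 mulmxDl mulmxBl !mulmxBr !mulmxA.
move: (X *m Z) (M *m Z') (M *m A *m Z) (A *m M *m Z) (M *m Z *m A0) => X1 X2 X3 X4 X5.
by apply/matrixP => c d; rewrite !mxE; ring.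
Qed.

(** The difference of the two sides solves Y' = Mm Y in t, by [zero_curvature], and vanishes at t =
    0. In other words, transport at fixed s carries the Fuchsian equation at time 0 to the one at
    time t. *)
Lemma compatibility s t : nr s < 5 * rho0 -> s != 0 -> nr t < 3 ->
  Zs s t = AA s t *m ZZ s t - ZZ s t *m AA s 0.
Proof.
move=> hs s0 ht; apply/eqP; rewrite -subr_eq0; apply/eqP; move: t ht.
apply: (@ode_uniq R N N _ (Mm s) 3 _ _ _ (fun t ht => Mm_mn hs ht)) => [//|t ht|]; last first.
  by rewrite Zs_at0// /ZZ Xi_at0 mulmx1 mul1mx subrr subr0.
have h := mcdB (Zs_dt hs s0 ht) (mcdB (mcdM (AA_dt hs s0 ht) (ZZ_ode hs ht))
  (mcdM (ZZ_ode hs ht) (mcd_cst (AA s 0) t))).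
move=> a b; apply: (cder_eqL _ (h a b)) => v; congr (v * _).
have zc := zero_curvature hs s0 ht; rewrite /= -/(Mm s t) in zc.
by rewrite -(compat_alg (dM s t) (ZZ s t) (Zs s t) (AA s 0) zc).
Qed.

Definition XX lam t : 'M[C]_N := Xi P Q (fun j => w j / (lam - u0 j)) t.

Definition sing (A : 'M[C]_N) k : 'M[C]_N := if k == 0%N then A else 0.

Lemma mps_sing A t : mps (sing A) t = A.
Proof.
apply/matrixP => a b; rewrite mxE; apply: Lim_cvg => e e0; exists 1%N => -[//|k] _.
rewrite /psum big_nat_recl//= expr0 mulr1 big1 ?addr0 ?subrr ?nr0// => l _.
by rewrite /sing/= mxE mul0r.
Qed.

Lemma mgbd_sing A s : 0 <= s -> mgbd (sing A) (mn A) s.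
Proof.
move=> s0 [|k]; rewrite /sing /=; first by rewrite expr0 mulr1.
by rewrite mn0 mulr_ge0 ?mn_ge0 ?exprn_ge0.
Qed.

(** The transport of dY/dlam = - (lam - u0)^-1 A Y from lam to lam - t om, at fixed poles. It
    involves the solution only through the constant matrix [A]. *)
Definition GG A lam om t : 'M[C]_N := Xi (sing 0) (sing A) (fun j => om / (lam - u0 j)) t.

Let lamd lam a : 2 * rho0 <= nr (lam - u0 i) <= 4 * rho0 -> 2 * rho0 <= nr (lam - u0 a).
Proof.
have r0 := rho00; move=> /andP[h1 h2]; have [->//|ai] := eqVneq a i.
have := sep ai; have := nrBD lam (u0 a) (u0 i); rewrite [nr (_ - lam)]nrBC.
by lra.
Qed.

Let qX_le lam a (om : C) : 2 * rho0 <= nr (lam - u0 i) <= 4 * rho0 -> nr om <= rho0 / 8 ->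
  nr (om / (lam - u0 a)) <= 8^-1.
Proof.
have r0 := rho00; move=> /(lamd a) h ho; rewrite nrM nrV ler_pdivrMr; last by lra.
by apply: le_trans ho _; lra.
Qed.

Let lamd0 lam a (om : C) : 2 * rho0 <= nr (lam - u0 i) <= 4 * rho0 -> nr om < 2 * rho0 ->
  lam - u0 a - om != 0.
Proof.
have r0 := rho00; move=> /(lamd a) h ho; apply/eqP => h0.
by have := nrBl (lam - u0 a) om; rewrite h0 nr0; apply/negP; rewrite -ltNge subr_gt0; apply: lt_le_trans h.
Qed.

Let tw_le (t : C) a : nr t < 3 -> nr (t * w a) <= 3 * (rho0 / 8).
Proof. by move=> ht; rewrite nrM ler_pM ?nr_ge0// ltW. Qed.

Let qtE lam t a (om : C) : 2 * rho0 <= nr (lam - u0 i) <= 4 * rho0 ->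
  om / (lam - u0 a) / (1 - om / (lam - u0 a) * t) = om / (lam - u0 a - t * om).
Proof.
have r0 := rho00; move=> h; have d0 : lam - u0 a != 0.
  by have := lamd0 a h (om := 0); rewrite nr0 subr0; apply; lra.
have -> : lam - u0 a - t * om = (lam - u0 a) * (1 - om / (lam - u0 a) * t) by field.
by rewrite invfM mulrA.
Qed.

Let BB lam t := VV t + diag_mx (\row_a (w a / (lam - u0 a - t * w a))) *m V t.

Lemma XX_ode lam t : 2 * rho0 <= nr (lam - u0 i) <= 4 * rho0 -> nr t < 3 ->
  mcd (XX lam) t (BB lam t *m XX lam t).
Proof.
move=> hl ht.
have := @Xi_ode R N P Q (fun j => w j / (lam - u0 j)) Cp 8^-1 4^-1 (7/24) t.
rewrite (_ : \row_j _ = \row_a (w a / (lam - u0 a - t * w a))).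
  by apply; try lra; [move=> a; exact: qX_le| |].
by apply/rowP => a; rewrite !mxE qtE.
Qed.

Lemma BB_mn lam t : 2 * rho0 <= nr (lam - u0 i) <= 4 * rho0 -> nr t < 3 ->
  mn (BB lam t) <= (N * N)%:R * ((Cp + N%:R * 8^-1 * Cp / (1 - 8^-1 / 4^-1)) / (1 - 3/4)).
Proof.
move=> hl ht; have := @Xi_coef_mn R N P Q (fun j => w j / (lam - u0 j)) Cp 8^-1 4^-1 (3/4) t.
rewrite (_ : \row_j _ = \row_a (w a / (lam - u0 a - t * w a))).
  by apply => //; try lra; move=> a; exact: qX_le.
by apply/rowP => a; rewrite !mxE qtE.
Qed.

Lemma GG_ode A lam (om t : C) (ka s : R) : (forall j, nr (om / (lam - u0 j)) <= ka) -> 0 <= ka -> ka < s ->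
  nr t * s < 1 ->
  mcd (GG A lam om) t (diag_mx (\row_j (om / (lam - u0 j) / (1 - om / (lam - u0 j) * t))) *m A
     *m GG A lam om t).
Proof.
move=> hq k0 ks ts; pose k' := (ka + s) / 2.
have := @Xi_ode R N (sing 0) (sing A) (fun j => om / (lam - u0 j)) (mn A) ka k' s t hq k0.
rewrite !mps_sing add0r; apply => //; rewrite /k'; try lra.
  move=> k; rewrite /sing; case: ifP => _; rewrite mn0 mulr_ge0 ?mn_ge0// exprn_ge0//; lra.
by apply: mgbd_sing; lra.
Qed.

Lemma ZZ_line lam t : 2 * rho0 <= nr (lam - u0 i) <= 4 * rho0 -> nr t < 3 ->
  nr (lam - u i t) < 5 * rho0 /\ lam - u i t != 0.
Proof.
have r0 := rho00; move=> hl ht; have hw3 := tw_le i ht.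
have e : lam - u i t = (lam - u0 i) - t * w i by rewrite /u; ring.
split; last by rewrite e; apply: lamd0 => //; lra.
by rewrite e; apply: le_lt_trans (nrB _ _) _; move/andP: hl => [_ h]; lra.
Qed.

Lemma ZZ_dline lam t : 2 * rho0 <= nr (lam - u0 i) <= 4 * rho0 -> nr t < 3 ->
  mcd (fun t => ZZ (lam - u i t) t) t
    (- w i *: Zs (lam - u i t) t + Mm (lam - u i t) t *m ZZ (lam - u i t) t).
Proof.
move=> hl ht a b; have [hs s0] := ZZ_line hl ht; set s := lam - u i t in hs s0 *.
have [r r0 h] := ZZ_hol hs ht; have {}h := h a b.
set f := (fun e : CC => ZZ e.1 e.2 a b) in h; have b0 : bal ((s, t) : CC) r (s, t) := balC _ r0.
have e z : (lam - u i z, z) = (lam - u0 i, 0) + z *: (- w i, 1) :> CC.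
  congr (_, _) => /=; first by rewrite -[z *: _]/(z * _) /u; ring.
  by rewrite -[z *: _]/(z * _) add0r mulr1.
have hc := hol_cder h b0; have c1 := cder_snd hc.
have vE : (- w i, 1) = (- w i) *: (1, 0) + (0, 1) :> CC.
  congr (_, _) => /=; rewrite -[_ *: _]/(_ * _); first by rewrite mulr1 addr0.
  by rewrite mulr0 add0r.
have hc' : cder f ((lam - u0 i, 0) + t *: (- w i, 1)) (fun v => 'D_v f (s, t)) by rewrite -e.
have := cder_line hc'; rewrite vE (cder_lin hc) -vE (cd_uniq c1 (ZZ_ode hs ht a b)) => h1.
apply: (@cder_eq R C (fun z : C => f ((lam - u0 i, 0) + z *: (- w i, 1)))).
  by move=> z; rewrite -e.
apply: (cder_eqL _ h1) => v; rewrite [X in _ = _ * X]mxE [X in _ = _ * (X + _)]mxE /Zs.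
by rewrite [X in _ = _ * (_ * X + _)]mxE.
Qed.

Lemma star_alg n (W Vt D1 D2 D3 D4 Z Zt G A0 : 'M[C]_n) (c : C) :
  Zt = - (D1 *m Vt) *m Z - Z *m - (D2 *m A0) ->
  D3 + c *: D1 = D4 ->
  (- c *: Zt + (W + D3 *m Vt) *m Z) *m G + Z *m ((c *: D2) *m A0 *m G) = (W + D4 *m Vt) *m (Z *m G).
Proof.
move=> -> <-.
have -> : - c *: (- (D1 *m Vt) *m Z - Z *m - (D2 *m A0)) = c *: (D1 *m Vt *m Z) - c *: (Z *m (D2 *m A0)).
  by rewrite mulNmx mulmxN opprK scaleNr scalerDr scalerN opprD opprK.
have -> : c *: D2 *m A0 *m G = c *: (D2 *m A0 *m G) by rewrite -!scalemxAl.
rewrite !mulmxDl -scalemxAr -!scalemxAl !mulNmx -?scalemxAl !mulmxA.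
move: (D1 *m Vt *m Z *m G) (Z *m D2 *m A0 *m G) (W *m Z *m G) (D3 *m Vt *m Z *m G) => X1 X2 X3 X4.
by apply/matrixP => k l; rewrite !mxE; ring.
Qed.

(** To move the poles at fixed lam, first move lam to lam - t w_i at fixed poles ([GG]), then move
    lam and the poles together at fixed lam - u_i ([ZZ]). Both sides solve the same equation in t,
    by [compatibility], and start at the identity. *)
Theorem star lam t : 2 * rho0 <= nr (lam - u0 i) <= 4 * rho0 -> nr t < 3 ->
  XX lam t = ZZ (lam - u i t) t *m GG (V 0) lam (w i) t.
Proof.
move=> hl; have r0 := rho00; have w8 := hw i.
move: t; apply: (@ode_uniq2 R N N _ _ (BB lam) 3 _ _ _ _ (fun t ht => BB_mn hl ht)) => [//|t ht||].
- exact: XX_ode.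
- move=> t ht; have [hs s0] := ZZ_line hl ht.
  have hg : mcd (GG (V 0) lam (w i)) t ((w i *: diag_mx (\row_j pp (lam - u i t) 0 j)) *m V 0 *m
    GG (V 0) lam (w i) t).
    have -> : w i *: diag_mx (\row_j pp (lam - u i t) 0 j) =
      diag_mx (\row_j (w i / (lam - u0 j) / (1 - w i / (lam - u0 j) * t))).
      apply/matrixP => a b; rewrite !mxE qtE// mulrnAr; congr (_ *+ _); congr (_ / _).
      by rewrite /u; ring.
    apply: (@GG_ode _ _ _ _ 8^-1 4^-1) => //; try lra.
    by move=> j; exact: qX_le.
  have h := mcdM (ZZ_dline hl ht) hg.
  move=> a b; apply: (cder_eqL _ (h a b)) => v; congr (v * _).
  rewrite /BB /Mm; congr ((_ : 'M[C]_N) a b).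
  apply: star_alg; first exact: (compatibility hs s0 ht).
  apply/matrixP => k l; rewrite !mxE mulrnAr -mulrnDl; congr (_ *+ _).
  have -> : lam - u0 k - t * w k = lam - u i t + u i t - u k t by rewrite /u; ring.
  by rewrite /pp; ring.
- by rewrite /XX /ZZ /GG !Xi_at0 mulmx1.
Qed.

(** At s = 0 column i of the coefficient matrix vanishes: in row a != i its two terms are opposite
    multiples of [Gam t a i], and in row i both carry the factor w_i - w_i, which also kills the
    conventional inverse of 0. *)
Lemma ZZ_fix t : nr t < 3 -> ZZ 0 t *m delta_mx i (0 : 'I_1) = delta_mx i 0.
Proof.
have r0 := rho00; have s0 : nr (0 : C) < 5 * rho0 by rewrite nr0; lra.
move: t; apply: (@ode_uniq2 R N 1 _ (fun=> delta_mx i 0) (Mm 0) 3 _ _ _ _ (fun t ht => Mm_mn s0 ht)) => [//|t ht|t ht|].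
- have h := mcdM (ZZ_ode s0 ht) (mcd_cst (delta_mx i (0 : 'I_1)) t).
  by rewrite mulmx0 addr0 -mulmxA in h.
- rewrite (_ : Mm 0 t *m _ = 0); first exact: mcd_cst.
  apply/matrixP => a b; rewrite -colE [LHS]mxE [RHS]mxE [LHS]mxE.
  have e2 (X : 'M[C]_N) f c : (diag_mx (\row_c f c) *m X) a c = f a * X a c.
    by rewrite mul_diag_mx !mxE.
  rewrite (e2 (V t) (fun a => (w a - w i) * pp 0 t a) i).
  rewrite (eV _ _ ht) (eVV _ _ ht) /pp; have [->|ai] := eqVneq a i.
    by rewrite !subrr !mul0r addr0.
  have d : u i t - u a t != 0.
    apply/eqP => h0; have := sep ai; rewrite leNgt => /negP; apply.
    have -> : u0 a - u0 i = t * (w i - w a) - (u i t - u a t) by rewrite /u; ring.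
    rewrite h0 subr0 nrM; apply: (@le_lt_trans _ _ (3 * (rho0 / 4))); last lra.
    by rewrite ler_pM ?nr_ge0// ltW.
  by rewrite add0r; field.
- by rewrite /ZZ Xi_at0 mul1mx.
Qed.

End Compatibility.

(** * Local holomorphic square roots *)

Section SquareRoot.
Variable R : realType.
Local Notation C := R[i].

(** Choosing the root with nonnegative real part forces real part at least 1/2 near 1. Then S(z + h)
    + S(z) stays away from 0, and (S(z + h) - S(z)) (S(z + h) + S(z)) = h gives the derivative. *)
Lemma sqrt_branch : exists S : C -> C, forall z : C, nr (z - 1) < 2^-1 ->
  S z ^+ 2 = z /\ exists b, cd S z b.
Proof.
pose S (z : C) : C := if 0 <= complex.Re (sqrtC z) then sqrtC z else - sqrtC z.
have S2 (z : C) : S z ^+ 2 = z by rewrite /S; case: ifP => _; rewrite ?sqrrN sqrtCK.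
have Sp z : 0 <= complex.Re (S z).
  rewrite /S; case: ifP => // /negbT; rewrite -ltNge; case: (sqrtC z) => x y /=; lra.
have Shalf (z : C) : nr (z - 1) < 2^-1 -> 2^-1 <= complex.Re (S z).
  move=> hz; have e : (S z - 1) * (S z + 1) = z - 1 by rewrite -[in RHS](S2 z); ring.
  have h1 : 1 <= nr (S z + 1).
    by apply: le_trans (Re_nr _); have := Sp z; case: (S z) => x y /=; lra.
  have h2 : nr (S z - 1) < 2^-1.
    apply: le_lt_trans hz; rewrite -e (nrM (S z - 1) (S z + 1)); have := nr_ge0 (S z - 1); nra.
  by move: (ReN_nr (S z - 1)) h2; case: (S z) => x y /=; lra.
exists S => z hz; split=> //; exists (2 * S z)^-1.
apply: (@quad_cd _ _ _ _ 1 (2^-1 - nr (z - 1))); first by rewrite subr_gt0.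
move=> h hh; have hz' : nr (z + h - 1) < 2^-1.
  by rewrite (_ : z + h - 1 = (z - 1) + h); [apply: le_lt_trans (nrD _ _) _; lra|ring].
have s1 := Shalf _ hz; have s2 := Shalf _ hz'.
have e : (S (z + h) - S z) * (S (z + h) + S z) = h.
  by rewrite -[RHS](addrK z) [h + z]addrC -{3}(S2 (z + h)) -[in X in _ = _ - X](S2 z); ring.
have n1 : 1 <= nr (S (z + h) + S z).
  by apply: le_trans (Re_nr _); move: s1 s2; case: (S z) => x y; case: (S _) => x' y' /=; lra.
have n2 : 1 <= nr (2 * S z).
  by apply: le_trans (Re_nr _); move: s1; case: (S z) => x y /=; lra.
have S0 : 2 * S z != 0 by rewrite nr_neq0//; lra.
have d1 : nr (S (z + h) - S z) <= nr h.
  by rewrite -[in leRHS]e (nrM (S (z + h) - S z) (S (z + h) + S z)); have := nr_ge0 (S (z + h) - S z); nra.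
have -> : S (z + h) - S z - h * (2 * S z)^-1 = - ((S (z + h) - S z) ^+ 2 / (2 * S z)).
  rewrite -[in h * _]e; move: S0; move: (S z) (S (z + h)) => x y S0; field.
  by apply: contraNneq S0 => ->; rewrite mulr0.
rewrite nrN (nrM ((S (z + h) - S z) ^+ 2)) nrV nrX mul1r ler_pdivrMr; last by lra.
have : nr (S (z + h) - S z) ^+ 2 <= nr h ^+ 2 by rewrite lerXn2r ?nnegrE ?nr_ge0.
by have := sqr_ge0 (nr h); nra.
Qed.

Lemma sqrt_hol (E : normedModType C) (f : E -> C) a (e : R) : 0 < e -> hol (bal a e) f -> f a != 0 ->
  exists2 d : R, 0 < d <= e & exists psi : E -> C, hol (bal a d) psi /\
    forall u, bal a d u -> psi u ^+ 2 = f u /\ psi u != 0.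
Proof.
move=> e0 hf fa; have [S hS] := sqrt_branch.
have n0 := nr_gt0 fa; have [L hL] := hf a (balC _ e0).
have [d d0 hd] := cder_cont hL (divr_gt0 n0 (ltr0n _ 4) : 0 < nr (f a) / 4).
have close u : bal a (Num.min d e) u -> nr (f u / f a - 1) < 2^-1.
  rewrite /bal /= lt_min => /andP[h _]; have h' := hd _ h.
  have -> : f u / f a - 1 = (f u - f a) / f a by field.
  rewrite nrM nrV ltr_pdivrMr//; lra.
exists (Num.min d e); first by rewrite lt_min d0 e0 ge_min lexx orbT.
exists (fun u => sqrtC (f a) * S (f u / f a)); split.
  move=> u ub; have [_ [b hb]] := hS _ (close u ub).
  have ue : bal a e u by move: ub; rewrite /bal /= lt_min => /andP[].
  have [L' hL'] := hf u ue; eexists; apply: cderZ; apply: (@cder_comp R E S (fun u => f u / f a) u _ b hb).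
  exact: cderM hL' (cder_cst _ _).
move=> u ub; have [h _] := hS _ (close u ub).
have e1 : (sqrtC (f a) * S (f u / f a)) ^+ 2 = f u by rewrite exprMn sqrtCK h; field.
split=> //; rewrite -sqrf_eq0 e1; apply/eqP => h0.
have := close u ub; rewrite h0 mul0r sub0r nrN nr1; lra.
Qed.

End SquareRoot.

(** * Directional derivatives as opaque derivations *)

HB.lock Definition dv (R : realType) (E : normedModType R[i]) (f : E -> R[i]) (u v : E) : R[i] := 'D_v f u.

Section Derivations.
Variable R : realType.
Local Notation C := R[i].
Variable E : normedModType C.
Implicit Types (B : set E) (f g L : E -> C) (u v : E).

Lemma dvE f u v : dv f u v = 'D_v f u. Proof. by rewrite dv.unlock. Qed.

Lemma cder_dv B f u : hol B f -> B u -> cder f u (dv f u).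
Proof. by move=> hf Bu; apply: cder_eqL (hol_cder hf Bu) => v; rewrite dvE. Qed.

Lemma dv_cder f u L v : cder f u L -> dv f u v = L v.
Proof. by move=> /cder_differentiable[_ h]; rewrite dvE; exact: h. Qed.

Lemma dv_cst (c : C) u v : dv (fun=> c) u v = 0.
Proof. exact: dv_cder (cder_cst c u). Qed.

Lemma dv_ext B f g u v : nbhs u B -> hol B f -> (forall x, B x -> f x = g x) -> dv g u v = dv f u v.
Proof.
move=> nB hf h; apply: dv_cder; apply: (cder_loc _ (cder_dv hf (nbhs_singleton nB))).
by apply: filterS nB => x; exact: h.
Qed.

Lemma dv_mul B f g u v : B u -> hol B f -> hol B g ->
  dv (fun x => f x * g x) u v = dv f u v * g u + f u * dv g u v.
Proof.
move=> Bu hf hg; by rewrite (dv_cder v (cderM (cder_dv hf Bu) (cder_dv hg Bu))); ring.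
Qed.

Lemma dv_lin B f u (a : C) x y : B u -> hol B f -> dv f u (a *: x + y) = a * dv f u x + dv f u y.
Proof. by move=> Bu hf; exact: (cder_lin (cder_dv hf Bu)). Qed.

Lemma dv_hol u0 (r : R) f v : hol (bal u0 r) f -> hol (bal u0 r) (fun w => dv f w v).
Proof.
move=> hf; have -> : (fun w => dv f w v) = (fun w => 'D_v f w) by apply/funext => w; rewrite dvE.
exact: hol_D.
Qed.

Lemma dv_comm u0 (r : R) f x v u : hol (bal u0 r) f -> bal u0 r u ->
  dv (fun w => dv f w v) u x = dv (fun w => dv f w x) u v.
Proof.
move=> hf ur; have e y : (fun w => dv f w y) = (fun w => 'D_y f w) by apply/funext => w; rewrite dvE.
have E1 : dv (fun w => dv f w v) u x = 'D_x (fun w => 'D_v f w) u.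
  rewrite (e v).
  exact: dvE.
have E2 : dv (fun w => dv f w x) u v = 'D_v (fun w => 'D_x f w) u.
  rewrite (e x).
  exact: dvE.
have E3 := D_comm x v hf ur.
exact: (etrans E1 (etrans E3 (esym E2))).
Qed.

End Derivations.

(** * Rotation coefficients of a solution *)

Section Solutions.
Variable R : realType.
Local Notation C := R[i].
Variable N : nat.
Local Notation CN := 'rV[C]_N.
Local Notation del k := (delta_mx 0 k : CN).
Implicit Types (eta : 'I_N -> CN -> C) (u v w : CN).

Lemma partialE k (f : CN -> C) u : partial k f u = dv f u (del k).
Proof. by rewrite dvE. Qed.

Lemma dv_partial (f : CN -> C) B u v : hol B f -> B u ->
  dv f u v = \sum_(k < N) v 0 k * dv f u (del k).
Proof.
move=> hf Bu; rewrite (D_partial v (cder_dv hf Bu)).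
by apply: eq_bigr => k _; rewrite partialE.
Qed.

Definition soln (D : C) (B : set CN) eta := (forall i, hol B (eta i)) /\
  forall u, B u -> [/\ forall i, eta i u != 0,
    forall a b, partial b (eta a) u = partial a (eta b) u,
    forall i, \sum_(k < N) partial k (eta i) u = 0,
    forall i, D * eta i u + \sum_(k < N) u 0 k * partial k (eta i) u = 0 &
    let e a b := partial b (eta a) in
    forall i j k, k != i -> i != j -> j != k ->
       partial k (e i j) u - 2^-1 * (e i j u * e k j u / eta j u
                 + e j k u * e i k u / eta k u + e k i u * e j i u / eta i u) = 0].

Section Frame.
Variables (D : C) (a : CN) (e0 : R) (eta : 'I_N -> CN -> C) (psi : 'I_N -> CN -> C).
Local Notation B := (bal a e0).
Hypothesis sol : soln D B eta.
Hypothesis hpsi : forall i, hol B (psi i).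
Hypothesis psi2 : forall i u, B u -> psi i u ^+ 2 = eta i u.
Hypothesis conf : forall u i j, B u -> i != j -> u 0 i != u 0 j.

Let psi0 i u : B u -> psi i u != 0.
Proof. by move=> Bu; have [h _ _ _ _] := sol.2 u Bu; have := h i; rewrite -psi2// sqrf_eq0. Qed.

Let ee i j u := dv (eta i) u (del j).

(** Rotation coefficients of the diagonal metric with Lame coefficients psi_i, characterised by d_k
    psi_i = gamma_ik psi_k for i != k. The diagonal value is a convention, as the diagonal always
    meets a factor u_i - u_i or w_i - w_i. *)
Definition gam i j u : C := if i == j then 0 else dv (eta i) u (del j) / (2 * psi i u * psi j u).

Let e_hol i j : hol B (ee i j).
Proof. exact: dv_hol (sol.1 i). Qed.

Lemma gam_hol i j : hol B (gam i j).
Proof.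
rewrite /gam; case: eqVneq => ij; first exact: hol_cst.
apply: holM; first exact: e_hol.
apply: holV; first by move=> u Bu; rewrite !mulf_neq0 ?psi0 ?pnatr_eq0.
by apply: holM => //; apply: holM => //; exact: hol_cst.
Qed.

Let ee_sym i j u : B u -> ee i j u = ee j i u.
Proof. by move=> Bu; have [_ h _ _ _] := sol.2 u Bu; have := h i j; rewrite !partialE. Qed.

Lemma gam_sym i j u : B u -> gam i j u = gam j i u.
Proof.
move=> Bu; rewrite /gam eq_sym; case: eqVneq => // ij.
by rewrite -!/(ee _ _ _) ee_sym//; congr (_ / _); ring.
Qed.

Let gamE i j u : B u -> i != j -> ee i j u = 2 * (psi i u * psi j u * gam i j u).
Proof.
move=> Bu ij; rewrite /gam (negPf ij) /ee; field.
by rewrite !psi0.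
Qed.

Let two0 : 2 != 0 :> C. Proof. by rewrite pnatr_eq0. Qed.

Let D_eta u v i : B u -> dv (eta i) u v = 2 * (psi i u * dv (psi i) u v).
Proof.
move=> Bu; rewrite (dv_ext v (bal_nbhs Bu) (holM (hpsi i) (hpsi i)) (fun x Bx => psi2 i Bx)).
by rewrite (dv_mul v Bu (hpsi i) (hpsi i)); ring.
Qed.

Let D_e u v i j : B u -> i != j -> dv (ee i j) u v =
  2 * (dv (psi i) u v * psi j u * gam i j u + psi i u * dv (psi j) u v * gam i j u +
       psi i u * psi j u * dv (gam i j) u v).
Proof.
move=> Bu ij; have nB := bal_nbhs Bu.
have h2 := @hol_cst R CN B 2; have h3 := holM (hpsi i) (hpsi j); have h4 := holM h3 (gam_hol i j).
rewrite (dv_ext v nB (holM h2 h4) (fun x Bx => esym (gamE Bx ij))).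
rewrite (dv_mul v Bu h2 h4) (dv_mul v Bu h3 (gam_hol i j)) (dv_mul v Bu (hpsi i) (hpsi j)).
by rewrite dv_cst; ring.
Qed.

Let one : CN := const_mx 1.

Let eta_one u i : B u -> dv (eta i) u one = 0.
Proof.
move=> Bu; rewrite (dv_partial one (sol.1 i) Bu).
have [_ _ h _ _] := sol.2 u Bu; rewrite -[RHS](h i); apply: eq_bigr => k _.
by rewrite mxE mul1r partialE.
Qed.

Let eta_u u i : B u -> dv (eta i) u u = - D * eta i u.
Proof.
move=> Bu; rewrite (dv_partial u (sol.1 i) Bu).
have [_ _ _ h _] := sol.2 u Bu; have /eqP := h i; rewrite addrC addr_eq0 mulNr => /eqP <-.
by apply: eq_bigr => k _; rewrite partialE.
Qed.

Let e_one u i j : B u -> dv (ee i j) u one = 0.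
Proof.
move=> Bu; rewrite (dv_comm one (del j) (sol.1 i) Bu).
rewrite (dv_ext (del j) (bal_nbhs Bu) (@hol_cst R CN B 0)); first exact: dv_cst.
by move=> x Bx; rewrite eta_one.
Qed.

(** A derivative of a function homogeneous of degree -D is homogeneous of degree -D - 1. Freeze the
    direction u: Euler's relation at x turns the derivative of eta_i at x along u into -D eta_i(x) -
    sum_k (x_k - u_k) d_k eta_i(x), which is then differentiated at x = u. *)
Let e_u u i j : B u -> dv (ee i j) u u = - (D + 1) * ee i j u.
Proof.
move=> Bu; rewrite (dv_comm u (del j) (sol.1 i) Bu).
have Fh : cder (fun x => - D * eta i x - \sum_k (x 0 k - u 0 k) * ee i k x) u
   (fun v => - D * dv (eta i) u v - \sum_k v 0 k * ee i k u).
  have h := cderB (cderZ (- D) (cder_dv (sol.1 i) Bu)) (cder_sum (index_enum _) (fun k (_ : true) =>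
    cderM (cderB (cder_coord u k) (cder_cst (u 0 k) u)) (cder_dv (e_hol i k) Bu))).
  apply: (cder_eqL _ h) => v; congr (_ - _); apply: eq_bigr => k _.
  by rewrite subrr; ring.
have Gh : cder (fun x => dv (eta i) x u) u (fun v => - D * dv (eta i) u v - \sum_k v 0 k * ee i k u).
  apply: cder_loc Fh; apply: filterS (bal_nbhs Bu) => x Bx; rewrite -(eta_u i Bx).
  have -> : dv (eta i) x u = dv (eta i) x ((-1) *: (x - u) + x).
    by congr dv; rewrite scaleN1r opprB subrK.
  rewrite (dv_lin _ _ _ Bx (sol.1 i)) mulN1r [RHS]addrC; congr (_ - _).
  rewrite (dv_partial (x - u) (sol.1 i) Bx).
  by apply: eq_bigr => k _; rewrite !mxE.
rewrite (dv_cder (del j) Gh) -(dv_partial (del j) (sol.1 i) Bu) /ee; ring.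
Qed.

Let psi_one u i : B u -> dv (psi i) u one = 0.
Proof.
move=> Bu; have := D_eta one i Bu; rewrite eta_one// => /esym/eqP.
by rewrite !mulf_eq0 (negPf two0) (negPf (psi0 i Bu)) /= => /eqP.
Qed.

Let psi_u u i : B u -> dv (psi i) u u = - D / 2 * psi i u.
Proof.
move=> Bu; have := D_eta u i Bu; rewrite eta_u// -psi2// => h.
apply: (mulfI (psi0 i Bu)); apply: (mulfI two0).
by rewrite -h; field.
Qed.

Let psi_k u i k : B u -> i != k -> dv (psi i) u (del k) = gam i k u * psi k u.
Proof.
move=> Bu ik; have := D_eta (del k) i Bu; rewrite -/(ee i k u) gamE// => h.
apply: (mulfI (psi0 i Bu)); apply: (mulfI two0).
by rewrite -h; ring.
Qed.

(** Along (1, ..., 1) the psi_i are constant, so w_i times this vector may be subtracted from w.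
    This removes component i; the other components are covered by [psi_k]. *)
Lemma psi_D u i w : B u -> dv (psi i) u w = \sum_k (w 0 k - w 0 i) * gam i k u * psi k u.
Proof.
move=> Bu; have {1}-> : w = w 0 i *: one + (w - w 0 i *: one) by rewrite addrC subrK.
rewrite (dv_lin _ _ _ Bu (hpsi i)) psi_one// mulr0 add0r.
rewrite (dv_partial _ (hpsi i) Bu); apply: eq_bigr => k _.
rewrite !mxE mulr1; have [->|ki] := eqVneq k i; first by rewrite subrr !mul0r.
by rewrite -mulrA -psi_k// eq_sym.
Qed.

Let gam_one u i j : B u -> dv (gam i j) u one = 0.
Proof.
move=> Bu; have [->|ij] := eqVneq i j; first by rewrite /gam eqxx dv_cst.
have := D_e one Bu ij; rewrite e_one// !psi_one// !(mulr0, mul0r, add0r) => /esym/eqP.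
by rewrite !mulf_eq0 (negPf two0) !(negPf (psi0 _ Bu)) /= => /eqP.
Qed.

Let gam_u u i j : B u -> dv (gam i j) u u = - gam i j u.
Proof.
move=> Bu; have [->|ij] := eqVneq i j; first by rewrite /gam eqxx oppr0 dv_cst.
have := D_e u Bu ij; rewrite e_u// !psi_u// gamE// => h.
apply: (mulfI (psi0 i Bu)); apply: (mulfI (psi0 j Bu)); apply: (mulfI two0).
have -> : 2 * (psi j u * (psi i u * dv (gam i j) u u)) =
  - (D + 1) * (2 * (psi i u * psi j u * gam i j u)) -
  2 * (- D / 2 * psi i u * psi j u * gam i j u + psi i u * (- D / 2 * psi j u) * gam i j u).
  by rewrite h; ring.
by field.
Qed.

(** The quadratic equation of the system equals 2 psi_i psi_j times this Darboux equation once eta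
    is expressed through psi and gamma. *)
Let gam_k u i j k : B u -> k != i -> i != j -> j != k ->
  dv (gam i j) u (del k) = gam i k u * gam k j u.
Proof.
move=> Bu ki ij jk; have [_ _ _ _ h] := sol.2 u Bu.
have ik : i != k by rewrite eq_sym.
have kj : k != j by rewrite eq_sym.
have ji : j != i by rewrite eq_sym.
have := h i j k ki ij jk; rewrite /= partialE.
have -> : partial j (eta i) = ee i j by apply/funext => x; rewrite partialE.
rewrite (D_e (del k) Bu ij) !partialE -!/(ee _ _ _) !psi_k// !gamE// -!psi2//.
rewrite (gam_sym k i Bu) (gam_sym j k Bu) (gam_sym j i Bu).
move: (psi0 i Bu) (psi0 j Bu) (psi0 k Bu).
move: (dv (gam i j) u (del k)) => d.
move: (psi i u) (psi j u) (psi k u) (gam i j u) (gam i k u) (gam k j u) => x y z p q r x0 y0 z0.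
have -> : 2 * (q * z * y * p + x * (r * z) * p + x * y * d) - 2^-1 *
  (2 * (x * y * p) * (2 * (z * y * r)) / y ^+ 2 + 2 * (y * z * r) * (2 * (x * z * q)) / z ^+ 2
   + 2 * (z * x * q) * (2 * (y * x * p)) / x ^+ 2) = 2 * (x * y) * (d - q * r).
  by field; rewrite x0 y0 z0.
by move=> /eqP; rewrite !mulf_eq0 (negPf two0) (negPf x0) (negPf y0) /= subr_eq0 => /eqP.
Qed.

(** The (i, j) entry of d_w V = W V - V W. Since gamma is translation invariant and homogeneous of
    degree -1, a combination of (1, ..., 1) and u can be subtracted from w so that components i and
    j vanish; the remaining ones are given by [gam_k]. *)
Lemma gam_D u i j w : B u ->
  (w 0 j - w 0 i) * gam i j u + (u 0 j - u 0 i) * dv (gam i j) u w =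
  \sum_k gam i k u * gam k j u *
     ((w 0 k - w 0 i) * (u 0 j - u 0 k) - (u 0 k - u 0 i) * (w 0 j - w 0 k)).
Proof.
move=> Bu; have [ij|ij] := eqVneq i j.
  rewrite -ij !subrr !mul0r add0r big1// => k _; rewrite (_ : _ - _ = 0) ?mulr0//; ring.
have d : u 0 j - u 0 i != 0 by rewrite subr_eq0 conf// eq_sym.
pose be := (w 0 j - w 0 i) / (u 0 j - u 0 i).
pose ws := w - ((w 0 i - be * u 0 i) *: one + be *: u).
have gl := dv_lin _ _ _ Bu (gam_hol i j).
have -> : dv (gam i j) u w = dv (gam i j) u ws - be * gam i j u.
  have -> : w = 1 *: ws + ((w 0 i - be * u 0 i) *: one + (be *: u + 0)).
    by rewrite scale1r addr0 /ws subrK.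
  rewrite !gl gam_one// mulr0 add0r gam_u// (cder_lin0 (cder_dv (gam_hol i j) Bu)).
  by rewrite mul1r addr0 mulrN.
have -> : (w 0 j - w 0 i) * gam i j u = (u 0 j - u 0 i) * (be * gam i j u).
  by rewrite /be; field.
rewrite -mulrDr [be * _ + _]addrC subrK (dv_partial ws (gam_hol i j) Bu) mulr_sumr.
apply: eq_bigr => k _; have wk : (u 0 j - u 0 i) * ws 0 k =
   (w 0 k - w 0 i) * (u 0 j - u 0 k) - (u 0 k - u 0 i) * (w 0 j - w 0 k).
  by rewrite /ws /be !mxE; field.
rewrite mulrA wk; have [->|ki] := eqVneq k i.
  by rewrite !subrr !mul0r subrr mul0r mulr0.
have [->|jk] := eqVneq j k; first by rewrite !subrr !mulr0 subrr mul0r mulr0.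
by rewrite gam_k// mulrC.
Qed.

End Frame.

End Solutions.

(** * Cauchy's formula outside the discs *)

Section Exterior.
Variable R : realType.
Local Notation C := R[i].

Lemma hol_id (B : set C) : hol B (fun z : C => z).
Proof. by move=> z _; eexists; exact: cd_id. Qed.

Lemma mean_hol0 (f : C -> C) (r r0 : R) : 0 < r < r0 -> hol [set z : C | nr z <= r0] f ->
  mean r (fun s => f s * s) = 0.
Proof.
move=> rr hf; have r1 : 0 < r by case/andP: rr.
have h z : nr (z - 0) <= r0 -> exists L, cder (fun z => f z * z) z L.
  by rewrite subr0 => zr; apply: (holM hf (@hol_id _)).
have c0 : nr (0 - 0 : C) < r by rewrite subrr nr0.
have := cauchy rr h c0; rewrite mulr0 => e; rewrite -[RHS]e.
apply: mean_ext => [|s sr]; first exact: ltW.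
by rewrite !subrr subr0 add0r divff ?mulr1// nr_neq0// sr.
Qed.

(** For n = 0 this is Cauchy's formula at the centre for 1 / (s - z), whose pole lies outside the
    circle; the induction step is the partial fraction of 1 / (s (s - z)). *)
Lemma mean_resolvent (r : R) (z : C) n : 0 < r -> r < nr z ->
  mean r (fun s => s^-1 ^+ n * (s - z)^-1) = - z^-1 ^+ n.+1.
Proof.
move=> r0 rz; have z0 : z != 0 by rewrite nr_neq0//; lra.
have sz (s : C) : nr s = r -> nr z - r <= nr (s - z) by rewrite [nr (s - _)]nrBC => <-; exact: nrBl.
have sz0 (s : C) : nr s = r -> s - z != 0 by move=> /sz h; rewrite nr_neq0//; lra.
have s0 (s : C) : nr s = r -> s != 0 by move=> sr; rewrite nr_neq0// sr.
elim: n => [|n IH].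
  have rr : 0 < r < (r + nr z) / 2 by lra.
  have h s : nr (s - 0) <= (r + nr z) / 2 -> exists L, cder (fun s : C => (s - z)^-1) s L.
    rewrite subr0 => sr; have s1 : s - z != 0.
      by rewrite nr_neq0// nrBC; apply: lt_le_trans (nrBl z s); lra.
    by eexists; apply: cderV; [exact: s1|apply: cderB; [exact: cd_id|exact: cder_cst]].
  have c0 : nr (0 - 0 : C) < r by rewrite subrr nr0.
  rewrite expr1 -invrN -[- z]sub0r -(cauchy rr h c0); apply: mean_ext => [|s sr]; first exact: ltW.
  by rewrite expr0 mul1r !subrr subr0 add0r divff ?s0// mulr1 add0r.
have b1 m : bnd_on r (fun s => s^-1 ^+ m).
  by exists (r^-1 ^+ m) => s sr; rewrite nrX nrV sr.
have b2 m : bnd_on r (fun s => s^-1 ^+ m * (s - z)^-1).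
  exists (r^-1 ^+ m * (nr z - r)^-1) => s sr; rewrite nrM nrX !nrV sr.
  rewrite ler_wpM2l ?exprn_ge0 ?invr_ge0 ?(ltW r0)// lef_pV2 ?sz// posrE ?subr_gt0//.
  by rewrite nr_gt0// sz0.
rewrite (mean_ext (ltW r0) (H := fun s => z^-1 * (s^-1 ^+ n * (s - z)^-1 - s^-1 ^+ n.+1))); last first.
  move=> s sr; rewrite exprSr; move: (s0 _ sr) (sz0 _ sr) => h1 h2.
  rewrite -[s^-1 ^+ n * _ - _]mulrBr [RHS]mulrCA -[LHS]mulrA; congr (_ * _); by field; rewrite z0 h1 h2.
rewrite meanZ ?(ltW r0)//; last first.
  have [M hM] := b2 n; have [M' hM'] := b1 n.+1; exists (M + M') => s sr.
  by apply: le_trans (nrB _ _) _; rewrite lerD ?hM ?hM'.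
rewrite meanB ?(ltW r0)// IH (mean_ext (ltW r0) (H := fun s => s ^- n.+1)); last by move=> s _; rewrite exprVn.
by rewrite mean_powV// subr0 mulrN -exprS.
Qed.

Variables (N : nat) (u0 : 'I_N -> C) (rho0 : R).
Hypothesis rho00 : 0 < rho0.
Hypothesis sep : forall a b, a != b -> 10 * rho0 <= nr (u0 a - u0 b).

Definition dom (lam : C) := forall j, 2 * rho0 <= nr (lam - u0 j).
Definition sdom (lam : C) := forall j, 2 * rho0 < nr (lam - u0 j).

Lemma dom_circle j (s : C) : 2 * rho0 <= nr s <= 4 * rho0 -> dom (u0 j + s).
Proof.
have r0 := rho00; move=> /andP[h1 h2] k; have [<-|jk] := eqVneq j k; first by rewrite [u0 j + s]addrC addrK.
have := sep jk; have := nrBl (u0 j - u0 k) (- s); rewrite nrN opprK.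
rewrite (_ : u0 j - u0 k + s = u0 j + s - u0 k); last by ring.
by move: (nr (u0 j - u0 k)) (nr (u0 j + s - u0 k)) => x y; lra.
Qed.

(** The Cauchy integral of [F] over the circle about u0_j; the factor s comes from ds in [mean]. *)
Definition cker (F : C -> C) j lam := mean (2 * rho0) (fun s => F (u0 j + s) * (s / (u0 j + s - lam))).

Let kd j (lam s : C) : nr s = 2 * rho0 -> nr (lam - u0 j) - 2 * rho0 <= nr (u0 j + s - lam).
Proof.
move=> <-; apply: le_trans (nrBl _ _) _; rewrite nrBC; rewrite (_ : s - _ = u0 j + s - lam)//; ring.
Qed.

Lemma cker_bnd (F : C -> C) (M : R) j (lam s : C) : (forall lam, dom lam -> nr (F lam) <= M) ->
  2 * rho0 < nr (lam - u0 j) -> nr s = 2 * rho0 ->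
  nr (F (u0 j + s) * (s / (u0 j + s - lam))) <= M * (2 * rho0 / (nr (lam - u0 j) - 2 * rho0)).
Proof.
have r0 := rho00; move=> hF hl sr; rewrite nrM; apply: ler_pM; rewrite ?nr_ge0//.
  by apply/hF/dom_circle; rewrite sr; apply/andP; split; lra.
have p : 0 < nr (lam - u0 j) - 2 * rho0 by rewrite subr_gt0.
have q := kd j lam sr; rewrite nrM nrV sr; apply: ler_wpM2l; first by lra.
by rewrite lef_pV2 ?posrE//; apply: lt_le_trans q.
Qed.

Definition ext_id (F : C -> C) (c : C) := (exists M : R, forall lam, dom lam -> nr (F lam) <= M) /\
  forall lam, sdom lam -> F lam = c - \sum_j cker F j lam.

(** Rational functions with poles among the u0_j, generated together with their value at infinity.
    Cauchy's formula is thereby checked on generators only. *)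
Inductive ext : (C -> C) -> C -> Prop :=
| ext_cst c : ext (fun=> c) c
| ext_add F c G d : ext F c -> ext G d -> ext (fun l => F l + G l) (c + d)
| ext_scal k F c : ext F c -> ext (fun l => k * F l) (k * c)
| ext_inv j n : ext (fun l => (l - u0 j)^-1 ^+ n.+1) 0
| ext_eq F G c : (forall l, dom l -> F l = G l) -> ext F c -> ext G c.

Let sdom_dom l : sdom l -> dom l. Proof. by move=> h j; exact: ltW. Qed.

Let bnd_cker (F : C -> C) lam j : (exists M : R, forall lam, dom lam -> nr (F lam) <= M) -> sdom lam ->
  bnd_on (2 * rho0) (fun s => F (u0 j + s) * (s / (u0 j + s - lam))).
Proof. by move=> [M hM] sl; eexists => s sr; exact: (cker_bnd hM (sl j) sr). Qed.

Let r2 : 0 < 2 * rho0. Proof. by rewrite mulr_gt0. Qed.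

(** Both sides are linear in the function. Among the integrals of the generators only that of (l -
    u0_j)^-(n+1) over circle j is nonzero, by [mean_resolvent]; in all the others the integrand is
    holomorphic inside the circle. *)
Lemma ext_idP F c : ext F c -> ext_id F c.
Proof.
have r0 := rho00.
elim=> {F c} [c|F c G d _ [bF IF] _ [bG IG]|k F c _ [bF IF]|j n|F G c FG _ [bF IF]].
- split; first by exists (nr c).
  move=> lam sl; rewrite big1 ?subr0// => j _; rewrite /cker.
  have rr : 0 < 2 * rho0 < (2 * rho0 + nr (lam - u0 j)) / 2 by have := sl j; lra.
  rewrite -[RHS](@mean_hol0 (fun s => c * (u0 j + s - lam)^-1) _ _ rr).
    by apply: mean_ext => [|s _]; [exact: ltW|rewrite -mulrA [_^-1 * s]mulrC].
  apply: holM; first exact: hol_cst.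
  apply: holV; last by apply: holB; [apply: holD; [exact: hol_cst|exact: hol_id]|exact: hol_cst].
  move=> s /= hs; rewrite nr_neq0// (_ : u0 j + s - lam = s - (lam - u0 j)); last by ring.
  by rewrite nrBC; apply: lt_le_trans (nrBl _ _); have := sl j; lra.
- split; first by have [M hM] := bF; have [M' hM'] := bG; exists (M + M') => l dl;
    apply: le_trans (nrD _ _) _; rewrite lerD ?hM ?hM'.
  move=> lam sl; rewrite IF// IG// addrACA -opprD -big_split/=; congr (_ - _).
  apply: eq_bigr => j _; rewrite /cker -meanD ?(ltW r2)//; [|exact: bnd_cker..].
  by apply: mean_ext => [|s _]; [exact: ltW|rewrite mulrDl].
- split; first by have [M hM] := bF; exists (nr k * M) => l dl; rewrite nrM ler_wpM2l ?nr_ge0 ?hM.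
  move=> lam sl; rewrite IF// mulrBr mulr_sumr; congr (_ - _).
  apply: eq_bigr => j _; rewrite /cker -meanZ ?(ltW r2)//; last exact: bnd_cker.
  by apply: mean_ext => [|s _]; [exact: ltW|rewrite mulrA].
- have bF : exists M : R, forall l, dom l -> nr ((l - u0 j)^-1 ^+ n.+1) <= M.
    exists ((2 * rho0)^-1 ^+ n.+1) => l /(_ j) dl; rewrite nrX nrV lerXn2r ?nnegrE ?invr_ge0 ?nr_ge0 ?(ltW r2)//.
    by rewrite lef_pV2// posrE//; apply: lt_le_trans r2 _.
  split=> // lam sl; rewrite (bigD1 j)//= big1 ?addr0 => [|k kj].
    rewrite /cker (mean_ext (ltW r2) (H := fun s => s^-1 ^+ n * (s - (lam - u0 j))^-1)).
      by rewrite mean_resolvent// sub0r opprK.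
    move=> s sr; have s0 : s != 0 by rewrite nr_neq0// sr.
    rewrite addrAC subrr add0r exprSr -mulrA mulKf//; congr (_ * _^-1); ring.
  rewrite /cker; have rr : 0 < 2 * rho0 < Num.min (3 * rho0) ((2 * rho0 + nr (lam - u0 k)) / 2).
    by rewrite lt_min r2 /=; have := sl k; lra.
  rewrite -[RHS](@mean_hol0 (fun s => (u0 k + s - u0 j)^-1 ^+ n.+1 * (u0 k + s - lam)^-1) _ _ rr).
    by apply: mean_ext => [|s _]; [exact: ltW|rewrite -mulrA [_^-1 * s]mulrC].
  have hl (m : C) : hol [set z : C | nr z <= Num.min (3 * rho0) ((2 * rho0 + nr (lam - u0 k)) / 2)]
     (fun s => u0 k + s - m).
    by apply: holB; [apply: holD; [exact: hol_cst|exact: hol_id]|exact: hol_cst].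
  apply: holM.
    apply: holX; apply: holV (hl _) => s /=; rewrite le_min => /andP[h1 _].
    rewrite nr_neq0// (_ : u0 k + s - u0 j = (u0 k - u0 j) - - s); last by ring.
    by apply: lt_le_trans (nrBl _ _); rewrite nrN; have := sep kj; lra.
  apply: holV (hl _) => s /=; rewrite le_min => /andP[_ h1].
  rewrite nr_neq0// (_ : u0 k + s - lam = s - (lam - u0 k)); last by ring.
  by rewrite nrBC; apply: lt_le_trans (nrBl _ _); have := sl k; lra.
- split; first by have [M hM] := bF; exists M => l dl; rewrite -FG// hM.
  move=> lam sl; rewrite -FG; last exact: sdom_dom.
  rewrite IF//; congr (_ - _); apply: eq_bigr => j _; apply: mean_ext => [|s sr]; first exact: ltW.
  by rewrite FG//; apply: dom_circle; rewrite sr; apply/andP; split; lra.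
Qed.

(** Partial fractions, each of which lowers the total order m + n by one. *)
Lemma ext_invM j m k n : ext (fun l => (l - u0 j)^-1 ^+ m.+1 * (l - u0 k)^-1 ^+ n.+1) 0.
Proof.
have [<-|jk] := eqVneq j k.
  by apply: ext_eq (ext_inv j (m + n.+1)) => l _; rewrite -exprD addSn.
have d0 : u0 j - u0 k != 0.
  by rewrite nr_neq0//; apply: lt_le_trans (sep jk); rewrite mulr_gt0.
have key l : dom l -> (l - u0 j)^-1 * (l - u0 k)^-1 =
    (u0 j - u0 k)^-1 * ((l - u0 j)^-1 + -1 * (l - u0 k)^-1).
  move=> dl; have nz i : l - u0 i != 0 by rewrite nr_neq0//; apply: lt_le_trans (dl i).
  by have h1 := nz j; have h2 := nz k; field; rewrite d0 h1 h2.
have [K] := ubnP (m + n); elim: K m n => // K IH m n.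
rewrite ltnS => mn; have sub (a b : nat) : (a + b <= (m + n).+1)%N -> (0 < a + b)%N ->
    ext (fun l => (l - u0 j)^-1 ^+ a * (l - u0 k)^-1 ^+ b) 0.
  case: a b => [|a] [|b] //= h _.
  - by apply: ext_eq (ext_inv k b) => l _; rewrite expr0 mul1r.
  - by apply: ext_eq (ext_inv j a) => l _; rewrite expr0 mulr1.
  by apply: IH; lia.
have h1 := sub m.+1 n; have h2 := sub m n.+1.
have {}h1 : ext (fun l => (l - u0 j)^-1 ^+ m.+1 * (l - u0 k)^-1 ^+ n) 0 by apply: h1; lia.
have {}h2 : ext (fun l => (l - u0 j)^-1 ^+ m * (l - u0 k)^-1 ^+ n.+1) 0 by apply: h2; lia.
have := ext_scal (u0 j - u0 k)^-1 (ext_add h1 (ext_scal (-1) h2)).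
rewrite mulr0 addr0 mulr0; apply: ext_eq => l dl.
rewrite !exprSr; have := key _ dl; move: (_^-1 ^+ m) (_^-1 ^+ n) => x y.
move: (l - u0 j)^-1 (l - u0 k)^-1 => p q e.
have -> : x * p * (y * q) = x * y * (p * q) by ring.
by rewrite e; ring.
Qed.

Lemma ext_mul F c G d : ext F c -> ext G d -> ext (fun l => F l * G l) (c * d).
Proof.
move=> hF; elim: hF G d => {F c} [c|F c F' c' _ IF _ IF'|k F c _ IF|j n|F F' c FF _ IF] G d hG.
- exact: ext_scal.
- by rewrite mulrDl; apply: ext_eq (ext_add (IF _ _ hG) (IF' _ _ hG)) => l _; rewrite mulrDl.
- by rewrite -mulrA; apply: ext_eq (ext_scal k (IF _ _ hG)) => l _; rewrite mulrA.
- rewrite mul0r; elim: hG => {G d} [d|G d G' d' _ IG _ IG'|k G d _ IG|k m|G G' d GG _ IG].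
  + by have := ext_scal d (ext_inv j n); rewrite mulr0; apply: ext_eq => l _; rewrite mulrC.
  + by have := ext_add IG IG'; rewrite addr0; apply: ext_eq => l _; rewrite mulrDr.
  + by have := ext_scal k IG; rewrite mulr0; apply: ext_eq => l _; rewrite mulrCA.
  + exact: ext_invM.
  + by apply: ext_eq IG => l dl; rewrite GG.
- by apply: ext_eq (IF _ _ hG) => l dl; rewrite FF.
Qed.

Lemma ext_sum (I : Type) (s : seq I) (F : I -> C -> C) (c : I -> C) :
  (forall i, ext (F i) (c i)) -> ext (fun l => \sum_(i <- s) F i l) (\sum_(i <- s) c i).
Proof.
move=> h; elim: s => [|x s IH].
  by rewrite big_nil; apply: ext_eq (ext_cst 0) => l _; rewrite big_nil.
by rewrite big_cons; apply: ext_eq (ext_add (h x) IH) => l _; rewrite big_cons.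
Qed.

Variables (P Q : nat -> 'M[C]_N) (w : 'I_N -> C).

Let qX l j : C := w j / (l - u0 j).

Lemma ext_Om k a b : ext (fun l => Om_ P Q (qX l) k a b) (P k a b).
Proof.
have h : ext (fun l => P k a b + \sum_(i < k.+1) (w a ^+ i.+1 * Q (k - i)%N a b) * (l - u0 a)^-1 ^+ i.+1)
    (P k a b + \sum_(i < k.+1) (w a ^+ i.+1 * Q (k - i)%N a b) * 0).
  apply: ext_add; first exact: ext_cst.
  by apply: (@ext_sum _ _ _ (fun i : 'I_k.+1 => (w a ^+ i.+1 * Q (k - i)%N a b) * 0)) => i; apply: ext_scal; exact: ext_inv.
move: h; rewrite [X in _ + X]big1 ?addr0 => [|i _]; last by rewrite mulr0.
apply: ext_eq => l _; rewrite mxE /mcprod summxE; congr (_ + _); apply: eq_bigr => i _.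
rewrite mxE (bigD1 a)//= !mxE eqxx mulr1n big1 ?addr0 => [|c ca].
  by rewrite exprMn; ring.
by rewrite !mxE eq_sym (negPf ca) mulr0n mul0r.
Qed.

Lemma Om_0 k : Om_ P Q (fun=> 0) k = P k.
Proof.
rewrite /Om_ /mcprod big1 ?addr0// => i _; rewrite /Dg (_ : \row_j _ = 0) ?raddf0 ?mul0mx//.
by apply/rowP => j; rewrite !mxE expr0n.
Qed.

Lemma ext_Xpre n k a b : ext (fun l => Xpre (Om_ P Q (qX l)) n k a b) (Xpre (Om_ P Q (fun=> 0)) n k a b).
Proof.
elim: n k a b => [|n IH] k a b /=; first exact: ext_cst.
case: leqP => _; first exact: IH.
have h : ext (fun l => n.+1%:R^-1 * \sum_(i < n.+1) \sum_c Om_ P Q (qX l) i a c *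
     Xpre (Om_ P Q (qX l)) n (n - i)%N c b)
   (n.+1%:R^-1 * \sum_(i < n.+1) \sum_c P i a c * Xpre (Om_ P Q (fun=> 0)) n (n - i)%N c b).
  apply: ext_scal; apply: (@ext_sum _ _ _ (fun i : 'I_n.+1 => \sum_c _)) => i.
  apply: (@ext_sum _ _ _ (fun c => P i a c * Xpre (Om_ P Q (fun=> 0)) n (n - i)%N c b)) => c.
  by apply: ext_mul; [exact: ext_Om|exact: IH].
set c1 := (X in ext _ X) in h.
have e : c1 = (n.+1%:R^-1 *: \sum_(i < n.+1) Om_ P Q (fun=> 0) i *m Xpre (Om_ P Q (fun=> 0)) n (n - i)%N) a b.
  rewrite mxE summxE; congr (_ * _); apply: eq_bigr => i _; rewrite mxE Om_0; exact: eq_bigr.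
rewrite e in h; apply: ext_eq h => l _.
by rewrite mxE summxE; congr (_ * _); apply: eq_bigr => i _; rewrite mxE.
Qed.

Variables (Cp : R).
Hypotheses (hP : mgbd P Cp 4^-1) (hQ : mgbd Q Cp 4^-1).
Hypothesis hw : forall a, nr (w a) <= rho0 / 8.

(** The value of [XX] at lam = infinity, where all parameters w_j / (lam - u0_j) become 0. *)
Definition XXinf : 'M[C]_N := Xi P Q (fun=> 0) 1.

(** The partial sums of the power series in t that defines [XX] are rational in lam and belong to
    [ext]. Their tails are bounded geometrically, uniformly on [dom], so the formula survives in the
    limit. *)
Lemma exterior_cauchy a b lam : sdom lam ->
  XX P Q u0 w lam 1 a b = XXinf a b - \sum_j cker (fun l => XX P Q u0 w l 1 a b) j lam.
Proof.
have r0 := rho00; move=> sl.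
pose K := XiK N Cp 8^-1 4^-1 (7/24).
have g0 q : (forall j, nr (q j) <= 8^-1) -> gbd (fun k => Xs (Om_ P Q q) k a b) K (7/24).
  by move=> hq; apply: mgbd_gbd; apply: Xi_gbd hq _ _ _ hP hQ; lra.
have gl l : dom l -> gbd (fun k => Xs (Om_ P Q (qX l)) k a b) K (7/24).
  move=> dl; apply: g0 => j; have d := dl j; rewrite nrM nrV ler_pdivrMr; last by apply: lt_le_trans d; lra.
  by apply: le_trans (hw j) _; move: d; move: (nr (l - u0 j)) => x d; lra.
have gi : gbd (fun k => Xs (Om_ P Q (fun=> 0)) k a b) K (7/24).
  by apply: g0 => j; rewrite nr0 invr_ge0.
pose F n l := psum (fun k => Xs (Om_ P Q (qX l)) k a b) 1 n.
pose c n := psum (fun k => Xs (Om_ P Q (fun=> 0)) k a b) 1 n.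
have hE n : ext_id (F n) (c n).
  apply: ext_idP; rewrite /F /c /psum.
  apply: (@ext_sum _ _ (fun k l => Xs (Om_ P Q (qX l)) k a b * 1 ^+ k)
     (fun k => Xs (Om_ P Q (fun=> 0)) k a b * 1 ^+ k)) => k.
  have -> : Xs (Om_ P Q (fun=> 0)) k a b * 1 ^+ k = Xpre (Om_ P Q (fun=> 0)) k k a b.
    by rewrite expr1n mulr1.
  by apply: ext_eq (ext_Xpre k k a b) => l _; rewrite expr1n mulr1.
have K0 : 0 <= K := gbd_ge0 gi.
pose e n : R := K * (7/24) ^+ n / (1 - 7/24).
have tail (x : nat -> C) n : gbd x K (7/24) -> nr (ps x 1 - psum x 1 n) <= e n.
  by move=> gx; have := ps_tail (t := 1) n gx; rewrite nr1 mulr1 mul1r; apply; lra.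
have e0 n : 0 <= e n by apply: divr_ge0; [apply: mulr_ge0 => //; apply: exprn_ge0; lra|lra].
pose B : R := 2 + \sum_j (2 * rho0 / (nr (lam - u0 j) - 2 * rho0)).
have B1 : 0 < B.
  have : 0 <= \sum_j (2 * rho0 / (nr (lam - u0 j) - 2 * rho0)).
    by apply: sumr_ge0 => j _; rewrite divr_ge0 ?subr_ge0 ?(ltW (sl j))//; lra.
  by rewrite /B; lra.
set X := fun l => XX P Q u0 w l 1 a b; rewrite -[LHS]/(X lam).
have XE l : X l = ps (fun k => Xs (Om_ P Q (qX l)) k a b) 1 by rewrite /X /XX /Xi mxE.
have XF l n : dom l -> nr (X l - F n l) <= e n by move=> dl; rewrite XE; exact: tail (gl _ dl).
have bX : exists M : R, forall l, dom l -> nr (X l) <= M.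
  have [[M hM] _] := hE 0%N; exists (M + e 0%N) => l dl; rewrite -[X l](subrK (F 0%N l)) addrC.
  by apply: le_trans (nrD _ _) _; rewrite lerD ?hM ?XF.
have Xinf n : nr (XXinf a b - c n) <= e n by rewrite /XXinf /Xi mxE; exact: tail.
have eE n : e n = K * (7/24) ^+ n / (1 - 7/24) by [].
clear XE tail; clearbody e X F c.
have alg (x y c' f S1 S2 : C) : f = c' - S2 -> x - (y - S1) = (x - f) - (y - c') + (S1 - S2).
  by move=> ->; ring.
have bnd n : nr (X lam - (XXinf a b - \sum_j cker X j lam)) <= e n * B.
  have [bF h] := hE n; have {}h := h _ sl.
  have -> : X lam - (XXinf a b - \sum_j cker X j lam) =
    (X lam - F n lam) - (XXinf a b - c n) + \sum_j cker (fun l => X l - F n l) j lam.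
    have -> : \sum_j cker (fun l => X l - F n l) j lam = \sum_j cker X j lam - \sum_j cker (F n) j lam.
      rewrite -sumrB; apply: eq_bigr => j _; rewrite /cker -meanB ?(ltW r2)//; [|exact: bnd_cker..].
      by apply: mean_ext => [|s _]; [exact: ltW|rewrite mulrBl].
    exact: alg h.
  apply: le_trans (nrD _ _) _; rewrite /B mulrDr; apply: lerD.
    apply: le_trans (nrB _ _) _; rewrite mulr_natr mulr2n; apply: lerD (Xinf n).
    by apply: XF; exact: sdom_dom.
  apply: le_trans (nr_sum _ _ _) _; rewrite mulr_sumr; apply: ler_sum => j _.
  by apply: nr_mean => [|s sr]; [exact: ltW|exact: (cker_bnd (F := fun l => X l - F n l) (fun l dl => XF l n dl) (sl j) sr)].
suff h : nr (X lam - (XXinf a b - \sum_j cker X j lam)) = 0.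
  by apply/eqP; rewrite -subr_eq0; apply/eqP; exact: (nr_eq0 h).
apply/eqP; rewrite eq_le nr_ge0 andbT leNgt; apply/negP => p.
have q01 : 0 <= (7/24 : R) < 1 by lra.
have KB : 0 < K / (1 - 7/24) * B + 1 by rewrite ltr_wpDl// mulr_ge0 ?(ltW B1)//; apply: divr_ge0 => //; lra.
have [n /(_ n (leqnn _))] := geom_small q01 (divr_gt0 p KB).
rewrite ltr_pdivlMr// => h; have := bnd n; rewrite eE.
have -> : K * (7/24) ^+ n / (1 - 7/24) * B = (7/24) ^+ n * (K / (1 - 7/24) * B) by ring.
move=> h1; have q0 : 0 <= (7/24 : R) ^+ n by rewrite exprn_ge0//; lra.
by have := lt_le_trans h h1; rewrite mulrDr mulr1 gtrDl ltNge q0.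
Qed.

End Exterior.

(** * Inverses of transports and means depending on parameters *)

Section FundamentalInverse.
Variable R : realType.
Local Notation C := R[i].

Lemma mcdT m n (F : C -> 'M[C]_(m, n)) t D : mcd F t D -> mcd (fun z => (F z)^T) t D^T.
Proof.
move=> h i j; rewrite /cd; apply: (@cder_eq R C (fun z => F z j i)); first by move=> z; rewrite mxE.
by apply: (cder_eqL _ (h j i)) => v; rewrite mxE.
Qed.

Definition dualOm n (Om : nat -> 'M[C]_n) k : 'M[C]_n := - (Om k)^T.

Lemma mps_dual n (Om : nat -> 'M[C]_n) (K s : R) t : mgbd Om K s -> 0 <= s -> nr t * s < 1 ->
  mps (dualOm Om) t = - (mps Om t)^T.
Proof.
move=> h s0 ts; apply/matrixP => i j; rewrite !mxE /ps -LimN; last exact: psum_bnd (mgbd_gbd j i h) s0 ts.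
apply: Lim_ext => k; rewrite /psum -sumrN; apply: eq_bigr => l _.
by rewrite !mxE mulNr.
Qed.

Lemma mgbd_dual n (Om : nat -> 'M[C]_n) (K s : R) : mgbd Om K s -> mgbd (dualOm Om) K s.
Proof.
move=> h k; rewrite /dualOm -scaleN1r mnZ mnT nrN nr1 mul1r; exact: h.
Qed.

Lemma dual_alg n (M Y X : 'M[C]_n) : (- M^T *m Y)^T *m X + Y^T *m (M *m X) = 0.
Proof. by rewrite mulNmx raddfN /= trmx_mul trmxK mulNmx mulmxA addNr. Qed.

(** The inverse as the transposed solution of the dual equation Y' = - Om^T Y, so that it is again a
    power series with the same bounds and the same dependence on parameters. *)
Definition Xinv n (Om : nat -> 'M[C]_n) t : 'M[C]_n := (mps (Xs (dualOm Om)) t)^T.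

Lemma XinvK n (Om : nat -> 'M[C]_n) (K s s' : R) t : mgbd Om K s -> 0 <= s -> s < s' -> nr t * s' < 1 ->
  mps (Xs Om) t *m Xinv Om t = 1%:M.
Proof.
move=> h s0 ss ts; apply: mulmx1C; rewrite /Xinv.
have s'0 : 0 < s' by lra.
have tau0 : 0 < s'^-1 by rewrite invr_gt0.
have small (t0 : C) : nr t0 < s'^-1 -> nr t0 * s' < 1.
  by move=> h0; rewrite -ltr_pdivlMr// mul1r.
have tt : nr t < s'^-1 by rewrite -[s'^-1]mul1r ltr_pdivlMr.
apply: (@ode_uniq2 R n n (fun z => (mps (Xs (dualOm Om)) z)^T *m mps (Xs Om) z) (fun=> 1%:M)
  (fun=> 0) s'^-1 0 tau0 _ _ _ _ t tt) => [z zt|z zt|z _|].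
- have zs := small _ zt; have zs0 : nr z * s < 1.
    by apply: le_lt_trans zs; rewrite ler_wpM2l ?nr_ge0// ltW.
  have := mcdM (mcdT (Xs_ode s0 ss (mgbd_dual h) zs)) (Xs_ode s0 ss h zs).
  by rewrite (mps_dual h s0 zs0) dual_alg mul0mx.
- by rewrite mul0mx; exact: mcd_cst.
- by rewrite mn0.
- by rewrite !mps_at0 !Xs0 trmx1 mul1mx.
Qed.

Lemma mean_hol (E : normedModType C) u0 (r rad M : R) (G : E -> C -> C) : 0 <= rad ->
  (forall s, nr s = rad -> hol (bal u0 r) (fun u => G u s)) ->
  (forall u s, bal u0 r u -> nr s = rad -> nr (G u s) <= M) ->
  hol (bal u0 r) (fun u => mean rad (G u)).
Proof.
move=> r0 hG hM; apply: (@hol_Lim R E (fun n u => avg rad (G u) n) u0 r M) => [n|n v bv].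
  apply: holM; first exact: hol_cst.
  by apply: hol_sum => k _; apply/hG/nr_node.
by apply: avg_le => // s; exact: hM.
Qed.

End FundamentalInverse.

(** * The Riemann-Hilbert problem as a Fredholm system *)

Section Kernels.
Variable R : realType.
Local Notation C := R[i].
Variable N : nat.
Local Notation CN := 'rV[C]_N.
Variables (a : CN) (rho0 : R) (A : 'M[C]_N) (psi0 : 'I_N -> C).
Hypothesis rho00 : 0 < rho0.
Let u0 j := a 0 j.
Hypothesis sep : forall k l, k != l -> 10 * rho0 <= nr (u0 k - u0 l).

Let om (u : CN) j : C := u 0 j - a 0 j.
Let qq lam (o : C) k : C := o / (lam - u0 k).
Let OmG lam (o : C) := Om_ (sing 0) (sing A) (qq lam o).
Definition GJ lam (o : C) : 'M[C]_N := Xinv (OmG lam o) 1.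
Local Notation G lam o := (GG u0 A lam o 1).

Let om_le u j : bal a rho0 u -> nr (om u j) <= rho0.
Proof.
rewrite /bal /= => /ltW; apply: le_trans; have := nr_coord (u - a) j.
by rewrite !mxE.
Qed.

Let q_le lam o k : dom u0 rho0 lam -> nr o <= rho0 -> nr (qq lam o k) <= 2^-1.
Proof.
have r0 := rho00; move=> /(_ k) d ho; rewrite /qq nrM nrV ler_pdivrMr; last by apply: lt_le_trans d; lra.
by apply: le_trans ho _; move: d; move: (nr (lam - u0 k)) => x d; lra.
Qed.

Let hs0 (s : R) : 0 <= s -> mgbd (sing (0 : 'M[C]_N)) (mn A) s.
Proof. by move=> s0 k; rewrite /sing; case: ifP => _; rewrite mn0 mulr_ge0 ?mn_ge0// exprn_ge0. Qed.

Let KO : R := mn A + N%:R * 2^-1 * mn A / (1 - 2^-1 / (5/8)).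
Let KX : R := odeK N KO (5/8) (3/4).
Let KG : R := locked ((N * N)%:R * (KX / (1 - 3/4))).

Let OmG_bnd lam o : dom u0 rho0 lam -> nr o <= rho0 -> mgbd (OmG lam o) KO (5/8).
Proof.
move=> dl ho; apply: (@Om_bound R N (sing 0) (sing A) (qq lam o) (mn A) 2^-1 (5/8)); try lra.
- by move=> k; exact: q_le.
- by apply: hs0; lra.
- by apply: mgbd_sing; lra.
Qed.

Let G_mn lam o : dom u0 rho0 lam -> nr o <= rho0 -> mn (G lam o) <= KG.
Proof.
move=> dl ho; rewrite /KG -lock; apply: (@mps_mn R N N (Xs (OmG lam o)) KX (3/4) 1 (3/4)); rewrite ?nr1; try lra.
by apply: Xs_bound (OmG_bnd dl ho); lra.
Qed.

Let GJ_mn lam o : dom u0 rho0 lam -> nr o <= rho0 -> mn (GJ lam o) <= KG.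
Proof.
move=> dl ho; rewrite /GJ /Xinv mnT /KG -lock.
apply: (@mps_mn R N N (Xs (dualOm (OmG lam o))) KX (3/4) 1 (3/4)); rewrite ?nr1; try lra.
by apply: Xs_bound (mgbd_dual (OmG_bnd dl ho)); lra.
Qed.

Lemma GJK lam o : dom u0 rho0 lam -> nr o <= rho0 -> G lam o *m GJ lam o = 1%:M.
Proof. by move=> dl ho; apply: (XinvK (s' := 3/4) (OmG_bnd dl ho)); rewrite ?nr1; lra. Qed.

Let om_hol j : hol (bal a rho0) (fun u => om u j).
Proof. by apply: holB; [exact: hol_coord|exact: hol_cst]. Qed.

Let q_hol lam j k : hol (bal a rho0) (fun u => qq lam (om u j) k).
Proof. by apply: holM; [exact: om_hol|exact: hol_cst]. Qed.

Let G_hol lam j b c : dom u0 rho0 lam -> hol (bal a rho0) (fun u => G lam (om u j) b c).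
Proof.
move=> dl; apply: (@Xi_hol R N _ (sing 0) (sing A) (fun u => qq lam (om u j)) (fun=> 1) a rho0 (mn A) 2^-1 (5/8) (3/4) (3/4)); try lra.
- by apply: hs0; lra.
- by apply: mgbd_sing; lra.
- by move=> k; exact: q_hol.
- exact: hol_cst.
- by move=> u bu; split; [move=> k; apply: q_le => //; exact: om_le|rewrite nr1; lra].
Qed.

Let GJ_hol lam j b c : dom u0 rho0 lam -> hol (bal a rho0) (fun u => GJ lam (om u j) b c).
Proof.
move=> dl; have h : hol (bal a rho0) (fun u => ps (fun k => Xs (dualOm (OmG lam (om u j))) k c b) 1).
  apply: (@ps_hol R _ (fun k u => Xs (dualOm (OmG lam (om u j))) k c b) (fun=> 1) a rho0 KX (3/4) (3/4)); try lra.
  - move=> k; apply: (@Xpre_hol R N _ _ (fun l u => dualOm (OmG lam (om u j)) l) k k c b) => l x y.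
    have h : hol (bal a rho0) (fun u => -1 * OmG lam (om u j) l y x).
      apply: holM; first exact: hol_cst.
      by apply: (@Om_hol R N _ _ (sing 0) (sing A) (fun u => qq lam (om u j))) => k'; exact: q_hol.
    apply: hol_ext h => [u|u _]; first exact: bal_nbhs.
    by rewrite /dualOm !mxE mulN1r.
  - exact: hol_cst.
  - move=> u bu; split; last by rewrite nr1; lra.
    apply: mgbd_gbd; apply: Xs_bound; [lra|lra|].
    by apply: mgbd_dual; apply: OmG_bnd => //; exact: om_le.
apply: hol_ext h => [u|u _]; first exact: bal_nbhs.
by rewrite /GJ /Xinv !mxE.
Qed.

Lemma G_base lam : dom u0 rho0 lam -> G lam 0 = 1%:M.
Proof.
move=> dl; have n1 : nr (1 : C) < 3/2 by rewrite nr1; lra.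
apply: (@ode_uniq2 R N N (GG u0 A lam 0) (fun=> 1%:M) (fun=> 0) (3/2) 0 _ _ _ _ _ 1 n1) => [|t tt|t _|t _|]; first lra.
- have h k : nr (0 / (lam - u0 k)) <= 2^-1 by rewrite mul0r nr0; lra.
  have h2 : nr t * (5/8) < 1 by lra.
  have := GG_ode A h _ _ h2; rewrite (_ : diag_mx _ = 0) ?mul0mx; first by apply; lra.
  by apply/matrixP => x y; rewrite !mxE !mul0r mul0rn.
- by rewrite mul0mx; exact: mcd_cst.
- by rewrite mn0.
- by rewrite /GG Xi_at0.
Qed.

(** What entry [b] of the inner row of disc [j] contributes to the exterior Cauchy integral at u0_i
    + s. [kof] multiplies by the inverse jump of disc [i] and takes the Taylor coefficient of order
    [n]. Integrating z over radius 2 rho0 and s over radius 4 rho0 keeps the Cauchy kernel bounded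
    and gives decay in both indices. *)
Definition kin (F : C -> C) j b i s c u : C :=
  mean (2 * rho0) (fun z => F z * (G (u0 j + z) (om u j) b c * (z / (u0 j + z - (u0 i + s))))).
Definition kof (F : C -> C) j b n i c u : C :=
  mean (4 * rho0) (fun s => (\sum_d kin F j b i s d u * GJ (u0 i + s) (om u i) d c) * s ^- n).

Let dom2 j (z : C) : nr z = 2 * rho0 -> dom u0 rho0 (u0 j + z).
Proof. by have r0 := rho00; move=> h; apply: dom_circle => //; rewrite h; apply/andP; split; lra. Qed.

Let dom4 j (z : C) : nr z = 4 * rho0 -> dom u0 rho0 (u0 j + z).
Proof. by have r0 := rho00; move=> h; apply: dom_circle => //; rewrite h; apply/andP; split; lra. Qed.

Let sdom4 i (s : C) : nr s = 4 * rho0 -> forall j, 4 * rho0 <= nr (u0 i + s - u0 j).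
Proof.
have r0 := rho00; move=> sr j; have [<-|ij] := eqVneq i j; first by rewrite [u0 i + s]addrC addrK sr.
have := sep ij; have := nrBl (u0 i - u0 j) (- s); rewrite nrN opprK sr.
rewrite (_ : u0 i - u0 j + s = u0 i + s - u0 j); last by ring.
by move: (nr (u0 i - u0 j)) (nr (u0 i + s - u0 j)) => x y; lra.
Qed.

Let ker_le j i (z s : C) : nr z = 2 * rho0 -> nr s = 4 * rho0 ->
  nr (z / (u0 j + z - (u0 i + s))) <= 1.
Proof.
have r0 := rho00; move=> zr sr; have h : 2 * rho0 <= nr (u0 j + z - (u0 i + s)).
  rewrite nrBC; apply: (@le_trans _ _ (nr (u0 i + s - u0 j) - nr z)).
    by have := sdom4 i sr j; rewrite zr; move: (nr _) => x; lra.
  apply: le_trans (nrBl _ _) _; rewrite (_ : u0 i + s - u0 j - z = u0 i + s - (u0 j + z))//; ring.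
by rewrite nrM nrV ler_pdivrMr ?mul1r ?zr//; apply: lt_le_trans h; lra.
Qed.

Let kin_bnd (F : C -> C) M j b i s c u z : bal a rho0 u -> (forall z, nr z = 2 * rho0 -> nr (F z) <= M) ->
  nr z = 2 * rho0 -> nr s = 4 * rho0 ->
  nr (F z * (G (u0 j + z) (om u j) b c * (z / (u0 j + z - (u0 i + s))))) <= M * KG.
Proof.
move=> bu hF zr sr; rewrite nrM; apply: ler_pM; rewrite ?nr_ge0 ?hF//.
rewrite nrM -[leRHS]mulr1; apply: ler_pM; rewrite ?nr_ge0 ?ker_le//.
by apply: le_trans (mn_coef _ _ _) _; apply: G_mn; [exact: dom2|exact: om_le].
Qed.

Let r2 : 0 <= 2 * rho0. Proof. by rewrite mulr_ge0// ltW. Qed.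
Let r4 : 0 <= 4 * rho0. Proof. by rewrite mulr_ge0// ltW. Qed.

Let kin_le (F : C -> C) M j b i s c u : bal a rho0 u -> (forall z, nr z = 2 * rho0 -> nr (F z) <= M) ->
  nr s = 4 * rho0 -> nr (kin F j b i s c u) <= M * KG.
Proof. by move=> bu hF sr; apply: nr_mean => // z zr; exact: kin_bnd. Qed.

Let outer_bnd (x : C -> 'I_N -> C) M i n c u s : bal a rho0 u ->
  (forall d, nr (x s d) <= M) -> nr s = 4 * rho0 ->
  nr ((\sum_d x s d * GJ (u0 i + s) (om u i) d c) * s ^- n) <= N%:R * (M * KG) * (4 * rho0) ^- n.
Proof.
move=> bu hx sr; rewrite nrM nrV nrX sr ler_wpM2r ?invr_ge0 ?exprn_ge0//.
apply: le_trans (nr_sum _ _ _) _; apply: (@le_trans _ _ (\sum_(d < N) M * KG)); last first.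
  by rewrite sumr_const card_ord mulr_natl.
apply: ler_sum => d _; rewrite nrM; apply: ler_pM; rewrite ?nr_ge0 ?hx//.
by apply: le_trans (mn_coef _ _ _) _; apply: GJ_mn; [exact: dom4|exact: om_le].
Qed.

Lemma kof_le (F : C -> C) M j b n i c u : bal a rho0 u -> (forall z, nr z = 2 * rho0 -> nr (F z) <= M) ->
  nr (kof F j b n i c u) <= N%:R * (M * KG * KG) * (4 * rho0) ^- n.
Proof.
move=> bu hF; apply: nr_mean => // s sr; apply: (outer_bnd (x := fun s d => kin F j b i s d u)) => // d.
exact: kin_le.
Qed.

Lemma kof_lin (F H : C -> C) k j b n i c u : bal a rho0 u -> bnd_on (2 * rho0) F -> bnd_on (2 * rho0) H ->
  kof (fun z => F z + k * H z) j b n i c u = kof F j b n i c u + k * kof H j b n i c u.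
Proof.
move=> bu [M hF] [M' hH].
have bk (F' : C -> C) M0 : (forall z, nr z = 2 * rho0 -> nr (F' z) <= M0) -> bnd_on (4 * rho0)
    (fun s => (\sum_d kin F' j b i s d u * GJ (u0 i + s) (om u i) d c) * s ^- n).
  move=> h; eexists => s sr; apply: (outer_bnd (x := fun s d => kin F' j b i s d u)) => // d.
  exact: (@kin_le F' M0 j b i s d u bu h sr).
rewrite /kof -meanZ//; last exact: bk hH.
rewrite -meanD//; [|exact: bk hF|]; last first.
  have [B hB] := bk _ _ hH; exists (nr k * B) => s sr; rewrite nrM ler_wpM2l ?nr_ge0 ?hB//.
apply: mean_ext => // s sr; rewrite mulrA -mulrDl mulr_sumr -big_split/=; congr (_ * _).
apply: eq_bigr => d _; rewrite mulrA -mulrDl; congr (_ * _).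
have bn (F' : C -> C) M0 : (forall z, nr z = 2 * rho0 -> nr (F' z) <= M0) -> bnd_on (2 * rho0)
    (fun z => F' z * (G (u0 j + z) (om u j) b d * (z / (u0 j + z - (u0 i + s))))).
  by move=> h; eexists => z zr; exact: kin_bnd h zr sr.
rewrite /kin -meanZ//; last exact: bn hH.
rewrite -meanD//; [|exact: bn hF|]; last first.
  by have [B hB] := bn _ _ hH; exists (nr k * B) => z zr; rewrite nrM ler_wpM2l ?nr_ge0 ?hB.
by apply: mean_ext => // z zr; rewrite mulrDl -(mulrA k).
Qed.

Lemma kof_hol (F : C -> C) M j b n i c : (forall z, nr z = 2 * rho0 -> nr (F z) <= M) ->
  hol (bal a rho0) (kof F j b n i c).
Proof.
move=> hF; apply: (@mean_hol R _ a rho0 (4 * rho0) (N%:R * (M * KG * KG) * (4 * rho0) ^- n)) => // [s sr|u s bu sr].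
  apply: holM; last exact: hol_cst.
  apply: hol_sum => d _; apply: holM; last by apply: GJ_hol; exact: dom4.
  apply: (@mean_hol R _ a rho0 (2 * rho0) (M * KG)) => // [z zr|u z bu zr]; last exact: kin_bnd.
  apply: holM; first exact: hol_cst.
  by apply: holM; [apply: G_hol; exact: dom2|exact: hol_cst].
by apply: (outer_bnd (x := fun s d => kin F j b i s d u)) => // d; exact: kin_le.
Qed.

(** At u = a the jump is the identity, and the inner integrand is holomorphic in disc j because its
    pole u0_i + s lies outside. *)
Lemma kof_base m j b n i c : kof (fun z => z ^+ m) j b n i c a = 0.
Proof.
have r0 := rho00; rewrite /kof (mean_ext r4 (H := fun=> 0)) ?mean_cst// => s sr.
rewrite big1 ?mul0r// => d _; rewrite /kin.
have d4 := sdom4 i sr j.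
have rr : 0 < 2 * rho0 < 3 * rho0 by lra.
rewrite (mean_ext r2 (H := fun z => (z ^+ m * (1%:M : 'M[C]_N) b d) * (u0 j + z - (u0 i + s))^-1 * z)).
  rewrite (@mean_hol0 R _ _ (3 * rho0)) ?mul0r//; apply: holM.
    by apply: holM; [apply: holX; exact: hol_id|exact: hol_cst].
  apply: holV; last by apply: holB; [apply: holD; [exact: hol_cst|exact: hol_id]|exact: hol_cst].
  move=> z /= zr; rewrite nr_neq0// nrBC; apply: (@lt_le_trans _ _ (nr (u0 i + s - u0 j) - nr z)).
    by move: d4; move: (nr _) => x; lra.
  apply: le_trans (nrBl _ _) _; rewrite (_ : u0 i + s - u0 j - z = u0 i + s - (u0 j + z))//; ring.
by move=> z zr; rewrite /om subrr G_base//; [ring|exact: dom2].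
Qed.


Definition bof n i c u : C :=
  mean (4 * rho0) (fun s => (\sum_d psi0 d * GJ (u0 i + s) (om u i) d c) * s ^- n).

Let KP : R := \sum_d nr (psi0 d).

Let psi0_le d : nr (psi0 d) <= KP.
Proof. by rewrite /KP (bigD1 d)//= lerDl sumr_ge0// => k _; exact: nr_ge0. Qed.

Let bof_bnd n i c u s : bal a rho0 u -> nr s = 4 * rho0 ->
  nr ((\sum_d psi0 d * GJ (u0 i + s) (om u i) d c) * s ^- n) <= N%:R * (KP * KG) * (4 * rho0) ^- n.
Proof. by move=> bu sr; apply: (outer_bnd (x := fun _ d => psi0 d)). Qed.

Lemma bof_le n i c u : bal a rho0 u -> nr (bof n i c u) <= N%:R * (KP * KG) * (4 * rho0) ^- n.
Proof. by move=> bu; apply: nr_mean => // s sr; exact: bof_bnd. Qed.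

Lemma bof_hol n i c : hol (bal a rho0) (bof n i c).
Proof.
apply: (@mean_hol R _ a rho0 (4 * rho0) (N%:R * (KP * KG) * (4 * rho0) ^- n)) => // [s sr|u s bu sr]; last exact: bof_bnd.
apply: holM; last exact: hol_cst.
apply: hol_sum => d _; apply: holM; first exact: hol_cst.
by apply: GJ_hol; exact: dom4.
Qed.

Lemma kof_sub (F : C -> C) (t : nat -> C) M j b n i c u : bal a rho0 u -> bnd_on (2 * rho0) F ->
  kof (fun z => F z - \sum_(0 <= m < M) t m * z ^+ m) j b n i c u =
  kof F j b n i c u - \sum_(0 <= m < M) t m * kof (fun z => z ^+ m) j b n i c u.
Proof.
move=> bu bF; have bp m : bnd_on (2 * rho0) (fun z : C => z ^+ m).
  by exists ((2 * rho0) ^+ m) => z zr; rewrite nrX zr.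
have key : bnd_on (2 * rho0) (fun z => F z - \sum_(0 <= m < M) t m * z ^+ m) /\
  kof (fun z => F z - \sum_(0 <= m < M) t m * z ^+ m) j b n i c u =
  kof F j b n i c u - \sum_(0 <= m < M) t m * kof (fun z => z ^+ m) j b n i c u; last by case: key.
elim: M => [|M [IH1 IH2]].
  have e : (fun z => F z - \sum_(0 <= m < 0) t m * z ^+ m) = F.
    by apply/funext => z; rewrite big_nil subr0.
  by rewrite e big_nil subr0; split.
have e : (fun z => F z - \sum_(0 <= m < M.+1) t m * z ^+ m) =
  (fun z => (F z - \sum_(0 <= m < M) t m * z ^+ m) + - t M * z ^+ M).
  by apply/funext => z; rewrite big_nat_recr//= opprD addrA mulNr.
rewrite e; split.
  have [B hB] := IH1; have [B' hB'] := bp M; exists (B + nr (t M) * B') => z zr.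
  apply: le_trans (nrD _ _) _; apply: lerD; first exact: hB.
  by rewrite nrM nrN ler_wpM2l ?nr_ge0 ?hB'.
by rewrite (kof_lin _ _ _ _ _ _ bu IH1 (bp M)) IH2 big_nat_recr//= opprD addrA mulNr.
Qed.

Section System.
Variables (u : CN) (xx : 'I_N -> 'I_N -> C -> C) (X : 'I_N -> C -> C).
Hypothesis bu : bal a rho0 u.
Hypothesis hxx : forall j c, hol [set z : C | nr z <= 9 / 2 * rho0] (xx j c).
Hypothesis hX : forall j z c, 2 * rho0 <= nr z <= 4 * rho0 ->
  X c (u0 j + z) = \sum_b xx j b z * G (u0 j + z) (om u j) b c.
Hypothesis ext_X : forall c lam, sdom u0 rho0 lam ->
  X c lam = psi0 c - \sum_j cker u0 rho0 (X c) j lam.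

Let M0_ex : exists M0 : R, forall j c z, nr z <= 9 / 2 * rho0 -> nr (xx j c z) <= M0.
Proof.
have hp (p : 'I_N * 'I_N) : exists M : R, forall z, nr z <= 9 / 2 * rho0 -> nr (xx p.1 p.2 z) <= M.
  have hd z : nr (z - 0) <= 9 / 2 * rho0 -> exists L, cder (xx p.1 p.2) z L.
    by rewrite subr0 => zr; exact: hxx.
  by have [M hM] := disc_bounded hd; exists M => z zr; apply: hM; rewrite subr0.
have [b hb] := choice hp; exists (\sum_p Num.max 0 (b p)) => j c z zr.
apply: (@le_trans _ _ (Num.max 0 (b (j, c)))); first by rewrite le_max (hb (j, c)) ?orbT.
rewrite (bigD1 (j, c))//= lerDl sumr_ge0// => k _; by rewrite le_max lexx.
Qed.

Let xx_bnd j b : bnd_on (2 * rho0) (xx j b).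
Proof. by have r0 := rho00; have [M hM] := M0_ex; exists M => z zr; apply: hM; rewrite zr; lra. Qed.

Let cker_kin i s d j : nr s = 4 * rho0 ->
  cker u0 rho0 (X d) j (u0 i + s) = \sum_b kin (xx j b) j b i s d u.
Proof.
have r0 := rho00; move=> sr; rewrite /cker /kin -mean_sum//; last first.
  by move=> b; have [M hM] := xx_bnd j b; exists (M * KG) => z zr; exact: kin_bnd.
apply: mean_ext => // z zr; rewrite hX; last by rewrite zr; apply/andP; split; lra.
by rewrite mulr_suml; apply: eq_bigr => b _; rewrite -mulrA.
Qed.

(** On the circle |s| = 4 rho0 about u0_i the inner row is X times the inverse jump, while X is
    given by the exterior Cauchy formula in terms of all inner rows. Taylor coefficients of this
    relation form the linear system. *)
Lemma tc_system i c n : tc (xx i c) 0 (4 * rho0) n =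
  bof n i c u - \sum_j \sum_b kof (xx j b) j b n i c u.
Proof.
have r0 := rho00.
have bk j b : bnd_on (4 * rho0) (fun s => (\sum_d kin (xx j b) j b i s d u * GJ (u0 i + s) (om u i) d c) * s ^- n).
  have [M hM] := xx_bnd j b; exists (N%:R * (M * KG * KG) * (4 * rho0) ^- n) => s sr.
  by apply: (outer_bnd (x := fun s d => kin (xx j b) j b i s d u)) => // d; exact: kin_le.
have -> : \sum_j \sum_b kof (xx j b) j b n i c u = mean (4 * rho0) (fun s => \sum_j \sum_b
   (\sum_d kin (xx j b) j b i s d u * GJ (u0 i + s) (om u i) d c) * s ^- n).
  rewrite mean_sum//.
    by apply: eq_bigr => j _; rewrite mean_sum// => b; exact: bk.
  move=> j; have [B hB] := choice (bk j); exists (\sum_b B b) => s sr.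
  by apply: le_trans (nr_sum _ _ _) _; apply: ler_sum => b _; exact: hB.
rewrite -meanB//; last 2 first.
- by exists (N%:R * (KP * KG) * (4 * rho0) ^- n) => s sr; exact: bof_bnd.
- have [B hB] := choice (fun p : 'I_N * 'I_N => bk p.1 p.2); exists (\sum_j \sum_b B (j, b)) => s sr.
  apply: le_trans (nr_sum _ _ _) _; apply: ler_sum => j _.
  by apply: le_trans (nr_sum _ _ _) _; apply: ler_sum => b _; exact: (hB (j, b)).
apply: mean_ext => // s sr; rewrite add0r.
have -> : \sum_j \sum_b (\sum_d kin (xx j b) j b i s d u * GJ (u0 i + s) (om u i) d c) * s ^- n =
    (\sum_j \sum_b \sum_d kin (xx j b) j b i s d u * GJ (u0 i + s) (om u i) d c) * s ^- n.
  by rewrite mulr_suml; apply: eq_bigr => j _; rewrite mulr_suml.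
rewrite -mulrBl; congr (_ * _).
have d4 := dom4 i sr.
have -> : xx i c s = \sum_d X d (u0 i + s) * GJ (u0 i + s) (om u i) d c.
  have sr' : 2 * rho0 <= nr s <= 4 * rho0 by rewrite sr; apply/andP; split; lra.
  have -> : xx i c s = \sum_b xx i b s * (1%:M : 'M[C]_N) b c.
    by rewrite (bigD1 c)//= mxE eqxx mulr1 big1 ?addr0// => b bc; rewrite mxE (negPf bc) mulr0.
  rewrite -(GJK d4 (om_le i bu)).
  under eq_bigr => b _ do rewrite mxE mulr_sumr.
  rewrite exchange_big/=; apply: eq_bigr => d _; rewrite hX// mulr_suml.
  by apply: eq_bigr => b _; rewrite mulrA.
have sd : sdom u0 rho0 (u0 i + s).
  by move=> j; apply: lt_le_trans (sdom4 i sr j); lra.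
have -> : \sum_j \sum_b \sum_d kin (xx j b) j b i s d u * GJ (u0 i + s) (om u i) d c =
  \sum_d (\sum_j cker u0 rho0 (X d) j (u0 i + s)) * GJ (u0 i + s) (om u i) d c.
  under eq_bigr => j _ do rewrite exchange_big/=.
  rewrite exchange_big/=; apply: eq_bigr => d _; rewrite mulr_suml; apply: eq_bigr => j _.
  by rewrite cker_kin// mulr_suml.
rewrite -sumrB; apply: eq_bigr => d _; rewrite -mulrBl; congr (_ * _).
exact: ext_X.
Qed.

End System.


(** Coefficients of order n are rescaled by (3 rho0)^n, a radius between the two contours; up to a
    constant the kernel is then bounded by (2/3)^p (3/4)^q, as [fredholm] requires with ratio
    3/4. *)
Let rc : C := (3 * rho0)%:C%C.

Let nr_rc : nr rc = 3 * rho0.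
Proof. by rewrite /rc nrR gtr0_norm// mulr_gt0. Qed.

Let rc0 : rc != 0.
Proof. by rewrite nr_neq0// nr_rc mulr_gt0. Qed.

Let Kop (p q : nat * ('I_N * 'I_N)) u : C :=
  rc ^+ q.1 / rc ^+ p.1 * kof (fun z => z ^+ p.1) p.2.1 p.2.2 q.1 q.2.1 q.2.2 u.
Let bop (q : nat * ('I_N * 'I_N)) u : C := rc ^+ q.1 * bof q.1 q.2.1 q.2.2 u.
(** Evaluation of entry i in disc i at z = u_i - a_i, that is at lam = u_i, in rescaled
    coefficients. *)
Let cop (i : 'I_N) (p : nat * ('I_N * 'I_N)) u : C := if p.2 == (i, i) then (om u i / rc) ^+ p.1 else 0.

Let pow_ratio n : (3 * rho0) ^+ n * (4 * rho0) ^- n = (3 / 4) ^+ n.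
Proof. by rewrite -expr_div_n -mulf_div divff ?mulr1// gt_eqF. Qed.

Let KG0 : 0 <= KG.
Proof.
have d2 : forall lam, dom u0 rho0 lam -> 0 <= KG.
  by move=> lam dl; apply: le_trans (mn_ge0 _) (G_mn (o := 0) dl _); rewrite nr0 ltW.
case: (pselect (exists j : 'I_N, True)) => [[j _]|nj].
  by apply: (d2 (u0 j + (2 * rho0)%:C%C)); apply: dom2; rewrite nrR ger0_norm.
by apply: (d2 0) => j; exfalso; apply: nj; exists j.
Qed.

Let KP0 : 0 <= KP. Proof. by apply: sumr_ge0 => d _; exact: nr_ge0. Qed.

Let Kop_le p q u : bal a rho0 u -> nr (Kop p q u) <= N%:R * (KG * KG) * (3 / 4) ^+ p.1 * (3 / 4) ^+ q.1.
Proof.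
move=> bu; have r0 := rho00; have z2 (z : C) : nr z = 2 * rho0 -> nr (z ^+ p.1) <= (2 * rho0) ^+ p.1.
  by move=> zr; rewrite nrX zr.
rewrite /Kop nrM nrM nrV !nrX nr_rc; have h := kof_le p.2.1 p.2.2 q.1 q.2.1 q.2.2 bu z2.
have p3 : 0 <= (3 * rho0) ^+ q.1 * (3 * rho0) ^- p.1.
  by rewrite mulr_ge0 ?invr_ge0 ?exprn_ge0//; lra.
apply: le_trans (ler_wpM2l p3 h) _.
have -> : (3 * rho0) ^+ q.1 * (3 * rho0) ^- p.1 * (N%:R * ((2 * rho0) ^+ p.1 * KG * KG) * (4 * rho0) ^- q.1) =
  N%:R * (KG * KG) * ((2 * rho0) ^+ p.1 * (3 * rho0) ^- p.1) * ((3 * rho0) ^+ q.1 * (4 * rho0) ^- q.1) by ring.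
rewrite pow_ratio -expr_div_n; have -> : 2 * rho0 / (3 * rho0) = 2 / 3.
  by rewrite -mulf_div divff ?mulr1// gt_eqF.
apply: ler_wpM2r; first by rewrite exprn_ge0//; lra.
have k0 := KG0; apply: ler_wpM2l; first by rewrite !mulr_ge0.
by rewrite lerXn2r ?nnegrE//; lra.
Qed.

(** The kernel is determined by [a] and [A], the right-hand side also by [psi0]; hence [h] and [g]
    live on the whole ball of radius rho0. Any solution of the Riemann-Hilbert problem at any [u] of
    this ball has Taylor coefficients to which Cramer's rule applies. *)
Theorem rh_fredholm : exists (h : CN -> C) (g : 'I_N -> CN -> C),
  [/\ hol (bal a rho0) h, forall i, hol (bal a rho0) (g i), h a = 1 &
  forall i u xx X, bal a rho0 u ->
    (forall j c, hol [set z : C | nr z <= 9 / 2 * rho0] (xx j c)) ->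
    (forall j z c, 2 * rho0 <= nr z <= 4 * rho0 ->
       X c (a 0 j + z) = \sum_b xx j b z * GG (fun k => a 0 k) A (a 0 j + z) (u 0 j - a 0 j) 1 b c) ->
    (forall c lam, sdom (fun k => a 0 k) rho0 lam ->
       X c lam = psi0 c - \sum_j cker (fun k => a 0 k) rho0 (X c) j lam) ->
    h u * xx i i (u 0 i - a 0 i) = g i u].
Proof.
have r0 := rho00; have k0 := KG0; have kp0 := KP0; pose Co : R := N%:R * (KG * KG) + N%:R * (KP * KG) + 1.
have Co0 : 0 <= Co by rewrite /Co !addr_ge0// !mulr_ge0.
have th01 : 0 <= (3 / 4 : R) < 1 by lra.
have th0 m : 0 <= (3 / 4 : R) ^+ m by rewrite exprn_ge0//; lra.
have bz m (z : C) : nr z = 2 * rho0 -> nr (z ^+ m) <= (2 * rho0) ^+ m by move=> zr; rewrite nrX zr.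
have hK p q : hol (bal a rho0) (Kop p q).
  by apply: holM; [exact: hol_cst|exact: kof_hol (bz _)].
have hb p : hol (bal a rho0) (bop p).
  by apply: holM; [exact: hol_cst|exact: bof_hol].
have hc i p : hol (bal a rho0) (cop i p).
  rewrite /cop; case: (p.2 == (i, i)); last exact: hol_cst.
  by apply: (@holX R CN _ (fun u => om u i * rc^-1)); apply: (@holM R CN _ (fun u => om u i) (fun=> rc^-1)); [exact: om_hol|exact: hol_cst].
have leK p q u : bal a rho0 u -> nr (Kop p q u) <= Co * (3 / 4) ^+ p.1 * (3 / 4) ^+ q.1.
  move=> bu; apply: le_trans (Kop_le p q bu) _; apply: ler_wpM2r => //; apply: ler_wpM2r => //.
  by rewrite /Co -addrA lerDl addr_ge0// !mulr_ge0.
have leb p u : bal a rho0 u -> nr (bop p u) <= Co * (3 / 4) ^+ p.1.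
  move=> bu; rewrite /bop nrM nrX nr_rc; have p3 : 0 <= (3 * rho0) ^+ p.1 by rewrite exprn_ge0//; lra.
  apply: le_trans (ler_wpM2l p3 (bof_le p.1 p.2.1 p.2.2 bu)) _.
  rewrite mulrCA pow_ratio; apply: ler_wpM2r => //.
  by rewrite /Co addrAC addrC lerDl addr_ge0// !mulr_ge0.
have lec i p u : bal a rho0 u -> nr (cop i p u) <= Co * (3 / 4) ^+ p.1.
  move=> bu; have C1 : 1 <= Co by rewrite /Co lerDr addr_ge0// !mulr_ge0.
  rewrite /cop; case: ifP => _; last by rewrite nr0 mulr_ge0.
  rewrite nrX nrM nrV nr_rc; apply: (@le_trans _ _ ((3 / 4) ^+ p.1)); last by rewrite ler_peMl.
  rewrite lerXn2r ?nnegrE ?divr_ge0 ?nr_ge0//; try lra.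
  by rewrite ler_pdivrMr; [apply: le_trans (om_le i bu) _|]; lra.
have K0 p q : Kop p q a = 0 by rewrite /Kop kof_base mulr0.
have [h [g [hh hg ha key]]] := fredholm th01 Co0 hK hb hc leK leb lec K0.
exists h, g; split=> // i u xx X bu hxx hX eX.
have [M0 hM0] : exists M0 : R, forall j c z, nr z <= 9 / 2 * rho0 -> nr (xx j c z) <= M0.
  have hp (p : 'I_N * 'I_N) : exists M : R, forall z, nr z <= 9 / 2 * rho0 -> nr (xx p.1 p.2 z) <= M.
    have hd z : nr (z - 0) <= 9 / 2 * rho0 -> exists L, cder (xx p.1 p.2) z L.
      by rewrite subr0 => zr; exact: hxx.
    by have [M hM] := disc_bounded hd; exists M => z zr; apply: hM; rewrite subr0.
  have [b hb'] := choice hp; exists (\sum_p Num.max 0 (b p)) => j c z zr.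
  apply: (@le_trans _ _ (Num.max 0 (b (j, c)))); first by rewrite le_max (hb' (j, c)) ?orbT.
  rewrite (bigD1 (j, c))//= lerDl sumr_ge0// => k _; by rewrite le_max lexx.
have M00 : 0 <= M0 by apply: le_trans (nr_ge0 _) (hM0 i i 0 _); rewrite nr0; lra.
have rr : 0 < 4 * rho0 < 9 / 2 * rho0 by lra.
have hxd j c z : nr (z - 0) <= 9 / 2 * rho0 -> exists L, cder (xx j c) z L.
  by rewrite subr0 => zr; exact: hxx.
have hx4 j c z : nr z = 4 * rho0 -> nr (xx j c (0 + z)) <= M0.
  by move=> zr; rewrite add0r hM0// zr; lra.
pose t j c m := tc (xx j c) 0 (4 * rho0) m.
pose al (p : nat * ('I_N * 'I_N)) : C := t p.2.1 p.2.2 p.1 * rc ^+ p.1.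
have tay j c z m : nr z < 4 * rho0 -> nr (xx j c z - \sum_(0 <= k < m) t j c k * z ^+ k) <=
    M0 * (nr z / (4 * rho0)) ^+ m * (4 * rho0 / (4 * rho0 - nr z)).
  by move=> zr; have := taylor rr (hxd j c) (hx4 j c) m zr; rewrite add0r.
pose D1 : R := N%:R * N%:R * (N%:R * (2 * M0 * KG * KG)).
apply: (key i u al (xx i i (om u i)) (D1 + 2 * M0)) => // [m [n [j c]]|m] /=.
(* Truncation replaces the inner rows by Taylor polynomials; [kd] is the effect of the remainders,
   which are at most 2 M0 / 2^m on |z| = 2 rho0, half the radius of expansion. *)
- pose kx k b := kof (xx k b) k b n j c u; pose km k b l := kof (fun z => z ^+ l) k b n j c u.
  pose kd k b := kof (fun z => xx k b z - \sum_(0 <= l < m) t k b l * z ^+ l) k b n j c u.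
  have kdE k b : kd k b = kx k b - \sum_(l < m) t k b l * km k b l.
    rewrite /kd kof_sub//; last by exists M0 => z zr; rewrite hM0// zr; lra.
    by rewrite big_mkord.
  have tE : t j c n = bof n j c u - \sum_k \sum_b kx k b := tc_system bu hxx hX eX j c n.
  have KE l s : al (l, s) * Kop (l, s) (n, (j, c)) u = rc ^+ n * (t s.1 s.2 l * km s.1 s.2 l).
    rewrite /al /Kop /= -/(km s.1 s.2 l); have rl : rc ^+ l != 0 by rewrite expf_neq0.
    by move: (km _ _ _) (t _ _ _) (rc ^+ n) (rc ^+ l) rl => x y z v v0; field.
  have le1 k b : nr (kd k b) <= N%:R * (2 * M0 * (3 / 4) ^+ m * KG * KG) * (4 * rho0) ^- n.
    apply: kof_le => // z zr; apply: le_trans (tay k b z m _) _; first by rewrite zr; lra.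
    have -> : nr z / (4 * rho0) = 2^-1 by rewrite zr; field; rewrite gt_eqF.
    have -> : 4 * rho0 / (4 * rho0 - nr z) = 2.
      by rewrite zr; field; rewrite gt_eqF//; lra.
    rewrite [2 * M0]mulrC mulrAC; apply: ler_wpM2l; first by rewrite mulr_ge0.
    by rewrite lerXn2r ?nnegrE//; lra.
  have e : al (n, (j, c)) + \sum_(p : 'I_m * ('I_N * 'I_N)) al (nat_of_ord p.1, p.2) * Kop (nat_of_ord p.1, p.2) (n, (j, c)) u
      - bop (n, (j, c)) u = - (rc ^+ n * \sum_k \sum_b kd k b).
    rewrite /bop {1}/al /= tE; clearbody kx km kd t.
    have -> : \sum_(p : 'I_m * ('I_N * 'I_N)) al (nat_of_ord p.1, p.2) * Kop (nat_of_ord p.1, p.2) (n, (j, c)) u =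
       rc ^+ n * \sum_k \sum_b \sum_(l < m) t k b l * km k b l.
      rewrite pair_bigA exchange_big pair_bigA mulr_sumr; apply: eq_bigr => p _; exact: KE.
    have -> : \sum_k \sum_b kd k b = \sum_k \sum_b kx k b - \sum_k \sum_b \sum_(l < m) t k b l * km k b l.
      by rewrite -sumrB; apply: eq_bigr => k _; rewrite -sumrB; apply: eq_bigr => b _.
    by move: (bof _ _ _ _) (\sum_k \sum_b kx k b) (\sum_k \sum_b _) (rc ^+ n) => x y z v; ring.
  rewrite e nrN nrM nrX nr_rc; have p3 : 0 <= (3 * rho0) ^+ n by rewrite exprn_ge0//; lra.
  have le2 : nr (\sum_k \sum_b kd k b) <=
      N%:R * N%:R * (N%:R * (2 * M0 * (3 / 4) ^+ m * KG * KG) * (4 * rho0) ^- n).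
    set Z := (N%:R * _ * _) in le1 *; apply: (@le_trans _ _ (\sum_(k < N) \sum_(b < N) Z)).
      apply: le_trans (nr_sum _ _ _) _; apply: ler_sum => k _.
      by apply: le_trans (nr_sum _ _ _) _; apply: ler_sum => b _; exact: le1.
    by rewrite !sumr_const !card_ord -[Z *+ N *+ N]mulr_natl -[Z *+ N]mulr_natl mulrA.
  apply: le_trans (ler_wpM2l p3 le2) _.
  have -> : (3 * rho0) ^+ n * (N%:R * N%:R * (N%:R * (2 * M0 * (3 / 4) ^+ m * KG * KG) * (4 * rho0) ^- n)) =
    D1 * (3 / 4) ^+ m * ((3 * rho0) ^+ n * (4 * rho0) ^- n) by rewrite /D1; ring.
  by rewrite pow_ratio ler_wpM2r// ler_wpM2r// lerDl mulr_ge0.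
- have -> : \sum_(p : 'I_m * ('I_N * 'I_N)) al (nat_of_ord p.1, p.2) * cop i (nat_of_ord p.1, p.2) u =
    \sum_(0 <= l < m) t i i l * om u i ^+ l.
    rewrite big_mkord -(pair_bigA _ (fun l s => al (nat_of_ord l, s) * cop i (nat_of_ord l, s) u))/=.
    apply: eq_bigr => l _; rewrite (bigD1 (i, i))//= big1 ?addr0 => [|s si]; last first.
      by rewrite /cop /= (negPf si) mulr0.
    rewrite /cop /= eqxx /al /= exprMn exprVn; have rl : rc ^+ l != 0 by rewrite expf_neq0.
    by move: (t i i l) (om u i ^+ l) (rc ^+ l) rl => x y z z0; field.
  have ol := om_le i bu; apply: le_trans (tay i i (om u i) m _) _; first lra.
  have o0 := nr_ge0 (om u i).
  have q1 : nr (om u i) / (4 * rho0) <= 3 / 4 by rewrite ler_pdivrMr; lra.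
  have q2 : 4 * rho0 / (4 * rho0 - nr (om u i)) <= 2 by rewrite ler_pdivrMr; lra.
  have q3 : 0 <= 4 * rho0 / (4 * rho0 - nr (om u i)) by rewrite divr_ge0//; lra.
  have q4 : (nr (om u i) / (4 * rho0)) ^+ m <= (3 / 4) ^+ m.
    by rewrite lerXn2r ?nnegrE ?divr_ge0//; lra.
  have D10 : 0 <= D1 by rewrite /D1 !mulr_ge0.
  apply: (@le_trans _ _ (M0 * (3 / 4) ^+ m * 2)).
    apply: ler_pM => //; first by rewrite mulr_ge0// exprn_ge0// divr_ge0//; lra.
    by rewrite ler_wpM2l.
  rewrite mulrAC [M0 * 2]mulrC ler_wpM2r//; lra.
Qed.

End Kernels.

(** * The Riemann-Hilbert data of a solution *)

Section LocalTheorem.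
Variable R : realType.
Local Notation C := R[i].
Variable N : nat.
Local Notation CN := 'rV[C]_N.

Lemma soln_sub (D : C) (B B' : set CN) eta : B' `<=` B -> soln D B eta -> soln D B' eta.
Proof. by move=> s [h1 h2]; split=> [i|u /s]; [exact: hol_sub (h1 i)|exact: h2]. Qed.

Lemma finite_min (n : nat) (e : R) (d : 'I_n -> R) : 0 < e -> (forall i, 0 < d i) ->
  exists2 r, 0 < r <= e & forall i, r <= d i.
Proof.
move=> e0 hd; exists (\big[Num.min/e]_i d i); last by move=> i; exact: bigmin_le.
by rewrite bigmin_le_id andbT; apply/bigmin_gtP; split.
Qed.

(** Taylor coefficients taken on |t| = 4 have the growth rate 1/4 that the deformation along a line
    asks of [P] and [Q]. *)
Lemma mps_tc (F : C -> 'M[C]_N) : (forall t : C, nr t <= 5 -> forall k l, exists L, cder (fun z => F z k l) t L) ->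
  exists (P : nat -> 'M[C]_N) (Cp : R), mgbd P Cp 4^-1 /\ forall t, nr t < 4 -> mps P t = F t.
Proof.
move=> hF; have hd (p : 'I_N * 'I_N) (z : C) : nr (z - 0) <= 5 -> exists L, cder (fun z => F z p.1 p.2) z L.
  by rewrite subr0 => /hF.
have hp (p : 'I_N * 'I_N) : exists M : R, forall z, nr z <= 5 -> nr (F z p.1 p.2) <= M.
  by have [M hM] := disc_bounded (hd p); exists M => z zr; apply: hM; rewrite subr0.
have [M hM] := choice hp.
have hM4 p s : nr s = 4 -> nr (F (0 + s) p.1 p.2) <= M p by move=> sr; rewrite add0r hM// sr; lra.
have rr : 0 < (4 : R) < 5 by lra.
exists (fun k => \matrix_(x, y) tc (fun z => F z x y) 0 4 k), (\sum_x \sum_y M (x, y)); split=> [k|t tr].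
  rewrite /mn mulr_suml; apply: ler_sum => x _; rewrite mulr_suml; apply: ler_sum => y _.
  rewrite mxE; apply: nr_mean => // s sr; rewrite nrM nrV nrX sr exprVn ler_wpM2r ?invr_ge0 ?exprn_ge0//.
  exact: (hM4 (x, y)).
apply/matrixP => x y; rewrite mxE -(ps_taylor rr (hd (x, y)) (hM4 (x, y)) tr).
by congr (ps _ t); apply/funext => k; rewrite mxE.
Qed.

Lemma mgbd_mono (P : nat -> 'M[C]_N) (K K' s : R) : mgbd P K s -> K <= K' -> 0 <= s -> mgbd P K' s.
Proof. by move=> h kk s0 k; apply: le_trans (h k) _; rewrite ler_wpM2r// exprn_ge0. Qed.

Variables (D : C) (a : CN) (rho0 d1 : R) (eta : 'I_N -> CN -> C) (psi : 'I_N -> CN -> C).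
Local Notation B := (bal a d1).
Hypothesis rho00 : 0 < rho0.
Hypothesis sep : forall k l, k != l -> 10 * rho0 <= nr (a 0 k - a 0 l).
Hypothesis d10 : 0 < d1.
Hypothesis sol : soln D B eta.
Hypothesis hpsi : forall i, hol B (psi i).
Hypothesis psi2 : forall i u, B u -> psi i u ^+ 2 = eta i u.
Hypothesis conf : forall u i j, B u -> i != j -> u 0 i != u 0 j.
Local Notation gm := (gam eta psi).

Section Line.
Variable u : CN.
Hypothesis hu1 : nr (u - a) < d1 / 6.
Hypothesis hu2 : nr (u - a) < rho0 / 8.
Let w := u - a.
Let ln (t : C) : CN := a + t *: w.
Let u0 k := a 0 k.
Let ww k := u 0 k - a 0 k.

Let ln_in t : nr t <= 5 -> B (ln t).
Proof.
have d0 := d10; have h := hu1; move=> ht; rewrite /bal /= /ln [a + _]addrC addrK nrZ.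
apply: (@le_lt_trans _ _ (5 * nr w)); first by rewrite ler_wpM2r ?nr_ge0.
by move: h; rewrite -/w; move: (nr w) => x; lra.
Qed.

Let wE k : w 0 k = ww k. Proof. by rewrite !mxE. Qed.

Let ww_le k : nr (ww k) <= rho0 / 8.
Proof. by rewrite -wE; apply: le_trans (nr_coord _ _) (ltW hu2). Qed.

Let lnE t k : ln t 0 k = u0 k + t * ww k.
Proof. by rewrite !mxE. Qed.

Let cd_line (f : CN -> C) t : hol B f -> nr t <= 5 -> cd (fun z => f (ln z)) t (dv f (ln t) w).
Proof. by move=> hf ht; apply: cder_line; exact: cder_dv hf (ln_in ht). Qed.

Let FP t : 'M[C]_N := \matrix_(k, l) ((ww l - ww k) * gm k l (ln t)).
Let FQ t : 'M[C]_N := \matrix_(k, l) (((u0 l + t * ww l) - (u0 k + t * ww k)) * gm k l (ln t)).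

Let cd_gm k l t : nr t <= 5 -> cd (fun z => gm k l (ln z)) t (dv (gm k l) (ln t) w).
Proof. by apply: cd_line; exact: gam_hol sol hpsi psi2 k l. Qed.

Let FP_cd t k l : nr t <= 5 -> cd (fun z => FP z k l) t ((ww l - ww k) * dv (gm k l) (ln t) w).
Proof.
move=> ht; apply: (@cder_eq R C (fun z => (ww l - ww k) * gm k l (ln z))); first by move=> z; rewrite mxE.
by apply: (cder_eqL _ (cderZ (ww l - ww k) (cd_gm k l ht))) => v; ring.
Qed.

Let FQ_cd t : nr t <= 5 -> mcd FQ t (FP t *m FQ t - FQ t *m FP t).
Proof.
move=> ht k l; have h1 : cd (fun z => (u0 l - u0 k) + z * (ww l - ww k)) t (ww l - ww k).
  by apply: (cder_eqL _ (cderD (cder_cst _ t) (cderM (cd_id t) (cder_cst _ t)))) => v; ring.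
have h2 := cderM h1 (cd_gm k l ht).
apply: (@cder_eq R C (fun z => ((u0 l - u0 k) + z * (ww l - ww k)) * gm k l (ln z))).
  by move=> z; rewrite mxE; congr (_ * _); ring.
apply: (cder_eqL _ h2) => v.
have e := gam_D sol hpsi psi2 conf k l w (ln_in ht).
rewrite !wE !lnE in e.
have -> : (FP t *m FQ t - FQ t *m FP t) k l = (ww l - ww k) * gm k l (ln t) +
   (u0 l + t * ww l - (u0 k + t * ww k)) * dv (gm k l) (ln t) w.
  rewrite e [LHS]mxE [X in _ + X]mxE [X in X - _]mxE [X in _ - X]mxE -sumrB; apply: eq_bigr => m _; rewrite !mxE.
  by move: (gm k m (ln t)) (gm m l (ln t)) => x y; rewrite /ww /u0; ring.
by move: (gm k l (ln t)) (dv _ _ _) => x y; ring.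
Qed.

Let PQ : exists (P Q : nat -> 'M[C]_N) (Cp : R), [/\ mgbd P Cp 4^-1, mgbd Q Cp 4^-1,
  forall t, nr t < 4 -> mps P t = FP t & forall t, nr t < 4 -> mps Q t = FQ t].
Proof.
have [t ht k l|P [C1 [hP eP]]] := @mps_tc FP; first by eexists; exact: FP_cd.
have [t ht k l|Q [C2 [hQ eQ]]] := @mps_tc FQ; first by eexists; exact: (FQ_cd ht).
exists P, Q, (Num.max C1 C2); split=> //.
  by apply: mgbd_mono hP _ _; rewrite ?le_max ?lexx// invr_ge0.
by apply: mgbd_mono hQ _ _; rewrite ?le_max ?lexx ?orbT// invr_ge0.
Qed.

Let psi_row t : 'rV[C]_N := \row_k psi k (ln t).

Let psi_row_cd t : nr t <= 5 -> mcd psi_row t (psi_row t *m (FP t)^T).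
Proof.
move=> ht k l; apply: (@cder_eq R C (fun z => psi l (ln z))); first by move=> z; rewrite mxE.
apply: (cder_eqL _ (cd_line (hpsi l) ht)) => v; congr (v * _).
rewrite (psi_D sol hpsi psi2 l w (ln_in ht)) [RHS]mxE; apply: eq_bigr => m _.
by rewrite !mxE /ww mulrC.
Qed.

Let FP_anti t : nr t <= 5 -> (FP t)^T = - FP t.
Proof.
move=> ht; apply/matrixP => k l; rewrite !mxE (gam_sym psi sol k l (ln_in ht)).
by move: (gm l k (ln t)) => x; rewrite /ww; ring.
Qed.

Let A : 'M[C]_N := \matrix_(k, l) ((u0 l - u0 k) * gm k l a).

(** Take [XX] outside and [ZZ] inside the discs, multiplied on the left by the row psi(u). The jump
    relation is [star], the exterior formula comes from [exterior_cauchy], and [ZZ_fix] reads off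
    psi_i(u) at lam = u_i. *)
Lemma rh_data : exists (xx : 'I_N -> 'I_N -> C -> C) (X : 'I_N -> C -> C),
  [/\ forall j c, hol [set z : C | nr z <= 9 / 2 * rho0] (xx j c),
    forall j z c, 2 * rho0 <= nr z <= 4 * rho0 ->
       X c (a 0 j + z) = \sum_b xx j b z * GG (fun k => a 0 k) A (a 0 j + z) (u 0 j - a 0 j) 1 b c,
    forall c lam, sdom (fun k => a 0 k) rho0 lam ->
       X c lam = psi c a - \sum_j cker (fun k => a 0 k) rho0 (X c) j lam &
    forall i, xx i i (u 0 i - a 0 i) = psi i u].
Proof.
have r0 := rho00; have [P [Q [Cp [hP hQ eP eQ]]]] := PQ.
have n1 : nr (1 : C) < 3 by rewrite nr1; lra.
have t34 (t : C) : nr t < 3 -> nr t < 4 by lra.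
have t724 (t : C) : nr t < 3 -> nr t * (7 / 24) < 1 by lra.
have c1 : 0 <= (8^-1 : R) by lra.
have c2 : 8^-1 < (4^-1 : R) by lra.
have c3 : 4^-1 < (7 / 24 : R) by lra.
have t35 (t : C) : nr t < 3 -> nr t <= 5 by lra.
have hV t : nr t < 3 -> mcd (mps Q) t (mps P t *m mps Q t - mps Q t *m mps P t).
  move=> ht; rewrite (eP _ (t34 _ ht)) (eQ _ (t34 _ ht)) => k l.
  apply: cder_loc (FQ_cd (t35 _ ht) k l); apply/near_nrP; exists (4 - nr t); first by rewrite subr_gt0; lra.
  by move=> v hv; rewrite eQ//; have := nrBl v t; lra.
pose Gm t : 'M[C]_N := \matrix_(k, l) gm k l (ln t).
have eV t k l : nr t < 3 -> mps Q t k l = ((u0 l + t * ww l) - (u0 k + t * ww k)) * Gm t k l.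
  by move=> ht; rewrite (eQ _ (t34 _ ht)) !mxE.
have eVV t k l : nr t < 3 -> mps P t k l = (ww l - ww k) * Gm t k l.
  by move=> ht; rewrite (eP _ (t34 _ ht)) !mxE.
have ln1 : ln 1 = u by rewrite /ln scale1r addrC subrK.
have A0 : mps Q 0 = A.
  rewrite eQ ?nr0//; apply/matrixP => k l; rewrite !mxE !mul0r !addr0 /ln scale0r addr0 //.
pose zz i s := ZZ P Q u0 ww i s 1.
(* Here the argument is lam - a_i, whereas [ZZ] is a function of lam - u_i. *)
pose xx i c s := \sum_b psi b u * zz i (s - ww i) b c.
pose X c lam := \sum_b psi b u * XX P Q u0 ww lam 1 b c.
exists xx, X; split=> [j c|j z c hz|c lam sl|i].
- apply: hol_sum => b _; apply: holM; first exact: hol_cst.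
  move=> z /= hz; have hs : nr (z - ww j) < 5 * rho0.
    by apply: le_lt_trans (nrB _ _) _; have := ww_le j; lra.
  have [r rp h] := ZZ_hol hP hQ rho00 sep ww_le j hs n1.
  have h1 := cder_fst (cder_dv (h b c) (balC _ rp)); rewrite /= in h1.
  have h2 : cd (fun z => z - ww j) z 1.
    by apply: (cder_eqL _ (cderB (cd_id z) (cder_cst _ z))) => v; rewrite subr0.
  by eexists; exact: (@cder_comp R C (fun s => zz j s b c) (fun z => z - ww j) z _ _ h1 h2).
- have hz' : 2 * rho0 <= nr ((a 0 j + z) - u0 j) <= 4 * rho0 by rewrite [a 0 j + z]addrC addrK.
  have e := star hP hQ hV eV eVV rho00 sep ww_le hz' n1.
  have sE : a 0 j + z - (u0 j + 1 * ww j) = z - ww j by rewrite /u0; ring.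
  rewrite /= sE A0 in e; rewrite /X e /xx.
  under eq_bigr => b _ do rewrite mxE mulr_sumr.
  rewrite exchange_big/=; apply: eq_bigr => m _; rewrite mulr_suml.
  by apply: eq_bigr => b _; rewrite mulrA.
- have XK l : dom u0 rho0 l -> forall b, nr (XX P Q u0 ww l 1 b c) <=
      (N * N)%:R * (XiK N Cp 8^-1 4^-1 (7/24) / (1 - 7/8)).
    move=> dl b; apply: le_trans (mn_coef _ _ _) _.
    have ql k : nr (ww k / (l - u0 k)) <= 8^-1.
      have dk := dl k; rewrite nrM nrV ler_pdivrMr; last by apply: lt_le_trans dk; lra.
      by apply: le_trans (ww_le k) _; move: dk; move: (nr (l - u0 k)) => x dk; lra.
    by apply: (Xi_mn (s := 7/24) (th := 7/8) ql _ _ _ _ hP hQ); rewrite ?nr1; lra.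
  have ckE j : cker u0 rho0 (X c) j lam = \sum_b psi b u * cker u0 rho0 (fun l => XX P Q u0 ww l 1 b c) j lam.
    have bb b : bnd_on (2 * rho0) (fun s => XX P Q u0 ww (u0 j + s) 1 b c * (s / (u0 j + s - lam))).
      by eexists => s sr; exact: (cker_bnd rho00 sep (F := fun l => XX P Q u0 ww l 1 b c) (fun l dl => XK l dl b) (sl j) sr).
    have r2 : 0 <= 2 * rho0 by lra.
    under eq_bigr => b _ do rewrite /cker -(meanZ _ r2 (bb b)).
    rewrite /cker -mean_sum//; last first.
      by move=> b; have [M hM] := bb b; exists (nr (psi b u) * M) => s sr; rewrite nrM ler_wpM2l ?nr_ge0 ?hM.
    by apply: mean_ext => // s _; rewrite /X mulr_suml; apply: eq_bigr => b _; rewrite -mulrA.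
  (* Along the line psi' = - psi W, because W is antisymmetric, while the transport at infinity
     satisfies X' = W X; so psi X is constant in t. *)
  have inf : psi c a = \sum_b psi b u * XXinf P Q b c.
    have h := @ode_uniq2 R 1 N (fun t => psi_row t *m Xi P Q (fun=> 0) t) (fun=> psi_row 0) (fun=> 0) 3 0.
    have {}h := h ltac:(lra) _ _ _ _ 1 n1.
    have e : psi_row 1 *m Xi P Q (fun=> 0) 1 = psi_row 0.
      apply: h => [t tt|t tt|t tt|]; last by rewrite Xi_at0 mulmx1.
      - have q0 (j : 'I_N) : nr (0 : C) <= 8^-1 by rewrite nr0 invr_ge0.
        have ts := t724 _ tt.
        have ox : mcd (Xi P Q (fun=> 0)) t (FP t *m Xi P Q (fun=> 0) t).
          have := Xi_ode (q := fun=> 0) q0 c1 c2 c3 hP hQ ts.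
          rewrite (_ : diag_mx _ = 0) ?mul0mx ?addr0 ?(eP _ (t34 _ tt))//.
          by apply/matrixP => x y; rewrite !mxE mul0r mul0rn.
        have := mcdM (psi_row_cd (t35 _ tt)) ox.
        by rewrite (FP_anti (t35 _ tt)) mulmxN mulNmx mulmxA addNr mul0mx.
      - by rewrite mul0mx; exact: mcd_cst.
      - by rewrite mn0.
    have := congr1 (fun Y : 'rV[C]_N => Y 0 c) e.
    rewrite !mxE /ln scale0r addr0 => <-; apply: eq_bigr => b _.
    by rewrite mxE -/(ln 1) ln1.
  rewrite inf; under [X in _ - X]eq_bigr => j _ do rewrite ckE.
  rewrite exchange_big -sumrB; apply: eq_bigr => b _.
  have ec := exterior_cauchy rho00 sep hP hQ ww_le b c sl.
  apply: (etrans (congr1 (fun y => psi b u * y) ec)).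
  rewrite mulrBr; congr (_ - _).
  exact: mulr_sumr.
- have e := ZZ_fix hP hQ eV eVV rho00 sep ww_le i n1.
  rewrite /xx subrr /zz (bigD1 i)//= big1 ?addr0.
    have e1 := congr1 (fun Y : 'cV[C]_N => Y i 0) e.
    by rewrite -colE [LHS]mxE [RHS]mxE !eqxx in e1; rewrite e1 mulr1.
  move=> b bi; have e1 := congr1 (fun Y : 'cV[C]_N => Y b 0) e.
  by rewrite -colE [LHS]mxE [RHS]mxE (negPf bi) in e1; rewrite e1 mulr0.
Qed.

End Line.
End LocalTheorem.

(** * Local meromorphy on a ball of uniform radius *)

Section LocalConclusion.
Variable R : realType.
Local Notation C := R[i].
Variable N : nat.
Local Notation CN := 'rV[C]_N.

(** The roots psi_i and the relation h psi_i = g_i are available only near [a], but [h] and [g_i]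
    are holomorphic on the ball of radius [rho0], which is limited by the separation of the
    coordinates of [a] and not by [e0]. Squaring returns to eta. *)
Theorem local_meromorphic (D : C) (a : CN) (rho0 e0 : R) (eta : 'I_N -> CN -> C) :
  0 < rho0 -> 0 < e0 -> (forall k l, k != l -> 10 * rho0 <= nr (a 0 k - a 0 l)) ->
  soln D (bal a e0) eta ->
  exists (h : CN -> C) (q : 'I_N -> CN -> C), [/\ hol (bal a rho0) h,
    forall i, hol (bal a rho0) (q i), h a = 1 &
    exists2 d : R, 0 < d & forall i u, bal a d u -> h u * eta i u = q i u].
Proof.
move=> r0 e00 sep sol.
have sq i : exists d : R, exists psi : CN -> C, 0 < d <= e0 /\ hol (bal a d) psi /\
    forall u, bal a d u -> psi u ^+ 2 = eta i u /\ psi u != 0.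
  have [h _ _ _ _] := sol.2 a (balC a e00).
  by have [d d0 [psi [h1 h2]]] := sqrt_hol e00 (sol.1 i) (h i); exists d, psi.
have [dd hdd] := choice sq; have [psi hpsi] := choice hdd.
have me : 0 < Num.min e0 rho0 by rewrite lt_min e00.
have [d1 /andP[d10 d1e] d1d] := finite_min me (fun i => (andP (hpsi i).1).1).
move: d1e; rewrite le_min => /andP[d1e d1r].
have sub i : bal a d1 `<=` bal a (dd i).
  by move=> u; rewrite /bal /= => h; apply: lt_le_trans h (d1d i).
have sol1 : soln D (bal a d1) eta.
  by apply: soln_sub sol => u; rewrite /bal /= => h; apply: lt_le_trans h d1e.
have psi_h i : hol (bal a d1) (psi i) by apply: hol_sub (hpsi i).2.1; exact: sub.
have psi_2 i u : bal a d1 u -> psi i u ^+ 2 = eta i u by move=> /(sub i)/(hpsi i).2.2[].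
have conf u i j : bal a d1 u -> i != j -> u 0 i != u 0 j.
  move=> hu ij; apply/eqP => e; have := sep _ _ ij; rewrite leNgt => /negP; apply.
  have -> : a 0 i - a 0 j = (u - a) 0 j - (u - a) 0 i by rewrite !mxE e; ring.
  apply: le_lt_trans (nrB _ _) _; have h1 := nr_coord (u - a) i; have h2 := nr_coord (u - a) j.
  by move: hu; rewrite /bal /= => hu; lra.
pose A : 'M[C]_N := \matrix_(k, l) ((a 0 l - a 0 k) * gam eta psi k l a).
have [h [g [hh hg ha key]]] := rh_fredholm A (fun c => psi c a) r0 sep.
exists (fun u => h u * h u), (fun i u => g i u * g i u); split.
- exact: holM.
- by move=> i; exact: holM.
- by rewrite ha mulr1.
exists (Num.min (d1 / 6) (rho0 / 8)); first by rewrite lt_min !divr_gt0.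
move=> i u; rewrite /bal /= lt_min => /andP[u1 u2].
have [xx [X [h1 h2 h3 h4]]] := rh_data r0 sep d10 sol1 psi_h psi_2 conf u1 u2.
have bu : bal a rho0 u by rewrite /bal /=; lra.
have bu1 : bal a d1 u by rewrite /bal /=; lra.
have := key i u xx X bu h1 h2 h3; rewrite h4 => <-; rewrite -(psi_2 i u bu1); ring.
Qed.

End LocalConclusion.

(** * Quotients that solve the system, and their extension to larger balls *)

Section Quotients.
Variable R : realType.
Local Notation C := R[i].
Variable N : nat.
Local Notation CN := 'rV[C]_N.
Local Notation del k := (delta_mx 0 k : CN).
Local Opaque partial.

Lemma soln_ext (D : C) (a : CN) (e : R) (eta eta' : 'I_N -> CN -> C) :
  (forall i u, bal a e u -> eta i u = eta' i u) -> soln D (bal a e) eta -> soln D (bal a e) eta'.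
Proof.
move=> h [h1 h2]; have h1' i : hol (bal a e) (eta' i).
  by apply: hol_ext (h1 i) => [u|u bu]; [exact: bal_nbhs|exact: h].
have dE i u v : bal a e u -> dv (eta' i) u v = dv (eta i) u v.
  by move=> bu; apply: (dv_ext v (bal_nbhs bu) (h1 i)) => x bx; exact: h.
have pE i k u : bal a e u -> partial k (eta' i) u = partial k (eta i) u.
  by move=> bu; rewrite !partialE dE.
have ppE i j k u : bal a e u -> partial k (partial j (eta' i)) u = partial k (partial j (eta i)) u.
  move=> bu; have e1 f : partial j f = (fun x => dv f x (del j)) by apply/funext => x; rewrite partialE.
  rewrite !e1 !partialE; apply: (dv_ext _ (bal_nbhs bu) (dv_hol (del j) (h1 i))) => x bx.
  by rewrite dE.
split; first exact: h1'.
move=> u bu; have [g1 g2 g3 g4 g5] := h2 u bu; split.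
- by move=> i; rewrite -(h i u bu).
- by move=> i j; rewrite (pE i j u bu) (pE j i u bu).
- by move=> i; apply: (etrans _ (g3 i)); apply: eq_bigr => k _; exact: pE.
- move=> i; rewrite -(h i u bu).
  have e1 : \sum_(k < N) u 0 k * partial k (eta' i) u = \sum_(k < N) u 0 k * partial k (eta i) u.
    by apply: eq_bigr => k _; rewrite (pE i k u bu).
  rewrite e1.
  exact: g4.
move=> e0 i j k ki ij jk; rewrite {}/e0.
rewrite (ppE i j k u bu).
rewrite (pE i j u bu) (pE k j u bu) (pE j k u bu).
rewrite (pE i k u bu) (pE k i u bu) (pE j i u bu).
rewrite -(h i u bu) -(h j u bu) -(h k u bu).
exact: (g5 i j k ki ij jk).
Qed.

Section Class.
Variables (x : CN) (r : R) (h : CN -> C) (q : 'I_N -> CN -> C).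
Local Notation B := (bal x r).
Hypothesis hh : hol B h.
Hypothesis hq : forall i, hol B (q i).
Definition pol u : C := h u * \prod_i q i u.

Lemma pol_hol : hol B pol.
Proof. by apply: holM => //; apply: hol_prod. Qed.

(** Functions whose denominator divides a power of [pol]. As [pol] is the product of [h] and all
    q_i, the class contains the quotients q_i / h and their inverses; it is a ring closed under
    derivatives, hence contains every expression in the system. *)
Definition mero (f : CN -> C) := exists k F, hol B F /\ forall u, B u -> pol u != 0 -> f u * pol u ^+ k = F u.

Lemma mero_ext f g : (forall u, B u -> pol u != 0 -> f u = g u) -> mero f -> mero g.
Proof. by move=> e [k [F [hF eF]]]; exists k, F; split=> // u Bu Pu; rewrite -e// eF. Qed.

Lemma mero_hol f : hol B f -> mero f.
Proof. by move=> hf; exists 0%N, f; split=> // u _ _; rewrite mulr1. Qed.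

Lemma mero_add f g : mero f -> mero g -> mero (fun u => f u + g u).
Proof.
move=> [k [F [hF eF]]] [l [G [hG eG]]]; exists (k + l)%N, (fun u => F u * pol u ^+ l + G u * pol u ^+ k); split.
  by apply: holD; apply: holM => //; apply: holX; exact: pol_hol.
by move=> u Bu Pu; rewrite -eF// -eG// exprD; ring.
Qed.

Lemma mero_mul f g : mero f -> mero g -> mero (fun u => f u * g u).
Proof.
move=> [k [F [hF eF]]] [l [G [hG eG]]]; exists (k + l)%N, (fun u => F u * G u); split; first exact: holM.
by move=> u Bu Pu; rewrite -eF// -eG// exprD; ring.
Qed.

Lemma mero_cst c : mero (fun=> c). Proof. exact: mero_hol (@hol_cst R CN _ c). Qed.

Lemma mero_sum (I : Type) (s : seq I) (F : I -> CN -> C) : (forall i, mero (F i)) ->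
  mero (fun u => \sum_(i <- s) F i u).
Proof.
move=> hF; elim: s => [|i s IH].
  by apply: mero_ext (mero_cst 0) => u _ _; rewrite big_nil.
by apply: mero_ext (mero_add (hF i) IH) => u _ _; rewrite big_cons.
Qed.

Lemma mero_sub f g : mero f -> mero g -> mero (fun u => f u - g u).
Proof.
move=> hf hg; apply: mero_ext (mero_add hf (mero_mul (mero_cst (-1)) hg)) => u _ _.
by rewrite mulN1r.
Qed.

Lemma mero_invh : mero (fun u => (h u)^-1).
Proof.
exists 1%N, (fun u => \prod_i q i u); split; first exact: hol_prod.
by move=> u Bu; rewrite /pol mulf_eq0 negb_or => /andP[h0 _]; rewrite expr1 mulKf.
Qed.

Lemma mero_invq j : mero (fun u => (q j u)^-1).
Proof.
exists 1%N, (fun u => h u * \prod_(i | i != j) q i u); split; first by apply: holM => //; exact: hol_prod.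
move=> u Bu; rewrite /pol (bigD1 j)//= !mulf_eq0 !negb_or => /andP[_ /andP[q0 _]].
by rewrite expr1 [h u * (_ * _)]mulrCA mulKf.
Qed.

Lemma pol_near u : B u -> pol u != 0 -> \forall z \near u, B z /\ pol z != 0.
Proof.
move=> Bu Pu; have [L hL] := pol_hol Bu; have n0 := nr_gt0 Pu.
have [d d0 hd] := cder_cont hL n0; have /near_nrP[e e0 he] := bal_nbhs Bu.
apply/near_nrP; exists (Num.min d e); first by rewrite lt_min d0.
move=> z; rewrite lt_min => /andP[zd ze]; split; first exact: he.
apply: contraTneq isT => z0; have := hd z zd; rewrite z0 sub0r nrN; lra.
Qed.

Lemma mero_dv f v : mero f -> mero (fun u => dv f u v).
Proof.
move=> [k [F [hF eF]]]; have hP := holX k pol_hol.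
exists (k + k)%N, (fun u => dv F u v * pol u ^+ k - F u * dv (fun u => pol u ^+ k) u v); split.
  by apply: holB; apply: holM => //; exact: dv_hol.
move=> u Bu Pu; have Pk : pol u ^+ k != 0 by rewrite expf_neq0.
have c := cderM (cder_dv hF Bu) (@cderV R CN (fun u => pol u ^+ k) u _ Pk (cder_dv hP Bu)).
have cf : cder f u (fun w => F u * (- dv (fun u => pol u ^+ k) u w / (pol u ^+ k) ^+ 2) + dv F u w * (pol u ^+ k)^-1).
  apply: (@cder_loc R CN (fun u => F u * (pol u ^+ k)^-1)).
    apply: filterS (pol_near Bu Pu) => z [Bz Pz]; rewrite -eF// mulfK// expf_neq0//.
  by apply: (cder_eqL _ c) => w; ring.
rewrite (dv_cder v cf) exprD; move: (dv F u v) (dv _ u v) (pol u ^+ k) Pk => y z p p0.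
by field.
Qed.

Lemma mero_zero f a : mero f -> B a -> (\forall z \near a, f z = 0) -> forall u, B u -> pol u != 0 -> f u = 0.
Proof.
move=> [k [F [hF eF]]] Ba fa u Bu Pu; apply/eqP.
have [Pz|Pz] := pselect (exists2 z, B z & pol z != 0 /\ F z != 0); last first.
  have : f u * pol u ^+ k == 0.
    by rewrite eF//; apply/negPn/negP => n; apply: Pz; exists u.
  by rewrite mulf_eq0 expf_eq0 (negPf Pu) andbF orbF.
exfalso; have /near_nrP[e e0 he] := fa; have /near_nrP[e' e'0 he'] := bal_nbhs Ba.
(* The extra factor [pol] makes the product vanish near [a] also at zeros of [pol], where the
   relation to [f] says nothing. *)
have key : forall z, B z -> F z * pol z = 0.
  apply: (@identity R CN x r (fun z => F z * pol z) a (holM hF pol_hol) Ba).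
  apply/near_nrP; exists (Num.min e e'); first by rewrite lt_min e0.
  move=> z; rewrite lt_min => /andP[z1 z2]; have [->|Pz0] := eqVneq (pol z) 0; first by rewrite mulr0.
  by rewrite -(eF z (he' z z2) Pz0) (he z z1) !mul0r.
have [z Bz [p0 F0]] := Pz; have := key z Bz => /eqP.
by rewrite mulf_eq0 (negPf p0) (negPf F0).
Qed.

Definition quo i u : C := q i u / h u.

Lemma mero_quo i : mero (quo i).
Proof. by apply: mero_mul; [exact: mero_hol|exact: mero_invh]. Qed.

Lemma mero_invquo i : mero (fun u => (quo i u)^-1).
Proof.
apply: mero_ext (mero_mul (mero_hol hh) (mero_invq i)) => u _ _.
by rewrite /quo invfM invrK mulrC.
Qed.

Theorem soln_generic (D : C) a (e : R) : B a -> 0 < e -> soln D (bal a e) quo ->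
  forall u, B u -> pol u != 0 -> exists2 e', 0 < e' & soln D (bal u e') quo.
Proof.
move=> Ba e0 [_ sol] u Bu Pu.
have na (f : CN -> C) : (forall z, bal a e z -> f z = 0) -> \forall z \near a, f z = 0.
  by move=> hf; apply: filterS (bal_nbhs (balC a e0)) => z; exact: hf.
have zero f : mero f -> (forall z, bal a e z -> f z = 0) -> forall u, B u -> pol u != 0 -> f u = 0.
  by move=> mf hf; apply: (mero_zero mf Ba); exact: na.
have /near_nrP[e' e'0 he'] := pol_near Bu Pu; exists e'; first exact: e'0.
split=> [i v bv|v bv].
  have [Bv Pv] := he' v bv; have h0 : h v != 0 by move: Pv; rewrite mulf_eq0 negb_or => /andP[].
  have [L1 c1] := hq i Bv; have [L2 c2] := hh Bv; eexists; exact: (cderM c1 (@cderV R CN h v _ h0 c2)).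
have [Bv Pv] := he' v bv.
have dE k f z : partial k f z = dv f z (del k) by rewrite partialE.
have dF k f : partial k f = fun z => dv f z (del k) by apply/funext => z; rewrite partialE.
have mp k f : mero f -> mero (partial k f) by move=> mf; rewrite dF; exact: mero_dv.
split.
- move=> i; rewrite /quo mulf_neq0 ?invr_neq0//; move: Pv; rewrite /pol mulf_eq0 negb_or => /andP[h0 p0] //.
  by move/prodf_neq0: p0; apply.
- move=> i j; apply/eqP; rewrite -subr_eq0; apply/eqP.
  apply: (zero (fun z => partial j (quo i) z - partial i (quo j) z)) => //.
    by apply: mero_sub; apply: mp; exact: mero_quo.
  by move=> z bz; have [_ g _ _ _] := sol z bz; rewrite g subrr.
- move=> i; apply: (zero (fun z => \sum_(k < N) partial k (quo i) z)) => //.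
    by apply: mero_sum => k; apply: mp; exact: mero_quo.
  by move=> z bz; have [_ _ g _ _] := sol z bz.
- move=> i; apply: (zero (fun z => D * quo i z + \sum_(k < N) z 0 k * partial k (quo i) z)) => //.
    apply: mero_add; first by apply: mero_mul; [exact: mero_cst|exact: mero_quo].
    apply: mero_sum => k; apply: mero_mul; first by apply: mero_hol; exact: hol_coord.
    by apply: mp; exact: mero_quo.
  by move=> z bz; have [_ _ _ g _] := sol z bz.
move=> e1 i j k ki ij jk.
have me i' j' : mero (e1 i' j') by apply: mp; exact: mero_quo.
apply: (zero (fun v => partial k (e1 i j) v - 2^-1 * (e1 i j v * e1 k j v / quo j v
   + e1 j k v * e1 i k v / quo k v + e1 k i v * e1 j i v / quo i v))) => //.
  apply: mero_sub; first exact: mp.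
  apply: mero_mul; first exact: mero_cst.
  have mt i1 j1 i2 j2 l : mero (fun v => e1 i1 j1 v * e1 i2 j2 v / quo l v).
    by apply: mero_mul; [exact: mero_mul|exact: mero_invquo].
  by apply: mero_add; [apply: mero_add|].
by move=> z bz; have [_ _ _ _ g] := sol z bz; exact: g.
Qed.

End Class.

Record datum := Datum { dh : CN -> C; dq : 'I_N -> CN -> C }.

Definition dat (D : C) (x : CN) (r : R) (d : datum) := [/\ hol (bal x r) (dh d),
  forall i, hol (bal x r) (dq d i), (exists2 v, bal x r v & pol (dh d) (dq d) v != 0) &
  forall u, bal x r u -> pol (dh d) (dq d) u != 0 ->
     exists2 e, 0 < e & soln D (bal u e) (quo (dh d) (dq d))].

(** Equality of the quotients as meromorphic germs, cross-multiplied so that zeros of the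
    denominators do no harm. *)
Definition eqv (y : CN) (d d' : datum) :=
  exists2 r : R, 0 < r & forall i u, bal y r u -> dq d i u * dh d' u = dq d' i u * dh d u.

Lemma dat_pos D x r d : dat D x r d -> 0 < r.
Proof. by move=> [_ _ [v bv _] _]; apply: le_lt_trans (nr_ge0 _) bv. Qed.

Lemma dat_sub D x r y s d : 0 < s -> bal y s `<=` bal x r -> dat D x r d -> dat D y s d.
Proof.
move=> s0 sub [h1 h2 h3 h4]; split.
- exact: hol_sub h1.
- by move=> i; exact: hol_sub (h2 i).
- by have [v [v1 v2] v3] := hol_dense (pol_hol h1 h2) h3 (sub _ (balC y s0)) s0; exists v.
- by move=> u /sub; exact: h4.
Qed.

(** Near [y] choose a point [a] where [pol] is nonzero and apply [local_meromorphic] there with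
    radius 9 rho / 10. As |a - x| < rho / 4, the coordinates of [a] are still at distance at least 9
    rho, and the new ball covers the ball of radius rho / 2 about [x], whatever the radius of the
    given datum. *)
Lemma extend D (x y : CN) (rho r : R) d : 0 < rho ->
  (forall k l, k != l -> 10 * rho <= nr (x 0 k - x 0 l)) -> bal x (rho / 4) y -> dat D y r d ->
  exists2 d', dat D x (rho / 2) d' & eqv y d d'.
Proof.
move=> rho0 sep bxy dd; have r0 := dat_pos dd.
pose s := Num.min r (rho / 4 - nr (y - x)).
have s0 : 0 < s by rewrite lt_min r0 subr_gt0.
have syr : bal y s `<=` bal y r by move=> z; rewrite /bal /= lt_min => /andP[].
have syx : bal y s `<=` bal x (rho / 4).
  by move=> z; rewrite /bal /= lt_min => /andP[_ hz]; have := nrBD y z x; lra.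
have sx2 : bal x (rho / 4) `<=` bal x (rho / 2) by move=> z; rewrite /bal /=; lra.
have [h1 h2 [a ya Pa] h4] := dat_sub s0 syr dd.
have [e e0 sol] := h4 a ya Pa; have bxa := syx _ ya.
have r9 : 0 < 9 / 10 * rho by rewrite mulr_gt0//; lra.
have sepa k l : k != l -> 10 * (9 / 10 * rho) <= nr (a 0 k - a 0 l).
  move=> kl; have := sep k l kl; have c1 := nr_coord (a - x) k; have c2 := nr_coord (a - x) l.
  rewrite !mxE in c1 c2; move: bxa; rewrite /bal /= => ba.
  have t1 := nrBD (a 0 k) (x 0 k) (x 0 l); have t2 := nrBD (a 0 l) (a 0 k) (x 0 l).
  rewrite [nr (x 0 k - a 0 k)]nrBC in t1; lra.
have [h' [q' [hh hq ha [d0 d00 hd]]]] := local_meromorphic r9 e0 sepa sol.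
have sub9 : bal x (rho / 2) `<=` bal a (9 / 10 * rho).
  move=> z; move: bxa; rewrite /bal /= => b1 b2.
  by have := nrBD x z a; rewrite [nr (x - a)]nrBC; lra.
have hx : hol (bal x (rho / 2)) h' by exact: hol_sub hh.
have qx i : hol (bal x (rho / 2)) (q' i) by exact: hol_sub (hq i).
have hy : hol (bal y s) h' by apply: hol_sub hx => z /syx/sx2.
have qy i : hol (bal y s) (q' i) by apply: hol_sub (qx i) => z /syx/sx2.
have Pn : \forall z \near a, pol (dh d) (dq d) z != 0.
  by apply: filterS (pol_near h1 h2 ya Pa) => z [].
have /near_nrP[e1 e10 he1] := Pn.
have hne z : pol (dh d) (dq d) z != 0 -> dh d z != 0 /\ forall i, dq d i z != 0.
  by rewrite /pol mulf_eq0 negb_or => /andP[-> /prodf_neq0 p0]; split=> // i; exact: p0.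
have near_eq i z : bal a (Num.min d0 e1) z -> dq d i z * h' z = q' i z * dh d z.
  rewrite /bal /= lt_min => /andP[z1 z2]; have [n0 _] := hne z (he1 z z2).
  by rewrite -hd// /quo mulrC -mulrA divfK.
have m0 : 0 < Num.min d0 e1 by rewrite lt_min d00.
exists (Datum h' q'); last first.
  exists s => // i u bu; apply/eqP; rewrite -subr_eq0; apply/eqP => /=.
  apply: (@identity R CN y s (fun u => dq d i u * h' u - q' i u * dh d u) a) => //.
    by apply: holB; apply: holM.
  by apply: filterS (bal_nbhs (balC a m0)) => z /(near_eq i) ->; rewrite subrr.
have q'a i : q' i a != 0.
  have [n0 nq] := hne a Pa; have := near_eq i a (balC a m0); rewrite ha mulr1 => e2.
  by have := nq i; rewrite e2 mulf_eq0 negb_or => /andP[].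
have P'a : pol h' q' a != 0.
  by rewrite /pol ha mul1r; apply/prodf_neq0 => i _; exact: q'a.
have bxa2 := sx2 _ bxa.
split=> //; first by exists a.
have /near_nrP[e2 e20 he2] := pol_near hx qx bxa2 P'a.
pose e3 := Num.min e (Num.min (Num.min d0 e1) e2).
have e30 : 0 < e3 by rewrite !lt_min e0 d00 e10 e20.
apply: (soln_generic hx qx bxa2 e30).
have sub3 : bal a e3 `<=` bal a e by move=> z; rewrite /bal /= lt_min => /andP[].
apply: soln_ext (soln_sub sub3 sol) => i u.
rewrite /bal /= /e3 !lt_min => /andP[_ /andP[/andP[u1 u2] u3]].
have [n0 _] := hne u (he1 u u2); have [_ p0] := he2 u u3.
have n1 : h' u != 0 by move: p0; rewrite /pol mulf_eq0 negb_or => /andP[].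
have := near_eq i u; rewrite /bal /= lt_min u1 u2 => /(_ isT) e4.
by rewrite /quo; apply/eqP; rewrite eqr_div// e4.
Qed.

End Quotients.

(** * Induction along a real interval *)

Section Induction.
Variable R : realType.

(** Connectedness of the unit interval: local transfer at the supremum of the points satisfying [P]
    puts the supremum at 1 and [P] there. *)
Lemma unit_ind (P : R -> Prop) : P 0 ->
  (forall s, 0 <= s <= 1 -> exists2 e, 0 < e & forall s1 s2, 0 <= s1 <= 1 -> 0 <= s2 <= 1 ->
     `|s1 - s| < e -> `|s2 - s| < e -> P s1 -> P s2) -> P 1.
Proof.
move=> P0 loc; pose S := [set s : R | 0 <= s <= 1 /\ P s].
have S0 : S 0 by split=> //; lra.
have ub : has_sup S by split; [exists 0|exists 1 => s [/andP[_ ?] _]].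
have c1 : sup S <= 1 by apply: ge_sup => [|s [/andP[_ ?] _]//]; exists 0.
have c0 : 0 <= sup S by apply: ub_le_sup => //; exists 1 => s [/andP[_ ?] _].
have cI : 0 <= sup S <= 1 by rewrite c0.
have [e e0 he] := loc _ cI; have [s [sI Ps] hs] := sup_adherent e0 ub.
have se : `|s - sup S| < e.
  have sle : s <= sup S by apply: ub_le_sup; [exists 1 => x [/andP[_ ?] _]|split].
  by rewrite distrC ger0_norm ?subr_ge0//; lra.
have [lt1|ge1] := ltP (sup S) 1; last first.
  have e1 : sup S = 1 by apply/eqP; rewrite eq_le c1.
  by apply: (he s 1) => //; [lra|rewrite e1 subrr normr0].
exfalso; pose x := Num.min 1 (sup S + e / 2).
have x1 : sup S < x by rewrite lt_min lt1/=; lra.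
have xle : x <= sup S + e / 2 by rewrite ge_min lexx orbT.
have xI : 0 <= x <= 1 by rewrite ge_min lexx /= andbT; lra.
have Px : P x by apply: (he s x) => //; rewrite gtr0_norm ?subr_gt0//; lra.
have : x <= sup S by apply: ub_le_sup; [exists 1 => y [/andP[_ ?] _]|split].
lra.
Qed.

Lemma seg_ind (P : R -> Prop) (a b : R) : P a ->
  (forall s, Num.min a b <= s <= Num.max a b -> exists2 e, 0 < e & forall s1 s2,
     Num.min a b <= s1 <= Num.max a b -> Num.min a b <= s2 <= Num.max a b ->
     `|s1 - s| < e -> `|s2 - s| < e -> P s1 -> P s2) -> P b.
Proof.
move=> Pa loc; have mm t : 0 <= t <= 1 -> Num.min a b <= a + t * (b - a) <= Num.max a b.
  move=> /andP[t0 t1]; rewrite ge_min le_max; have [ab|ab] := leP a b.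
    by apply/andP; split; apply/orP; [left|right]; nra.
  by apply/andP; split; apply/orP; [right|left]; nra.
rewrite (_ : b = a + 1 * (b - a)); last by ring.
apply: (unit_ind (P := fun t => P (a + t * (b - a)))); first by rewrite mul0r addr0.
move=> t tI; have [e e0 he] := loc _ (mm t tI).
have k0 : 0 < `|b - a| + 1 by have := normr_ge0 (b - a); lra.
exists (e / (`|b - a| + 1)); first by rewrite divr_gt0.
have close t1 : `|t1 - t| < e / (`|b - a| + 1) -> `|a + t1 * (b - a) - (a + t * (b - a))| < e.
  rewrite ltr_pdivlMr// => h; have -> : a + t1 * (b - a) - (a + t * (b - a)) = (t1 - t) * (b - a) by ring.
  rewrite normrM; apply: le_lt_trans h; rewrite ler_wpM2l//; lra.
by move=> t1 t2 h1 h2 /close c1 /close c2; apply: he => //; exact: mm.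
Qed.

End Induction.

(** * Continuation of germs along paths and homotopies *)

Section Continuation.
Variable R : realType.
Local Notation C := R[i].
Variable N : nat.
Local Notation CN := 'rV[C]_N.
Variable D : C.
Implicit Types (d : datum R N) (x y z : CN).

Lemma sep_radius x : (forall k l : 'I_N, k != l -> x 0 k != x 0 l) -> exists2 rho : R, 0 < rho &
  forall k l, k != l -> 10 * rho <= nr (x 0 k - x 0 l).
Proof.
move=> hx; pose f k l : R := if k == l then 1 else nr (x 0 k - x 0 l) / 10.
have f0 k l : 0 < f k l.
  by rewrite /f; case: eqVneq => // kl; rewrite divr_gt0// nr_gt0// subr_eq0 hx.
have hk k : exists r : R, 0 < r /\ forall l, r <= f k l.
  by have [r /andP[r0 _] hr] := finite_min (ltr01 : 0 < 1 :> R) (f0 k); exists r.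
have [g hg] := choice hk.
have [rho /andP[rho0 _] hr] := finite_min (ltr01 : 0 < 1 :> R) (fun k => (hg k).1).
exists rho => // k l kl; have := le_trans (hr k) ((hg k).2 l); rewrite /f (negPf kl).
by rewrite ler_pdivlMr// mulrC.
Qed.

Definition good y d := exists r, dat D y r d.

Lemma good_in x r d y : dat D x r d -> bal x r y -> exists2 s, dat D y s d & bal y s `<=` bal x r.
Proof.
move=> dd bxy; have s0 : 0 < r - nr (y - x) by rewrite subr_gt0.
have sub : bal y (r - nr (y - x)) `<=` bal x r by apply: bal_sub; rewrite addrC subrK.
by exists (r - nr (y - x)) => //; exact: dat_sub sub dd.
Qed.

Lemma eqv_refl y d : eqv y d d. Proof. by exists 1. Qed.

Lemma eqv_sym y d d' : eqv y d d' -> eqv y d' d.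
Proof. by move=> [r r0 h]; exists r => // i u /(h i) ->. Qed.

Lemma eqv_at y d d' i : eqv y d d' -> dq d i y * dh d' y = dq d' i y * dh d y.
Proof. by move=> [r r0 h]; apply: h; exact: balC. Qed.

Lemma eqv_open y d d' : eqv y d d' -> exists2 r, 0 < r & forall z, bal y r z -> eqv z d d'.
Proof.
move=> [r r0 h]; exists r => // z bz; exists (r - nr (z - y)); first by rewrite subr_gt0.
move=> i u bu; apply: h; apply: (bal_sub _ bu); by rewrite addrC subrK.
Qed.

Lemma eqv_ball x r d d' y z : dat D x r d -> dat D x r d' -> bal x r y -> eqv y d d' -> bal x r z -> eqv z d d'.
Proof.
move=> [h1 h2 _ _] [h1' h2' _ _] by_ [e e0 he] bz.
have key i u : bal x r u -> dq d i u * dh d' u = dq d' i u * dh d u.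
  move=> bu; apply/eqP; rewrite -subr_eq0; apply/eqP.
  apply: (@identity R CN x r (fun u => dq d i u * dh d' u - dq d' i u * dh d u) y (holB (holM (h2 i) h1') (holM (h2' i) h1)) by_ _ u bu).
  by apply: filterS (bal_nbhs (balC y e0)) => v /(he i) ->; rewrite subrr.
have s0 : 0 < r - nr (z - x) by rewrite subr_gt0.
exists (r - nr (z - x)) => // i u bu; apply: key; apply: (bal_sub _ bu); by rewrite addrC subrK.
Qed.

(** The middle denominator can be cancelled only where it is nonzero. This holds near some point of
    the ball, because [d2] is good, and the identity theorem does the rest. *)
Lemma eqv_trans y d1 d2 d3 : good y d1 -> good y d2 -> good y d3 ->
  eqv y d1 d2 -> eqv y d2 d3 -> eqv y d1 d3.
Proof.
move=> [r1 g1] [r2 g2] [r3 g3] [e1 e10 h1] [e2 e20 h2].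
pose r := Num.min (Num.min r1 r2) (Num.min r3 (Num.min e1 e2)).
have r0 : 0 < r by rewrite !lt_min (dat_pos g1) (dat_pos g2) (dat_pos g3) e10.
have [s1 s2 s3 [s4 s5]] : [/\ bal y r `<=` bal y r1, bal y r `<=` bal y r2, bal y r `<=` bal y r3 &
    bal y r `<=` bal y e1 /\ bal y r `<=` bal y e2].
  by split; [| | |split]; move=> u; rewrite /bal /= !lt_min => /andP[/andP[? ?] /and3P[? ? ?]].
have [a1 b1 _ _] := dat_sub r0 s1 g1; have [a2 b2 [v bv Pv] _] := dat_sub r0 s2 g2.
have [a3 b3 _ _] := dat_sub r0 s3 g3.
have v2 : dh d2 v != 0 by move: Pv; rewrite /pol mulf_eq0 negb_or => /andP[].
have near2 : \forall z \near v, bal y r z /\ dh d2 z != 0.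
  apply: filterS (pol_near a2 b2 bv Pv) => z [bz]; rewrite /pol mulf_eq0 negb_or => /andP[z0 _] //.
exists r => // i u bu; apply/eqP; rewrite -subr_eq0; apply/eqP.
apply: (@identity R CN y r (fun u => dq d1 i u * dh d3 u - dq d3 i u * dh d1 u) v (holB (holM (b1 i) a3) (holM (b3 i) a1)) bv _ u bu).
apply: filterS near2 => z [bz z0]; apply: (mulfI z0); rewrite mulr0.
have E1 := h1 i z (s4 _ bz); have E2 := h2 i z (s5 _ bz).
have -> : dh d2 z * (dq d1 i z * dh d3 z - dq d3 i z * dh d1 z) =
  (dq d1 i z * dh d2 z) * dh d3 z - (dq d3 i z * dh d2 z) * dh d1 z by ring.
by rewrite E1 -E2; ring.
Qed.

Definition germ y d : set (datum R N) := [set d' | good y d' /\ eqv y d d'].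

Lemma germ_self y d : good y d -> germ y d d.
Proof. by move=> g; split=> //; exact: eqv_refl. Qed.

Lemma germ_eq y d d' : good y d -> good y d' -> eqv y d d' -> germ y d = germ y d'.
Proof.
move=> g g' e; apply/seteqP; split=> d2 [g2 e2]; split=> //.
  exact: eqv_trans g' g g2 (eqv_sym e) e2.
exact: eqv_trans g g' g2 e e2.
Qed.

Lemma germ_eqv y d d' : good y d' -> germ y d = germ y d' -> eqv y d d'.
Proof. by move=> g' e; have [] : germ y d d' by rewrite e; exact: germ_self. Qed.

Implicit Types (gam : R -> CN) (sg : R -> set (datum R N)).

(** A continuous section of the sheaf of germs along the path: near each parameter one datum
    represents all values of [sg]. *)
Definition flat gam (b : R) sg := forall s, 0 <= s <= b -> exists d r, dat D (gam s) r d /\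
  exists2 e : R, 0 < e & forall s', 0 <= s' <= b -> `|s' - s| < e ->
    bal (gam s) r (gam s') /\ sg s' = germ (gam s') d.

Definition pcont gam := forall s, 0 <= s <= 1 -> forall e : R, 0 < e -> exists2 dl : R, 0 < dl &
  forall s', 0 <= s' <= 1 -> `|s' - s| < dl -> nr (gam s' - gam s) < e.

Let self_dist (s e : R) : 0 < e -> `|s - s| < e. Proof. by rewrite subrr normr0. Qed.

Let minmaxI (s1 s2 s : R) : 0 <= s1 <= 1 -> 0 <= s2 <= 1 -> Num.min s1 s2 <= s <= Num.max s1 s2 -> 0 <= s <= 1.
Proof.
by rewrite ge_min le_max => /andP[a b] /andP[c d] /andP[/orP[] h1 /orP[] h2]; apply/andP; split; lra.
Qed.

(** Two data on a common ball are equivalent at all of its points as soon as they are at one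
    ([eqv_ball]), so agreement with [d] spreads along the segment. *)
Lemma flat_prop gam sg d s1 s2 : pcont gam -> flat gam 1 sg -> 0 <= s1 <= 1 -> 0 <= s2 <= 1 ->
  (forall s, Num.min s1 s2 <= s <= Num.max s1 s2 -> good (gam s) d) ->
  sg s1 = germ (gam s1) d -> sg s2 = germ (gam s2) d.
Proof.
move=> pc fl I1 I2 gd E0; apply: (@seg_ind R (fun s => sg s = germ (gam s) d) s1 s2 E0) => s hs.
have sI := minmaxI I1 I2 hs.
have [d' [r' [dd' [e e0 he]]]] := fl s sI; have [r dd] := gd s hs.
pose r3 := Num.min r r'; have r30 : 0 < r3 by rewrite lt_min (dat_pos dd) (dat_pos dd').
have sub : bal (gam s) r3 `<=` bal (gam s) r by move=> u; rewrite /bal /= lt_min => /andP[].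
have sub' : bal (gam s) r3 `<=` bal (gam s) r' by move=> u; rewrite /bal /= lt_min => /andP[].
have D3 := dat_sub r30 sub dd; have D3' := dat_sub r30 sub' dd'.
have [dl dl0 hdl] := pc s sI r3 r30.
exists (Num.min e dl); first by rewrite lt_min e0.
move=> t1 t2 h1 h2; rewrite !lt_min => /andP[a1 b1] /andP[a2 b2] E.
have J1 := minmaxI I1 I2 h1; have J2 := minmaxI I1 I2 h2.
have [_ F1] := he t1 J1 a1; have [_ F2] := he t2 J2 a2.
have B1 : bal (gam s) r3 (gam t1) := hdl t1 J1 b1.
have B2 : bal (gam s) r3 (gam t2) := hdl t2 J2 b2.
have g' : good (gam t2) d' by have [s' ? _] := good_in D3' B2; exists s'.
rewrite F2; apply: germ_eq => //; first exact: gd.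
apply: (eqv_ball D3' D3 B1 _ B2); apply: germ_eqv; first exact: gd.
by rewrite -F1.
Qed.

Lemma flat_germ gam b sg s : flat gam b sg -> 0 <= s <= b -> exists2 d, good (gam s) d & sg s = germ (gam s) d.
Proof.
move=> fl sI; have [d [r [dd [e e0 he]]]] := fl s sI; exists d; first by exists r.
by have [] := he s sI (self_dist s e0).
Qed.

Lemma flat_uniq gam sg sg' : pcont gam -> flat gam 1 sg -> flat gam 1 sg' -> sg 0 = sg' 0 ->
  forall s, 0 <= s <= 1 -> sg s = sg' s.
Proof.
move=> pc fl fl' E0 s0 s0I; have O : 0 <= (0 : R) <= 1 by lra.
apply: (@seg_ind R (fun s => sg s = sg' s) 0 s0) => // s hs; have sI := minmaxI O s0I hs.
have [d [r [dd [e e0 he]]]] := fl s sI; have [d' [r' [dd' [e' e'0 he']]]] := fl' s sI.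
pose r3 := Num.min r r'; have r30 : 0 < r3 by rewrite lt_min (dat_pos dd) (dat_pos dd').
have sub : bal (gam s) r3 `<=` bal (gam s) r by move=> u; rewrite /bal /= lt_min => /andP[].
have sub' : bal (gam s) r3 `<=` bal (gam s) r' by move=> u; rewrite /bal /= lt_min => /andP[].
have D3 := dat_sub r30 sub dd; have D3' := dat_sub r30 sub' dd'.
have [dl dl0 hdl] := pc s sI r3 r30.
exists (Num.min (Num.min e e') dl); first by rewrite !lt_min e0 e'0.
move=> t1 t2 h1 h2; rewrite !lt_min => /andP[/andP[a1 a1'] b1] /andP[/andP[a2 a2'] b2] E.
have J1 := minmaxI O s0I h1; have J2 := minmaxI O s0I h2.
have [_ F1] := he t1 J1 a1; have [_ F2] := he t2 J2 a2.
have [_ F1'] := he' t1 J1 a1'; have [_ F2'] := he' t2 J2 a2'.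
have B1 : bal (gam s) r3 (gam t1) := hdl t1 J1 b1.
have B2 : bal (gam s) r3 (gam t2) := hdl t2 J2 b2.
have g t : bal (gam s) r3 t -> good t d by move=> B; have [s' ? _] := good_in D3 B; exists s'.
have g' t : bal (gam s) r3 t -> good t d' by move=> B; have [s' ? _] := good_in D3' B; exists s'.
rewrite F2 F2'; apply: germ_eq; [exact: g|exact: g'|].
apply: (eqv_ball D3 D3' B1 _ B2); apply: germ_eqv; first exact: g'.
by rewrite -F1 -F1'.
Qed.

Lemma flat_comp gam sg (c k : R) : pcont gam -> flat gam 1 sg -> (forall s, 0 <= s <= 1 -> 0 <= c + k * s <= 1) ->
  flat (fun s => gam (c + k * s)) 1 (fun s => sg (c + k * s)).
Proof.
move=> pc fl hI s sI; have [d [r [dd [e e0 he]]]] := fl _ (hI s sI).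
have k0 : 0 < `|k| + 1 by have := normr_ge0 k; lra.
exists d, r; split=> //; exists (e / (`|k| + 1)); first by rewrite divr_gt0.
move=> s' s'I; rewrite ltr_pdivlMr// => h; apply: he; first exact: hI.
have -> : c + k * s' - (c + k * s) = (s' - s) * k by ring.
by rewrite normrM; apply: le_lt_trans h; rewrite ler_wpM2l//; lra.
Qed.

Lemma flat_ext gam gam' sg : (forall s, 0 <= s <= 1 -> gam s = gam' s) -> flat gam 1 sg -> flat gam' 1 sg.
Proof.
move=> h fl s sI; have [d [r [dd [e e0 he]]]] := fl s sI; exists d, r; rewrite -h//; split=> //.
by exists e => // s' s'I hs; rewrite -!h//; exact: he.
Qed.

(** By [extend], a germ reached at any parameter close to s extends to a ball about gam s of radius
    fixed by the separation of the coordinates of gam s, so continuation cannot stop before s. *)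
Lemma flat_exists gam d0 : pcont gam -> (forall s, 0 <= s <= 1 -> @Zconf R N (gam s)) -> good (gam 0) d0 ->
  exists2 sg, flat gam 1 sg & sg 0 = germ (gam 0) d0.
Proof.
move=> pc hZ [r0 g0]; have O : 0 <= (0 : R) <= 1 by lra.
suff [sg [h1 h2]] : exists sg, flat gam 1 sg /\ sg 0 = germ (gam 0) d0 by exists sg.
apply: (@unit_ind R (fun b => exists sg, flat gam b sg /\ sg 0 = germ (gam 0) d0)).
  exists (fun=> germ (gam 0) d0); split=> // s /andP[sa sb].
  have -> : s = 0 by lra.
  exists d0, r0; split=> //; exists 1 => // s' /andP[sa' sb'] _.
  by have -> : s' = 0 by [lra]; split=> //; apply: balC; exact: dat_pos g0.
move=> s sI; have [rho rho0 sep] := sep_radius (hZ s sI).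
have q0 : 0 < rho / 4 by rewrite divr_gt0.
have [e e0 he] := pc s sI _ q0; exists e => // s1 s2 I1 I2 c1 c2 [sg [fl sg0]].
have [s21|s12] := leP s2 s1.
  exists sg; split=> // t /andP[ta tb].
  have tI : 0 <= t <= s1 by rewrite ta (le_trans tb).
  have [d [r [dd [e' e'0 he']]]] := fl t tI; exists d, r; split=> //; exists e' => // s' /andP[sa sb] hs.
  by apply: he' => //; rewrite sa (le_trans sb).
have s1I : 0 <= s1 <= s1 by case/andP: I1 => -> _ /=.
have [d1 [r1 [dd1 [e1 e10 he1]]]] := fl s1 s1I.
have [_ F1] := he1 s1 s1I (self_dist s1 e10).
have [d dd ed] := extend rho0 sep (he s1 I1 c1) dd1.
have inball t : s1 <= t <= s2 -> bal (gam s) (rho / 4) (gam t).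
  move=> /andP[t1 t2]; apply: he; first by case/andP: I1 => a b; case/andP: I2 => a' b'; apply/andP; split; lra.
  by move: c1 c2; rewrite !ltr_norml => /andP[a b] /andP[a' b']; apply/andP; split; lra.
have sub2 t : bal (gam s) (rho / 4) t -> bal t (rho / 4) `<=` bal (gam s) (rho / 2).
  by rewrite /bal /= => bt; apply: bal_sub; lra.
have dt t : s1 <= t <= s2 -> dat D (gam t) (rho / 4) d.
  by move=> tI; apply: dat_sub q0 (sub2 _ (inball t tI)) dd.
pose sg' t := if t <= s1 then sg t else germ (gam t) d.
exists sg'; split; last by rewrite /sg'; case/andP: I1 => -> _.
move=> t /andP[ta tb]; have t1 : 0 <= t <= 1 by case/andP: I2 => _ ?; rewrite ta (le_trans tb).
have [lt1|ge1] := ltP t s1.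
  have tI : 0 <= t <= s1 by rewrite ta ltW.
  have [d' [r' [dd' [e' e'0 he']]]] := fl t tI; exists d', r'; split=> //.
  exists (Num.min e' (s1 - t)); first by rewrite lt_min e'0 subr_gt0.
  move=> s' /andP[sa sb]; rewrite lt_min => /andP[h1 h2].
  have s's1 : s' <= s1 by move: h2; rewrite ltr_norml => /andP[_ ?]; lra.
  by rewrite /sg' s's1; apply: he' => //; rewrite sa.
have tI : s1 <= t <= s2 by rewrite ge1.
exists d, (rho / 4); split; first exact: dt.
have [e2 e20 he2] := pc t t1 _ q0.
(* Only the junction t = s1 matters: there [ed] identifies the old datum with the new one on a
   neighbourhood, hence also just before s1. *)
have main : exists2 e3 : R, 0 < e3 & forall s', 0 <= s' <= s1 -> `|s' - t| < e3 -> sg s' = germ (gam s') d.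
  move: ge1; rewrite le_eqVlt => /orP[/eqP st|lt1]; last first.
    exists (t - s1); first by rewrite subr_gt0.
    by move=> s' /andP[_ h]; rewrite ltr_norml => /andP[h' _]; exfalso; lra.
  have [r2 r20 hr2] := eqv_open ed.
  pose r3 := Num.min r2 (rho / 4); have r30 : 0 < r3 by rewrite lt_min r20.
  have [e3 e30 he3] := pc s1 I1 r3 r30.
  exists (Num.min e1 e3); first by rewrite lt_min e10.
  move=> s' sI'; rewrite -st lt_min => /andP[h1 h2].
  have s'1 : 0 <= s' <= 1 by case/andP: sI' => a b; case/andP: I1 => _ c; rewrite a (le_trans b).
  have [B1 ->] := he1 s' sI' h1; have := he3 s' s'1 h2; rewrite lt_min => /andP[n1 n2].
  apply: germ_eq; last exact: hr2.
    by have [x1 ? _] := good_in dd1 B1; exists x1.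
  have ss : s1 <= s1 <= s2 by rewrite lexx ltW.
  by have [x1 ? _] := good_in (dt s1 ss) n2; exists x1.
have [e3 e30 he3] := main; exists (Num.min e2 e3); first by rewrite lt_min e20.
move=> s' /andP[sa sb]; rewrite lt_min => /andP[h1 h2].
have s'1 : 0 <= s' <= 1 by case/andP: I2 => _ c; rewrite sa (le_trans sb).
split; first exact: he2.
by rewrite /sg'; case: leP => // h; apply: he3 => //; rewrite sa.
Qed.

Section Homotopy.
Variables (H : R -> R -> CN) (x0 : CN) (d0 : datum R N).
Hypothesis Hc : forall s t, 0 <= s <= 1 -> 0 <= t <= 1 -> forall e : R, 0 < e -> exists2 dl : R, 0 < dl &
  forall s' t', 0 <= s' <= 1 -> 0 <= t' <= 1 -> `|s' - s| < dl -> `|t' - t| < dl -> nr (H s' t' - H s t) < e.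
Hypothesis HZ : forall s t, 0 <= s <= 1 -> 0 <= t <= 1 -> @Zconf R N (H s t).
Hypothesis H0 : forall t, 0 <= t <= 1 -> H 0 t = x0.
Hypothesis H1 : forall t, 0 <= t <= 1 -> H 1 t = x0.
Hypothesis Hend : forall s, 0 <= s <= 1 -> H s 1 = x0.
Hypothesis g0 : good x0 d0.

Let Hpc t : 0 <= t <= 1 -> pcont (fun s => H s t).
Proof.
move=> tI s sI e e0; have [dl dl0 h] := Hc sI tI e0; exists dl => // s' s'I hs.
by apply: h => //; exact: self_dist.
Qed.

(** The final germ of the continuation along s -> H(s, t) is locally constant in t, and for t = 1
    the path is constant, so its final germ is the initial one. *)
Lemma monodromy_trivial sg : flat (fun s => H s 0) 1 sg -> sg 0 = germ x0 d0 -> sg 1 = germ x0 d0.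
Proof.
have O : 0 <= (0 : R) <= 1 by lra.
have I : 0 <= (1 : R) <= 1 by lra.
have ex t : exists sg, 0 <= t <= 1 -> flat (fun s => H s t) 1 sg /\ sg 0 = germ x0 d0.
  have [tI|tI] := pselect (0 <= t <= 1); last by exists (fun=> set0).
  have g : good (H 0 t) d0 by rewrite H0.
  have [sg2 h1 h2] := flat_exists (Hpc tI) (fun s sI => HZ sI tI) g.
  by exists sg2 => _; split=> //; rewrite h2 H0.
have [S hS] := choice ex.
have step t0 : 0 <= t0 <= 1 -> exists2 dl : R, 0 < dl & forall t, 0 <= t <= 1 -> `|t - t0| < dl -> S t 1 = S t0 1.
  move=> t0I; have [fl0 _] := hS t0 t0I.
  (* Induction along s at fixed t0, with the claim that one datum represents the continuations along
     all paths with t near t0 at that parameter. *)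
  have : exists d (dl : R), [/\ good (H 1 t0) d, 0 < dl & forall t, 0 <= t <= 1 -> `|t - t0| < dl ->
      good (H 1 t) d /\ S t 1 = germ (H 1 t) d].
    apply: (@unit_ind R (fun s => exists d (dl : R), [/\ good (H s t0) d, 0 < dl & forall t, 0 <= t <= 1 -> `|t - t0| < dl ->
      good (H s t) d /\ S t s = germ (H s t) d])).
      exists d0, 1; split=> [|//|t tI _]; rewrite H0//; split=> //; exact: (hS t tI).2.
    move=> s sI; have [d [r [dd [e e0 he]]]] := fl0 s sI.
    have [dl dl0 hdl] := Hc sI t0I (dat_pos dd).
    have gd s' t' : 0 <= s' <= 1 -> 0 <= t' <= 1 -> `|s' - s| < dl -> `|t' - t0| < dl -> good (H s' t') d.
      by move=> a b c c'; have [x1 ? _] := good_in dd (hdl s' t' a b c c'); exists x1.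
    exists (Num.min e dl); first by rewrite lt_min e0.
    move=> s1 s2 I1 I2; rewrite !lt_min => /andP[a1 b1] /andP[a2 b2] [d1 [dl1 [g1 dl10 h1]]].
    have t00 := self_dist t0 dl0.
    have E1 : eqv (H s1 t0) d1 d.
      apply: germ_eqv; first exact: gd.
      have [_ <-] := h1 t0 t0I (self_dist t0 dl10).
      by have [] := he s1 I1 a1.
    have [r2 r20 hr2] := eqv_open E1; have [dl2 dl20 hdl2] := Hc I1 t0I r20.
    exists d, (Num.min dl (Num.min dl1 dl2)); split=> [||t tI]; first exact: gd.
      by rewrite !lt_min dl0 dl10.
    rewrite !lt_min => /and3P[c0 c1 c2]; split; first exact: gd.
    have [flt _] := hS t tI.
    have J s' : Num.min s1 s2 <= s' <= Num.max s1 s2 -> `|s' - s| < dl.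
      move: b1 b2; rewrite !ltr_norml ge_min le_max => /andP[x1 x2] /andP[x3 x4] /andP[/orP[] y1 /orP[] y2];
        apply/andP; split; lra.
    apply: (@flat_prop (fun s => H s t) (S t) d s1 s2 (Hpc tI) flt I1 I2).
      by move=> s' hs'; apply: gd => //; [exact: minmaxI hs'|exact: J].
    have [G1 ->] := h1 t tI c1; apply: germ_eq => //; first exact: gd.
    by apply: hr2; apply: hdl2 => //; exact: self_dist.
  move=> [d [dl [g dl0 h]]]; exists dl => // t tI ht.
  have [_ ->] := h t tI ht; have [_ ->] := h t0 t0I (self_dist t0 dl0).
  by rewrite !H1.
have S1 : S 1 1 = germ x0 d0.
  have [fl1 S10] := hS 1 I.
  have := @flat_prop (fun s => H s 1) (S 1) d0 0 1 (Hpc I) fl1 O I.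
  rewrite !Hend// => h; apply: h => // s hs; rewrite Hend//; exact: minmaxI O I hs.
have Sall : S 0 1 = germ x0 d0.
  apply: (@seg_ind R (fun t => S t 1 = germ x0 d0) 1 0) => // t ht; have tI := minmaxI I O ht.
  have [dl dl0 h] := step t tI; exists dl => // t1 t2 k1 k2 e1 e2.
  by rewrite (h t1 (minmaxI I O k1) e1) (h t2 (minmaxI I O k2) e2).
move=> fl sg0; have [flS S00] := hS 0 O; rewrite -Sall.
by apply: (flat_uniq (Hpc O) fl flS) => //; rewrite sg0 S00.
Qed.

End Homotopy.

End Continuation.

(** * Paths in a topological space and their concatenation *)

Section Paths.
Variables (R : realType) (T : topologicalType).
Implicit Types (al be : R -> T).

Definition tpath al := forall s : R, 0 <= s <= 1 -> forall O, nbhs (al s) O ->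
  exists2 dl : R, 0 < dl & forall s', 0 <= s' <= 1 -> `|s' - s| < dl -> O (al s').

Lemma near_unit (s : R) (P : set R) : (\forall x \near s, 0 <= x <= 1 -> P x) <->
  exists2 dl : R, 0 < dl & forall x, 0 <= x <= 1 -> `|x - s| < dl -> P x.
Proof.
split=> [/nbhs_ballP[e /= e0 he]|[e e0 he]].
  by exists e => // x xI xs; apply: he => //; rewrite /ball /= distrC.
by apply/nbhs_ballP; exists e => // x; rewrite /ball /= distrC => xs xI; exact: he.
Qed.

Lemma tpathP al : {within `[0, 1], continuous al} <-> tpath al.
Proof.
split=> [/subspace_continuousP h s sI O hO|h].
  have sA : `[(0 : R), 1]%classic s by rewrite /= in_itv.
  have h1 : \forall x \near s, `[(0 : R), 1]%classic x -> O (al x) := h s sA O hO.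
  apply/near_unit.
  by apply: filterS h1 => x hx xI; apply: hx; rewrite /= in_itv.
apply/subspace_continuousP => s; rewrite /= in_itv /= => sI O hO.
have /near_unit h1 := h s sI O hO.
suff : \forall x \near s, `[(0 : R), 1]%classic x -> O (al x) by [].
by apply: filterS h1 => x hx; rewrite /= in_itv /=; exact: hx.
Qed.

Lemma tpath_aff al (c k : R) : tpath al -> (forall s, 0 <= s <= 1 -> 0 <= c + k * s <= 1) ->
  tpath (fun s => al (c + k * s)).
Proof.
move=> h hI s sI O hO; have [e e0 he] := h _ (hI s sI) O hO.
have k0 : 0 < `|k| + 1 by have := normr_ge0 k; lra.
exists (e / (`|k| + 1)); first by rewrite divr_gt0.
move=> s' s'I; rewrite ltr_pdivlMr// => hs; apply: he; first exact: hI.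
have -> : c + k * s' - (c + k * s) = (s' - s) * k by ring.
by rewrite normrM; apply: le_lt_trans hs; rewrite ler_wpM2l//; lra.
Qed.

Definition pcat al be (s : R) : T := if s <= 2^-1 then al (2 * s) else be (2 * s - 1).

Lemma tpath_cat al be : tpath al -> tpath be -> al 1 = be 0 -> tpath (pcat al be).
Proof.
move=> ha hb ab s /andP[s0 s1] O; rewrite /pcat; have [lt|lt|eq] := ltgtP s 2^-1 => hO.
- have sI : 0 <= 2 * s <= 1 by apply/andP; split; lra.
  have [e e0 he] := ha _ sI O hO; exists (Num.min (e / 2) (2^-1 - s)).
    by rewrite lt_min divr_gt0// subr_gt0.
  move=> s' /andP[a b]; rewrite lt_min !ltr_norml => /andP[/andP[x1 x2] /andP[x3 x4]].
  have -> : s' <= 2^-1 by lra.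
  by apply: he; [apply/andP; split; lra|rewrite ltr_norml; apply/andP; split; lra].
- have sI : 0 <= 2 * s - 1 <= 1 by apply/andP; split; lra.
  have [e e0 he] := hb _ sI O hO; exists (Num.min (e / 2) (s - 2^-1)).
    by rewrite lt_min divr_gt0// subr_gt0.
  move=> s' /andP[a b]; rewrite lt_min !ltr_norml => /andP[/andP[x1 x2] /andP[x3 x4]].
  have -> : s' <= 2^-1 = false by apply/negbTE; rewrite -ltNge; lra.
  by apply: he; [apply/andP; split; lra|rewrite ltr_norml; apply/andP; split; lra].
have e1 : 2 * s = 1 by rewrite eq; lra.
rewrite e1 in hO; have I1 : 0 <= (1 : R) <= 1 by lra.
have I0 : 0 <= (0 : R) <= 1 by lra.
have [e e0 he] := ha 1 I1 O hO; rewrite ab in hO; have [e' e'0 he'] := hb 0 I0 O hO.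
exists (Num.min (e / 2) (e' / 2)); first by rewrite lt_min !divr_gt0.
move=> s' /andP[a b]; rewrite lt_min !ltr_norml => /andP[/andP[x1 x2] /andP[x3 x4]].
case: leP => h; [apply: he|apply: he'].
- by apply/andP; split; lra.
- by rewrite ltr_norml; apply/andP; split; lra.
- by apply/andP; split; lra.
- by rewrite ltr_norml; apply/andP; split; lra.
Qed.

End Paths.

(** * Continuation on the covering space *)

Section Cover.
Variables (R : realType) (N : nat).
Local Notation C := R[i].
Local Notation CN := 'rV[C]_N.
Variables (T : topologicalType) (p : T -> CN).
Hypothesis Tcover : universal_cover R p (@Zconf R N).
Variable D : C.

Let pc : continuous p. Proof. by have [[h _ _] _] := Tcover. Qed.

Let pZ t : @Zconf R N (p t).
Proof. by have [[_ h _] _] := Tcover; rewrite -h; exists t. Qed.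

Let near_p t (r : R) : 0 < r -> nbhs t (p @^-1` (bal (p t) r)).
Proof. by move=> r0; exact: (pc (bal_nbhs (balC _ r0))). Qed.

Lemma tpath_pcont (al : R -> T) : tpath al -> pcont (fun s => p (al s)).
Proof.
move=> h s sI e e0; have [dl dl0 hd] := h s sI _ (near_p (al s) e0); exists dl => // s' s'I hs; exact: hd.
Qed.

Lemma bal_open (x : CN) r : open (bal x r).
Proof. by rewrite openE => u bu; exact: bal_nbhs. Qed.

Lemma sheet t (r : R) : 0 < r -> exists (O : set T) (r' : R) (g : CN -> T),
  [/\ open O /\ O t, 0 < r' <= r, forall t', O t' -> bal (p t) r' (p t') /\ g (p t') = t',
   forall u, bal (p t) r' u -> O (g u) /\ p (g u) = u &
   forall u, bal (p t) r' u -> forall O', nbhs (g u) O' -> exists2 e : R, 0 < e & forall v, nr (v - u) < e -> O' (g v)].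
Proof.
move=> r0; have [[_ _ hcov] _] := Tcover; have [V [Vo Vt _ [sheets [_ hV hS]]]] := hcov _ (pZ t).
have [S hSs St] : (\bigcup_(S in sheets) S) t by rewrite -hV.
have [So [pSV _ [g [gVS gc pg gp]]]] := hS S hSs.
have /near_nrP[e e0 he] : nbhs (p t) V by exact: open_nbhs_nbhs.
pose r' := Num.min r e; have r'0 : 0 < r' by rewrite lt_min r0.
have sub : bal (p t) r' `<=` V by move=> u; rewrite /bal /= lt_min => /andP[_]; exact: he.
exists (S `&` p @^-1` (bal (p t) r')), r', g; split.
- split; last by split=> //; exact: balC.
  by apply: openI => //; apply: open_comp => [x _|]; [exact: pc|exact: bal_open].
- by rewrite r'0 ge_min lexx.
- by move=> t' [St' bt']; split=> //; apply: pg; rewrite inE.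
- move=> u bu; have Vu := sub _ bu; have e1 : p (g u) = u by apply: gp; rewrite inE.
  by split; last exact: e1; split; [exact: gVS|rewrite /= e1].
move=> u bu O' hO'; have Vu := sub _ bu; have /subspace_continuousP gc2 := gc.
have h1 : \forall v \near u, V v -> O' (g v) := gc2 u Vu O' hO'.
have : nbhs u (g @^-1` O').
  have h2 : nbhs u V by exact: open_nbhs_nbhs.
  by apply: filterS2 h1 h2 => v hv Vv; exact: hv.
by move=> /near_nrP[e1 e10 h2]; exists e1.
Qed.

Variables (t0 : T) (d0 : datum R N).
Hypothesis g0 : good D (p t0) d0.

Definition continued t g := exists (al : R -> T) sg, [/\ tpath al, al 0 = t0, al 1 = t,
  flat D (fun s => p (al s)) 1 sg & sg 0 = germ D (p t0) d0 /\ sg 1 = g].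

Let I0 : 0 <= (0 : R) <= 1. Proof. by lra. Qed.
Let I1 : 0 <= (1 : R) <= 1. Proof. by lra. Qed.

Let half1 s : 0 <= s <= 1 -> 0 <= (0 : R) + 2^-1 * s <= 1.
Proof. by move=> /andP[a b]; apply/andP; split; lra. Qed.

Let half2 s : 0 <= s <= 1 -> 0 <= (1 : R) + - 2^-1 * s <= 1.
Proof. by move=> /andP[a b]; apply/andP; split; lra. Qed.

Let rev1 s : 0 <= s <= 1 -> 0 <= (1 : R) + -1 * s <= 1.
Proof. by move=> /andP[a b]; apply/andP; split; lra. Qed.

Let pcat_l (al be : R -> T) s : 0 <= s <= 1 -> pcat al be (0 + 2^-1 * s) = al s.
Proof.
move=> /andP[a b]; rewrite /pcat; have -> : 0 + 2^-1 * s <= 2^-1 by lra.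
by congr al; lra.
Qed.

(** Run the first path and then the second one backwards. This loop of T contracts, its image
    contracts inside the configuration space, and [monodromy_trivial] applies; comparison with the
    section along the loop on its two halves identifies both end germs with its value at the
    midpoint. *)
Lemma continued_uniq t g g' : continued t g -> continued t g' -> g = g'.
Proof.
move=> [al [sg [ha a0 a1 fl [sg0 sg1]]]] [be [sg' [hb b0 b1 fl' [sg'0 sg'1]]]].
pose lp := pcat al (fun s => be (1 + -1 * s)).
have hl : tpath lp.
  by apply: tpath_cat => //; [exact: tpath_aff hb rev1|rewrite mulr0 addr0 a1 b1].
have lp0 : lp 0 = t0.
  by rewrite -a0 -(@pcat_l al (fun s => be (1 + -1 * s)) 0 I0) mulr0 addr0.
have lp2 s : 0 <= s <= 1 -> lp (1 + - 2^-1 * s) = be s.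
  move=> /andP[x y]; rewrite /lp /pcat; case: leP => h.
    have -> : s = 1 by lra.
    by rewrite b1 -a1; congr al; lra.
  by congr be; lra.
have lp1 : lp 1 = t0 by rewrite -b0 -(lp2 0 I0) mulr0 addr0.
have [_ [_ _ sc]] := Tcover.
have [H [Hc H0 H1 H2]] := sc lp ((tpathP _).2 hl) (etrans lp0 (esym lp1)).
have [|sl fls sl0] := flat_exists (tpath_pcont hl) (fun s _ => pZ (lp s)) (d0 := d0) (D := D).
  by rewrite lp0.
rewrite lp0 in sl0.
have sl1 : sl 1 = germ D (p t0) d0.
  apply: (@monodromy_trivial R N D (fun s t => p (H (s, t))) (p t0) d0) => //.
  - move=> s u sI uI e e0.
    have A : (`[(0 : R), 1]%classic `*` `[(0 : R), 1]%classic) (s, u) by split; rewrite /= in_itv.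
    have hO := near_p (H (s, u)) e0; have /subspace_continuousP Hc2 := Hc.
    have : \forall z \near ((s, u) : R * R), (`[(0 : R), 1]%classic `*` `[(0 : R), 1]%classic) z ->
        (p @^-1` (bal (p (H (s, u))) e)) (H z) := Hc2 (s, u) A _ hO.
    move=> /nbhs_ballP[dl /= dl0 hd]; exists dl => // s' u' s'I u'I hs hu.
    apply: (hd (s', u')); first by split; rewrite /ball /= distrC.
    by split; rewrite /= in_itv.
  - by move=> u uI; have [-> _] := H2 u ltac:(by rewrite /= in_itv); rewrite lp0.
  - by move=> u uI; have [_ ->] := H2 u ltac:(by rewrite /= in_itv); rewrite lp0.
  - by move=> s sI; rewrite H1 ?lp0// /= in_itv.
  - by apply: flat_ext fls => s sI; rewrite H0// /= in_itv.
have E1 : sg 1 = sl (0 + 2^-1 * 1).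
  apply: (flat_uniq (tpath_pcont ha) fl (sg' := fun s => sl (0 + 2^-1 * s))) => //.
    apply: flat_ext (flat_comp (tpath_pcont hl) fls half1) => s sI; by rewrite /lp pcat_l.
  by rewrite mulr0 addr0 sg0 sl0.
have E2 : sg' 1 = sl (1 + - 2^-1 * 1).
  apply: (flat_uniq (tpath_pcont hb) fl' (sg' := fun s => sl (1 + - 2^-1 * s))) => //.
    by apply: flat_ext (flat_comp (tpath_pcont hl) fls half2) => s sI; rewrite lp2.
  by rewrite mulr0 addr0 sg'0 sl1.
by rewrite -sg1 -sg'1 E1 E2; congr sl; lra.
Qed.

Lemma continued_ex t : exists g, continued t g.
Proof.
have [_ [_ cn _]] := Tcover; have [al [ac a0 a1]] := cn t0 t.
have ha := (tpathP _).1 ac.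
have [|sg fl sg0] := flat_exists (tpath_pcont ha) (fun s _ => pZ (al s)) (d0 := d0) (D := D).
  by rewrite a0.
by exists (sg 1), al, sg; split=> //; rewrite -{1}a0.
Qed.

Lemma continued_step t d (be : R -> T) : continued t (germ D (p t) d) -> tpath be -> be 0 = t ->
  (forall s, 0 <= s <= 1 -> good D (p (be s)) d) -> continued (be 1) (germ D (p (be 1)) d).
Proof.
move=> [al [sg [ha a0 a1 fl [sg0 sg1]]]] hb b0 gd.
pose ct := pcat al be; have hc : tpath ct by apply: tpath_cat => //; rewrite a1 b0.
have ct0 : ct 0 = t0 by rewrite -a0 -(@pcat_l al be 0 I0) mulr0 addr0.
have cth : ct 2^-1 = t by rewrite -a1 -(@pcat_l al be 1 I1) mulr1 add0r.
have ct1 : ct 1 = be 1.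
  rewrite /ct /pcat; have -> : ((1 : R) <= 2^-1) = false by apply/negbTE; rewrite -ltNge; lra.
  by congr be; lra.
have [|sl fls sl0] := flat_exists (tpath_pcont hc) (fun s _ => pZ (ct s)) (d0 := d0) (D := D).
  by rewrite ct0.
rewrite ct0 in sl0.
have E1 : sg 1 = sl (0 + 2^-1 * 1).
  apply: (flat_uniq (tpath_pcont ha) fl (sg' := fun s => sl (0 + 2^-1 * s))) => //.
    by apply: flat_ext (flat_comp (tpath_pcont hc) fls half1) => s sI; rewrite /ct pcat_l.
  by rewrite mulr0 addr0 sg0 sl0.
exists ct, sl; split=> //; split=> //; rewrite -ct1.
have hI : 0 <= (2^-1 : R) <= 1 by apply/andP; split; lra.
apply: (flat_prop (tpath_pcont hc) fls (s1 := 2^-1)) => //.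
  move=> s; rewrite ge_min le_max => /andP[x y].
  have s2 : 2^-1 <= s by case/orP: x; lra.
  have s1 : s <= 1 by case/orP: y; lra.
  rewrite /ct /pcat; case: leP => h.
    have -> : 2 * s = 1 by lra.
    by rewrite a1 -b0; exact: gd.
  by apply: gd; apply/andP; split; lra.
by rewrite cth -sg1 E1; congr sl; lra.
Qed.

(** Within a sheet over a ball, lifted segments continue one datum to every point. Its denominator
    vanishes on no open subset of the sheet, because [pol] is not identically zero on the ball. *)
Lemma continued_local t g : continued t g -> exists (O : set T) d (r : R),
  [/\ open O /\ O t, dat D (p t) r d,
   forall t', O t' -> bal (p t) r (p t') /\ continued t' (germ D (p t') d) &
   forall O', open O' -> O' !=set0 -> O' `<=` O -> exists2 t', O' t' & dh d (p t') != 0].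
Proof.
move=> ct; have [al [sg [ha a0 a1 fl [sg0 sg1]]]] := ct.
have [d [r dd] gE] := flat_germ fl I1; rewrite sg1 a1 in gE; rewrite a1 in dd.
have [Os [r' [gg [[Oo Ot] /andP[r'0 r'r] h1 h2 h3]]]] := sheet t (dat_pos dd).
have sub : bal (p t) r' `<=` bal (p t) r by move=> u; rewrite /bal /= => h; exact: lt_le_trans h r'r.
exists Os, d, r; split=> // [t' Ot'|O' O'o [t1 O't1] O'O].
  have [b' gt'] := h1 t' Ot'; split; first exact: sub.
  have [_ gt] := h1 t Ot; pose ln (s : R) : CN := p t + s%:C%C *: (p t' - p t).
  have lnb s : 0 <= s <= 1 -> bal (p t) r' (ln s).
    move=> /andP[x y]; rewrite /bal /= /ln [p t + _]addrC addrK nrZ nrR ger0_norm//.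
    by apply: le_lt_trans b'; rewrite ler_piMl ?nr_ge0.
  have e1 : gg (ln 1) = t' by rewrite /ln scale1r [p t + _]addrC subrK.
  have e0 : gg (ln 0) = t by rewrite /ln scale0r addr0.
  rewrite -e1; apply: (@continued_step t d (fun s => gg (ln s))) => //; first by rewrite -gE.
    move=> s sI O1 hO1; have [e ep he] := h3 _ (lnb s sI) O1 hO1.
    have k0 : 0 < nr (p t' - p t) + 1 by have := nr_ge0 (p t' - p t); lra.
    exists (e / (nr (p t' - p t) + 1)); first by rewrite divr_gt0.
    move=> s' _; rewrite ltr_pdivlMr// => hs; apply: he.
    have -> : ln s' - ln s = (s' - s)%:C%C *: (p t' - p t).
      by rewrite /ln opprD addrACA subrr add0r -scalerBl -rmorphB.
    by rewrite nrZ nrR; apply: le_lt_trans hs; rewrite ler_wpM2l//; lra.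
  move=> s sI; have b := lnb s sI; have [_ ->] := h2 _ b.
  by have [x ? _] := good_in dd (sub _ b); exists x.
have Ot1 := O'O _ O't1; have [bt1 gt1] := h1 _ Ot1.
have hO' : nbhs (gg (p t1)) O' by rewrite gt1; exact: open_nbhs_nbhs.
have [e e0 he] := h3 _ bt1 O' hO'.
have [q1 q2 q3 _] := dd.
have m0 : 0 < Num.min e (r' - nr (p t1 - p t)) by rewrite lt_min e0 subr_gt0.
have [v [_ hv] Pv] := hol_dense (pol_hol q1 q2) q3 (sub _ bt1) m0.
move: hv; rewrite lt_min => /andP[v1 v2].
have bv : bal (p t) r' v by rewrite /bal /=; have := nrBD (p t1) v (p t); lra.
exists (gg v); first exact: he.
by have [_ ->] := h2 _ bv; move: Pv; rewrite /pol mulf_eq0 negb_or => /andP[].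
Qed.

(** The regular set consists of the points whose germ has a representative with nonzero denominator;
    equivalence makes the value independent of the representative. Around an arbitrary point, the
    datum of [continued_local] provides numerator and denominator. *)
Theorem global_quotient : exists (W : set T) (f : 'I_N -> T -> C), (forall i, meromorphic_cover p W (f i)) /\
  forall t d, dh d (p t) != 0 -> good D (p t) d -> continued t (germ D (p t) d) ->
    W t /\ forall i, f i t = dq d i (p t) / dh d (p t).
Proof.
have [sg hsg] := choice continued_ex.
pose W := [set t | exists2 d, sg t d & dh d (p t) != 0].
have ex t : exists d, W t -> sg t d /\ dh d (p t) != 0.
  have [[d h1 h2]|nW] := pselect (W t); first by exists d.
  by exists d0.
have [rp hrp] := choice ex.
pose f i t : C := dq (rp t) i (p t) / dh (rp t) (p t).
have fE i t d : sg t = germ D (p t) d -> W t -> dh d (p t) * f i t = dq d i (p t).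
  move=> e Wt; have [s1 s2] := hrp t Wt; rewrite e in s1; have [_ e1] := s1.
  by rewrite /f mulrA [dh d _ * _]mulrC -(eqv_at i e1) mulfK.
have fE2 i t d : sg t = germ D (p t) d -> W t -> dh d (p t) != 0 -> f i t = dq d i (p t) / dh d (p t).
  by move=> e Wt n0; rewrite -(fE i t d e Wt) mulrC mulKf.
have loc t := continued_local (hsg t).
have Wnear t d : sg t d -> dh d (p t) != 0 -> \forall t' \near t,
    [/\ sg t' = germ D (p t') d, dh d (p t') != 0 & W t'].
  move=> sd n0; have [Os [d1 [r [[Oo Ot] dd hO _]]]] := loc t.
  have tg : sg t = germ D (p t) d1 := continued_uniq (hsg t) (hO t Ot).2.
  rewrite tg in sd; have [[r2 gd] ed] := sd; have [r3 r30 hr3] := eqv_open ed.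
  have [hh _ _ _] := gd; have [L cL] := hh _ (balC (p t) (dat_pos gd)).
  have [e e0 he] := cder_cont cL (nr_gt0 n0).
  pose m := Num.min (Num.min r2 r3) e; have m0 : 0 < m by rewrite !lt_min (dat_pos gd) r30.
  have O1 : nbhs t Os by exact: open_nbhs_nbhs.
  apply: filterS2 O1 (near_p t m0) => t' Ot' /=; rewrite /bal /= !lt_min => /andP[/andP[b2 b3] be].
  have [b' ct'] := hO t' Ot'.
  have g1 : good D (p t') d1 by have [x ? _] := good_in dd b'; exists x.
  have g2 : good D (p t') d by have [x ? _] := good_in gd b2; exists x.
  have sE : sg t' = germ D (p t') d.
    by rewrite (continued_uniq (hsg t') ct'); apply: germ_eq => //; exact: hr3.
  have n' : dh d (p t') != 0.
    by apply: contraTneq isT => z0; have := he _ be; rewrite z0 sub0r nrN ltxx.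
  split=> //; exists d => //; rewrite sE; exact: germ_self.
exists W, f; split=> [i|t d n0 gd ct]; last first.
  have sE := continued_uniq (hsg t) ct.
  have Wt : W t by exists d => //; rewrite sE; exact: germ_self.
  by split=> // i; exact: fE2.
split.
- rewrite openE => t [d sd n0]; apply: filterS (Wnear t d sd n0) => t' [_ _] //.
- move=> O' [t Ot] O'o; have [Os [d [r [[Oo Ost] dd hO hdense]]]] := loc t.
  have IO : open (O' `&` Os) by exact: openI.
  have [| |t' [m1 Ot'] n0] := hdense _ IO; [by exists t|by move=> x []|].
  exists t'; split=> //; have [b' ct'] := hO t' Ot'.
  exists d => //; rewrite (continued_uniq (hsg t') ct'); apply: germ_self.
  by have [x ? _] := good_in dd b'; exists x.
- move=> t [d sd n0]; exists (fun u => dq d i u / dh d u).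
  have [Os [d1 [r [[Oo Ot] dd hO _]]]] := loc t.
  have tg : sg t = germ D (p t) d1 := continued_uniq (hsg t) (hO t Ot).2.
  have [[r2 gd] _] : germ D (p t) d1 d by rewrite -tg.
  have [hh hq _ _] := gd; split.
    have [L cL] := hh _ (balC (p t) (dat_pos gd)).
    have [e e0 he] := cder_cont cL (nr_gt0 n0).
    apply/near_nrP; exists (Num.min r2 e); first by rewrite lt_min (dat_pos gd).
    move=> u; rewrite lt_min => /andP[u1 u2].
    have nu : dh d u != 0.
      by apply: contraTneq isT => z0; have := he _ u2; rewrite z0 sub0r nrN ltxx.
    have [L1 c1] := hq i _ u1; have [L2 c2] := hh _ u1.
    exact: (cder_differentiable (cderM c1 (@cderV R CN (dh d) u _ nu c2))).1.
  by apply: filterS (Wnear t d sd n0) => t' [sE n' Wt']; exact: fE2.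
move=> t; have [Os [d [r [[Oo Ot] dd hO hdense]]]] := loc t.
have [hh hq _ _] := dd.
have hc (F : CN -> C) : hol (bal (p t) r) F -> holomorphic_cover p Os (fun s => F (p s)).
  move=> hF s Os_s; exists F; split; last by apply: nearW.
  have [bs _] := hO s Os_s; apply: filterS (bal_nbhs bs) => u bu.
  by have [L cL] := hF u bu; exact: (cder_differentiable cL).1.
exists Os, (fun s => dq d i (p s)), (fun s => dh d (p s)); split=> //.
- exact: hc (hq i).
- exact: hc hh.
by move=> s Oss Ws; apply: fE => //; exact: continued_uniq (hsg s) (hO s Oss).2.
Qed.

End Cover.

(** * Proof of the theorem *)

Lemma soln_quo1 (R : realType) (N : nat) (D : R[i]) (B : set 'rV[R[i]]_N) (eta : 'I_N -> 'rV[R[i]]_N -> R[i]) :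
  soln D B eta -> soln D B (quo (fun=> 1) eta).
Proof.
have -> : quo (fun=> 1) eta = eta; last by [].
by apply/funext => i; apply/funext => u; rewrite /quo divr1.
Qed.

Theorem theorem1p1 (R : realType) (N : nat)
    (T : topologicalType) (p : T -> 'rV[R[i]]_N)
    (Tcover : universal_cover R p (@Zconf R N))
    (U : set 'rV[R[i]]_N) (Uopen : open U) (UZ : U `<=` @Zconf R N)
    (Ucontr : contractible R U)
    (L : set T) (Llift : lift_of p U L)
    (eta : 'I_N -> 'rV[R[i]]_N -> R[i])
    (eta_hol : forall i, holomorphic U (eta i))
    (eta_neq0 : forall i u, U u -> eta i u != 0)
    (eta_closed : forall a b u, U u ->
       partial b (eta a) u = partial a (eta b) u)
    (D : R[i])
    (eta_transl : forall i u, U u -> \sum_(k < N) partial k (eta i) u = 0)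
    (eta_homog : forall i u, U u ->
       D * eta i u + \sum_(k < N) u 0 k * partial k (eta i) u = 0)
    (eta_pde : let e a b := partial b (eta a) in
       forall i j k u, k != i -> i != j -> j != k -> U u ->
       partial k (e i j) u
       - 2^-1 * (e i j u * e k j u / eta j u
                 + e j k u * e i k u / eta k u
                 + e k i u * e j i u / eta i u) = 0) :
  forall i, exists (W : set T) (f : T -> R[i]),
    [/\ meromorphic_cover p W f, L `<=` W &
        forall t, L t -> f t = eta i (p t)].
Proof.
have solU : soln D U eta.
  split=> [i|u Uu]; first by apply/hol_holomorphic.
  split.
  - by move=> i; exact: eta_neq0.
  - by move=> a b; exact: eta_closed.
  - by move=> i; exact: eta_transl.
  - by move=> i; exact: eta_homog.
  by move=> e i j k ki ij jk; exact: eta_pde.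
pose d0 := Datum (fun=> 1) eta.
have gd u : U u -> good D u d0.
  move=> Uu; have /near_nrP[r r0 hr] : nbhs u U by exact: open_nbhs_nbhs.
  have sol := soln_sub hr solU; exists r; split.
  - exact: hol_cst.
  - exact: sol.1.
  - exists u; first exact: balC.
    by rewrite /pol mul1r; apply/prodf_neq0 => i _; exact: eta_neq0.
  move=> v bv _; exists (r - nr (v - u)); first by rewrite subr_gt0.
  apply: soln_quo1; apply: soln_sub sol; apply: bal_sub; by rewrite addrC subrK.
have [c [H [Uc Hc HU H0 H1]]] := Ucontr.
have [Lo [pLU _ [g [gUL gc pg gp]]]] := Llift.
have pgE u : U u -> p (g u) = u by move=> Uu; apply: gp; rewrite inE.
have gpE t : L t -> g (p t) = t by move=> Lt; apply: pg; rewrite inE.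
have g0 : good D (p (g c)) d0 by rewrite pgE//; exact: gd.
have cont t : L t -> continued p D (g c) d0 t (germ D (p t) d0).
  move=> Lt; have Up : U (p t) := pLU _ Lt.
  (* The contraction of U run backwards from [c] to [p t] and lifted to L. Its image stays in U, so
     the germs of the single datum [d0] form a flat section along it. *)
  pose al (s : R) : T := g (H (1 + -1 * s, p t)).
  have I01 (s : R) : 0 <= s <= 1 -> 0 <= (1 : R) + -1 * s <= 1.
    by move=> /andP[a b]; apply/andP; split; lra.
  have Ual s : 0 <= s <= 1 -> U (H (1 + -1 * s, p t)).
    by move=> /I01 h; apply: HU => //; rewrite /= in_itv.
  have ha : tpath al.
    pose h s := H (s, p t).
    have hh s : 0 <= s <= 1 -> forall O, nbhs (g (h s)) O -> exists2 dl : R, 0 < dl &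
        forall s', 0 <= s' <= 1 -> `|s' - s| < dl -> O (g (h s')).
      move=> sI O hO; have Uh : U (h s) by apply: HU => //; rewrite /= in_itv.
      have /subspace_continuousP gc2 := gc.
      have n1 : \forall v \near h s, U v -> O (g v) := gc2 _ Uh O hO.
      have /subspace_continuousP Hc2 := Hc.
      have A : (`[(0 : R), 1]%classic `*` U) (s, p t) by split; rewrite /= ?in_itv.
      have n2 : \forall z \near ((s, p t) : R * 'rV[R[i]]_N), (`[(0 : R), 1]%classic `*` U) z ->
        U (H z) -> O (g (H z)) := Hc2 _ A _ n1.
      have [[A1 A2] /= [a1 a2] hA] := n2; have /nbhs_ballP[dl /= dl0 hd] := a1.
      exists dl => // s' s'I hs; apply: (hA (s', p t)).
      - by split; [apply: hd; rewrite /ball /= distrC|exact: nbhs_singleton a2].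
      - by split; rewrite /= ?in_itv.
      - by apply: HU => //; rewrite /= in_itv.
    exact: (@tpath_aff R T (fun s => g (h s)) 1 (-1) hh I01).
  have pal s : 0 <= s <= 1 -> p (al s) = H (1 + -1 * s, p t) by move=> sI; rewrite /al pgE//; exact: Ual.
  have I0 : 0 <= (0 : R) <= 1 by lra.
  have I1 : 0 <= (1 : R) <= 1 by lra.
  have al1 : al 1 = t by rewrite /al (_ : 1 + -1 * 1 = 0) ?H0 ?gpE//; ring.
  have al0 : al 0 = g c by rewrite /al mulr0 addr0 H1.
  have gal s : 0 <= s <= 1 -> good D (p (al s)) d0 by move=> sI; rewrite pal//; apply/gd/Ual.
  exists al, (fun s => germ D (p (al s)) d0); split=> //; last by rewrite al0 al1.
  move=> s sI; have [r dr] := gal s sI; exists d0, r; split=> //.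
  by have [dl dl0 hd] := tpath_pcont Tcover ha sI (dat_pos dr); exists dl => // s' s'I hs; split=> //; exact: hd.
have [W [f [hf hW]]] := global_quotient Tcover g0.
move=> i; exists W, (f i); split=> [//|t Lt|t Lt].
  have [] := hW t d0 _ _ (cont t Lt) => //; first by rewrite /= oner_neq0.
  by apply/gd/pLU.
have [| |_ ->] := hW t d0 _ _ (cont t Lt); first by rewrite /= oner_neq0.
  by apply/gd/pLU.
by rewrite /= divr1.
Qed.
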